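(* Let $n\ge2$, let $m\ge 2$ be an integer, let $0<r_0<r_1$, let $\delta\in(0,1)$, and let $\Theta_1\subset\mathbb{S}^{n-1}$ be a closed subset with $C_{\mathcal H}^{n-2+\delta}(\Theta_1)>0$. Let $H=-\Delta+|x|^{2m}$ on $L^2(\mathbb{R}^n)$. Then for every $T>0$ there exists a constant $C_{obs}>0$, depending on $T,n,m,\delta,\Theta_1$ (and on the fixed radii $r_0,r_1$), such that for every $u_0\in L^2(\mathbb{R}^n)$, $$\left\|e^{-TH}u_0\right\|_{L^2(\mathbb{R}^n)}\le C_{obs}\int_0^T\left(\int_{r_0}^{r_1}\left(\sup_{\omega\in\Theta_1}\left|(e^{-tH}u_0)(r,\omega)\right|\right)^2dr\right)^{\frac12}dt.$$
   Context: $\mathbb{S}^{n-1}$ is the unit sphere in $\mathbb{R}^n$. For a function $v$ on $\mathbb{R}^n$, $v(r,\omega)$ denotes its value at $x=r\omega$, with $r=|x|>0$ and $\omega=x/|x|\in\mathbb{S}^{n-1}$. $H=-\Delta+|x|^{2m}$ is the self-adjoint Schrödinger operator on $L^2(\mathbb{R}^n)$ and $e^{-tH}$ its semigroup, so that $u(t,\cdot)=e^{-tH}u_0$ solves $\partial_tu+Hu=0$ for $t>0$, $u(0,\cdot)=u_0$. For $\alpha>0$ and $E\subset\mathbb{R}^n$, the $\alpha$-Hausdorff content is $C_{\mathcal H}^\alpha(E)=\inf\{\sum_{j=1}^\infty d(B_j)^\alpha: E\subset\bigcup_{j=1}^\infty B_j\}$, where the $B_j\subset\mathbb{R}^n$ are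 open balls and $d(B_j)$ is the diameter of $B_j$. *)

(* Defs.v *)
From HB Require Import structures.
From mathcomp Require Import all_boot all_order all_algebra.
From mathcomp Require Import all_classical all_reals all_analysis.
From mathcomp Require Import complex.

Set Implicit Arguments.
Unset Strict Implicit.
Unset Printing Implicit Defensive.

Import Order.TTheory GRing.Theory Num.Theory.
Import numFieldNormedType.Exports.
Import ComplexField.Normc.

Local Open Scope classical_set_scope.
Local Open Scope complex_scope.
Local Open Scope ring_scope.

Section rV_measurable.
Context {R : realType} {n : nat}.

Let coor (i : 'I_n) (x : 'rV[R]_n) : R := x ord0 i.

Let rV_set0 : g_sigma_preimage coor set0.
Proof. exact: sigma_algebra0. Qed.

Let rV_setC A : g_sigma_preimage coor A -> g_sigma_preimage coor (~` A).
Proof. exact: sigma_algebraC. Qed.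

Let rV_bigcup (F : _^nat) : (forall i, g_sigma_preimage coor (F i)) ->
  g_sigma_preimage coor (\bigcup_i (F i)).
Proof. exact: sigma_algebra_bigcup. Qed.

(* The sigma-algebra generated by the coordinates; R being second countable,
   it is the Borel sigma-algebra of R^n. *)
HB.instance Definition _ :=
  @isMeasurable.Build (measure_tuple_display default_measure_display)
    'rV[R]_n (g_sigma_preimage coor) rV_set0 rV_setC rV_bigcup.

Lemma measurable_coor (i : 'I_n) :
  measurable_fun [set: 'rV[R]_n] (fun x => x ord0 i).
Proof.
move=> _ Y mY; rewrite setTI; apply: sub_sigma_algebra => /=.
rewrite -bigcup_seq/=; exists i => /=; first by rewrite mem_index_enum.
by exists Y => //; rewrite setTI.
Qed.

Lemma measurable_fun_rV d (T : measurableType d) (f : T -> 'rV[R]_n) :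
  (forall i, measurable_fun setT (fun t => f t ord0 i)) ->
  measurable_fun setT f.
Proof.
move=> mf; suff prefS : g_sigma_preimage (fun i => coor i \o f) `<=` measurable.
  move=> _ A mA; apply: prefS; rewrite g_sigma_preimage_comp.
  by exists A.
apply: smallest_sub; first exact: sigma_algebra_measurable.
rewrite -bigcup_seq/=; apply: bigcup_sub => i _ _ [B mB <-].
exact: mf.
Qed.

End rV_measurable.

Section cons_measure.
Context {R : realType} {n : nat}.
Variable mu : {sigma_finite_measure set 'rV[R]_n -> \bar R}.

Definition cons_rV (z : measurableTypeR R * 'rV[R]_n) : 'rV[R]_n.+1 :=
  row_mx (z.1)%:M z.2.

Lemma measurable_cons_rV : measurable_fun setT cons_rV.
Proof.
apply: measurable_fun_rV => i.
case: (split_ordP (i : 'I_(1 + n))) => j ->.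
  have -> : (fun z => cons_rV z ord0 (lshift n j)) = fst.
    apply/funext => z; rewrite [LHS](@row_mxEl R 1 1 n).
    by rewrite !ord1 mxE eqxx mulr1n.
  exact: measurable_fst.
have -> : (fun z => cons_rV z ord0 (rshift 1 j)) =
    (fun x : 'rV[R]_n => x ord0 j) \o snd.
  by apply/funext => z; rewrite [LHS](@row_mxEr R 1 1 n).
by apply: measurableT_comp; [exact: measurable_coor|exact: measurable_snd].
Qed.

(* The image of the product of the Lebesgue measure of R and of mu. *)
Definition cons_measure (A : set 'rV[R]_n.+1) : \bar R :=
  (lebesgue_measure \x mu)%E (cons_rV @^-1` A).

Let cons_measure0 : cons_measure set0 = 0%E.
Proof. by rewrite /cons_measure preimage_set0 measure0. Qed.

Let cons_measure_ge0 A : (0 <= cons_measure A)%E.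
Proof. exact: measure_ge0. Qed.

Let cons_measure_sigma_additive : semi_sigma_additive cons_measure.
Proof.
move=> F mF tF mUF; rewrite /cons_measure preimage_bigcup.
have mpre A : measurable A -> measurable (cons_rV @^-1` A).
  by move=> mA; rewrite -[X in measurable X]setTI; exact: measurable_cons_rV.
apply: measure_semi_sigma_additive.
- by move=> k; exact: mpre.
- apply/trivIsetP => /= i j _ _ ij; rewrite -preimage_setI.
  by move/trivIsetP : tF => /(_ _ _ _ _ ij) ->//; rewrite preimage_set0.
- by rewrite -preimage_bigcup; exact: mpre.
Qed.

HB.instance Definition _ := isMeasure.Build _ _ _ cons_measure
  cons_measure0 cons_measure_ge0 cons_measure_sigma_additive.

Let cons_measure_sigma_finite : sigma_finite setT cons_measure.
Proof.
have /sigma_finiteP[F [TF ndF Foo]] := sigma_finiteT (@lebesgue_measure R).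
have /sigma_finiteP[G [TG ndG Goo]] := sigma_finiteT mu.
pose uncons (x : 'rV[R]_n.+1) : measurableTypeR R * 'rV[R]_n :=
  (x ord0 ord0, @rsubmx R 1 1 n x).
have munc : measurable_fun setT uncons.
  apply: measurable_fun_pair; first exact: measurable_coor.
  apply: measurable_fun_rV => i.
  rewrite (_ : (fun _ => _) = fun x : 'rV[R]_n.+1 => x ord0 (rshift 1 i)).
    exact: measurable_coor.
  by apply/funext => x; rewrite mxE.
have uncK z : uncons (cons_rV z) = z.
  case: z => a y; rewrite /uncons /cons_rV; congr pair; last exact: row_mxKr.
  have -> : ord0 = lshift n (@ord0 0) by exact/val_inj.
  by rewrite (@row_mxEl R 1 1 n) mxE eqxx mulr1n.
exists (fun k => uncons @^-1` (F k `*` G k)).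
  apply/esym; rewrite -subTset => x _.
  have [i _ Fx] : (\bigcup_i F i) (uncons x).1 by rewrite -TF.
  have [j _ Gx] : (\bigcup_i G i) (uncons x).2 by rewrite -TG.
  exists (maxn i j) => //; split.
  - by move: Fx; exact/subsetPset/ndF/leq_maxl.
  - by move: Gx; exact/subsetPset/ndG/leq_maxr.
move=> k; have [mF Fk] := Foo k; have [mG Gk] := Goo k; split.
  by rewrite -[X in measurable X]setTI; apply: munc => //; exact: measurableX.
rewrite /cons_measure -comp_preimage (_ : _ \o _ = idfun).
  by rewrite preimage_id product_measure1E// lte_mul_pinfty// ge0_fin_numE.
by apply/funext => z; exact: uncK.
Qed.

HB.instance Definition _ := @Measure_isSigmaFinite.Build _ _ _ cons_measure
  cons_measure_sigma_finite.

End cons_measure.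

Fixpoint lebesgue_rV (R : realType) (n : nat) :
    {sigma_finite_measure set 'rV[R]_n -> \bar R} :=
  match n with
  | 0 => \d_(0 : 'rV[R]_0)
  | k.+1 => cons_measure (lebesgue_rV R k)
  end.

Lemma measurable_box (R : realType) (n : nat) (A : 'I_n -> set R) :
  (forall i, measurable (A i)) ->
  measurable [set x : 'rV[R]_n | forall i, A i (x ord0 i)].
Proof.
move=> mA; rewrite (_ : [set x | _] =
    \big[setI/setT]_(i < n) ((fun x : 'rV[R]_n => x ord0 i) @^-1` A i)).
  apply: bigsetI_measurable => i _; rewrite -[X in measurable X]setTI.
  exact: measurable_coor.
by rewrite -bigcap_seq; apply/seteqP; split=> x /= Ax i;
  [move=> _; exact: Ax|exact: (Ax i (mem_index_enum i))].
Qed.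

Lemma lebesgue_rV_box (R : realType) (n : nat) (A : 'I_n -> set R) :
  (forall i, measurable (A i)) ->
  lebesgue_rV R n [set x | forall i, A i (x ord0 i)] =
  (\prod_(i < n) lebesgue_measure (A i))%E.
Proof.
elim: n A => [|n IH] A mA.
  by rewrite big_ord0 /= diracE mem_set// => -[].
rewrite big_ord_recl -IH => [|i]; last exact: mA.
rewrite -product_measure1E; [|exact: mA|]; last first.
  by apply: (@measurable_box R n (fun i => A (lift ord0 i))) => i; exact: mA.
rewrite -[LHS]/((lebesgue_measure \x lebesgue_rV R n)%E
  (cons_rV @^-1` [set x : 'rV[R]_n.+1 | forall i, A i (x ord0 i)])).
congr (product_measure1 _ _ _).
have E0 (z : R * 'rV[R]_n) : cons_rV z ord0 ord0 = z.1.
  have -> : ord0 = lshift n (@ord0 0) by exact/val_inj.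
  by rewrite [LHS](@row_mxEl R 1 1 n) mxE eqxx mulr1n.
have E1 (z : R * 'rV[R]_n) i : cons_rV z ord0 (lift ord0 i) = z.2 ord0 i.
  have -> : lift ord0 i = rshift 1 i by exact/val_inj.
  by rewrite [LHS](@row_mxEr R 1 1 n).
apply/seteqP; split=> -[a y] /=.
  move=> Az; split=> [|i].
    by have := Az ord0; rewrite E0.
  by have := Az (lift ord0 i); rewrite E1.
move=> [Aa Ay] i; case: (unliftP ord0 i) => [j ->|->].
  by rewrite E1; exact: Ay.
by rewrite E0.
Qed.

Section euclidean.
Context {R : realType} {n : nat}.
Implicit Types (x y c : 'rV[R]_n) (r : R).

(* The library norm of 'rV[R]_n is the sup norm. *)
Definition enorm x : R := Num.sqrt (\sum_(i < n) x ord0 i ^+ 2).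

Definition unit_sphere : set 'rV[R]_n := [set x | enorm x = 1].

Definition open_eball c r : set 'rV[R]_n := [set x | enorm (x - c) < r].

Definition ediameter (A : set 'rV[R]_n) : \bar R :=
  ereal_sup [set (enorm (z.1 - z.2))%:E | z in A `*` A].

Definition hausdorff_content (a : R) (E : set 'rV[R]_n) : \bar R :=
  ereal_inf [set (\sum_(0 <= j <oo) ediameter (B j) `^ a)%E | B in
    [set B : (set 'rV[R]_n)^nat |
      (forall j, exists c r, 0 < r /\ B j = open_eball c r) /\
      E `<=` \bigcup_j B j]].

Definition partial_derivative (i : 'I_n) (f : 'rV[R]_n -> R) :
    'rV[R]_n -> R :=
  'D_(delta_mx ord0 i) f.

Definition iterated_partial (s : seq 'I_n) (f : 'rV[R]_n -> R) :
    'rV[R]_n -> R :=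
  foldr partial_derivative f s.

Definition smooth (f : 'rV[R]_n -> R) : Prop :=
  forall s : seq 'I_n, continuous (iterated_partial s f) /\
    forall i x, derivable (iterated_partial s f) x (delta_mx ord0 i).

Definition test_function (f : 'rV[R]_n -> R) : Prop :=
  smooth f /\ compact (closure [set x | f x != 0]).

Definition laplacian (f : 'rV[R]_n -> R) (x : 'rV[R]_n) : R :=
  \sum_(i < n) iterated_partial [:: i; i] f x.

Definition schrodinger_expr (m : nat) (f : 'rV[R]_n -> R) (x : 'rV[R]_n) : R :=
  - laplacian f x + enorm x ^+ (2 * m) * f x.

End euclidean.

Section L2.
Context {R : realType} {n : nat}.
Local Notation mu := (lebesgue_rV R n).
Local Notation cfun := ('rV[R]_n -> R[i]).
Implicit Types f g : cfun.

Definition L2norm f : \bar R := Lnorm mu 2%:E (fun x => (normc (f x))%:E).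

(* Elements of L^2(R^n; C) are represented by functions, to be considered up
   to equality almost everywhere. *)
Definition L2 f : Prop :=
  [/\ measurable_fun setT (fun x => complex.Re (f x)),
      measurable_fun setT (fun x => complex.Im (f x))
    & (L2norm f < +oo)%E].

Definition ae_equal f g : Prop := f = g %[ae mu].

(* The graph of H = - Delta + |x|^(2m): H f = g in the sense of
   distributions, with f and g in L^2. This is the adjoint of - Delta + |x|^(2m)
   on C_c^oo(R^n), which is essentially self-adjoint since the potential is
   smooth and nonnegative; so it is the self-adjoint realisation of H. *)
Definition schrodinger (m : nat) f g : Prop :=
  [/\ L2 f, L2 g & forall phi : 'rV[R]_n -> R, test_function phi ->
    \int[mu]_x (complex.Re (f x) * schrodinger_expr m phi x) =
      \int[mu]_x (complex.Re (g x) * phi x) /\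
    \int[mu]_x (complex.Im (f x) * schrodinger_expr m phi x) =
      \int[mu]_x (complex.Im (g x) * phi x)].

Record C0_semigroup (S : R -> cfun -> cfun) : Prop := {
  C0_L2 : forall t f, 0 <= t -> L2 f -> L2 (S t f) ;
  C0_ae : forall t f g, 0 <= t -> L2 f -> L2 g ->
    ae_equal f g -> ae_equal (S t f) (S t g) ;
  C0_linear : forall t (a : R[i]) f g, 0 <= t -> L2 f -> L2 g ->
    ae_equal (S t (fun x => a * f x + g x))
             (fun x => a * S t f x + S t g x) ;
  C0_bounded : forall t, 0 <= t -> exists M : R, forall f, L2 f ->
    (L2norm (S t f) <= M%:E * L2norm f)%E ;
  C0_id : forall f, L2 f -> ae_equal (S 0 f) f ;
  C0_add : forall s t f, 0 <= s -> 0 <= t -> L2 f ->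
    ae_equal (S (s + t) f) (S s (S t f)) ;
  C0_continuous : forall f, L2 f ->
    L2norm (fun x => S h f x - f x) @[h --> 0^'+] --> 0%E }.

(* The graph of the infinitesimal generator of S. *)
Definition generator (S : R -> cfun -> cfun) f g : Prop :=
  [/\ L2 f, L2 g &
    L2norm (fun x => (h^-1)%:C * (S h f x - f x) - g x)
      @[h --> 0^'+] --> 0%E].

(* S t = e^{-tH}: S is the strongly continuous semigroup on L^2 whose
   generator is -H. *)
Definition schrodinger_semigroup (m : nat) (S : R -> cfun -> cfun) : Prop :=
  C0_semigroup S /\
  forall f g, generator S f g <-> schrodinger m f (fun x => - g x).

(* For t > 0, e^{-tH} u0 has a (unique) continuous representative, which gives
   a meaning to its values on the null sets r Theta. *)
Definition continuous_version (S : R -> cfun -> cfun) (u0 : cfun)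
    (u : R -> cfun) : Prop :=
  forall t, 0 < t ->
    [/\ continuous (fun x => complex.Re (u t x)),
        continuous (fun x => complex.Im (u t x))
      & ae_equal (u t) (S t u0)].

Definition sup_on_sphere (Theta : set 'rV[R]_n) (v : cfun) (r : R) : \bar R :=
  ereal_sup [set (normc (v (r *: w)))%:E | w in Theta].

End L2.

(* Main.v *)
Require Import Defs.
From HB Require Import structures.
From mathcomp Require Import all_boot all_order all_algebra ssrAC.
From mathcomp Require Import all_classical all_reals all_analysis.
From mathcomp Require Import measurable_realfun lebesgue_stieltjes_measure.
From mathcomp Require Import complex ring lra zify.

Set Implicit Arguments.
Unset Strict Implicit.
Unset Printing Implicit Defensive.

Import Order.TTheory GRing.Theory Num.Theory.
Import numFieldNormedType.Exports.

Local Open Scope classical_set_scope.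
Local Open Scope ring_scope.

(** At a positive time a solution is analytic along lines, with explicit bounds, so it cannot be too
    small on the cone over [Theta1]. That cone has dimension greater than n - 1, hence meets many
    lines in sets of positive dimension. The resulting lower bound at one time is then summed over a
    sequence of times tending to 0.

    Product formula. Only the generator of e^{-tH} is given. The semigroup is therefore first
    identified with the limit of the 2^k-th iterates of A_{t/2^k}, where A_t = e^{-tV/2} e^{t Delta}
    e^{-tV/2} and V = |x|^{2m} ([chernoff_limit], [split_op_consistent], [schrodinger_chernoff]).
    The operators A_t are real symmetric contractions with explicit Gaussian kernels. Estimates are
    proved for their iterates and pass to the limit. Real and imaginary parts are treated
    separately; what is kept of each is [schr_flow].

    Analyticity along lines. An iterate of A is an integral over polygonal paths. Displacing the
    paths linearly in time, so that one end moves by u e while the other end, where the data is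
    evaluated, stays fixed, puts the whole dependence on u into the exponential of a polynomial in
    u. On |z| <= rho the real part of that polynomial is bounded above, because Re V(x + c z e) >= -
    C rho^{2m} uniformly in x ([Re_potP_ge]). Hence a finite measure on a line that kills the
    polynomials of degree at most D sees the solution as it would see a holomorphic function bounded
    by M on the disc of radius rho ([path_bound], [flow_line_bound]). This property, [path_class],
    replaces a holomorphic extension. By log-convexity of the norm in time, M is controlled by the
    norm at the final time itself.

    Concentration. Let a and b be the norms at the final and initial times of an interval of length
    t. Log-convexity bounds the potential energy, so half of the final mass lies where V < R^{2m} as
    soon as t R^{2m} >= 64 (1 + ln(b/a)) ([flow_tail]). This gives a point y with |y| <= R where the
    solution is not small ([flow_point]).

    Propagation of smallness. Lagrange interpolation at D + 1 separated nodes carries smallness from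
    the nodes to any other point of their line, up to an exponentially small error ([propagate]).
    Positive content yields a Frostman measure on [Theta1] ([frostman], [sphere_weights]), and
    adding the radial variable raises its dimension by one ([cone_ball]). Moving y one coordinate at
    a time ([coord_step]) produces many points x outside the cone where the solution is still large.
    Averaging over them ([slicing]) selects an x and a thin tube around a line through x that
    carries a measure of positive dimension supported on the cone. Were the solution small on
    [Theta1] for at least half of the radial cells, it would be small at x ([line_step]), a
    contradiction; this is [static_bound].

    Time. With R a power of an integer P taken as small as concentration allows, the total
    exponential loss is a power of P of lower degree than the power appearing in the concentration
    condition; here m >= 2 enters. The loss is thus at most ln(b/a) + K / t^kap, which gives (a^2 /
    b) e^{-K / t^kap} as a lower bound for the observation ([scale_choice], [one_time_observation]).
    Iterating over a geometric sequence of times eliminates b ([telescope_bound],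
    [flow_observability]). *)

(** * Integration on R^n: slicing, translations and reflections *)

Section lebesgue_rV_integral.
Context {R : realType}.
Local Notation leb := (@lebesgue_measure R).

Lemma ge0_integral_rV0 (f : 'rV[R]_0 -> \bar R) :
  measurable_fun [set: 'rV[R]_0] f -> (forall x, 0 <= f x)%E ->
  (\int[lebesgue_rV R 0]_x f x = f 0%R)%E.
Proof. by move=> mf f0; rewrite /= integral_dirac// diracT mul1e. Qed.

Lemma eq_integral_pushforward d1 d2 (T1 : measurableType d1)
    (T2 : measurableType d2) (m1 : {measure set T1 -> \bar R})
    (m2 : {measure set T2 -> \bar R}) (h : T1 -> T2) (f : T2 -> \bar R) :
  measurable_fun setT h -> (forall A, measurable A -> m2 A = m1 (h @^-1` A)) ->
  measurable_fun setT f -> (forall x, 0 <= f x)%E ->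
  (\int[m2]_x f x = \int[m1]_x f (h x))%E.
Proof.
move=> mh m12 mf f0.
have := ge0_integral_pushforward mh m1 measurableT mf (fun x _ => f0 x).
rewrite preimage_setT => <-; apply: eq_measure_integral => A mA _.
exact: m12.
Qed.

Lemma ge0_integral_rVS n (f : 'rV[R]_n.+1 -> \bar R) :
  measurable_fun [set: 'rV[R]_n.+1] f -> (forall x, 0 <= f x)%E ->
  (\int[lebesgue_rV R n.+1]_x f x =
   \int[leb]_a \int[lebesgue_rV R n]_y f (cons_rV (a, y)))%E.
Proof.
move=> mf f0.
rewrite (@eq_integral_pushforward _ _ _ _ (leb \x lebesgue_rV R n)%E _
  (@cons_rV R n))//; last exact: measurable_cons_rV.
have mfc : measurable_fun setT (f \o @cons_rV R n).
  by apply: measurableT_comp => //; exact: measurable_cons_rV.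
by rewrite (fubini_tonelli1 _ mfc (fun z => f0 _)).
Qed.

Lemma ge0_integral_translation (f : R -> \bar R) (c : R) :
  measurable_fun setT f -> (forall x, 0 <= f x)%E ->
  (\int[leb]_x f (x + c)%R = \int[leb]_x f x)%E.
Proof.
move=> mf f0; apply/esym.
have mt : measurable_fun setT (fun x : measurableTypeR R => x + c : measurableTypeR R).
  by apply: measurable_funD => //; exact: measurable_id.
apply: (eq_integral_pushforward mt) => // A mA.
apply: (@lebesgue_measure_unique _ (pushforward leb
  (fun x : measurableTypeR R => x + c : measurableTypeR R))) => // _ [[a b]] _ <-.
transitivity (leb `]a - c, b - c]%classic); last first.
  congr (leb _).
  by apply/seteqP; split => x /=; rewrite !in_itv/= ltrBlDr lerBrDr.
rewrite !lebesgue_measure_itv/= !lte_fin ltrD2r -!EFinB.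
by case: ifP => // _; congr (_%:E); ring.
Qed.

Lemma ge0_integral_reflection (f : R -> \bar R) :
  measurable_fun setT f -> (forall x, 0 <= f x)%E ->
  (\int[leb]_x f (- x)%R = \int[leb]_x f x)%E.
Proof.
move=> mf f0; apply/esym.
have mt : measurable_fun setT (-%R : measurableTypeR R -> measurableTypeR R).
  exact: oppr_measurable.
by apply: (eq_integral_pushforward mt) => // A mA; exact/esym/lebesgue_measureN.
Qed.

(** Sign changes and translations are combined so that a single induction on the dimension covers
    translations, the map x -> - x and the reflection of one coordinate. *)
Definition flip_shift n (s : 'I_n -> bool) (c x : 'rV[R]_n) : 'rV[R]_n :=
  \row_i ((-1) ^+ s i * x ord0 i + c ord0 i).

Lemma measurable_flip_shift n (s : 'I_n -> bool) (c : 'rV[R]_n) :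
  measurable_fun [set: 'rV[R]_n] (flip_shift s c).
Proof.
apply: measurable_fun_rV => i.
rewrite [X in measurable_fun _ X](_ : _ =
    fun t : 'rV[R]_n => (-1) ^+ s i * t ord0 i + c ord0 i); last first.
  by apply/funext => x; rewrite mxE.
by apply: measurable_funD => //; apply: measurable_funM => //; exact: measurable_coor.
Qed.

Lemma measurable_cons_rVr n (a : R) :
  measurable_fun setT (fun y : 'rV[R]_n => cons_rV (a, y)).
Proof. by apply: (measurableT_comp (@measurable_cons_rV R n)). Qed.

Lemma cons_rV0 n (z : R * 'rV[R]_n) : cons_rV z ord0 ord0 = z.1.
Proof.
have -> : ord0 = lshift n (@ord0 0) by exact/val_inj.
by rewrite [LHS](@row_mxEl R 1 1 n) mxE eqxx mulr1n.
Qed.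

Lemma cons_rVS n (z : R * 'rV[R]_n) i :
  cons_rV z ord0 (lift ord0 i) = z.2 ord0 i.
Proof.
have -> : lift ord0 i = rshift 1 i by exact/val_inj.
by rewrite [LHS](@row_mxEr R 1 1 n).
Qed.

(** By induction on the dimension: Tonelli isolates the first coordinate, and the inner integral is
    invariant by induction, the outer one by the invariance of Lebesgue measure on the line. *)
Lemma ge0_integral_flip_shift n (s : 'I_n -> bool) (c : 'rV[R]_n)
    (f : 'rV[R]_n -> \bar R) :
  measurable_fun [set: 'rV[R]_n] f -> (forall x, 0 <= f x)%E ->
  (\int[lebesgue_rV R n]_x f (flip_shift s c x) =
   \int[lebesgue_rV R n]_x f x)%E.
Proof.
elim: n s c f => [|n IH] s c f mf f0.
  rewrite !ge0_integral_rV0//; last first.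
    by apply: measurableT_comp => //; exact: measurable_flip_shift.
  by congr f; apply/rowP => -[].
have mfs : measurable_fun [set: 'rV[R]_n.+1] (f \o flip_shift s c).
  by apply: measurableT_comp => //; exact: measurable_flip_shift.
rewrite (ge0_integral_rVS mf f0) (ge0_integral_rVS mfs (fun=> f0 _)).
pose F a := (\int[lebesgue_rV R n]_y f (cons_rV (a, y)))%E.
have mF : measurable_fun setT F.
  have mfc : measurable_fun setT (f \o @cons_rV R n).
    by apply: measurableT_comp => //; exact: measurable_cons_rV.
  exact: (measurable_fun_fubini_tonelli_F _ mfc (fun z => f0 _)).
have F0 a : (0 <= F a)%E by exact: integral_ge0.
transitivity (\int[leb]_a F ((-1) ^+ s ord0 * a + c ord0 ord0)%R)%E.
  apply: eq_integral => a _; rewrite /F.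
  have mfa (b : R) : measurable_fun [set: 'rV[R]_n] (fun y => f (cons_rV (b, y))).
    by apply: measurableT_comp => //; exact: measurable_cons_rVr.
  rewrite -[RHS](IH (fun i => s (lift ord0 i)) (\row_i c ord0 (lift ord0 i)) _ (mfa _)
    (fun=> f0 _)).
  apply: eq_integral => y _; congr f; apply/rowP => i; rewrite mxE.
  case: (unliftP ord0 i) => [j ->|->]; first by rewrite !cons_rVS !mxE.
  by rewrite !cons_rV0.
case: (s ord0); last first.
  rewrite -[RHS](ge0_integral_translation (c ord0 ord0) mF F0).
  by apply: eq_integral => x _; rewrite expr0 mul1r.
have mFc : measurable_fun setT (fun a : R => F (a + c ord0 ord0)).
  apply: (measurableT_comp mF).
  by apply: measurable_funD => //; exact: measurable_id.
rewrite -[RHS](ge0_integral_translation (c ord0 ord0) mF F0).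
rewrite -[RHS](ge0_integral_reflection mFc (fun=> F0 _)).
by apply: eq_integral => x _; rewrite expr1 mulN1r.
Qed.

Lemma ge0_integral_shift n (c : 'rV[R]_n) (f : 'rV[R]_n -> \bar R) :
  measurable_fun [set: 'rV[R]_n] f -> (forall x, 0 <= f x)%E ->
  (\int[lebesgue_rV R n]_x f (x + c)%R = \int[lebesgue_rV R n]_x f x)%E.
Proof.
move=> mf f0; rewrite -(ge0_integral_flip_shift (fun=> false) c mf f0).
by apply: eq_integral => x _; congr f; apply/rowP => i; rewrite !mxE mul1r.
Qed.

Lemma ge0_integral_opp n (f : 'rV[R]_n -> \bar R) :
  measurable_fun [set: 'rV[R]_n] f -> (forall x, 0 <= f x)%E ->
  (\int[lebesgue_rV R n]_x f (- x)%R = \int[lebesgue_rV R n]_x f x)%E.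
Proof.
move=> mf f0; rewrite -(ge0_integral_flip_shift (fun=> true) 0 mf f0).
by apply: eq_integral => x _; congr f; apply/rowP => i; rewrite !mxE mulN1r addr0.
Qed.

End lebesgue_rV_integral.

(** * Measurability of continuous functions on R^n *)

Section rV_measurability.
Context {R : realType} {n : nat}.
Local Notation rV := 'rV[R]_n.

Lemma measurable_fun_rVP d (T : measurableType d) (f : T -> rV) :
  measurable_fun setT f <->
  forall i, measurable_fun setT (fun t => f t ord0 i).
Proof.
split; last exact: measurable_fun_rV.
by move=> mf i; apply: (measurableT_comp (@measurable_coor R n i)).
Qed.

Lemma measurable_rVD d (T : measurableType d) (f g : T -> rV) :
  measurable_fun setT f -> measurable_fun setT g ->
  measurable_fun setT (fun t => f t + g t).
Proof.
move=> /measurable_fun_rVP mf /measurable_fun_rVP mg.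
apply/measurable_fun_rVP => i; rewrite [X in measurable_fun _ X](_ : _ = fun t => f t ord0 i + g t ord0 i).
  exact: measurable_funD.
by apply/funext => t; rewrite mxE.
Qed.

Lemma measurable_rVN d (T : measurableType d) (f : T -> rV) :
  measurable_fun setT f -> measurable_fun setT (fun t => - f t).
Proof.
move=> /measurable_fun_rVP mf.
apply/measurable_fun_rVP => i; rewrite [X in measurable_fun _ X](_ : _ = fun t => - f t ord0 i).
  exact: measurable_funN.
by apply/funext => t; rewrite mxE.
Qed.

Lemma measurable_rVB d (T : measurableType d) (f g : T -> rV) :
  measurable_fun setT f -> measurable_fun setT g ->
  measurable_fun setT (fun t => f t - g t).
Proof. by move=> mf mg; apply: measurable_rVD => //; exact: measurable_rVN. Qed.

Lemma rV_norm_le (x : rV) (e : R) :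
  0 <= e -> (forall i, `|x ord0 i| <= e) -> `|x| <= e.
Proof.
move=> e0 h; rewrite [leLHS]/Num.Def.normr /= mx_normrE.
by apply: bigmax_le => // -[i j] _ /=; rewrite ord1.
Qed.

Lemma rV_norm_coor (x : rV) i : `|x ord0 i| <= `|x|.
Proof.
rewrite [leRHS]/Num.Def.normr /= mx_normrE.
by apply: (le_trans _ (le_bigmax _ _ (ord0, i))).
Qed.

Definition grid_round (k : nat) (x : rV) : rV :=
  \row_i ((Num.floor (x ord0 i * 2 ^+ k))%:~R / 2 ^+ k).

Lemma grid_round_dist k (x : rV) i : `|x ord0 i - grid_round k x ord0 i| <= (2 ^+ k)^-1.
Proof.
rewrite mxE; set y := x ord0 i.
have k0 : 0 < (2 : R) ^+ k by exact: exprn_gt0.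
have -> : y - (Num.floor (y * 2 ^+ k))%:~R / 2 ^+ k =
   (y * 2 ^+ k - (Num.floor (y * 2 ^+ k))%:~R) / 2 ^+ k.
  by rewrite mulrBl mulfK// gt_eqF.
rewrite normrM normfV (gtr0_norm k0) ler_pdivrMr// mulVf ?gt_eqF//.
have /andP[h1 h2] := floor_itv (y * 2 ^+ k).
rewrite ger0_norm ?subr_ge0//.
by rewrite lerBlDr addrC; apply: ltW; move: h2; rewrite intrD.
Qed.

Lemma grid_round_cvg (x : rV) : grid_round k x @[k --> \oo] --> x.
Proof.
apply/cvgrPdist_le => e e0.
have := @cvg_geometric R 1 2^-1.
rewrite ger0_norm // => /(_ _) h.
have {h} h : (fun k => 1 * 2^-1 ^+ k : R) @ \oo --> (0 : R).
  by apply: h; rewrite invf_lt1// ltr1n.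
move/cvgrPdist_le : h => /(_ e e0)[N _ hN]; exists N => // k Nk.
apply: rV_norm_le => [|j]; first exact: ltW.
have := grid_round_dist k x j; rewrite !mxE => /le_trans; apply.
by have := hN k Nk; rewrite sub0r normrN mul1r exprVn ger0_norm.
Qed.

(** The sigma-algebra is generated by the coordinates, not by the open sets. A continuous f is the
    pointwise limit of [f] composed with [grid_round k], which is constant on countably many
    half-open dyadic boxes. *)
Lemma measurable_fun_continuous_rV (f : rV -> R) :
  continuous f -> measurable_fun [set: rV] f.
Proof.
move=> cf.
apply: (@measurable_fun_cvg _ rV R setT (fun k x => f (grid_round k x))); last first.
  move=> x _; apply: continuous_cvg; [exact: cf|exact: grid_round_cvg].
move=> k _ Y mY; rewrite setTI.
pose D := {ffun 'I_n -> int}.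
pose pt (d : D) : rV := \row_i ((d i)%:~R / 2 ^+ k).
rewrite (_ : _ @^-1` Y = \bigcup_(d : D) [set x : rV | Y (f (pt d)) /\
  forall i, [set r : R | Num.floor (r * 2 ^+ k) = d i] (x ord0 i)]).
  apply: countable_bigcupT_measurable => [|d]; first exact: countableP.
  have [Yd|nYd] := pselect (Y (f (pt d))); last first.
    by rewrite (_ : [set x | _] = set0)//; apply/seteqP; split => x // -[].
  rewrite (_ : [set x | _] = [set x : rV | forall i,
      [set r : R | Num.floor (r * 2 ^+ k) = d i] (x ord0 i)]); last first.
    by apply/seteqP; split => x // -[].
  apply: (measurable_box (A := fun i => [set r : R | Num.floor (r * 2 ^+ k) = d i])) => i.
  rewrite (_ : [set r | _] = `[(d i)%:~R / 2 ^+ k, (d i + 1)%:~R / 2 ^+ k[%classic).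
    exact: measurable_itv.
  have k0 : 0 < (2 : R) ^+ k by exact: exprn_gt0.
  apply/seteqP; split => r /=; rewrite in_itv/= ler_pdivrMr// ltr_pdivlMr//.
    by move=> <-; exact: floor_itv.
  by move=> /floor_def.
apply/seteqP; split => x /=.
  move=> Yx; exists [ffun i => Num.floor (x ord0 i * 2 ^+ k)] => //=; split.
    suff <- : grid_round k x = pt [ffun i => Num.floor (x ord0 i * 2 ^+ k)] by [].
    by apply/rowP => i; rewrite !mxE ffunE.
  by move=> i; rewrite ffunE.
move=> [d _ /= [Yd xd]]; suff -> : grid_round k x = pt d by [].
by apply/rowP => i; rewrite !mxE xd.
Qed.

End rV_measurability.

(** * Semi-inner-product spaces *)

(** The form is only semi-definite because functions are not quotiented by almost everywhere
    equality; L^2 is a predicate [L] on a vector space of functions. Completeness is stated for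
    sequences whose increments are dominated by a sequence that at least halves at each step. *)
Record semi_hilbert (R : realType) (V : lmodType R) (L : V -> Prop)
    (ip : V -> V -> R) : Prop := {
  sh0 : L 0 ;
  sh_lin : forall a x y, L x -> L y -> L (a *: x + y) ;
  sh_ipC : forall x y, L x -> L y -> ip x y = ip y x ;
  sh_ipl : forall a x y z, L x -> L y -> L z ->
    ip (a *: x + y) z = a * ip x z + ip y z ;
  sh_ip_ge0 : forall x, L x -> 0 <= ip x x ;
  sh_complete0 : forall (u : nat -> V) (e : nat -> R), (forall k, L (u k)) ->
    (forall k, 0 <= e k) -> (forall k, e k.+1 <= e k / 2) ->
    (forall k, Num.sqrt (ip (u k.+1 - u k) (u k.+1 - u k)) <= e k) ->
    exists2 x, L x & forall eps, 0 < eps -> exists N, forall k, (N <= k)%N ->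
      Num.sqrt (ip (x - u k) (x - u k)) <= eps }.

Section semi_hilbert.
Context {R : realType} {V : lmodType R} (L : V -> Prop) (ip : V -> V -> R).
Hypothesis sh : semi_hilbert L ip.
Implicit Types (x y z : V) (a b c t e : R).

Definition hnorm x := Num.sqrt (ip x x).
Local Notation nrm := hnorm.

Lemma shD x y : L x -> L y -> L (x + y).
Proof. by move=> Lx Ly; rewrite -[x]scale1r; apply: (sh_lin sh). Qed.

Lemma shZ a x : L x -> L (a *: x).
Proof. by move=> Lx; rewrite -[_ *: _]addr0; apply: (sh_lin sh) => //; exact: (sh0 sh). Qed.

Lemma shN x : L x -> L (- x).
Proof. by move=> Lx; rewrite -scaleN1r; exact: shZ. Qed.

Lemma shB x y : L x -> L y -> L (x - y).
Proof. by move=> Lx Ly; apply: shD => //; exact: shN. Qed.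

Hint Resolve shD shZ shN shB : core.

Lemma shipDl x y z : L x -> L y -> L z -> ip (x + y) z = ip x z + ip y z.
Proof. by move=> Lx Ly Lz; rewrite -{1}[x]scale1r (sh_ipl sh)// mul1r. Qed.

Lemma ship0l z : L z -> ip 0 z = 0.
Proof.
move=> Lz; have := shipDl (sh0 sh) (sh0 sh) Lz.
by rewrite addr0 => /eqP; rewrite -subr_eq subrr eq_sym => /eqP.
Qed.

Lemma shipZl a x z : L x -> L z -> ip (a *: x) z = a * ip x z.
Proof.
by move=> Lx Lz; rewrite -[_ *: _]addr0 (sh_ipl sh)// ?ship0l ?addr0//; exact: (sh0 sh).
Qed.

Lemma shipNl x z : L x -> L z -> ip (- x) z = - ip x z.
Proof. by move=> Lx Lz; rewrite -scaleN1r shipZl// mulN1r. Qed.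

Lemma shipBl x y z : L x -> L y -> L z -> ip (x - y) z = ip x z - ip y z.
Proof. by move=> Lx Ly Lz; rewrite shipDl ?shipNl//; exact: shN. Qed.

Lemma shipDr x y z : L x -> L y -> L z -> ip z (x + y) = ip z x + ip z y.
Proof.
move=> Lx Ly Lz; rewrite (sh_ipC sh)//; last exact: shD.
by rewrite shipDl// (sh_ipC sh Lx)// (sh_ipC sh Ly).
Qed.

Lemma shipZr a x z : L x -> L z -> ip z (a *: x) = a * ip z x.
Proof.
move=> Lx Lz; rewrite (sh_ipC sh)//; last exact: shZ.
by rewrite shipZl// (sh_ipC sh Lx).
Qed.

Lemma shipNr x z : L x -> L z -> ip z (- x) = - ip z x.
Proof. by move=> Lx Lz; rewrite -scaleN1r shipZr// mulN1r. Qed.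

Lemma shipBr x y z : L x -> L y -> L z -> ip z (x - y) = ip z x - ip z y.
Proof. by move=> Lx Ly Lz; rewrite shipDr ?shipNr//; exact: shN. Qed.

Lemma hnorm_ge0 x : 0 <= nrm x. Proof. exact: sqrtr_ge0. Qed.
Hint Resolve hnorm_ge0 : core.

Lemma hnorm_sqr x : L x -> nrm x ^+ 2 = ip x x.
Proof. by move=> Lx; rewrite sqr_sqrtr// (sh_ip_ge0 sh). Qed.

Lemma hnorm_combo a b x y : L x -> L y ->
  nrm (a *: x + b *: y) ^+ 2 = a ^+ 2 * nrm x ^+ 2 + 2 * (a * b) * ip x y + b ^+ 2 * nrm y ^+ 2.
Proof.
move=> Lx Ly; rewrite !hnorm_sqr; auto.
rewrite !(shipDl, shipDr, shipZl, shipZr); auto.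
by rewrite (sh_ipC sh Ly Lx); ring.
Qed.

Lemma hnormD_sqr x y : L x -> L y ->
  nrm (x + y) ^+ 2 = nrm x ^+ 2 + 2 * ip x y + nrm y ^+ 2.
Proof.
by move=> Lx Ly; have := hnorm_combo 1 1 Lx Ly; rewrite !scale1r => ->; ring.
Qed.

Lemma hnormB_sqr x y : L x -> L y ->
  nrm (x - y) ^+ 2 = nrm x ^+ 2 - 2 * ip x y + nrm y ^+ 2.
Proof.
move=> Lx Ly; have := hnorm_combo 1 (-1) Lx Ly.
by rewrite scale1r scaleN1r => ->; ring.
Qed.

Lemma hnormZ a x : L x -> nrm (a *: x) = `|a| * nrm x.
Proof.
move=> Lx; rewrite /nrm shipZl ?shipZr; auto.
by rewrite mulrA -expr2 sqrtrM ?sqr_ge0// sqrtr_sqr.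
Qed.

Lemma hnormN x : L x -> nrm (- x) = nrm x.
Proof. by move=> Lx; rewrite -scaleN1r hnormZ// normrN1 mul1r. Qed.

Lemma hnormC x y : L x -> L y -> nrm (x - y) = nrm (y - x).
Proof. by move=> Lx Ly; rewrite -hnormN ?opprB; auto. Qed.

Lemma hnorm0 : nrm 0 = 0.
Proof. by rewrite /nrm ship0l ?sqrtr0//; exact: (sh0 sh). Qed.

Lemma sh_cauchy_schwarz x y : L x -> L y -> `|ip x y| <= nrm x * nrm y.
Proof.
move=> Lx Ly; rewrite -(@ler_pXn2r _ 2%N) ?nnegrE ?mulr_ge0// -normrX ger0_norm ?sqr_ge0// exprMn.
have [y0|y0] := eqVneq (nrm y) 0.
  rewrite y0 expr0n/= mulr0.
  have [->|b0] := eqVneq (ip x y) 0; first by rewrite expr0n.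
  pose k := (nrm x ^+ 2 + 1) / (2 * ip x y).
  have := sqr_ge0 (nrm (1 *: x + (- k) *: y)).
  rewrite hnorm_combo// y0 expr0n/= mulr0 addr0 expr1n !mul1r.
  have -> : 2 * - k * ip x y = - (nrm x ^+ 2 + 1) by rewrite /k; field.
  lra.
have := sqr_ge0 (nrm (nrm y ^+ 2 *: x + (- ip x y) *: y)).
rewrite hnorm_combo//.
have y2 : 0 < nrm y ^+ 2 by rewrite exprn_gt0// lt_def y0/=.
have -> : (nrm y ^+ 2) ^+ 2 * nrm x ^+ 2 + 2 * (nrm y ^+ 2 * - ip x y) * ip x y +
  (- ip x y) ^+ 2 * nrm y ^+ 2 = nrm y ^+ 2 * (nrm x ^+ 2 * nrm y ^+ 2 - ip x y ^+ 2).
  by ring.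
by rewrite pmulr_rge0// subr_ge0.
Qed.

Lemma hnorm_triangle x y : L x -> L y -> nrm (x + y) <= nrm x + nrm y.
Proof.
move=> Lx Ly; rewrite -(@ler_pXn2r _ 2%N) ?nnegrE ?addr_ge0// hnormD_sqr//.
have := sh_cauchy_schwarz Lx Ly; have := ler_norm (ip x y).
by rewrite sqrrD; nra.
Qed.

Lemma hnorm_triangleB x y : L x -> L y -> nrm (x - y) <= nrm x + nrm y.
Proof. by move=> Lx Ly; rewrite -(hnormN Ly) hnorm_triangle; auto. Qed.

Lemma hdist_triangle y x z : L x -> L y -> L z ->
  nrm (x - z) <= nrm (x - y) + nrm (y - z).
Proof.
move=> Lx Ly Lz; have -> : x - z = (x - y) + (y - z) by rewrite addrA subrK.
by apply: hnorm_triangle; auto.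
Qed.

Lemma hnorm_le_dist x y : L x -> L y -> nrm x <= nrm y + nrm (x - y).
Proof.
by move=> Lx Ly; rewrite -{1}[x](subrK y) addrC; apply: hnorm_triangle; auto.
Qed.

Lemma hnorm_congr x y : L x -> L y -> nrm (x - y) = 0 -> nrm x = nrm y.
Proof.
move=> Lx Ly xy0; apply/eqP; rewrite eq_le.
have := hnorm_le_dist Lx Ly; have := hnorm_le_dist Ly Lx.
by rewrite (hnormC Ly Lx) xy0 !addr0 => -> ->.
Qed.

(** Telescoping the increments, whose bounds at least halve, gives a tail of at most 2 e_k after
    [u k]; this adds a rate to the bare convergence of [sh_complete0]. *)
Lemma sh_complete (u : nat -> V) (e : nat -> R) : (forall k, L (u k)) ->
  (forall k, 0 <= e k) -> (forall k, e k.+1 <= e k / 2) ->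
  (forall k, nrm (u k.+1 - u k) <= e k) ->
  exists2 x, L x & forall k, nrm (x - u k) <= 2 * e k.
Proof.
move=> Lu e0 eh ue; have [x Lx hx] := sh_complete0 sh Lu e0 eh ue.
exists x => // k; apply/ler_addgt0Pr => eps eps0.
have tel i : nrm (u (k + i)%N - u k) + 2 * e (k + i)%N <= 2 * e k.
  elim: i => [|i IH]; first by rewrite addn0 subrr hnorm0 add0r.
  rewrite addnS; apply: le_trans IH.
  have := hdist_triangle (Lu (k + i).+1) (Lu (k + i)%N) (Lu k).
  have := ue (k + i)%N; have := eh (k + i)%N; lra.
have [N hN] := hx _ eps0.
have := hdist_triangle Lx (Lu (k + N)%N) (Lu k).
have := hN _ (leq_addl k N); have := tel N; have := e0 (k + N)%N.
rewrite /hnorm; lra.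
Qed.

(* The minimising sequence for the distance to D is Cauchy by the
   parallelogram law, and its limit differs from x by a vector orthogonal
   to D. *)
Lemma sh_dense (D : V -> Prop) : D 0 ->
  (forall a x y, D x -> D y -> D (a *: x + y)) -> (forall x, D x -> L x) ->
  (forall h, L h -> (forall d, D d -> ip h d = 0) -> nrm h = 0) ->
  forall x e, L x -> 0 < e -> exists2 d, D d & nrm (x - d) <= e.
Proof.
move=> D0 Dlin DL Dperp x e Lx e0.
pose E := [set r | exists2 d, D d & r = nrm (x - d) ^+ 2].
have Ene : E !=set0 by exists (nrm (x - 0) ^+ 2), 0.
have Elb : has_lbound E by exists 0 => _ [d _ ->]; exact: sqr_ge0.
pose I := inf E.
have IE d : D d -> I <= nrm (x - d) ^+ 2.
  by move=> Dd; apply: ge_inf => //; exists d.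
have DB d d' : D d -> D d' -> D (d - d').
  by move=> Dd Dd'; rewrite addrC -scaleN1r; exact: Dlin.
(* With this tolerance the parallelogram law gives |u_{k+1} - u_k|^2 <= (5/8) 4^{-k}, so the
   minimising sequence converges geometrically. *)
have step k : exists d, D d /\ nrm (x - d) ^+ 2 <= I + (2^-1 ^+ k) ^+ 2 / 4.
  have ek : 0 < (2^-1 ^+ k : R) ^+ 2 / 4 by rewrite divr_gt0// !exprn_gt0// invr_gt0.
  have [_ [d Dd ->] dI] := inf_adherent ek (conj Ene Elb).
  by exists d; split => //; exact: ltW.
pose u k := projT1 (cid (step k)).
have Du k : D (u k) by rewrite /u; case: cid => d /= [].
have uI k : nrm (x - u k) ^+ 2 <= I + (2^-1 ^+ k) ^+ 2 / 4.
  by rewrite /u; case: cid => d /= [].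
have Lu k : L (u k) by exact: DL.
have u_step k : nrm (u k.+1 - u k) <= 2^-1 ^+ k.
  have p0 : 0 <= (2^-1 : R) ^+ k by rewrite exprn_ge0.
  rewrite -(@ler_pXn2r _ 2%N) ?nnegrE//.
  have Dm : D (2^-1 *: (u k.+1 + u k)).
    rewrite -[_ *: _]addr0; apply: (Dlin) => //.
    by rewrite -[u k.+1]scale1r; exact: Dlin.
  have h1 := uI k; have h2 := uI k.+1; have h3 := IE _ Dm.
  have e1 : u k.+1 - u k = (x - u k) - (x - u k.+1).
    by rewrite opprB [RHS]addrC addrA subrK.
  have e2 : x - 2^-1 *: (u k.+1 + u k) = 2^-1 *: (x - u k) + 2^-1 *: (x - u k.+1).
    rewrite -scalerDr addrACA -opprD scalerBr [in LHS](addrC (u k.+1)).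
    by rewrite -[x + x]mulr2n -[x *+ 2]scaler_nat scalerA mulVf ?scale1r ?pnatr_eq0.
  have Lk : L (x - u k) by auto.
  have Lk1 : L (x - u k.+1) by auto.
  move: h3; rewrite e1 e2 hnormB_sqr// hnorm_combo//.
  move: h1 h2; rewrite [2^-1 ^+ k.+1]exprS [(2^-1 * _) ^+ 2]exprMn.
  set a := nrm (x - u k) ^+ 2; set b := nrm (x - u k.+1) ^+ 2.
  set c := ip _ _; set q := (_ ^+ k) ^+ 2 => h1 h2 h3.
  have q0 : 0 <= q by exact: sqr_ge0.
  lra.
have [y Ly uy] : exists2 y, L y & forall k, nrm (y - u k) <= 2 * 2^-1 ^+ k.
  apply: sh_complete => // [k].
  by rewrite exprS mulrC.
have small (r : R) : 0 < r -> exists k, 4 * 2^-1 ^+ k <= r.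
  move=> r0; have [N HN] : exists N, 4 / r < 2 ^+ N.
    by exists (Num.bound (4 / r)); exact: upper_nthrootP.
  exists N; rewrite exprVn ler_pdivrMr ?exprn_gt0// mulrC.
  by rewrite -ler_pdivrMr// ltW.
have I0 : 0 <= I by apply: lb_le_inf => // _ [d _ ->]; exact: sqr_ge0.
pose s := Num.sqrt I.
have hI : nrm (x - y) <= s.
  apply/ler_addgt0Pr => r r0; have [k hk] := small r r0.
  have h1 : nrm (x - u k) <= s + 2^-1 ^+ k.
    have p0 : 0 <= (2^-1 : R) ^+ k by rewrite exprn_ge0.
    rewrite -(@ler_pXn2r _ 2%N) ?nnegrE ?addr_ge0 ?sqrtr_ge0//.
    apply: le_trans (uI k) _; rewrite sqrrD sqr_sqrtr//.
    have : 0 <= s * 2^-1 ^+ k by rewrite mulr_ge0// sqrtr_ge0.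
    have := sqr_ge0 ((2^-1 : R) ^+ k); lra.
  have := hdist_triangle Lx (Lu k) Ly; have := uy k.
  rewrite (hnormC Ly (Lu k)); have : 0 <= (2^-1 : R) ^+ k by rewrite exprn_ge0.
  lra.
have hD d t : D d -> I <= nrm (x - y - t *: d) ^+ 2.
  move=> Dd; rewrite -[I]sqr_sqrtr// ler_pXn2r ?nnegrE ?sqrtr_ge0// -/s.
  apply/ler_addgt0Pr => r r0; have [k hk] := small r r0.
  have Dtd : D (t *: d + u k) by exact: Dlin.
  have h1 : s <= nrm (x - (t *: d + u k)).
    by rewrite -(@ler_pXn2r _ 2%N) ?nnegrE ?sqrtr_ge0// sqr_sqrtr//; exact: IE.
  have Ld := DL _ Dd.
  have Lz : L (x - y - t *: d) by auto.
  have LD := DL _ Dtd.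
  have := hnorm_le_dist (shB Lx LD) Lz.
  have -> : x - (t *: d + u k) - (x - y - t *: d) = y - u k.
    by rewrite !opprD !opprK addrACA addNKr addrAC addNr add0r.
  have := uy k; have : 0 <= (2^-1 : R) ^+ k by rewrite exprn_ge0.
  lra.
have perp d : D d -> ip (x - y) d = 0.
  move=> Dd; have Ld := DL _ Dd; have Lxy : L (x - y) by auto.
  apply/eqP; apply: contraT => b0.
  (* The optimal displacement along d would divide by |d|^2; adding 1 keeps the quotient meaningful
     when d is a null vector and still lowers the distance strictly. *)
  pose t := ip (x - y) d / (nrm d ^+ 2 + 1).
  have := hD d t Dd.
  have -> : x - y - t *: d = 1 *: (x - y) + (- t) *: d by rewrite scale1r scaleNr.
  rewrite hnorm_combo//.
  have : nrm (x - y) ^+ 2 <= I.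
    by rewrite -[I]sqr_sqrtr// ler_pXn2r ?nnegrE ?sqrtr_ge0.
  set b := ip (x - y) d in t b0 *; set m := nrm d ^+ 2 in t *.
  have m0 : 0 <= m by exact: sqr_ge0.
  have -> : 2 * (1 * - t) * b = - (2 * (b ^+ 2 / (m + 1))) by rewrite /t; field; lra.
  have -> : (- t) ^+ 2 * m = b ^+ 2 / (m + 1) * (m / (m + 1)) by rewrite /t; field; lra.
  have q0 : 0 < b ^+ 2 / (m + 1).
    by rewrite divr_gt0//; [rewrite lt_def sqrf_eq0 b0 sqr_ge0|lra].
  have q1 : m / (m + 1) <= 1 by rewrite ler_pdivrMr; lra.
  nra.
have hy0 := Dperp _ (shB Lx Ly) perp.
have [k hk] := small e e0; exists (u k) => //.
have := hdist_triangle Lx Ly (Lu k); rewrite hy0 add0r => /le_trans; apply.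
have : 0 <= (2^-1 : R) ^+ k by rewrite exprn_ge0.
have := uy k; lra.
Qed.

End semi_hilbert.

(** * Strongly continuous semigroups and uniform boundedness *)

(** All semigroup laws hold up to vectors of seminorm zero, which is what almost everywhere equality
    becomes. *)
Record semi_c0 (R : realType) (V : lmodType R) (L : V -> Prop)
    (ip : V -> V -> R) (S : R -> V -> V) : Prop := {
  sc_L : forall t x, 0 <= t -> L x -> L (S t x) ;
  sc_lin : forall t a x y, 0 <= t -> L x -> L y ->
    hnorm ip (S t (a *: x + y) - (a *: S t x + S t y)) = 0 ;
  sc_bd : forall t, 0 <= t -> exists M, forall x, L x ->
    hnorm ip (S t x) <= M * hnorm ip x ;
  sc_id : forall x, L x -> hnorm ip (S 0 x - x) = 0 ;
  sc_add : forall s t x, 0 <= s -> 0 <= t -> L x ->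
    hnorm ip (S (s + t) x - S s (S t x)) = 0 ;
  sc_cont : forall x e, L x -> 0 < e -> exists2 eta : R, 0 < eta &
    forall t, 0 < t -> t < eta -> hnorm ip (S t x - x) <= e }.

Section uniform_bound.
Context {R : realType} {V : lmodType R} (L : V -> Prop) (ip : V -> V -> R)
  (S : R -> V -> V).
Hypothesis sh : semi_hilbert L ip.
Hypothesis sc : semi_c0 L ip S.
Local Notation nrm := (hnorm ip).

Let LD x y : L x -> L y -> L (x + y) := @shD _ _ _ _ sh x y.
Let LZ a x : L x -> L (a *: x) := @shZ _ _ _ _ sh a x.
Let LN x : L x -> L (- x) := @shN _ _ _ _ sh x.
Let LB x y : L x -> L y -> L (x - y) := @shB _ _ _ _ sh x y.
Hint Resolve LD LZ LN LB : core.

Lemma sc_bd_ge1 t : 0 <= t -> exists2 M, 1 <= M & forall x, L x ->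
  nrm (S t x) <= M * nrm x.
Proof.
move=> t0; have [M hM] := sc_bd sc t0; exists (Num.max 1 M).
  by rewrite le_max lexx.
move=> x Lx; apply: le_trans (hM _ Lx) _.
by rewrite ler_wpM2r ?hnorm_ge0// le_max lexx orbT.
Qed.

Lemma sc_dist t x y : 0 <= t -> L x -> L y ->
  nrm (S t (x - y) - (S t x - S t y)) = 0.
Proof.
move=> t0 Lx Ly; have := sc_lin sc (-1) t0 Ly Lx.
by rewrite !scaleN1r [- y + x]addrC [- S t y + _]addrC.
Qed.

Lemma sc_distE t x y : 0 <= t -> L x -> L y ->
  nrm (S t x - S t y) = nrm (S t (x - y)).
Proof.
move=> t0 Lx Ly; apply/esym/(hnorm_congr sh); last exact: sc_dist.
- by apply: (sc_L sc) => //; auto.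
- by apply: LB; exact: (sc_L sc).
Qed.

(** One step of the gliding hump; a pair is a centre and a radius. On the ball of radius twice
    [s'.2] around [s'.1], some operator of time at most 1/(k+1) takes values of norm at least k + 1.
    The radii at least halve, so the centres converge. *)
Let bump k (s s' : V * R) := L s'.1 /\ 0 < s'.2 /\ s'.2 <= s.2 / 2 /\
  nrm (s'.1 - s.1) <= s.2 /\ exists t : R, [/\ 0 <= t, t <= k.+1%:R^-1 &
  forall z, L z -> nrm (z - s'.1) <= 2 * s'.2 -> k.+1%:R <= nrm (S t z)].

(* Gliding hump. *)
Lemma sc_bounded_near0 : exists eta M, [/\ 0 < eta, 1 <= M &
  forall t x, 0 <= t -> t <= eta -> L x -> nrm (S t x) <= M * nrm x].
Proof.
apply: contrapT => nbd.
have unb (eta M : R) : 0 < eta -> 1 <= M -> exists t x,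
    [/\ 0 <= t, t <= eta, L x & M * nrm x < nrm (S t x)].
  move=> eta0 M1; apply: contrapT => h; apply: nbd; exists eta, M; split => //.
  move=> t x t0 teta Lx; rewrite leNgt; apply/negP => hlt; apply: h.
  by exists t, x.
have step k (s : V * R) : L s.1 -> 0 < s.2 -> exists s', bump k s s'.
  case: s => x e /= Lx e0.
  have k0 : 0 < k.+1%:R^-1 :> R by rewrite invr_gt0.
  have M1 : 1 <= 1 + k.+2%:R / e by rewrite lerDl divr_ge0// ltW.
  have [t [y [t0 tk Ly hy]]] := unb _ _ k0 M1.
  have [M hM1 hM] := sc_bd_ge1 t0.
  have y0 : 0 < nrm y.
    rewrite lt_def hnorm_ge0 andbT; apply/eqP => y0.
    by have := hM _ Ly; move: hy; rewrite y0 !mulr0 => /lt_le_trans h /h; rewrite ltxx.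
  pose w := (e / nrm y) *: y.
  have Lw : L w by exact: LZ.
  have nw : nrm w = e.
    by rewrite (hnormZ sh)// gtr0_norm ?divr_gt0// divfK// gt_eqF.
  have LSt z : L z -> L (S t z) by exact: (sc_L sc).
  have Sw : k.+2%:R <= nrm (S t w).
    have := sc_lin sc (e / nrm y) t0 Ly (sh0 sh).
    rewrite addr0 => h1.
    have S0 : nrm (S t 0) = 0.
      apply/eqP; rewrite eq_le hnorm_ge0 andbT.
      by have := hM _ (sh0 sh); rewrite (hnorm0 sh) mulr0.
    have h2 := hnorm_congr sh (LSt _ Lw) (LD (LZ (e / nrm y) (LSt _ Ly)) (LSt _ (sh0 sh))) h1.
    have h3 : nrm (e / nrm y *: S t y) <= nrm (S t w).
      rewrite h2.
      have := hnorm_le_dist sh (LZ (e / nrm y) (LSt _ Ly))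
        (LD (LZ (e / nrm y) (LSt _ Ly)) (LSt _ (sh0 sh))).
      rewrite opprD addNKr (hnormN sh); last exact/LSt/(sh0 sh).
      by rewrite S0 addr0.
    apply: le_trans h3; rewrite (hnormZ sh); last exact: LSt.
    rewrite gtr0_norm ?divr_gt0// mulrAC ler_pdivlMr//.
    rewrite mulrC; have := ltW hy; rewrite mulrDl mul1r => h.
    have : k.+2%:R / e * nrm y <= nrm (S t y) by have := hnorm_ge0 ip y; lra.
    by rewrite -(ler_pM2l e0) mulrA mulrCA divff ?gt_eqF// mulr1 mulrC.
  (* The images of x + w and x - w differ by twice the image of w up to null vectors, so one of them
     has norm at least k + 2. *)
  have [x' Lx' [nx' Sx']] : exists2 x', L x' & nrm (x' - x) = e /\ k.+2%:R <= nrm (S t x').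
    have [h|h] := leP k.+2%:R (nrm (S t (x + w))).
      by exists (x + w); [auto|rewrite addrC addKr].
    exists (x - w); first by auto.
    split; first by rewrite addrC addKr (hnormN sh).
    have Lp : L (x + w) by auto.
    have Lm : L (x - w) by auto.
    have h1 := sc_distE t0 Lp Lm.
    have e1 : x + w - (x - w) = 2%:R *: w.
      by rewrite opprB addrC addrA subrK scaler_nat mulr2n.
    have h2 : nrm (S t (2%:R *: w)) = 2 * nrm (S t w).
      have := sc_lin sc 1 t0 Lw Lw; rewrite !scale1r => h3.
      have := hnorm_congr sh (LSt _ (LD Lw Lw)) (LD (LSt _ Lw) (LSt _ Lw)) h3.
      rewrite -mulr2n -scaler_nat => ->.
      by rewrite -mulr2n -scaler_nat (hnormZ sh) ?ger0_norm//; exact: LSt.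
    have := hnorm_triangleB sh (LSt _ Lp) (LSt _ Lm).
    by rewrite h1 e1 h2; lra.
  have M0 : 0 < M by exact: lt_le_trans hM1.
  exists (x', Num.min (e / 2) (2 * M)^-1); rewrite /bump/=; split => //.
  split; first by rewrite lt_min divr_gt0//= invr_gt0 mulr_gt0.
  split; first by rewrite ge_min lexx.
  split; first by rewrite nx'.
  exists t; split => // z Lz hz.
  have h1 : nrm (z - x') <= M^-1.
    apply: le_trans hz _; rewrite -ler_pdivlMl// ge_min; apply/orP; right.
    by rewrite invfM mulrC.
  have h2 : nrm (S t (x' - z)) <= 1.
    apply: le_trans (hM _ (LB Lx' Lz)) _.
    by rewrite (hnormC sh)// -ler_pdivlMl// mulr1.
  have := hnorm_le_dist sh (LSt _ Lx') (LSt _ Lz).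
  rewrite sc_distE// => h3.
  have : k.+2%:R = k.+1%:R + 1 :> R by rewrite -natr1.
  lra.
pose next k (s : V * R) : V * R :=
  if pselect (exists s', bump k s s') is left h then projT1 (cid h) else s.
have nextP k s : L s.1 -> 0 < s.2 -> bump k s (next k s).
  move=> h1 h2; rewrite /next; case: pselect => [h|]; last by move=> /(_ (step k s h1 h2)).
  by case: cid.
pose st := fix st k := if k is k'.+1 then next k' (st k') else (0, 1) : V * R.
have stP k : L (st k).1 /\ 0 < (st k).2.
  elim: k => [|k [h1 h2]] /=; first by split; [exact: (sh0 sh)|].
  by have [? []] := nextP k _ h1 h2.
have stS k : bump k (st k) (st k.+1) by have [h1 h2] := stP k; exact: nextP.
have [z Lz hz] : exists2 z, L z & forall k, nrm (z - (st k).1) <= 2 * (st k).2.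
  apply: (sh_complete sh) => k; first by have [] := stP k.
  - by have [_ /ltW] := stP k.
  - by have [_ [_ []]] := stS k.
  - by have [_ [_ [_ []]]] := stS k.
(* At the limit z, strong continuity keeps [S t z] within distance 1 of z for small t, against the
   growth imposed by all the humps. *)
have [eta eta0 heta] := sc_cont sc Lz (@ltr01 R).
pose k := Num.bound (Num.max eta^-1 (nrm z + 1)).
have k1 : eta^-1 < k%:R.
  apply: le_lt_trans (archi_boundP _); last by rewrite le_max invr_ge0 ltW.
  by rewrite le_max lexx.
have k2 : nrm z + 1 < k%:R.
  apply: le_lt_trans (archi_boundP _); last by rewrite le_max invr_ge0 ltW.
  by rewrite le_max lexx orbT.
have [_ [_ [_ [_ [t [t0 tk ht]]]]]] := stS k.
have kk : k%:R < k.+1%:R :> R by rewrite ltr_nat.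
have teta : t < eta.
  apply: le_lt_trans tk _; rewrite invf_plt ?posrE//; exact: lt_trans kk.
have := ht z Lz (hz k.+1); apply/negP; rewrite -ltNge.
apply: lt_trans kk; apply: le_lt_trans k2.
have LSt : L (S t z) by exact: (sc_L sc).
apply: le_trans (hnorm_le_dist sh LSt Lz) _; rewrite lerD2l.
have [->|tn0] := eqVneq t 0; first by rewrite (sc_id sc)// ler01.
by apply: heta => //; rewrite lt_def tn0.
Qed.

(** The bound near 0 is iterated through the semigroup law: at most a factor M for each time step
    eta. *)
Lemma sc_bounded : exists eta M, [/\ 0 < eta, 1 <= M &
  forall k t x, 0 <= t -> t <= k%:R * eta -> L x ->
  nrm (S t x) <= M ^+ k * nrm x].
Proof.
have [eta [M [eta0 M1 hM]]] := sc_bounded_near0.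
have M0 : 0 <= M by exact: le_trans M1.
exists eta, M; split => //; elim=> [|k IH] t x t0.
  rewrite mul0r => t0' Lx; have -> : t = 0 by apply/eqP; rewrite eq_le t0 t0'.
  rewrite expr0 mul1r (hnorm_congr sh _ Lx (sc_id sc Lx))//.
  exact: (sc_L sc).
move=> tk Lx; have [te|te] := leP t eta.
  apply: le_trans (hM _ _ t0 te Lx) _; rewrite ler_wpM2r ?hnorm_ge0//.
  by rewrite exprS ler_peMr// exprn_ege1.
have t1 : 0 <= t - eta by rewrite subr_ge0 ltW.
have LSx : L (S (t - eta) x) by exact: (sc_L sc).
have := sc_add sc (ltW eta0) t1 Lx; rewrite [eta + _]addrC subrK => h.
rewrite (hnorm_congr sh _ _ h); [|exact: (sc_L sc)|by apply: (sc_L sc) => //; exact: ltW].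
apply: le_trans (hM _ _ (ltW eta0) (lexx _) LSx) _.
rewrite exprS -mulrA ler_wpM2l//; apply: IH => //.
by rewrite lerBlDr -[X in _ + X]mul1r -mulrDl natr1.
Qed.

End uniform_bound.

(** * Chernoff's product formula *)

Definition semi_generator (R : realType) (V : lmodType R) (L : V -> Prop)
    (ip : V -> V -> R) (S : R -> V -> V) (x g : V) : Prop :=
  [/\ L x, L g & forall e, 0 < e -> exists2 eta : R, 0 < eta &
    forall t, 0 < t -> t < eta ->
      hnorm ip (t^-1 *: (S t x - x) - g) <= e].

(** [A] is a family of symmetric linear contractions with derivative - H at time 0 on the test space
    C. Together with the description of the generator of S as minus the adjoint of H on C, this is
    the setting of Chernoff's theorem. *)
Record semi_approx (R : realType) (V : lmodType R) (L : V -> Prop)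
    (ip : V -> V -> R) (C : V -> Prop) (H : V -> V) (A : R -> V -> V) : Prop := {
  sa_C0 : C 0 ;
  sa_Clin : forall a x y, C x -> C y -> C (a *: x + y) ;
  sa_CL : forall x, C x -> L x ;
  sa_HL : forall x, C x -> L (H x) ;
  sa_Hlin : forall a x y, C x -> C y -> H (a *: x + y) = a *: H x + H y ;
  sa_L : forall t x, 0 < t -> L x -> L (A t x) ;
  sa_lin : forall t a x y, 0 < t -> L x -> L y ->
    A t (a *: x + y) = a *: A t x + A t y ;
  sa_contr : forall t x, 0 < t -> L x -> hnorm ip (A t x) <= hnorm ip x ;
  sa_sym : forall t x y, 0 < t -> L x -> L y -> ip (A t x) y = ip x (A t y) ;
  sa_cons : forall x e, C x -> 0 < e -> exists2 eta : R, 0 < eta &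
    forall t, 0 < t -> t < eta ->
      hnorm ip (t^-1 *: (x - A t x) - H x) <= e }.

Lemma bernoulli_ineq (R : realDomainType) (x : R) k :
  0 <= x -> 1 + k%:R * x <= (1 + x) ^+ k.
Proof.
move=> x0; elim: k => [|k IH]; first by rewrite mul0r addr0 expr0.
rewrite exprS -natr1; have k0 : 0 <= k%:R :> R by [].
have : 0 <= k%:R * x * x by rewrite !mulr_ge0.
have : (1 + x) * (1 + k%:R * x) <= (1 + x) * (1 + x) ^+ k.
  by rewrite ler_wpM2l// addr_ge0.
lra.
Qed.

Section chernoff.
Context {R : realType} {V : lmodType R} (L : V -> Prop) (ip : V -> V -> R)
  (S : R -> V -> V) (C : V -> Prop) (H : V -> V) (A : R -> V -> V).
Hypothesis sh : semi_hilbert L ip.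
Hypothesis sc : semi_c0 L ip S.
Hypothesis sa : semi_approx L ip C H A.
Hypothesis SH : forall x g, semi_generator L ip S x g <->
  [/\ L x, L g & forall phi, C phi -> ip x (H phi) = - ip g phi].
Local Notation nrm := (hnorm ip).

Let LD x y : L x -> L y -> L (x + y) := @shD _ _ _ _ sh x y.
Let LZ a x : L x -> L (a *: x) := @shZ _ _ _ _ sh a x.
Let LN x : L x -> L (- x) := @shN _ _ _ _ sh x.
Let LB x y : L x -> L y -> L (x - y) := @shB _ _ _ _ sh x y.
Let CL x : C x -> L x := @sa_CL _ _ _ _ _ _ _ sa x.
Let HL x : C x -> L (H x) := @sa_HL _ _ _ _ _ _ _ sa x.
Let L0 : L 0 := sh0 sh.
Hint Resolve LD LZ LN LB CL HL L0 : core.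
Hint Resolve hnorm_ge0 : core.

Lemma saCB x y : C x -> C y -> C (x - y).
Proof. by move=> Cx Cy; rewrite addrC -scaleN1r; exact: (sa_Clin sa). Qed.

Lemma saHB x y : C x -> C y -> H (x - y) = H x - H y.
Proof.
move=> Cx Cy; rewrite addrC -scaleN1r (sa_Hlin sa)// scaleN1r.
by rewrite addrC.
Qed.

Lemma sa_linB t x y : 0 < t -> L x -> L y -> A t (x - y) = A t x - A t y.
Proof.
move=> t0 Lx Ly; rewrite addrC -scaleN1r (sa_lin sa)// scaleN1r.
by rewrite addrC.
Qed.

(** Symmetry of [A t] passes to the quotients t^{-1}(x - A t x), which converge to H x on C. *)
Lemma sa_Hsym x y : C x -> C y -> ip (H x) y = ip x (H y).
Proof.
move=> Cx Cy; apply/eqP; rewrite -subr_eq0 -normr_eq0 eq_le normr_ge0 andbT.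
apply/ler_addgt0Pr => e e0; rewrite add0r.
pose K := nrm x + nrm y + 1.
have K0 : 0 < K by rewrite ltr_wpDl// addr_ge0.
have [eta1 eta10 h1] := sa_cons sa Cx (divr_gt0 e0 K0).
have [eta2 eta20 h2] := sa_cons sa Cy (divr_gt0 e0 K0).
pose t := Num.min eta1 eta2 / 2.
have m0 : 0 < Num.min eta1 eta2 by rewrite lt_min eta10.
have t0 : 0 < t by rewrite divr_gt0.
have tm : t < Num.min eta1 eta2 by rewrite /t; lra.
have := h1 t t0; have := h2 t t0.
move: tm; rewrite lt_min => /andP[-> ->] => /(_ isT) k2 /(_ isT) k1.
have LA z : L z -> L (A t z) by exact: (sa_L sa).
set Bx := t^-1 *: (x - A t x) in k1; set By := t^-1 *: (y - A t y) in k2.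
have LBx : L Bx by apply: LZ; apply: LB; auto.
have LBy : L By by apply: LZ; apply: LB; auto.
have sym : ip Bx y = ip x By.
  rewrite /Bx /By (shipZl sh) ?(shipZr sh) ?(shipBl sh) ?(shipBr sh); auto.
  by rewrite (sa_sym sa); auto.
have -> : ip (H x) y - ip x (H y) = ip x (By - H y) - ip (Bx - H x) y.
  by rewrite (shipBl sh) ?(shipBr sh); auto; rewrite sym; ring.
have c1 : `|ip x (By - H y)| <= nrm x * nrm (By - H y).
  by apply: (sh_cauchy_schwarz sh); auto.
have c2 : `|ip (Bx - H x) y| <= nrm (Bx - H x) * nrm y.
  by apply: (sh_cauchy_schwarz sh); auto.
apply: le_trans (ler_normB _ _) _.
have : e / K * (nrm x + nrm y) <= e.
  by rewrite mulrAC ler_pdivrMr// ler_pM2l// /K; lra.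
have nx := hnorm_ge0 ip x; have ny := hnorm_ge0 ip y.
nra.
Qed.

(** Contractivity makes the quotients t^{-1}(x - A t x) nonnegative against x, by Cauchy-Schwarz,
    and the sign survives in the limit. *)
Lemma sa_Hge0 x : C x -> 0 <= ip (H x) x.
Proof.
move=> Cx; apply/ler_addgt0Pr => e e0; have Lx := CL Cx.
have K0 : 0 < nrm x + 1 by rewrite ltr_wpDl.
have [eta eta0 h1] := sa_cons sa Cx (divr_gt0 e0 K0).
pose t := eta / 2.
have t0 : 0 < t by rewrite divr_gt0.
have te : t < eta by rewrite /t; lra.
have := h1 t t0 te; set B := t^-1 *: _ => hB.
have LA : L (A t x) by exact: (sa_L sa).
have LBx : L B by apply: LZ; auto.
have B0 : 0 <= ip B x.
  rewrite /B (shipZl sh); auto.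
  apply: mulr_ge0; first by rewrite invr_ge0 ltW.
  rewrite (shipBl sh); auto; rewrite subr_ge0 -(hnorm_sqr sh)//.
  apply: le_trans (ler_norm _) _; apply: le_trans (sh_cauchy_schwarz sh LA Lx) _.
  by rewrite expr2 ler_wpM2r ?hnorm_ge0//; exact: (sa_contr sa).
have : `|ip (B - H x) x| <= nrm (B - H x) * nrm x by apply: (sh_cauchy_schwarz sh); auto.
rewrite (shipBl sh); auto.
have := ler_norm (ip B x - ip (H x) x).
have : e / (nrm x + 1) * nrm x <= e.
  by rewrite mulrAC ler_pdivrMr// ler_pM2l//; lra.
have nx := hnorm_ge0 ip x.
nra.
Qed.

Lemma generator_null h g : L h -> nrm h = 0 -> semi_generator L ip S h g ->
  nrm g = 0.
Proof.
move=> Lh h0 [_ Lg hg]; apply/eqP; rewrite eq_le hnorm_ge0 andbT.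
apply/ler_addgt0Pr => e e0; rewrite add0r.
have [eta eta0 he] := hg e e0.
pose t := eta / 2.
have t0 : 0 < t by rewrite divr_gt0.
have te : t < eta by rewrite /t; lra.
have LS : L (S t h) by apply: (sc_L sc) => //; exact: ltW.
have S0 : nrm (S t h) = 0.
  have [M hM] := sc_bd sc (ltW t0); have := hM h Lh; rewrite h0 mulr0 => S0.
  by apply/eqP; rewrite eq_le S0 hnorm_ge0.
have LT : L (t^-1 *: (S t h - h)) by apply: LZ; auto.
have : nrm (t^-1 *: (S t h - h)) <= 0.
  rewrite (hnormZ sh); auto.
  have := hnorm_triangleB sh LS Lh; rewrite S0 h0 addr0 => h1.
  by rewrite mulr_ge0_le0.
have := hnorm_le_dist sh Lg LT.
rewrite (hnormC sh)//; have := he t t0 te; lra.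
Qed.

(** If h is orthogonal to C, the pair (0, h) satisfies the adjoint relation and lies in the graph of
    the generator. That graph is single-valued up to null vectors, so h is null; hence C is
    dense. *)
Lemma test_perp_null h : L h -> (forall phi, C phi -> ip h phi = 0) -> nrm h = 0.
Proof.
move=> Lh perp; apply: (generator_null L0 (hnorm0 sh)).
apply/SH; split => // phi Cphi; rewrite (ship0l sh); auto.
by rewrite perp// oppr0.
Qed.

Lemma test_dense x e : L x -> 0 < e -> exists2 phi, C phi & nrm (x - phi) <= e.
Proof.
move=> Lx e0; apply: (sh_dense sh (sa_C0 sa)) => //.
- exact: (sa_Clin sa).
- exact: test_perp_null.
Qed.

(** Over the time eta an eigenvector for lam is multiplied by at least 1 + lam eta, as an Euler
    scheme with small steps shows, while S is bounded by M there. With lam = M / eta the two facts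
    give (1 + M)|h| <= M |h| up to an arbitrarily small error. *)
Lemma eigen_null : exists2 lam : R, 0 < lam &
  forall h, semi_generator L ip S h (lam *: h) -> nrm h = 0.
Proof.
have [eta [M [eta0 M1 hM]]] := sc_bounded sh sc.
have {hM} hM t x : 0 <= t -> t <= eta -> L x -> nrm (S t x) <= M * nrm x.
  by move=> t0 te; apply: (hM 1%N); rewrite ?mul1r.
have M0 : 0 < M by exact: lt_le_trans M1.
pose lam := M / eta; have lam0 : 0 < lam by rewrite divr_gt0.
exists lam => // h [Lh _ hg].
suff key e : 0 < e -> nrm h <= M * eta * expR (lam * eta) * e.
  apply/eqP; rewrite eq_le hnorm_ge0 andbT; apply/ler_addgt0Pr => e e0.
  rewrite add0r; have K0 : 0 < M * eta * expR (lam * eta) by rewrite !mulr_gt0// expR_gt0.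
  by have := key _ (divr_gt0 e0 K0); rewrite mulrC divfK// gt_eqF.
move=> e0; have [eta' eta'0 he] := hg e e0.
pose K := (Num.bound (eta / eta')).+1.
have K0 : 0 < K%:R :> R by rewrite ltr0n.
pose tau := eta / K%:R.
have tau0 : 0 < tau by rewrite divr_gt0.
have tau' : tau < eta'.
  rewrite /tau ltr_pdivrMr// mulrC -ltr_pdivrMr//.
  apply: lt_le_trans (archi_boundP _) _; first by rewrite divr_ge0// ltW.
  by rewrite ler_nat /K leqW.
pose q := 1 + lam * tau.
have q1 : 1 <= q by rewrite lerDl mulr_ge0// ltW.
have q0 : 0 <= q by exact: le_trans q1.
have LS t : 0 <= t -> L (S t h) by move=> t0; exact: (sc_L sc).
have LSt : L (S tau h) by apply: LS; exact: ltW.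
have one : nrm (S tau h - q *: h) <= tau * e.
  have := he tau tau0 tau'.
  have -> : S tau h - q *: h = tau *: (tau^-1 *: (S tau h - h) - lam *: h).
    rewrite scalerBr scalerA divff ?gt_eqF// scale1r scalerA /q scalerDl scale1r.
    by rewrite opprD addrA mulrC.
  rewrite (hnormZ sh) ?gtr0_norm ?ler_pM2l//; apply: LB; apply: LZ => //.
  exact: LB.
(* Each Euler step adds an error M tau e; the earlier ones are amplified by q at most, so they
   accumulate linearly up to the factor q^i. *)
have ind i : (i <= K)%N -> nrm (S (i%:R * tau) h - q ^+ i *: h) <=
    i%:R * (M * (tau * e) * q ^+ i).
  elim: i => [_|i IH iK].
    by rewrite !mul0r expr0 scale1r (sc_id sc).
  have it0 : 0 <= i%:R * tau by rewrite mulr_ge0// ltW.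
  have Li := LS _ it0.
  have ite : i%:R * tau <= eta.
    rewrite /tau mulrA ler_pdivrMr// [leRHS]mulrC ler_pM2r// ler_nat.
    exact: ltnW.
  rewrite -[i.+1]addn1 natrD mulrDl mul1r.
  have LSS : L (S (i%:R * tau) (S tau h)) by exact: (sc_L sc).
  have LSq : L (S (i%:R * tau) (q *: h)) by apply: (sc_L sc) => //; exact: LZ.
  have L1 : L (S (i%:R * tau + tau) h) by apply: LS; rewrite addr_ge0// ltW.
  have Lq k : L (q ^+ k *: h) by exact: LZ.
  have d1 := sc_add sc it0 (ltW tau0) Lh.
  have d2 : nrm (S (i%:R * tau) (S tau h) - S (i%:R * tau) (q *: h)) <= M * (tau * e).
    rewrite (sc_distE sh sc)//; last exact: LZ.
    apply: le_trans (hM _ _ it0 ite _) _; first by apply: LB => //; exact: LZ.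
    by rewrite ler_pM2l.
  have d3 : nrm (S (i%:R * tau) (q *: h) - q *: S (i%:R * tau) h) = 0.
    have h1 := sc_lin sc q it0 Lh L0; rewrite addr0 in h1.
    have S00 : nrm (S (i%:R * tau) 0) = 0.
      have := hM _ _ it0 ite L0; rewrite (hnorm0 sh) mulr0 => h2.
      by apply/eqP; rewrite eq_le h2 hnorm_ge0.
    have LS0 : L (S (i%:R * tau) 0) by exact: (sc_L sc).
    have LqS : L (q *: S (i%:R * tau) h) by exact: LZ.
    apply/eqP; rewrite eq_le hnorm_ge0 andbT.
    have := hdist_triangle sh LSq (LD LqS LS0) LqS.
    by rewrite h1 add0r [_ + S _ 0]addrC addrK S00.
  have d4 : nrm (q *: S (i%:R * tau) h - q ^+ i.+1 *: h) <= q * (i%:R * (M * (tau * e) * q ^+ i)).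
    rewrite exprS -scalerA -scalerBr (hnormZ sh) ?(ger0_norm q0); last by apply: LB.
    by rewrite ler_wpM2l//; apply: IH; exact: ltnW.
  have LqS : L (q *: S (i%:R * tau) h) by exact: LZ.
  have t1 := hdist_triangle sh L1 LSS (Lq i.+1).
  have t2 := hdist_triangle sh LSS LSq (Lq i.+1).
  have t3 := hdist_triangle sh LSq LqS (Lq i.+1).
  have e1 : M * (tau * e) <= M * (tau * e) * q ^+ i.+1.
    by rewrite ler_peMr ?exprn_ege1// !mulr_ge0// ltW.
  have e2 : q * (i%:R * (M * (tau * e) * q ^+ i)) = i%:R * (M * (tau * e) * q ^+ i.+1).
    by rewrite exprS; ring.
  rewrite addn1; lra.
have := ind K (leqnn _).
have -> : K%:R * tau = eta by rewrite /tau mulrC divfK// gt_eqF.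
have -> : K%:R * (M * (tau * e) * q ^+ K) = M * eta * q ^+ K * e.
  by rewrite /tau; field; rewrite gt_eqF.
have qK : q ^+ K <= expR (lam * eta).
  apply: le_trans (_ : expR (lam * tau) ^+ K <= _); last first.
    rewrite -expRM_natl /tau.
    have -> : K%:R * (lam * (eta / K%:R)) = lam * eta by field; rewrite gt_eqF.
    by [].
  by rewrite lerXn2r// ?nnegrE ?expR_ge0// expR_ge1Dx.
have bern : 1 + lam * eta <= q ^+ K.
  have : 1 + K%:R * (lam * tau) <= q ^+ K.
    by apply: bernoulli_ineq; rewrite mulr_ge0// ltW.
  by rewrite /tau; have -> : K%:R * (lam * (eta / K%:R)) = lam * eta by field; rewrite gt_eqF.
have le : lam * eta = M by rewrite /lam divfK// gt_eqF.
have LSe : L (S eta h) by apply: LS; exact: ltW.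
have Lqh : L (q ^+ K *: h) by exact: LZ.
have := hnorm_le_dist sh Lqh LSe; rewrite (hnormC sh)//.
rewrite (hnormZ sh)// ger0_norm ?exprn_ge0//.
have := hM _ _ (ltW eta0) (lexx _) Lh.
have nh := hnorm_ge0 ip h.
have : (1 + M) * nrm h <= q ^+ K * nrm h by rewrite ler_wpM2r// -le.
have : M * eta * q ^+ K * e <= M * eta * expR (lam * eta) * e.
  by rewrite ler_pM2r// ler_pM2l// mulr_gt0.
nra.
Qed.

Lemma generator_lin a x g x' g' : semi_generator L ip S x g ->
  semi_generator L ip S x' g' ->
  semi_generator L ip S (a *: x + x') (a *: g + g').
Proof.
move=> /SH[Lx Lg h] /SH[Lx' Lg' h']; apply/SH; split; auto => phi Cphi.
by rewrite (sh_ipl sh) ?(sh_ipl sh) ?h ?h'; auto; ring.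
Qed.

Lemma generator_test phi : C phi -> semi_generator L ip S phi (- H phi).
Proof.
move=> Cphi; apply/SH; split; auto => psi Cpsi.
by rewrite (shipNl sh) ?opprK ?sa_Hsym; auto.
Qed.

(* The test space is a core: lam + H has dense range and is bounded below
   by lam on it, and lam is not an eigenvalue of the generator. *)
Lemma generator_core f g e : semi_generator L ip S f g -> 0 < e ->
  exists2 phi, C phi & nrm (phi - f) <= e /\ nrm (H phi + g) <= e.
Proof.
move=> fg e0; have [Lf Lg _] := fg.
have [lam lam0 hlam] := eigen_null.
pose D d := exists2 phi, C phi & d = lam *: phi + H phi.
have D0 : D 0.
  exists 0; first exact: (sa_C0 sa).
  have := sa_Hlin sa (-1) (sa_C0 sa) (sa_C0 sa).
  by rewrite scaler0 addr0 scaleN1r addNr => ->; rewrite addr0 scaler0.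
have Dlin a x y : D x -> D y -> D (a *: x + y).
  move=> [p Cp ->] [q Cq ->]; exists (a *: p + q); first exact: (sa_Clin sa).
  rewrite (sa_Hlin sa)// !scalerDr !scalerA [lam * a]mulrC.
  by rewrite addrACA.
have DL d : D d -> L d by move=> [p Cp ->]; auto.
have Dperp h : L h -> (forall d, D d -> ip h d = 0) -> nrm h = 0.
  move=> Lh perp; apply: hlam; apply/SH; split; auto => phi Cphi.
  have := perp _ (ex_intro2 _ _ phi Cphi erefl).
  rewrite (shipDr sh) ?(shipZr sh) ?(shipZl sh); auto.
  by move/eqP; rewrite addrC addr_eq0 => /eqP.
pose chi := lam *: f - g; have Lchi : L chi by rewrite /chi; auto.
have coer p : C p -> lam * nrm p <= nrm (lam *: p + H p).
  move=> Cp; have Lp := CL Cp; have LHp := HL Cp.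
  have [->|p0] := eqVneq (nrm p) 0; first by rewrite mulr0 hnorm_ge0.
  have p1 : 0 < nrm p by rewrite lt_def p0 hnorm_ge0.
  have LlH : L (lam *: p + H p) by auto.
  have := sh_cauchy_schwarz sh LlH Lp.
  rewrite (shipDl sh) ?(shipZl sh); auto => /(le_trans (ler_norm _)).
  rewrite -(hnorm_sqr sh)// => h; have := sa_Hge0 Cp => h1.
  rewrite -(ler_pM2r p1); apply: le_trans h.
  by rewrite -mulrA -expr2 lerDl.
(* Coercivity divides by lam, and the tolerances of steps k and k + 1 then add up to less than
   2^{-k}. *)
pose ep k := lam * (2^-1 ^+ k) / 4.
have half0 k : 0 < (2^-1 : R) ^+ k by rewrite exprn_gt0// invr_gt0.
have ep0 k : 0 < ep k by rewrite /ep divr_gt0// mulr_gt0.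
have step k : exists phi, C phi /\ nrm (chi - (lam *: phi + H phi)) <= ep k.
  have [_ [phi Cphi ->] h] := sh_dense sh D0 Dlin DL Dperp Lchi (ep0 k).
  by exists phi.
pose u k := projT1 (cid (step k)).
have Cu k : C (u k) by rewrite /u; case: cid => phi /= [].
have hu k : nrm (chi - (lam *: u k + H (u k))) <= ep k.
  by rewrite /u; case: cid => phi /= [].
have Lu k : L (u k) by auto.
have LHu k : L (H (u k)) by auto.
have Lw k : L (lam *: u k + H (u k)) by auto.
have u_step k : nrm (u k.+1 - u k) <= 2^-1 ^+ k.
  have := coer _ (saCB (Cu k.+1) (Cu k)); rewrite saHB//.
  have -> : lam *: (u k.+1 - u k) + (H (u k.+1) - H (u k)) =
      (lam *: u k.+1 + H (u k.+1)) - (lam *: u k + H (u k)).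
    by rewrite scalerBr addrACA opprD.
  move=> /le_trans /(_ (hdist_triangle sh (Lw k.+1) Lchi (Lw k))).
  have := hu k; have := hu k.+1; rewrite [X in X <= ep k.+1](hnormC sh)// /ep [2^-1 ^+ k.+1]exprS => h1 h2 h3.
  rewrite -(ler_pM2l lam0); have := half0 k.
  have : 0 < lam * 2^-1 ^+ k by rewrite mulr_gt0.
  lra.
have [f' Lf' hf'] : exists2 y, L y & forall k, nrm (y - u k) <= 2 * 2^-1 ^+ k.
  by apply: (sh_complete sh) => // k; rewrite exprS mulrC.
have small (r : R) : 0 < r -> exists k, (lam + 1) * 4 * 2^-1 ^+ k <= r.
  move=> r0; exists (Num.bound ((lam + 1) * 4 / r)).
  rewrite exprVn ler_pdivrMr ?exprn_gt0// [r * _]mulrC -ler_pdivrMr//.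
  by apply: ltW; exact: upper_nthrootP.
pose g' := lam *: f' - chi; have Lg' : L g' by rewrite /g'; auto.
(* The limit f' of the u_k solves (lam + H) f' = chi weakly, which by the adjoint description puts
   it in the domain of the generator. *)
have gen' : semi_generator L ip S f' g'.
  apply/SH; split => // psi Cpsi.
  have Lpsi := CL Cpsi; have LHpsi := HL Cpsi.
  apply/eqP; rewrite -subr_eq0 -normr_eq0 eq_le normr_ge0 andbT.
  apply/ler_addgt0Pr => r r0; rewrite add0r.
  pose K := nrm psi + nrm (H psi) + 1.
  have nK : 0 < K by rewrite ltr_wpDl ?addr_ge0 ?hnorm_ge0.
  have [k hk] := small _ (divr_gt0 r0 nK).
  have e1 : ip f' (H psi) - - ip g' psi =
      ip (f' - u k) (H psi) + lam * ip (f' - u k) psi - ip (chi - (lam *: u k + H (u k))) psi.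
    rewrite /g' !(shipBl sh) ?(shipDl sh) ?(shipZl sh); auto.
    by rewrite sa_Hsym//; ring.
  have Lfu : L (f' - u k) by auto.
  have Lcu : L (chi - (lam *: u k + H (u k))) by auto.
  rewrite e1.
  have c1 := sh_cauchy_schwarz sh Lfu LHpsi.
  have c2 := sh_cauchy_schwarz sh Lfu Lpsi.
  have c3 := sh_cauchy_schwarz sh Lcu Lpsi.
  apply: le_trans (ler_normB _ _) _.
  have := ler_normD (ip (f' - u k) (H psi)) (lam * ip (f' - u k) psi).
  rewrite normrM (gtr0_norm lam0).
  have := hf' k; have := hu k; rewrite /ep.
  set q := 2^-1 ^+ k in hk * => h1 h2 h3.
  have q0 : 0 < q by exact: half0.
  have n1 := hnorm_ge0 ip psi; have n2 := hnorm_ge0 ip (H psi).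
  have b1 : nrm (f' - u k) * nrm (H psi) <= 2 * q * nrm (H psi) by rewrite ler_wpM2r.
  have b2 : lam * (nrm (f' - u k) * nrm psi) <= lam * (2 * q * nrm psi).
    by rewrite ler_pM2l// ler_wpM2r.
  have b3 : nrm (chi - (lam *: u k + H (u k))) * nrm psi <= lam * q / 4 * nrm psi.
    by rewrite ler_wpM2r.
  have b2' : lam * `|ip (f' - u k) psi| <= lam * (nrm (f' - u k) * nrm psi).
    by rewrite ler_pM2l.
  have : (lam + 1) * 4 * q * K <= r by rewrite -ler_pdivlMr.
  have : 0 <= lam * q * nrm psi by rewrite !mulr_ge0// ltW.
  have : 0 <= lam * q * nrm (H psi) by rewrite !mulr_ge0// ltW.
  have : 0 <= q * nrm (H psi) by rewrite mulr_ge0// ltW.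
  have : 0 <= q * nrm psi by rewrite mulr_ge0// ltW.
  have : 0 <= lam * q by rewrite mulr_ge0// ltW.
  have -> : (lam + 1) * 4 * q * K = 4 * (lam * q * nrm psi) + 4 * (lam * q * nrm (H psi))
    + 4 * (lam * q) + 4 * (q * nrm psi) + 4 * (q * nrm (H psi)) + 4 * q by rewrite /K; ring.
  lra.
(* The difference f - f' is an eigenvector of the generator for lam, hence null; the u_k therefore
   approximate f itself in the graph norm. *)
have ff' : nrm (f - f') = 0.
  apply: hlam; have := generator_lin (-1) gen' fg.
  rewrite !scaleN1r [- f' + f]addrC; congr (semi_generator L ip S _ _).
  by rewrite /g' /chi opprB addrAC subrK scalerBr.
have [k hk] := small _ e0.
exists (u k) => //.
have q0 := half0 k.
have lq : 0 < lam * 2^-1 ^+ k by rewrite mulr_gt0.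
have d : nrm (u k - f) <= 2 * 2^-1 ^+ k.
  have := hdist_triangle sh (Lu k) Lf' Lf.
  by rewrite (hnormC sh Lf' Lf) ff' addr0 (hnormC sh (Lu k) Lf') => /le_trans; apply.
split; first by apply: le_trans d _; lra.
have e1 : H (u k) + g = - (chi - (lam *: u k + H (u k))) - lam *: (u k - f).
  rewrite /chi scalerBr !opprB !addrA subrK.
  by rewrite -[lam *: u k + H (u k) + g]addrA [lam *: u k + _]addrC addrK.
rewrite e1; apply: le_trans (hnorm_triangleB sh _ _) _; auto.
rewrite (hnormN sh); auto; rewrite (hnormZ sh); auto.
have := hu k; rewrite /ep (gtr0_norm lam0).
have : lam * nrm (u k - f) <= lam * (2 * 2^-1 ^+ k) by rewrite ler_pM2l.
lra.
Qed.

End chernoff.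

Section chernoff_limit.
Context {R : realType} {V : lmodType R} (L : V -> Prop) (ip : V -> V -> R)
  (S : R -> V -> V) (C : V -> Prop) (H : V -> V) (A : R -> V -> V).
Hypothesis sh : semi_hilbert L ip.
Hypothesis sc : semi_c0 L ip S.
Hypothesis sa : semi_approx L ip C H A.
Hypothesis SH : forall x g, semi_generator L ip S x g <->
  [/\ L x, L g & forall phi, C phi -> ip x (H phi) = - ip g phi].
Local Notation nrm := (hnorm ip).

Let LD x y : L x -> L y -> L (x + y) := @shD _ _ _ _ sh x y.
Let LZ a x : L x -> L (a *: x) := @shZ _ _ _ _ sh a x.
Let LN x : L x -> L (- x) := @shN _ _ _ _ sh x.
Let LB x y : L x -> L y -> L (x - y) := @shB _ _ _ _ sh x y.
Let CL x : C x -> L x := @sa_CL _ _ _ _ _ _ _ sa x.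
Let HL x : C x -> L (H x) := @sa_HL _ _ _ _ _ _ _ sa x.
Hint Resolve LD LZ LN LB CL HL : core.

Lemma iter_approx_L t k x : 0 < t -> L x -> L (iter k (A t) x).
Proof. by move=> t0 Lx; elim: k => //= k IH; exact: (sa_L sa). Qed.

Lemma iter_approx_dist t k x y : 0 < t -> L x -> L y ->
  nrm (iter k (A t) x - iter k (A t) y) <= nrm (x - y).
Proof.
move=> t0 Lx Ly; elim: k => //= k IH.
have Li := iter_approx_L k t0 Lx; have Lj := iter_approx_L k t0 Ly.
rewrite -(sa_linB sa)//; apply: le_trans IH; apply: (sa_contr sa) => //.
exact: LB.
Qed.

(* Comparison of the iterates with the segment from p to p'. *)
Lemma approx_segment p p' D e : C p -> C p' -> 0 < D -> 0 < e ->
  nrm (p' - p + D *: H p) <= D * e -> nrm (H (p' - p)) <= e ->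
  exists K0, forall K, (K0 <= K)%N -> (0 < K)%N ->
    nrm (iter K (A (D / K%:R)) p - p') <= 4 * e * D.
Proof.
move=> Cp Cp' D0 e0 h1 h2; pose w := p' - p.
have Cw : C w by exact: (saCB sa).
have Lp := CL Cp; have Lw := CL Cw; have LHp := HL Cp; have LHw := HL Cw.
have [eta1 eta10 c1] := sa_cons sa Cp e0.
have [eta2 eta20 c2] := sa_cons sa Cw e0.
pose K0 := Num.bound (D / Num.min eta1 eta2).
have m0 : 0 < Num.min eta1 eta2 by rewrite lt_min eta10.
exists K0 => K K0K Kpos.
have K1 : 0 < K%:R :> R by rewrite ltr0n.
pose t := D / K%:R; have t0 : 0 < t by rewrite divr_gt0.
have tm : t < Num.min eta1 eta2.
  rewrite /t ltr_pdivrMr// mulrC -ltr_pdivrMr//.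
  apply: lt_le_trans (archi_boundP _) _; first by rewrite divr_ge0// ltW.
  by rewrite ler_nat.
move: tm; rewrite lt_min => /andP[tm1 tm2].
have {c1} c1 := c1 t t0 tm1; have {c2} c2 := c2 t t0 tm2.
have LA x : L x -> L (A t x) by exact: (sa_L sa).
pose z l : V := p + (l%:R / K%:R) *: w.
have Lz l : L (z l) by rewrite /z; auto.
have zK : z K = p' by rewrite /z divff ?gt_eqF// scale1r /w addrC subrK.
have bnd x : C x -> nrm (t^-1 *: (x - A t x) - H x) <= e ->
    nrm (x - A t x - t *: H x) <= t * e.
  move=> Cx h; have Lx := CL Cx; have LHx := HL Cx; have LAx := LA _ Lx.
  have -> : x - A t x - t *: H x = t *: (t^-1 *: (x - A t x) - H x).
    by rewrite scalerBr scalerA divff ?gt_eqF// scale1r.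
  by rewrite (hnormZ sh) ?gtr0_norm ?ler_pM2l//; auto.
have b1 := bnd _ Cp c1; have b2 := bnd _ Cw c2.
have one l : (l <= K)%N -> nrm (A t (z l) - z l.+1) <= 4 * e * t.
  move=> lK; have l1 : l%:R / K%:R <= 1 :> R by rewrite ler_pdivrMr// mul1r ler_nat.
  have l0 : 0 <= l%:R / K%:R :> R by rewrite divr_ge0.
  have LAp := LA _ Lp; have LAw := LA _ Lw.
  (* One step errs by the consistency defects at p and at w = p' - p, by the failure of w to be - D
     H p, and by H w; each contribution is at most t e. *)
  have e1 : A t (z l) - z l.+1 = - (p - A t p - t *: H p)
      - ((l%:R / K%:R) *: (w - A t w - t *: H w))
      - (K%:R^-1 *: (w + D *: H p) + (l%:R / K%:R * t) *: H w).
    have -> : A t (z l) - z l.+1 =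
        - (p - A t p) - (l%:R / K%:R) *: (w - A t w) - K%:R^-1 *: w.
      have -> : A t (z l) = A t p + (l%:R / K%:R) *: A t w.
        by rewrite /z addrC (sa_lin sa)// addrC.
      have -> : z l.+1 = p + ((l%:R / K%:R) *: w + K%:R^-1 *: w).
        by rewrite /z -natr1 mulrDl mul1r scalerDl.
      rewrite [_ *: (w - A t w)]scalerBr !opprD !opprK.
      by rewrite [RHS](AC ((2*2)*1) ((2*4)*(1*(3*5)))).
    rewrite [K%:R^-1 *: (w + _)]scalerDr [_ *: (_ - t *: _)]scalerBr !scalerA [K%:R^-1 * D]mulrC -/t.
    rewrite !opprD !opprK.
    set P := p - A t p; set X := _ *: (w - _); set a := t *: H p.
    set b := (_ * t) *: H w; set Y := _ *: w.
    rewrite [RHS](AC ((2*2)*3) ((1*3*5)*(2*6)*(4*7))) /=.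
    by rewrite !subrr !addr0.
  rewrite e1.
  have n3 : nrm (K%:R^-1 *: (w + D *: H p) + (l%:R / K%:R * t) *: H w) <= t * e + t * e.
    apply: le_trans (hnorm_triangle sh _ _) _; auto.
    rewrite !(hnormZ sh); auto.
    rewrite gtr0_norm ?invr_gt0// ger0_norm; last by rewrite mulr_ge0// ltW.
    rewrite lerD//.
      by rewrite ler_pdivrMl// mulrA /t mulrC [K%:R * _]mulrC divfK ?gt_eqF// mulrC.
    apply: (@le_trans _ _ (t * nrm (H w))); last by rewrite ler_pM2l.
    by rewrite -[_ * t * nrm _]mulrA; apply: ler_piMl => //; rewrite mulr_ge0 ?hnorm_ge0// ltW.
  have n2 : nrm ((l%:R / K%:R) *: (w - A t w - t *: H w)) <= t * e.
    rewrite (hnormZ sh); last by auto 6.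
    by rewrite ger0_norm// (le_trans _ b2)// ler_piMl// hnorm_ge0.
  apply: le_trans (hnorm_triangleB sh _ _) _; [by auto 8|by auto 8|].
  have := hnorm_triangleB sh (LN (LB (LB Lp LAp) (LZ t LHp)))
     (LZ (l%:R / K%:R) (LB (LB Lw LAw) (LZ t LHw))).
  rewrite (hnormN sh); last by auto 6.
  lra.
have ind l : (l <= K)%N -> nrm (iter l (A t) p - z l) <= l%:R * (4 * e * t).
  elim: l => [_|l IH lK]; first by rewrite /= /z mul0r scale0r addr0 subrr (hnorm0 sh) mul0r.
  have Li := iter_approx_L l t0 Lp.
  have LA1 := LA _ Li; have LA2 := LA _ (Lz l).
  rewrite -natr1 mulrDl mul1r iterS.
  apply: le_trans (hdist_triangle sh LA1 LA2 (Lz l.+1)) _.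
  apply: lerD; last by apply: one; exact: ltnW.
  rewrite -(sa_linB sa)//; apply: le_trans (sa_contr sa t0 _) _; first exact: LB.
  by apply: IH; exact: ltnW.
have := ind K (leqnn _); rewrite zK => /le_trans; apply.
suff -> : K%:R * (4 * e * t) = 4 * e * D by [].
by rewrite /t; field; rewrite gt_eqF.
Qed.

(** Equality up to null vectors, the congruence modulo which the semigroup laws are exact. *)
Let eqv x y := [/\ L x, L y & nrm (x - y) = 0].

Let eqv_trans y x z : eqv x y -> eqv y z -> eqv x z.
Proof.
move=> [Lx Ly h1] [_ Lz h2]; split => //.
apply/eqP; rewrite eq_le hnorm_ge0 andbT.
by have := hdist_triangle sh Lx Ly Lz; rewrite h1 h2 addr0.
Qed.

Let eqv_sym x y : eqv x y -> eqv y x.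
Proof. by move=> [Lx Ly h]; split => //; rewrite (hnormC sh). Qed.

Let eqv_refl x : L x -> eqv x x.
Proof. by move=> Lx; split => //; rewrite subrr (hnorm0 sh). Qed.

Let eqv_lin a x y x' y' : eqv x y -> eqv x' y' -> eqv (a *: x + x') (a *: y + y').
Proof.
move=> [Lx Ly h] [Lx' Ly' h']; split; auto.
have -> : a *: x + x' - (a *: y + y') = a *: (x - y) + (x' - y').
  by rewrite scalerBr opprD addrACA.
apply/eqP; rewrite eq_le hnorm_ge0 andbT.
have := hnorm_triangle sh (LZ a (LB Lx Ly)) (LB Lx' Ly').
by rewrite (hnormZ sh) ?h ?h' ?mulr0 ?addr0; auto.
Qed.

Let eqvZ a x y : eqv x y -> eqv (a *: x) (a *: y).
Proof.
move=> h; have := eqv_lin a h (eqv_refl (sh0 sh)).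
by rewrite !addr0.
Qed.

Let eqvB x y x' y' : eqv x y -> eqv x' y' -> eqv (x - x') (y - y').
Proof.
move=> h h'; have := eqv_lin (-1) h' h.
by rewrite !scaleN1r ![- _ + _]addrC.
Qed.

Let eqv_Slin t a x y : 0 <= t -> L x -> L y ->
  eqv (S t (a *: x + y)) (a *: S t x + S t y).
Proof.
move=> t0 Lx Ly; have LS z : L z -> L (S t z) by exact: (sc_L sc).
by split; auto; exact: (sc_lin sc).
Qed.

Let eqv_SB t x y : 0 <= t -> L x -> L y -> eqv (S t (x - y)) (S t x - S t y).
Proof.
move=> t0 Lx Ly; have LS z : L z -> L (S t z) by exact: (sc_L sc).
by split; auto; exact: (sc_dist sc).
Qed.

Let eqv_SZ t a x : 0 <= t -> L x -> eqv (S t (a *: x)) (a *: S t x).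
Proof.
move=> t0 Lx; have := eqv_Slin a t0 Lx (sh0 sh); rewrite addr0 => h.
apply: (eqv_trans h).
have LS z : L z -> L (S t z) by exact: (sc_L sc).
have [M hM] := sc_bd sc t0; have := hM _ (sh0 sh); rewrite (hnorm0 sh) mulr0 => h1.
have S0 : nrm (S t 0) = 0 by apply/eqP; rewrite eq_le h1 hnorm_ge0.
have LS0 := LS _ (sh0 sh).
split; auto.
by rewrite [_ + S t 0]addrC addrK.
Qed.

Let eqv_Sadd s t x : 0 <= s -> 0 <= t -> L x -> eqv (S (s + t) x) (S s (S t x)).
Proof.
move=> s0 t0 Lx; split; last exact: (sc_add sc).
- by apply: (sc_L sc) => //; exact: addr_ge0.
- by do 2 apply: (sc_L sc) => //.
Qed.

Lemma generator_S t f g : 0 <= t -> semi_generator L ip S f g ->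
  semi_generator L ip S (S t f) (S t g).
Proof.
move=> t0 [Lf Lg hg]; have LS z : L z -> L (S t z) by exact: (sc_L sc).
split; auto => e e0.
have [M M1 hM] := sc_bd_ge1 sc t0.
have M0 : 0 < M by exact: lt_le_trans M1.
have [eta eta0 he] := hg _ (divr_gt0 e0 M0).
exists eta => // h h0 heta; have h0' := ltW h0.
have LSh z : L z -> L (S h z) by exact: (sc_L sc).
have q : eqv (h^-1 *: (S h (S t f) - S t f) - S t g)
             (S t (h^-1 *: (S h f - f) - g)).
  apply: eqv_sym; apply: (eqv_trans (eqv_SB t0 _ _)); auto.
  apply: eqvB; last by apply: eqv_refl; auto.
  apply: (eqv_trans (eqv_SZ _ t0 _)); auto.
  apply: eqvZ; apply: (eqv_trans (eqv_SB t0 _ _)); auto.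
  apply: eqvB; last by apply: eqv_refl; auto.
  apply: (eqv_trans (eqv_sym (eqv_Sadd t0 h0' Lf))).
  by rewrite addrC; apply: eqv_Sadd.
have [L1 L2 q0] := q; rewrite (hnorm_congr sh L1 L2 q0).
apply: le_trans (hM _ _) _; first by auto.
by rewrite -ler_pdivlMl// mulrC; apply: he.
Qed.

(** The orbit of f is cut into 2^j pieces so short that it is nearly affine and its derivative
    nearly constant on each. The nodes are replaced by elements of C close in graph norm,
    [approx_segment] compares the iterates of A with each piece, and contractivity lets the errors
    merely add up. *)
Lemma chernoff_domain f g s e : semi_generator L ip S f g -> 0 < s -> 0 < e ->
  exists k0, forall k, (k0 <= k)%N ->
    nrm (iter (2 ^ k) (A (s / (2 ^ k)%:R)) f - S s f) <= e.
Proof.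
move=> fg s0 e0; have [Lf Lg hg] := fg.
have [M [M1 hM]] : exists M, 1 <= M /\ forall t x, 0 <= t -> t <= s -> L x ->
    nrm (S t x) <= M * nrm x.
  have [eta [M [eta0 M1 hM]]] := sc_bounded sh sc.
  exists (M ^+ Num.bound (s / eta)); split; first exact: exprn_ege1.
  move=> t x t0 ts Lx; apply: hM => //; apply: le_trans ts _.
  rewrite -ler_pdivrMr//; apply/ltW/archi_boundP.
  by rewrite divr_ge0// ltW.
have M0 : 0 < M by exact: lt_le_trans M1.
(* The denominator gathers the error 4 (M + 3) ep s of all the segments and the replacement of the
   two end nodes by elements of C, at most ep s each. *)
pose ep := e / (4 * (M + 3) * s + 2 * s).
have K0 : 0 < 4 * (M + 3) * s + 2 * s by rewrite addr_gt0// !mulr_gt0// addr_gt0.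
have ep0 : 0 < ep by rewrite divr_gt0.
have [eta1 eta10 h1] := hg _ ep0.
have [eta2 eta20 h2] := sc_cont sc Lg ep0.
have m0 : 0 < Num.min eta1 eta2 by rewrite lt_min eta10.
pose j := Num.bound (s / Num.min eta1 eta2).
pose D := s / 2 ^+ j.
have p2 k : 0 < (2 : R) ^+ k by rewrite exprn_gt0.
have D0 : 0 < D by rewrite divr_gt0.
have Ds : D <= s.
  rewrite ler_pdivrMr//; apply: ler_peMr; first exact: ltW.
  by apply: exprn_ege1; rewrite ler1n.
have : D < Num.min eta1 eta2.
  rewrite /D ltr_pdivrMr// mulrC -ltr_pdivrMr//.
  exact: upper_nthrootP.
rewrite lt_min => /andP[D1 D2].
have {h1} h1 := h1 D D0 D1; have {h2} h2 := h2 D D0 D2.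
have iD0 i : 0 <= i%:R * D by rewrite mulr_ge0// ltW.
pose F i := S (i%:R * D) f; pose G i := S (i%:R * D) g.
have LF i : L (F i) by exact: (sc_L sc).
have LG i : L (G i) by exact: (sc_L sc).
have me0 : 0 < Num.min (ep * D) ep by rewrite lt_min mulr_gt0.
have step i := generator_core sh sc sa SH (generator_S (iD0 i) fg) me0.
pose phi i := s2val (cid2 (step i)).
have Cphi i : C (phi i) by rewrite /phi; case: cid2.
have hphi i : nrm (phi i - F i) <= ep * D /\ nrm (H (phi i) + G i) <= ep.
  rewrite /phi; case: cid2 => p /= Cp [].
  by rewrite !le_min => /andP[-> _] /andP[_ ->].
have Lphi i : L (phi i) by auto.
have LHphi i : L (H (phi i)) by auto.
have LSD z : L z -> L (S D z) by apply: (sc_L sc); exact: ltW.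
pose e' := (M + 3) * ep.
have e'0 : 0 < e' by rewrite mulr_gt0// addr_gt0.
have seg i : (i < 2 ^ j)%N -> exists K0, forall K, (K0 <= K)%N -> (0 < K)%N ->
    nrm (iter K (A (D / K%:R)) (phi i) - phi i.+1) <= 4 * e' * D.
  move=> ij.
  have iDs : i%:R * D <= s.
    rewrite /D mulrA ler_pdivrMr// [leRHS]mulrC ler_pM2r// -natrX ler_nat.
    exact: ltnW.
  have LSi z : L z -> L (S (i%:R * D) z) by exact: (sc_L sc).
  have FS : eqv (F i.+1) (S (i%:R * D) (S D f)).
    by rewrite /F -natr1 mulrDl mul1r; apply: eqv_Sadd => //; exact: ltW.
  have GS : eqv (G i.+1) (S (i%:R * D) (S D g)).
    by rewrite /G -natr1 mulrDl mul1r; apply: eqv_Sadd => //; exact: ltW.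
  have nF : nrm (F i.+1 - F i - D *: G i) <= M * (D * ep).
    have : eqv (F i.+1 - F i - D *: G i) (S (i%:R * D) (S D f - f - D *: g)).
      apply: eqv_sym; apply: (eqv_trans (eqv_SB (iD0 i) _ _)); auto.
      apply: eqvB; last by apply: eqv_SZ.
      apply: (eqv_trans (eqv_SB (iD0 i) _ _)); auto.
    move=> [L1 L2 q]; rewrite (hnorm_congr sh L1 L2 q).
    apply: le_trans (hM _ _ (iD0 i) iDs _) _; first by auto.
    rewrite ler_pM2l//.
    have -> : S D f - f - D *: g = D *: (D^-1 *: (S D f - f) - g).
      by rewrite scalerBr scalerA divff ?gt_eqF// scale1r.
    by rewrite (hnormZ sh) ?gtr0_norm ?ler_pM2l//; auto.
  have nG : nrm (G i.+1 - G i) <= M * ep.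
    have : eqv (G i.+1 - G i) (S (i%:R * D) (S D g - g)).
      apply: eqv_sym; apply: (eqv_trans (eqv_SB (iD0 i) _ _)); auto.
    move=> [L1 L2 q]; rewrite (hnorm_congr sh L1 L2 q).
    apply: le_trans (hM _ _ (iD0 i) iDs _) _; first by auto.
    by rewrite ler_pM2l.
  have [p1 p2'] := hphi i; have [p3 p4] := hphi i.+1.
  apply: approx_segment => //.
    have -> : phi i.+1 - phi i + D *: H (phi i) = (phi i.+1 - F i.+1) - (phi i - F i)
        + D *: (H (phi i) + G i) + (F i.+1 - F i - D *: G i).
      rewrite scalerDr !opprD !opprK.
      set a := phi _; set b := phi _; set c := F _; set d := F _.
      set x := D *: _; set y := D *: _.
      rewrite [RHS](AC ((2*2)*2*3) ((1*3*5)*(2*7)*(4*8)*(6*9))) /=.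
      by rewrite addNr addrN addrN !addr0.
    have La : L (phi i.+1 - F i.+1) by auto.
    have Lb : L (phi i - F i) by auto.
    have Lc : L (D *: (H (phi i) + G i)) by auto.
    have Ld : L (F i.+1 - F i - D *: G i) by auto.
    have t1 := hnorm_triangle sh (LD (LB La Lb) Lc) Ld.
    have t2 := hnorm_triangle sh (LB La Lb) Lc.
    have t3 := hnorm_triangleB sh La Lb.
    have t4 : nrm (D *: (H (phi i) + G i)) <= D * ep.
      by rewrite (hnormZ sh) ?gtr0_norm ?ler_pM2l//; auto.
    have -> : D * e' = M * (D * ep) + D * ep + ep * D + ep * D by rewrite /e'; ring.
    lra.
  rewrite (saHB sa)//.
  have -> : H (phi i.+1) - H (phi i) = (H (phi i.+1) + G i.+1) - (H (phi i) + G i)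
      - (G i.+1 - G i).
    rewrite !opprD !opprK [RHS](AC (2*2*2) ((1*3)*(2*5)*(4*6))) /=.
    by rewrite addrN addNr !addr0.
  have La : L (H (phi i.+1) + G i.+1) by auto.
  have Lb : L (H (phi i) + G i) by auto.
  have Lc : L (G i.+1 - G i) by auto.
  have t1 := hnorm_triangleB sh (LB La Lb) Lc.
  have t2 := hnorm_triangleB sh La Lb.
  rewrite /e'; lra.
pose K1 i := if pselect (i < 2 ^ j)%N is left h then projT1 (cid (seg i h)) else 0%N.
have hK1 i K : (i < 2 ^ j)%N -> (K1 i <= K)%N -> (0 < K)%N ->
    nrm (iter K (A (D / K%:R)) (phi i) - phi i.+1) <= 4 * e' * D.
  move=> ij; rewrite /K1; case: pselect => // h; case: cid => K' hK' /=.
  exact: hK'.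
exists (j + \max_(i < 2 ^ j) K1 i)%N => k jk.
(* As all subdivisions are dyadic, the 2^k iterations split into K equal steps on each of the 2^j
   pieces. *)
pose K := (2 ^ (k - j))%N.
have Kpos : (0 < K)%N by rewrite expn_gt0.
have KK i : (i < 2 ^ j)%N -> (K1 i <= K)%N.
  move=> ij; apply: (@leq_trans (k - j)%N); last exact/ltnW/ltn_expl.
  rewrite leq_subRL; last by apply: leq_trans jk; exact: leq_addr.
  apply: leq_trans jk; rewrite leq_add2l.
  exact: (@leq_bigmax _ (fun i : 'I_(2 ^ j) => K1 i) (Ordinal ij)).
have kE : (2 ^ k = 2 ^ j * K)%N.
  by rewrite -expnD subnKC//; apply: leq_trans jk; exact: leq_addr.
have tE : s / (2 ^ k)%:R = D / K%:R.
  by rewrite kE natrM natrX /D -mulrA -invfM.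
rewrite tE kE; set t := D / K%:R.
have t0 : 0 < t by rewrite divr_gt0// ltr0n.
have ind i : (i <= 2 ^ j)%N ->
    nrm (iter (i * K) (A t) (phi 0%N) - phi i) <= i%:R * (4 * e' * D).
  elim: i => [_|i IH ij]; first by rewrite mul0n /= subrr (hnorm0 sh) mul0r.
  rewrite mulSn iterD -natr1 mulrDl mul1r.
  have Li := iter_approx_L (i * K) t0 (Lphi 0%N).
  have L1 := iter_approx_L K t0 Li; have L2 := iter_approx_L K t0 (Lphi i).
  apply: le_trans (hdist_triangle sh L1 L2 (Lphi i.+1)) _.
  apply: lerD; last by apply: hK1 => //; exact: KK.
  apply: le_trans (iter_approx_dist K t0 Li (Lphi i)) _.
  by apply: IH; exact: ltnW.
have := ind _ (leqnn _).
have Lit z : L z -> L (iter (2 ^ j * K) (A t) z) by exact: iter_approx_L.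
have LSs : L (S s f) by apply: (sc_L sc) => //; exact: ltW.
have FE : F (2 ^ j)%N = S s f.
  by rewrite /F natrX /D mulrC divfK// gt_eqF.
have [p1 _] := hphi (2 ^ j)%N; rewrite FE in p1.
have [p0 _] := hphi 0%N.
have F0 : nrm (F 0%N - f) = 0 by rewrite /F mul0r (sc_id sc).
have d1 := iter_approx_dist (2 ^ j * K) t0 Lf (Lphi 0%N).
have d2 := hdist_triangle sh Lf (LF 0%N) (Lphi 0%N).
rewrite (hnormC sh Lf (LF 0%N)) F0 add0r (hnormC sh (LF 0%N) (Lphi 0%N)) in d2.
have t1 := hdist_triangle sh (Lit _ Lf) (Lit _ (Lphi 0%N)) LSs.
have t2 := hdist_triangle sh (Lit _ (Lphi 0%N)) (Lphi (2 ^ j)%N) LSs.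
have -> : (2 ^ j)%:R * (4 * e' * D) = 4 * (M + 3) * ep * s.
  by rewrite natrX /D /e'; field; rewrite gt_eqF.
have : ep * (4 * (M + 3) * s + 2 * s) = e by rewrite /ep divfK// gt_eqF.
have : ep * D <= ep * s by rewrite ler_pM2l.
lra.
Qed.

(** C is dense and contained in the domain; contractivity of the iterates and boundedness of [S s]
    extend the convergence from C to the whole space. *)
Theorem chernoff_limit f s e : L f -> 0 < s -> 0 < e ->
  exists k0, forall k, (k0 <= k)%N ->
    nrm (iter (2 ^ k) (A (s / (2 ^ k)%:R)) f - S s f) <= e.
Proof.
move=> Lf s0 e0.
have [M M1 hM] := sc_bd_ge1 sc (ltW s0).
have M0 : 0 < M by exact: lt_le_trans M1.
have K0 : 0 < 2 * (M + 1) by rewrite mulr_gt0// addr_gt0.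
have [phi Cphi hphi] := test_dense sh sc sa SH Lf (divr_gt0 e0 K0).
have [k0 hk0] := chernoff_domain (generator_test sh sa SH Cphi) s0
  (divr_gt0 e0 (ltr0n R 2)).
exists k0 => k kk; have Lphi := CL Cphi.
have t0 : 0 < s / (2 ^ k)%:R by rewrite divr_gt0// ltr0n expn_gt0.
have LS z : L z -> L (S s z) by apply: (sc_L sc); exact: ltW.
have Lit z : L z -> L (iter (2 ^ k) (A (s / (2 ^ k)%:R)) z) by exact: iter_approx_L.
have d1 := iter_approx_dist (2 ^ k) t0 Lf Lphi.
have d2 : nrm (S s phi - S s f) <= M * nrm (f - phi).
  rewrite (sc_distE sh sc)//; last exact: ltW.
  by rewrite (hnormC sh Lf Lphi); apply: hM; auto.
have t1 := hdist_triangle sh (Lit _ Lf) (Lit _ Lphi) (LS _ Lf).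
have t2 := hdist_triangle sh (Lit _ Lphi) (LS _ Lphi) (LS _ Lf).
have := hk0 k kk.
have : e / (2 * (M + 1)) * (M + 1) = e / 2 by field; lra.
have : M * nrm (f - phi) <= M * (e / (2 * (M + 1))) by rewrite ler_pM2l.
lra.
Qed.

End chernoff_limit.

(** * Square-integrable functions and the real form of complex L^2 *)

(** For nonnegative functions the integral is a supremum over the simple functions below, so it is
    monotone for arbitrary such functions. *)
Lemma le_integral_nn d (T : measurableType d) (R : realType)
    (mu : {measure set T -> \bar R}) (D : set T) (f g : T -> \bar R) :
  (forall x, D x -> 0 <= f x)%E -> (forall x, D x -> f x <= g x)%E ->
  (\int[mu]_(x in D) f x <= \int[mu]_(x in D) g x)%E.
Proof.
move=> f0 fg; have g0 x : D x -> (0 <= g x)%E by move=> Dx; exact: le_trans (f0 _ Dx) (fg _ Dx).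
rewrite !ge0_integralE//; apply: le_ereal_sup => _ [h hf <-] /=.
exists h => // x; apply: (le_trans (hf x)).
by rewrite /patch; case: ifPn => //; rewrite inE => /fg.
Qed.

Section square_integrable.
Context d {T : measurableType d} {R : realType}.
Variable mu : {measure set T -> \bar R}.
Implicit Types (f g h : T -> R).

Definition sqnorm f : \bar R := (\int[mu]_x (f x ^+ 2)%:E)%E.

Definition sq_int f : Prop :=
  measurable_fun [set: T] f /\ (sqnorm f < +oo)%E.

Definition ip2 f g : R := \int[mu]_x (f x * g x).

Lemma sqnorm_ge0 f : (0 <= sqnorm f)%E.
Proof. by apply: integral_ge0 => x _; rewrite lee_fin sqr_ge0. Qed.

Lemma measurable_sqr f : measurable_fun [set: T] f ->
  measurable_fun [set: T] (fun x => (f x ^+ 2)%:E).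
Proof. by move=> mf; apply/measurable_EFinP; exact: measurable_funX. Qed.

Lemma le_sqnorm f g :
  (forall x, f x ^+ 2 <= g x ^+ 2) -> (sqnorm f <= sqnorm g)%E.
Proof.
move=> fg; by apply: le_integral_nn => x _; rewrite lee_fin ?sqr_ge0.
Qed.

Lemma sqnormZ a f : measurable_fun [set: T] f ->
  sqnorm (fun x => a * f x) = ((a ^+ 2)%:E * sqnorm f)%E.
Proof.
move=> mf; rewrite /sqnorm -ge0_integralZl//; first last.
- by rewrite lee_fin sqr_ge0.
- by move=> x _; rewrite lee_fin sqr_ge0.
- exact: measurable_sqr.
- by apply: eq_integral => x _; rewrite -EFinM exprMn.
Qed.

Lemma sqnormD_le f g : measurable_fun [set: T] f -> measurable_fun [set: T] g ->
  (sqnorm (fun x => (f x + g x)%R) <= 2%:E * sqnorm f + 2%:E * sqnorm g)%E.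
Proof.
move=> mf mg; have p h x : setT x -> (0 <= (h x ^+ 2)%:E)%E by rewrite lee_fin sqr_ge0.
have m2 := measurable_sqr.
rewrite /sqnorm -(ge0_integralZl _ _ (m2 _ mf) (p f))//.
rewrite -(ge0_integralZl _ _ (m2 _ mg) (p g))//.
rewrite -ge0_integralD//; first last.
- by apply: emeasurable_funM => //; exact: measurable_sqr.
- by move=> x _; rewrite -EFinM lee_fin mulr_ge0// sqr_ge0.
- by apply: emeasurable_funM => //; exact: measurable_sqr.
- by move=> x _; rewrite -EFinM lee_fin mulr_ge0// sqr_ge0.
apply: le_integral_nn => x _; first by rewrite lee_fin sqr_ge0.
 rewrite -!EFinM -EFinD lee_fin.
  have := sqr_ge0 (f x - g x); rewrite sqrrB sqrrD; lra.
Qed.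

Lemma sq_int_lin a f g : sq_int f -> sq_int g -> sq_int (fun x => a * f x + g x).
Proof.
move=> [mf f2] [mg g2].
have maf : measurable_fun [set: T] (fun x => a * f x) by exact: measurable_funM.
split; first exact: measurable_funD.
apply: le_lt_trans (sqnormD_le maf mg) _.
rewrite sqnormZ//.
have p2 : (0 <= 2%:E :> \bar R)%E by rewrite lee_fin.
have pa : (0 <= (a ^+ 2)%:E :> \bar R)%E by rewrite lee_fin sqr_ge0.
rewrite lte_add_pinfty//; first by do 2 (apply: lte_mul_pinfty => //).
exact: lte_mul_pinfty.
Qed.

Lemma sq_int0 : sq_int (fun=> 0).
Proof.
split => //; rewrite /sqnorm (eq_integral (fun=> 0%E)) ?integral0//.
by move=> x _; rewrite expr0n.
Qed.

Lemma sq_int_mul f g : sq_int f -> sq_int g ->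
  mu.-integrable [set: T] (fun x => (f x * g x)%:E).
Proof.
move=> [mf f2] [mg g2]; apply/integrableP; split.
  by apply/measurable_EFinP; exact: measurable_funM.
apply: (@le_lt_trans _ _ (sqnorm f + sqnorm g)%E); last by rewrite lte_add_pinfty.
have p h x : setT x -> (0 <= (h x ^+ 2)%:E)%E by rewrite lee_fin sqr_ge0.
have m2 := measurable_sqr.
rewrite /sqnorm -(ge0_integralD _ _ (p f) (m2 _ mf) (p g) (m2 _ mg))//.
apply: le_integral_nn => x _ //=.
  rewrite -EFinD/= lee_fin normrM.
  rewrite -[f x ^+ 2]ger0_norm ?sqr_ge0// -[g x ^+ 2]ger0_norm ?sqr_ge0//.
  rewrite !normrX; have := sqr_ge0 (`|f x| - `|g x|); rewrite sqrrB.
  have := mulr_ge0 (normr_ge0 (f x)) (normr_ge0 (g x)); lra.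
Qed.

Lemma ip2C f g : ip2 f g = ip2 g f.
Proof. by apply: eq_Rintegral => x _; rewrite mulrC. Qed.

Lemma ip2_lin a f g h : sq_int f -> sq_int g -> sq_int h ->
  ip2 (fun x => a * f x + g x) h = a * ip2 f h + ip2 g h.
Proof.
move=> sf sg s; rewrite /ip2 -RintegralZl//; last exact: sq_int_mul.
rewrite -RintegralD//; last exact: sq_int_mul.
  by apply: eq_Rintegral => x _; rewrite mulrDl mulrA.
have := integrableZl measurableT a (sq_int_mul sf s).
by apply: eq_integrable => // x _ /=; rewrite EFinM.
Qed.

Lemma ip2_sqr f : ip2 f f = fine (sqnorm f).
Proof. by rewrite /ip2 /Rintegral; congr fine; apply: eq_integral => x _; rewrite expr2. Qed.

Lemma ip2_ge0 f : 0 <= ip2 f f.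
Proof. by rewrite ip2_sqr fine_ge0// sqnorm_ge0. Qed.

Lemma sq_int_fineK f : sq_int f -> (ip2 f f)%:E = sqnorm f.
Proof.
move=> [mf f2]; rewrite ip2_sqr fineK// ge0_fin_numE//; exact: sqnorm_ge0.
Qed.

(* With d_j = |u_(j+1) - u_j|, the weighted sum \sum_j 2^j d_(k+j)^2 is
   integrable and dominates (lim u - u_k)^2 / 2 pointwise. *)
Lemma sq_int_complete (u : nat -> T -> R) (e : nat -> R) :
  (forall k, sq_int (u k)) -> (forall k, 0 <= e k) ->
  (forall k, e k.+1 <= e k / 2) ->
  (forall k, (sqnorm (fun x => (u k.+1 x - u k x)%R) <= (e k ^+ 2)%:E)%E) ->
  exists2 f, sq_int f &
    forall k, (sqnorm (fun x => (f x - u k x)%R) <= (4 * e k ^+ 2)%:E)%E.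
Proof.
move=> su e0 eh ue.
pose D k j x : \bar R := ((2 ^+ j) * (u (k + j).+1 x - u (k + j)%N x) ^+ 2)%:E.
have D0 k j x : (0 <= D k j x)%E by rewrite lee_fin mulr_ge0 ?sqr_ge0// exprn_ge0.
have mu_ k : measurable_fun [set: T] (u k) by have [] := su k.
have mD k j : measurable_fun [set: T] (D k j).
  apply/measurable_EFinP; apply: measurable_funM => //.
  by apply: measurable_funX; exact: measurable_funB.
pose G k x := (\sum_(j <oo) D k j x)%E.
have G0 k x : (0 <= G k x)%E by exact: nneseries_ge0.
have mG k : measurable_fun [set: T] (G k).
  exact: ge0_emeasurable_sum.
have eE k j : e (k + j)%N <= e k / 2 ^+ j.
  elim: j => [|j IH]; first by rewrite addn0 expr0 divr1.
  rewrite addnS; apply: le_trans (eh _) _.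
  by rewrite exprSr invfM mulrA ler_pM2r ?invr_gt0.
have IG k : (\int[mu]_x G k x <= (2 * e k ^+ 2)%:E)%E.
  rewrite integral_nneseries//.
  apply: lime_le; first by apply: is_cvg_nneseries => j _ _; exact: integral_ge0.
  apply: nearW => N.
  apply: (@le_trans _ _ (\sum_(0 <= j < N) (e k ^+ 2 / 2 ^+ j)%:E)%E).
    apply: lee_sum => j _.
    rewrite /D; under eq_integral do rewrite EFinM.
    have mdd := measurable_sqr (measurable_funB (mu_ (k + j).+1) (mu_ (k + j)%N)).
    have pd x : setT x -> (0 <= ((u (k + j).+1 x - u (k + j)%N x) ^+ 2)%:E)%E.
      by rewrite lee_fin sqr_ge0.
    have pj : (0 <= (2 ^+ j)%:E :> \bar R)%E by rewrite lee_fin exprn_ge0.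
    rewrite (ge0_integralZl mu measurableT mdd pd pj).
    apply: (@le_trans _ _ ((2 ^+ j)%:E * (e (k + j)%N ^+ 2)%:E)%E).
      by rewrite lee_pmul2l ?lte_fin ?exprn_gt0//; exact: ue.
    rewrite -EFinM lee_fin -ler_pdivlMl ?exprn_gt0//.
    have -> : (2 ^+ j)^-1 * (e k ^+ 2 / 2 ^+ j) = (e k / 2 ^+ j) ^+ 2.
      by rewrite expr_div_n; field; rewrite expf_neq0.
    by rewrite lerXn2r// ?nnegrE// divr_ge0// exprn_ge0.
  rewrite sumEFin lee_fin.
  suff : \sum_(0 <= j < N) e k ^+ 2 / 2 ^+ j = 2 * e k ^+ 2 * (1 - (2 ^+ N)^-1).
    move=> ->; rewrite ler_piMr ?mulr_ge0 ?sqr_ge0// gerBl invr_ge0.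
  elim: N => [|N IH]; first by rewrite big_geq// expr0 invr1 subrr mulr0.
  rewrite big_nat_recr//= IH [2 ^+ N.+1]exprS; field.
  by rewrite expf_neq0.
have sum_le k i x : (((u (k + i)%N x - u k x) ^+ 2)%:E <= 2%:E * G k x)%E.
  apply: (@le_trans _ _ (2%:E * \sum_(0 <= j < i) D k j x)%E); last first.
    by rewrite lee_pmul2l//; apply: nneseries_lim_ge.
  rewrite /D sumEFin -EFinM lee_fin.
  suff : (u (k + i)%N x - u k x) ^+ 2 <= (2 - 2 / 2 ^+ i) *
      (\sum_(0 <= j < i) 2 ^+ j * (u (k + j).+1 x - u (k + j)%N x) ^+ 2).
    move=> /le_trans; apply; rewrite ler_wpM2r//.
      by rewrite sumr_ge0// => j _; rewrite mulr_ge0 ?sqr_ge0// exprn_ge0.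
    by rewrite gerBl divr_ge0// exprn_ge0.
  elim: i => [|i IH].
    by rewrite addn0 subrr expr0n/= big_geq// mulr0.
  rewrite addnS big_nat_recr//= [2 ^+ i.+1]exprS.
  set s := \sum_(0 <= j < i) _ in IH *.
  set a := u (k + i).+1 x; set b := u (k + i)%N x in IH *; set c := u k x in IH *.
  set q := 2 ^+ i in IH *.
  have q1 : 1 <= q by rewrite exprn_ege1// ler1n.
  have q0 : 0 < q by exact: lt_le_trans q1.
  have s0 : 0 <= s by rewrite sumr_ge0// => j _; rewrite mulr_ge0 ?sqr_ge0// exprn_ge0.
  pose A := 2 - 2 / q.
  have A0 : 0 <= A by rewrite subr_ge0 ler_pdivrMr// ler_peMr.
  have -> : 2 - 2 / (2 * q) = A + q^-1 by rewrite /A; field; rewrite gt_eqF.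
  have {}IH : (b - c) ^+ 2 <= A * s by [].
  have -> : a - c = (a - b) + (b - c) by ring.
  set x1 := a - b; set x2 := b - c in IH *.
  have iq : 0 < q^-1 by rewrite invr_gt0.
  have [A00|A1] := eqVneq A 0.
    have : x2 = 0 by apply/eqP; rewrite -sqrf_eq0 eq_le sqr_ge0 andbT -[leRHS](mul0r s) -A00.
    move=> ->; rewrite addr0 A00 add0r mulrDr mulrA mulVf ?gt_eqF// mul1r.
    by rewrite lerDr mulr_ge0// ltW.
  have Ap : 0 < A by rewrite lt_def A1.
  (* (x1 + x2)^2 <= (A + 1/q) (x2^2 / A + q x1^2) *)
  have h : (x1 + x2) ^+ 2 <= (A + q^-1) * (x2 ^+ 2 / A + q * x1 ^+ 2).
    rewrite -subr_ge0.
    have -> : (A + q^-1) * (x2 ^+ 2 / A + q * x1 ^+ 2) - (x1 + x2) ^+ 2 =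
        (q^-1 / A) * (x2 - A * q * x1) ^+ 2.
      by field; rewrite (gt_eqF q0) A1.
    by rewrite mulr_ge0 ?sqr_ge0// divr_ge0 ?ltW.
  apply: le_trans h _; rewrite ler_wpM2l//; first by rewrite addr_ge0 ?ltW.
  by rewrite lerD2r ler_pdivrMr// mulrC.
(* [fine] gives the default value 0 to an infinite limit superior; this can only occur where [G k]
   is infinite, and there the pointwise bound is trivial. *)
pose f x := fine (limn_esup (fun k => (u k x)%:E)).
have mf : measurable_fun [set: T] f.
  apply: measurableT_comp => //; apply: measurable_fun_limn_esup => k.
  exact/measurable_EFinP.
have fle k x : (((f x - u k x) ^+ 2)%:E <= 2%:E * G k x)%E.
  have [Gk|] := ltP (G k x) +oo%E; last first.
    by rewrite leye_eq => /eqP ->; rewrite gt0_muley ?leey// lte_fin.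
  pose r := fine (G k x).
  have rE : G k x = r%:E by rewrite fineK// ge0_fin_numE.
  have r0 : 0 <= r by rewrite -lee_fin -rE.
  pose c := Num.sqrt (2 * r).
  have cau1 m : (k <= m)%N -> `|u m x - u k x| <= c.
    move=> /subnKC <-; rewrite -sqrtr_sqr ler_wsqrtr// -lee_fin.
    by apply: le_trans (sum_le _ _ _) _; rewrite EFinM -rE.
  have up : (limn_esup (fun k => (u k x)%:E) <= (u k x + c)%:E)%E.
    rewrite /limn_esup /limf_esup.
    apply: (@le_trans _ _ (ereal_sup [set (u m x)%:E | m in [set m | (k <= m)%N]])).
      by apply: ereal_inf_lbound => /=; exists [set m | (k <= m)%N] => //; exists k.
    apply: ge_ereal_sup => _ [m km <-]; rewrite lee_fin.
    by have := ler_norm (u m x - u k x); have := cau1 m km; lra.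
  have lo : ((u k x - c)%:E <= limn_esup (fun k => (u k x)%:E))%E.
    rewrite /limn_esup /limf_esup; apply: le_ereal_inf_tmp => _ [/= A [N _ hA] <-].
    apply: (@le_trans _ _ (u (maxn k N) x)%:E).
      rewrite lee_fin; have := cau1 _ (leq_maxl k N).
      by have := ler_norm (- (u (maxn k N) x - u k x)); rewrite normrN; lra.
    by apply: ereal_sup_ubound; exists (maxn k N) => //; apply: hA => /=; exact: leq_maxr.
  have fE : limn_esup (fun k => (u k x)%:E) = (f x)%:E.
    by rewrite /f fineK//; case: limn_esup up lo.
  move: up lo; rewrite fE !lee_fin => up lo.
  rewrite rE -EFinM lee_fin -[leRHS]sqr_sqrtr ?mulr_ge0// -/c.
  have : 0 <= (c - (f x - u k x)) * (c + (f x - u k x)) by rewrite mulr_ge0//; lra.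
  by rewrite -subr_ge0; congr (_ <= _); ring.
have fu k : (sqnorm (fun x => (f x - u k x)%R) <= (4 * e k ^+ 2)%:E)%E.
  apply: (@le_trans _ _ (\int[mu]_x (2%:E * G k x))%E).
    by apply: le_integral_nn => x _ //; rewrite lee_fin sqr_ge0.
  rewrite ge0_integralZl// ?lee_fin//.
  have -> : (4 * e k ^+ 2)%:E = (2%:E * (2 * e k ^+ 2)%:E)%E by rewrite -EFinM; congr EFin; ring.
  by rewrite lee_pmul2l.
exists f => //.
have sf : sq_int (fun x => f x - u 0%N x).
  split; first exact: measurable_funB.
  by apply: le_lt_trans (fu 0%N) _; rewrite ltry.
rewrite (_ : f = fun x => 1 * (f x - u 0%N x) + u 0%N x); first exact: sq_int_lin.
by apply/funext => x; rewrite mul1r subrK.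
Qed.

End square_integrable.

Section pairs.
Context d {T : measurableType d} {R : realType}.
Variable mu : {measure set T -> \bar R}.
Local Notation V := ((T -> R) * (T -> R))%type.

(** A complex function is represented by its real and imaginary parts, so that the abstract real
    theory applies; H and its approximations act on each component. *)
Definition L2pair (v : V) : Prop := sq_int mu v.1 /\ sq_int mu v.2.

Definition ippair (v w : V) : R := ip2 mu v.1 w.1 + ip2 mu v.2 w.2.

Lemma hnorm_pair_le (v : V) (e : R) : L2pair v -> 0 <= e ->
  (hnorm ippair v <= e) = (ip2 mu v.1 v.1 + ip2 mu v.2 v.2 <= e ^+ 2).
Proof.
move=> [v1 v2] e0; rewrite /hnorm /ippair.
have p0 : 0 <= ip2 mu v.1 v.1 + ip2 mu v.2 v.2 by rewrite addr_ge0// ip2_ge0.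
by rewrite -[in LHS](ger0_norm e0) -sqrtr_sqr ler_sqrt// sqr_ge0.
Qed.

Lemma L2pair_semi_hilbert : semi_hilbert L2pair ippair.
Proof.
have lin a x y : L2pair x -> L2pair y -> L2pair (a *: x + y).
  by move=> [x1 x2] [y1 y2]; split; exact: sq_int_lin.
have L0 : L2pair 0 by split; exact: sq_int0.
split => //.
- by move=> x y _ _; rewrite /ippair !(ip2C _ x.1) !(ip2C _ x.2).
- move=> a x y z [x1 x2] [y1 y2] [z1 z2]; rewrite /ippair.
  rewrite (_ : (a *: x + y).1 = fun t => a * x.1 t + y.1 t)//.
  rewrite (_ : (a *: x + y).2 = fun t => a * x.2 t + y.2 t)//.
  by rewrite !ip2_lin//; ring.
- by move=> x _; rewrite addr_ge0// ip2_ge0.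
move=> u e Lu e0 eh ue.
have LB x y : L2pair x -> L2pair y -> L2pair (x - y).
  by move=> Lx Ly; rewrite addrC -scaleN1r; exact: lin.
have ue2 k : ip2 mu (u k.+1 - u k).1 (u k.+1 - u k).1 +
    ip2 mu (u k.+1 - u k).2 (u k.+1 - u k).2 <= e k ^+ 2.
  by rewrite -hnorm_pair_le//; [exact: ue|exact: LB].
have half (proj : V -> T -> R) : (forall v, L2pair v -> sq_int mu (proj v)) ->
    (forall v w x, proj (v - w) x = proj v x - proj w x) ->
    (forall v, ip2 mu (proj v) (proj v) <= ip2 mu v.1 v.1 + ip2 mu v.2 v.2) ->
    exists2 f, sq_int mu f &
    forall k, (sqnorm mu (fun x => (f x - proj (u k) x)%R) <= (4 * e k ^+ 2)%:E)%E.
  move=> pL pB pn; apply: sq_int_complete => // [k|k]; first exact: pL.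
  rewrite (_ : (fun x => _) = proj (u k.+1 - u k)); last first.
    by apply/funext => x; rewrite pB.
  rewrite -sq_int_fineK; last by apply: pL; exact: LB.
  by rewrite lee_fin (le_trans (pn _)).
have [f1 sf1 h1] : exists2 f, sq_int mu f &
    forall k, (sqnorm mu (fun x => (f x - (u k).1 x)%R) <= (4 * e k ^+ 2)%:E)%E.
  apply: half => // [v []//|v]; by rewrite lerDl ip2_ge0.
have [f2 sf2 h2] : exists2 f, sq_int mu f &
    forall k, (sqnorm mu (fun x => (f x - (u k).2 x)%R) <= (4 * e k ^+ 2)%:E)%E.
  apply: half => // [v []//|v]; by rewrite lerDr ip2_ge0.
have Lf : L2pair (f1, f2) by split.
exists (f1, f2) => // eps eps0.
have eE k : e k <= e 0%N / 2 ^+ k.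
  elim: k => [|k IH]; first by rewrite expr0 divr1.
  apply: le_trans (eh _) _.
  by rewrite exprSr invfM mulrA ler_pM2r ?invr_gt0.
exists (Num.bound (3 * e 0%N / eps)) => k kk.
rewrite -/(hnorm ippair _) hnorm_pair_le; [|exact: LB|exact: ltW].
have sB (f g : T -> R) : sq_int mu f -> sq_int mu g -> sq_int mu (fun x => f x - g x).
  move=> sf sg; rewrite (_ : (fun x => _) = fun x => -1 * g x + f x).
    exact: sq_int_lin.
  by apply/funext => x; rewrite mulN1r addrC.
have b1 : ip2 mu ((f1, f2) - u k).1 ((f1, f2) - u k).1 <= 4 * e k ^+ 2.
  have [l1 _] := Lu k; rewrite -lee_fin sq_int_fineK; first exact: h1.
  exact: (sB f1 (u k).1 sf1 l1).
have b2 : ip2 mu ((f1, f2) - u k).2 ((f1, f2) - u k).2 <= 4 * e k ^+ 2.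
  have [_ l2] := Lu k; rewrite -lee_fin sq_int_fineK; first exact: h2.
  exact: (sB f2 (u k).2 sf2 l2).
have e3 : 3 * e k <= eps.
  apply: le_trans (_ : 3 * (e 0%N / 2 ^+ k) <= _); first by rewrite ler_pM2l.
  rewrite mulrA ler_pdivrMr ?exprn_gt0// [eps * _]mulrC -ler_pdivrMr//.
  by apply: ltW; exact: upper_nthrootP.
have : (3 * e k) ^+ 2 <= eps ^+ 2 by rewrite ler_pXn2r ?nnegrE ?mulr_ge0 ?(ltW eps0)//.
rewrite exprMn; move: (e k ^+ 2) (sqr_ge0 (e k)) b1 b2 => z z0; lra.
Qed.

End pairs.

Section complex_pairs.
Context {R : realType} {n : nat}.
Local Notation mu := (lebesgue_rV R n).
Local Notation rV := 'rV[R]_n.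
Local Notation cfun := (rV -> R[i]).
Local Notation V := ((rV -> R) * (rV -> R))%type.
Local Notation L := (@L2pair _ rV R mu).
Local Notation ip := (@ippair _ rV R mu).

Definition cfun_of (v : V) : cfun := fun x => (v.1 x +i* v.2 x)%C.
Definition pair_of (f : cfun) : V :=
  ((fun x => complex.Re (f x)), (fun x => complex.Im (f x))).

Lemma pair_ofK (f : cfun) : cfun_of (pair_of f) = f.
Proof. by apply/funext => x; rewrite /cfun_of /=; case: (f x). Qed.

Lemma cfun_ofK (v : V) : pair_of (cfun_of v) = v.
Proof. by case: v. Qed.

Lemma normc_sqr (z : R[i]) :
  ComplexField.Normc.normc z ^+ 2 = complex.Re z ^+ 2 + complex.Im z ^+ 2.
Proof. by case: z => a b /=; rewrite sqr_sqrtr// addr_ge0// sqr_ge0. Qed.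

Lemma L2norm_pow (f : cfun) :
  (L2norm f `^ 2 = \int[mu]_x (complex.Re (f x) ^+ 2 + complex.Im (f x) ^+ 2)%:E)%E.
Proof.
rewrite /L2norm poweR_Lnorm//; apply: eq_integral => x _ /=.
rewrite powR_mulrn ?normr_ge0// -normrX ger0_norm ?sqr_ge0//.
by rewrite normc_sqr.
Qed.

Lemma measurable_pair (f : cfun) :
  measurable_fun [set: rV] (fun x => complex.Re (f x)) ->
  measurable_fun [set: rV] (fun x => complex.Im (f x)) ->
  (\int[mu]_x (complex.Re (f x) ^+ 2 + complex.Im (f x) ^+ 2)%:E =
   sqnorm mu (pair_of f).1 + sqnorm mu (pair_of f).2)%E.
Proof.
move=> m1 m2; rewrite /sqnorm -ge0_integralD//.
- by move=> x _; rewrite lee_fin sqr_ge0.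
- exact: measurable_sqr.
- by move=> x _; rewrite lee_fin sqr_ge0.
- exact: measurable_sqr.
Qed.

Lemma L2_pairP (f : cfun) : L2 f <-> L (pair_of f).
Proof.
have half : (2 : R) != 0 by [].
split.
  move=> [m1 m2 f2]; have := L2norm_pow f; rewrite measurable_pair// => h.
  have lt : (sqnorm mu (pair_of f).1 + sqnorm mu (pair_of f).2 < +oo)%E.
    by rewrite -h poweR_lty.
  have [p1 p2] := (sqnorm_ge0 mu (pair_of f).1, sqnorm_ge0 mu (pair_of f).2).
  split; split => //; apply: le_lt_trans lt; [exact: leeDl|exact: leeDr].
move=> [[m1 f1] [m2 f2]]; split => //.
have := L2norm_pow f; rewrite measurable_pair// => h.
have : (L2norm f `^ 2 < +oo)%E by rewrite h lte_add_pinfty.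
by rewrite !ltey; apply: contra => /eqP ->; rewrite poweRyr.
Qed.

Lemma L2normE (f : cfun) : L2 f -> L2norm f = (hnorm ip (pair_of f))%:E.
Proof.
move=> Lf; have [m1 m2 _] := Lf; have /L2_pairP[s1 s2] := Lf.
have := L2norm_pow f; rewrite measurable_pair// -!sq_int_fineK// -EFinD.
move=> /(congr1 (fun z => z `^ 2^-1)%E); rewrite -poweRrM mulfV// poweRe1 ?Lnorm_ge0// => ->.
by rewrite poweR_EFin powR12_sqrt// addr_ge0// ip2_ge0.
Qed.

Lemma ae_equal_hnorm (f g : cfun) : ae_equal f g -> L2 f -> L2 g ->
  hnorm ip (pair_of f - pair_of g) = 0.
Proof.
move=> fg /L2_pairP[f1 f2] /L2_pairP[g1 g2]; rewrite /hnorm.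
suff -> : ip (pair_of f - pair_of g) (pair_of f - pair_of g) = 0 by rewrite sqrtr0.
have half (h : R[i] -> R) (a b : rV -> R) : sq_int mu a -> sq_int mu b ->
    a = (fun x => h (f x)) -> b = (fun x => h (g x)) ->
    ip2 mu (fun x => a x - b x) (fun x => a x - b x) = 0.
  move=> [ma _] [mb _] aE bE.
  have mab : measurable_fun [set: rV] (fun x => a x - b x) by exact: measurable_funB.
  rewrite /ip2 /Rintegral (ae_eq_integral (cst 0%E))//.
  - by rewrite integral0.
  - by apply/measurable_EFinP; exact: measurable_funM.
  - by apply: filterS fg => x /(_ I) fgx _; rewrite aE bE fgx subrr mul0r.
rewrite /ippair.
have -> := half (fun z => complex.Re z) (pair_of f).1 (pair_of g).1 f1 g1 erefl erefl.
by have -> := half (fun z => complex.Im z) (pair_of f).2 (pair_of g).2 f2 g2 erefl erefl; rewrite addr0.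
Qed.

Lemma ae_equal_L2norm (f g : cfun) : ae_equal f g -> L2 f -> L2 g ->
  L2norm f = L2norm g.
Proof.
move=> fg Lf Lg; rewrite !L2normE//; congr EFin.
apply: (hnorm_congr (L2pair_semi_hilbert mu)); [exact/L2_pairP|exact/L2_pairP|].
exact: ae_equal_hnorm.
Qed.

Definition pair_semigroup (S : R -> cfun -> cfun) (t : R) (v : V) : V :=
  pair_of (S t (cfun_of v)).

Lemma cvg_at_right_hnorm (F : R -> V) : (forall h, 0 < h -> L (F h)) ->
  (L2norm (cfun_of (F h)) @[h --> 0^'+] --> 0%E) <->
  (forall e, 0 < e -> exists2 eta : R, 0 < eta &
    forall t, 0 < t -> t < eta -> hnorm ip (F t) <= e).
Proof.
move=> LF.
have FE h : 0 < h -> L2norm (cfun_of (F h)) = (hnorm ip (F h))%:E.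
  by move=> h0; rewrite L2normE ?cfun_ofK//; apply/L2_pairP; rewrite cfun_ofK; exact: LF.
split.
  move=> /fine_cvgP[_ /cvgrPdist_le cv] e e0; have := cv e e0.
  rewrite near_withinE => /nbhs_ballP[eta /= eta0 h].
  exists eta => // t t0 teta; have /= := h t.
  rewrite FE//= sub0r normrN ger0_norm ?hnorm_ge0//; apply => //.
  by rewrite /ball/= sub0r normrN gtr0_norm.
move=> h; apply/fine_cvgP; split.
  near=> t; rewrite FE//; near: t; exact: nbhs_right_gt.
apply/cvgrPdist_le => e e0; have [eta eta0 he] := h e e0.
near=> t; have t0 : 0 < t by near: t; exact: nbhs_right_gt.
rewrite /= FE//= sub0r normrN ger0_norm ?hnorm_ge0//; apply: he => //.
Unshelve. all: by end_near. Qed.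

Lemma pair_of_lin (a : R) (f g : cfun) :
  pair_of (fun x => a%:C%C * f x + g x) = a *: pair_of f + pair_of g.
Proof.
congr pair; apply/funext => x.
  rewrite -[RHS]/(a * complex.Re (f x) + complex.Re (g x)).
  by case: (f x) => b c; case: (g x) => b' c' /=; rewrite mul0r subr0.
rewrite -[RHS]/(a * complex.Im (f x) + complex.Im (g x)).
by case: (f x) => b c; case: (g x) => b' c' /=; rewrite mul0r addr0.
Qed.

Lemma cfun_of_lin (a : R) (v w : V) :
  cfun_of (a *: v + w) = fun x => a%:C%C * cfun_of v x + cfun_of w x.
Proof.
by rewrite -[RHS]pair_ofK pair_of_lin !cfun_ofK.
Qed.

Lemma pair_semigroup_L (S : R -> cfun -> cfun) t (v : V) : C0_semigroup S ->
  0 <= t -> L v -> L (pair_semigroup S t v).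
Proof.
move=> c0 t0 Lv; apply: (iffLR (L2_pairP (S t (cfun_of v)))).
by apply: (C0_L2 c0) => //; apply/L2_pairP; rewrite cfun_ofK.
Qed.

Lemma pair_semigroup_c0 (S : R -> cfun -> cfun) : C0_semigroup S ->
  semi_c0 L ip (pair_semigroup S).
Proof.
move=> c0; have Lc v : L v -> L2 (cfun_of v) by move=> Lv; apply/L2_pairP; rewrite cfun_ofK.
have LS t f : 0 <= t -> L2 f -> L2 (S t f) by exact: (C0_L2 c0).
have LC (a : R) (f g : cfun) : L2 f -> L2 g -> L2 (fun x => a%:C%C * f x + g x).
  move=> Lf Lg; apply/L2_pairP; rewrite pair_of_lin.
  by apply: (sh_lin (L2pair_semi_hilbert mu)); exact/L2_pairP.
split.
- by move=> t x t0 Lx; exact: pair_semigroup_L.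
- move=> t a x y t0 Lx Ly; rewrite /pair_semigroup cfun_of_lin -pair_of_lin.
  apply: ae_equal_hnorm; first by apply: (C0_linear c0) => //; exact: Lc.
    by apply: LS => //; apply: LC; exact: Lc.
  by apply: LC; apply: LS => //; exact: Lc.
- move=> t t0; have [M hM] := C0_bounded c0 t0; exists M => x Lx.
  have := hM _ (Lc _ Lx); rewrite !L2normE; [|exact: Lc|by apply: LS => //; exact: Lc].
  by rewrite -EFinM lee_fin cfun_ofK.
- move=> x Lx; rewrite -{2}[x]cfun_ofK; apply: ae_equal_hnorm; last exact: Lc.
    by apply: (C0_id c0); exact: Lc.
  by apply: LS => //; exact: Lc.
- move=> s t x s0 t0 Lx; rewrite /pair_semigroup pair_ofK.
  apply: ae_equal_hnorm; first by apply: (C0_add c0) => //; exact: Lc.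
    by apply: LS; [exact: addr_ge0|exact: Lc].
  by do 2 apply: (LS) => //; exact: Lc.
- move=> x e Lx e0.
  have LF h : 0 < h -> L (pair_semigroup S h x - x).
    move=> h0; apply: (shB (L2pair_semi_hilbert mu)) => //.
    by apply: pair_semigroup_L => //; exact: ltW.
  apply: (iffLR (cvg_at_right_hnorm LF)) => //.
  have := C0_continuous c0 (Lc _ Lx).
  apply: cvg_trans; apply: near_eq_cvg; near=> h; congr L2norm.
  rewrite -[LHS]pair_ofK; congr cfun_of.
  rewrite /pair_semigroup -[in RHS](cfun_ofK x) /=.
  congr pair; apply/funext => y.
    rewrite -[RHS]/(complex.Re (S h (cfun_of x) y) - x.1 y) /=.
    by case: (S h (cfun_of x) y).
  rewrite -[RHS]/(complex.Im (S h (cfun_of x) y) - x.2 y) /=.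
  by case: (S h (cfun_of x) y).
Unshelve. all: by end_near. Qed.

Lemma pair_semigroup_generator (S : R -> cfun -> cfun) : C0_semigroup S ->
  forall x g : V, semi_generator L ip (pair_semigroup S) x g <->
    generator S (cfun_of x) (cfun_of g).
Proof.
move=> c0 x g.
have Lc v : L v <-> L2 (cfun_of v) by rewrite L2_pairP cfun_ofK.
have E h : (fun y => (h^-1)%:C%C * (S h (cfun_of x) y - cfun_of x y) - cfun_of g y) =
    cfun_of (h^-1 *: (pair_semigroup S h x - x) - g).
  rewrite -[LHS]pair_ofK; congr cfun_of.
  congr pair; apply/funext => y.
    rewrite -[RHS]/(h^-1 * (complex.Re (S h (cfun_of x) y) - x.1 y) - g.1 y).
    by case: (S h (cfun_of x) y) => a b /=; rewrite mul0r subr0.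
  rewrite -[RHS]/(h^-1 * (complex.Im (S h (cfun_of x) y) - x.2 y) - g.2 y).
  by case: (S h (cfun_of x) y) => a b /=; rewrite mul0r addr0.
suff main : L x -> L g -> (forall e, 0 < e -> exists2 eta : R, 0 < eta &
    forall t, 0 < t -> t < eta ->
      hnorm ip (t^-1 *: (pair_semigroup S t x - x) - g) <= e) <->
   (L2norm (fun y => (h^-1)%:C%C * (S h (cfun_of x) y - cfun_of x y) - cfun_of g y)
      @[h --> 0^'+] --> 0%E).
  split=> -[Lx Lg h]; split; try by apply/Lc.
    by apply/main.
  by apply/main => //; apply/Lc.
move=> Lx Lg.
have sh := L2pair_semi_hilbert mu.
have LF h : 0 < h -> L (h^-1 *: (pair_semigroup S h x - x) - g).
  move=> h0; apply: (shB sh) => //; apply: (shZ sh); apply: (shB sh) => //.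
  by apply: pair_semigroup_L => //; exact: ltW.
rewrite -(cvg_at_right_hnorm LF).
have -> : (fun h => L2norm (fun y => (h^-1)%:C%C *
    (S h (cfun_of x) y - cfun_of x y) - cfun_of g y)) =
    (fun h => L2norm (cfun_of (h^-1 *: (pair_semigroup S h x - x) - g))).
  by apply/funext => h; congr L2norm; exact: E.
by [].
Qed.

End complex_pairs.

(** * Gaussian kernels and the heat operator *)

Lemma ge0_integralZ d (T : measurableType d) (R : realType)
    (mu : {measure set T -> \bar R}) (k : R) (f : T -> \bar R) :
  0 <= k -> measurable_fun [set: T] f -> (forall x, 0 <= f x)%E ->
  (\int[mu]_x (k%:E * f x) = k%:E * \int[mu]_x f x)%E.
Proof. by move=> k0 mf f0; rewrite ge0_integralZl// lee_fin. Qed.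

Section gaussian_kernel.
Context {R : realType} {n : nat}.
Local Notation rV := 'rV[R]_n.
Local Notation mu := (lebesgue_rV R n).
Implicit Types (x y b c : rV) (a s : R).

Definition dotv x y : R := \sum_(i < n) x ord0 i * y ord0 i.
Definition nsq x : R := dotv x x.

Lemma enorm_sqr x : enorm x ^+ 2 = nsq x.
Proof.
rewrite sqr_sqrtr; last by rewrite sumr_ge0// => i _; exact: sqr_ge0.
by apply: eq_bigr => i _; rewrite expr2.
Qed.

Lemma nsq_ge0 x : 0 <= nsq x.
Proof. by rewrite -enorm_sqr sqr_ge0. Qed.

Lemma dotvC x y : dotv x y = dotv y x.
Proof. by apply: eq_bigr => i _; rewrite mulrC. Qed.

Lemma dotvDl x y z : dotv (x + y) z = dotv x z + dotv y z.
Proof. by rewrite /dotv -big_split/=; apply: eq_bigr => i _; rewrite mxE mulrDl. Qed.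

Lemma dotvZl a x z : dotv (a *: x) z = a * dotv x z.
Proof. by rewrite /dotv mulr_sumr; apply: eq_bigr => i _; rewrite mxE mulrA. Qed.

Lemma dotvNl x z : dotv (- x) z = - dotv x z.
Proof. by rewrite -scaleN1r dotvZl mulN1r. Qed.

Lemma dotvDr x y z : dotv z (x + y) = dotv z x + dotv z y.
Proof. by rewrite dotvC dotvDl !(dotvC _ z). Qed.

Lemma dotvZr a x z : dotv z (a *: x) = a * dotv z x.
Proof. by rewrite dotvC dotvZl dotvC. Qed.

Lemma dotvNr x z : dotv z (- x) = - dotv z x.
Proof. by rewrite dotvC dotvNl dotvC. Qed.

Definition dotvE := (dotvDl, dotvDr, dotvZl, dotvZr, dotvNl, dotvNr).

Lemma nsqD x y : nsq (x + y) = nsq x + 2 * dotv x y + nsq y.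
Proof. by rewrite /nsq !dotvE (dotvC y x); ring. Qed.

Lemma nsqZ a x : nsq (a *: x) = a ^+ 2 * nsq x.
Proof. by rewrite /nsq !dotvE; ring. Qed.

Lemma nsqN x : nsq (- x) = nsq x.
Proof. by rewrite /nsq !dotvE opprK. Qed.

Lemma measurable_dotv d (T : measurableType d) (f g : T -> rV) :
  measurable_fun setT f -> measurable_fun setT g ->
  measurable_fun setT (fun t => dotv (f t) (g t)).
Proof.
move=> /measurable_fun_rVP mf /measurable_fun_rVP mg.
by apply: measurable_sum => i; exact: measurable_funM.
Qed.

Lemma measurable_nsq : measurable_fun [set: rV] nsq.
Proof. by apply: (measurable_dotv (f := id) (g := id)); exact: measurable_id. Qed.

Definition gau a y : R := expR (- (a * nsq y)).

Lemma measurable_gau a : measurable_fun [set: rV] (gau a).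
Proof.
apply: measurableT_comp => //; apply: measurable_funN.
by apply: measurable_funM => //; exact: measurable_nsq.
Qed.

Lemma gau_ge0 a y : 0 <= gau a y. Proof. exact: expR_ge0. Qed.

Lemma gauN a y : gau a (- y) = gau a y.
Proof. by rewrite /gau nsqN. Qed.

End gaussian_kernel.

Lemma gauS (R : realType) n (a : R) (r : R) (y : 'rV[R]_n) :
  gau a (cons_rV (r, y)) = expR (- (a * r ^+ 2)) * gau a y.
Proof.
rewrite /gau /nsq /dotv big_ord_recl cons_rV0 -expRD; congr expR.
rewrite (eq_bigr (fun i => y ord0 i * y ord0 i)) => [|i _]; last by rewrite cons_rVS.
by rewrite mulrDr opprD expr2.
Qed.

Lemma integral_gau1_lty (R : realType) (a : R) : 0 < a ->
  (\int[@lebesgue_measure R]_r (expR (- (a * r ^+ 2)))%:E < +oo)%E.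
Proof.
move=> a0; pose s := Num.sqrt (2 * a)^-1.
have s0 : 0 < s by rewrite sqrtr_gt0 invr_gt0 mulr_gt0.
have s2 : s ^+ 2 = (2 * a)^-1 by rewrite sqr_sqrtr// invr_ge0 mulr_ge0// ltW.
have p0 := normal_peak_gt0 (lt0r_neq0 s0).
rewrite (eq_integral (fun r : measurableTypeR R => ((normal_peak s)^-1%:E * (normal_pdf 0 s r)%:E)%E)).
  have mp : measurable_fun [set: measurableTypeR R] (fun r => (normal_pdf 0 s r)%:E).
    by apply/measurable_EFinP; exact: measurable_normal_pdf.
  rewrite (ge0_integralZ _ _ mp) => [||r].
  - by rewrite integral_normal_pdf ?lt0r_neq0// mule1 ltry.
  - by rewrite invr_ge0 ltW.
  - by rewrite lee_fin normal_pdf_ge0.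
move=> r _; rewrite normal_pdfE ?lt0r_neq0// -EFinM mulKf ?gt_eqF//.
rewrite /normal_fun subr0 s2; congr (expR _)%:E.
by rewrite mulNr; congr (- _); field; rewrite gt_eqF.
Qed.

Lemma integral_gau_lty (R : realType) n (a : R) : 0 < a ->
  (\int[lebesgue_rV R n]_y (gau a y)%:E < +oo)%E.
Proof.
move=> a0; elim: n => [|n IH].
  have mg0 : measurable_fun [set: 'rV[R]_0] (fun y => (gau a y)%:E).
    by apply/measurable_EFinP; exact: measurable_gau.
  by rewrite (ge0_integral_rV0 mg0) ?ltry// => x; rewrite lee_fin gau_ge0.
have mg1 : measurable_fun [set: 'rV[R]_n.+1] (fun y => (gau a y)%:E).
  by apply/measurable_EFinP; exact: measurable_gau.
have g0 k (y : 'rV[R]_k) : (0 <= (gau a y)%:E)%E by rewrite lee_fin gau_ge0.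
rewrite (ge0_integral_rVS mg1 (@g0 _)).
have mg : measurable_fun [set: 'rV[R]_n] (fun y => (gau a y)%:E).
  by apply/measurable_EFinP; exact: measurable_gau.
have Z0 : (0 <= \int[lebesgue_rV R n]_y (gau a y)%:E)%E.
  by apply: integral_ge0 => y _; rewrite lee_fin gau_ge0.
rewrite (eq_integral (fun r : measurableTypeR R => ((\int[lebesgue_rV R n]_y (gau a y)%:E) *
    (expR (- (a * r ^+ 2)))%:E)%E)).
  have me : measurable_fun [set: measurableTypeR R] (fun r => (expR (- (a * r ^+ 2)))%:E).
    apply/measurable_EFinP; apply: measurableT_comp => //; apply: measurable_funN.
    by apply: measurable_funM => //; exact: measurable_funX.
  have ZE : (\int[lebesgue_rV R n]_y (gau a y)%:E)%E =
      (fine (\int[lebesgue_rV R n]_y (gau a y)%:E))%:E.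
    by rewrite fineK// ge0_fin_numE.
  rewrite ZE (ge0_integralZ _ _ me) => [||r]; last by rewrite lee_fin expR_ge0.
    by apply: lte_mul_pinfty => //; [rewrite -ZE|exact: integral_gau1_lty].
  by rewrite fine_ge0.
move=> r _; rewrite muleC.
rewrite -(ge0_integralZ _ (expR_ge0 _) mg (@g0 _)).
by apply: eq_integral => y _; rewrite gauS EFinM.
Qed.

Section gaussian_probability.
Context {R : realType} {n : nat}.
Local Notation rV := 'rV[R]_n.
Local Notation mu := (lebesgue_rV R n).
Implicit Types (x y b c : rV) (a s : R).

Lemma measurable_EFin_gau a : measurable_fun [set: rV] (fun y => (gau a y)%:E).
Proof. by apply/measurable_EFinP; exact: measurable_gau. Qed.

(** Restriction to the cube of half-side r. The normalising constant [gauZ] is not computed; this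
    lower bound is what later controls it for small times. *)
Lemma gau_box a (r : R) : 0 < a -> 0 < r ->
  ((expR (- (a * (n%:R * r ^+ 2))) * (2 * r) ^+ n)%:E <=
   \int[mu]_y (gau a y)%:E)%E.
Proof.
move=> a0 r0; pose B := [set x : rV | forall i, `[- r, r]%classic (x ord0 i)].
have mB : measurable B.
  by apply: (@measurable_box R n (fun=> `[- r, r]%classic)) => i; exact: measurable_itv.
have muB : mu B = ((2 * r) ^+ n)%:E.
  rewrite (@lebesgue_rV_box R n (fun=> `[- r, r]%classic)); last first.
    by move=> i; exact: measurable_itv.
  rewrite (eq_bigr (fun=> (2 * r)%:E)) => [|i _].
    by rewrite prodEFin prodr_const card_ord.
  rewrite lebesgue_measure_itv/= lte_fin gtrN// -EFinB; congr EFin; ring.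
rewrite EFinM -muB -[mu B]mul1e -[B]setIT -integral_indic//.
have mi : measurable_fun [set: rV] (fun x => (\1_B x : R)%:E) by exact/measurable_EFinP.
have i0 x : (0 <= (\1_B x : R)%:E)%E by rewrite lee_fin.
rewrite mul1e -(ge0_integralZ _ (expR_ge0 _) mi i0).
apply: le_integral_nn => x _; first by rewrite -EFinM lee_fin mulr_ge0// expR_ge0.
rewrite -EFinM lee_fin indicE; case: (boolP (x \in B)) => [|_]; last first.
  by rewrite mulr0 gau_ge0.
rewrite inE mulr1 => Bx; rewrite ler_expR lerN2 ler_pM2l//.
rewrite [leRHS]mulr_natl -[X in _ *+ X]card_ord -sumr_const.
apply: ler_sum => i _; have := Bx i; rewrite /= in_itv/= => /andP[b1 b2].
have : 0 <= (r - x ord0 i) * (x ord0 i + r) by rewrite mulr_ge0; lra.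
nra.
Qed.

Definition gauZ a : R := fine (\int[mu]_y (gau a y)%:E).

Lemma gauZE a : 0 < a -> (\int[mu]_y (gau a y)%:E)%E = (gauZ a)%:E.
Proof.
move=> a0; rewrite /gauZ fineK// ge0_fin_numE ?integral_gau_lty//.
by apply: integral_ge0 => y _; rewrite lee_fin gau_ge0.
Qed.

Lemma gauZ_ge a (r : R) : 0 < a -> 0 < r ->
  expR (- (a * (n%:R * r ^+ 2))) * (2 * r) ^+ n <= gauZ a.
Proof. by move=> a0 r0; rewrite -lee_fin -gauZE// gau_box. Qed.

Lemma gauZ_gt0 a : 0 < a -> 0 < gauZ a.
Proof.
move=> a0; apply: lt_le_trans (gauZ_ge a0 (@ltr01 R)).
by rewrite mulr_gt0 ?expR_gt0// exprn_gt0// mulr_gt0.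
Qed.

(* The fundamental solution exp(- |y|^2 / 4t) / Z of the heat equation. *)
Definition heat (t : R) y : R := gau (4 * t)^-1 y / gauZ (4 * t)^-1.

Lemma heat_ge0 t y : 0 < t -> 0 <= heat t y.
Proof.
move=> t0; rewrite divr_ge0 ?gau_ge0// ltW// gauZ_gt0// invr_gt0.
by rewrite mulr_gt0.
Qed.

Lemma heatN t y : heat t (- y) = heat t y.
Proof. by rewrite /heat gauN. Qed.

Lemma measurable_heat t : measurable_fun [set: rV] (heat t).
Proof. by apply: measurable_funM => //; exact: measurable_gau. Qed.

(** Completing the square turns the exponential factor into the translation by 2 t b and the
    constant exp(t |b|^2). *)
Lemma integral_expdot_heat t b : 0 < t ->
  (\int[mu]_y (heat t y * expR (dotv b y))%:E = (expR (t * nsq b))%:E)%E.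
Proof.
move=> t0; set a := (4 * t)^-1.
have a0 : 0 < a by rewrite invr_gt0 mulr_gt0.
pose c := (2 * t) *: b.
have E y : heat t y * expR (dotv b y) =
    (expR (t * nsq b) / gauZ a) * gau a (y + - c).
  rewrite /heat -/a mulrAC [RHS]mulrAC; congr (_ / _).
  rewrite /gau -!expRD; congr expR.
  rewrite nsqD nsqN dotvNr /c nsqZ dotvZr (dotvC y b) /a.
  by field; rewrite gt_eqF.
have Z0 := gauZ_gt0 a0.
transitivity (\int[mu]_y ((expR (t * nsq b) / gauZ a)%:E * (gau a (y + - c))%:E))%E.
  by apply: eq_integral => y _; rewrite E EFinM.
have mg := measurable_EFin_gau a.
have ms : measurable_fun [set: rV] (fun y => (gau a (y + - c))%:E).
  apply: (measurableT_comp mg).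
  by apply: measurable_rVD; [exact: measurable_id|exact: measurable_cst].
rewrite (ge0_integralZ _ _ ms) => [||y]; last by rewrite lee_fin gau_ge0.
2: by rewrite divr_ge0 ?expR_ge0// ltW.
rewrite (ge0_integral_shift (- c) mg) => [|x]; last by rewrite lee_fin gau_ge0.
by rewrite gauZE// -EFinM divfK// gt_eqF.
Qed.

Lemma integral_heat t : 0 < t -> (\int[mu]_y (heat t y)%:E = 1)%E.
Proof.
move=> t0; have := integral_expdot_heat 0 t0.
rewrite /nsq !/dotv big1 => [|i _]; last by rewrite mxE mul0r.
rewrite mulr0 expR0 => <-; apply: eq_integral => y _.
by rewrite big1 ?expR0 ?mulr1// => i _; rewrite mxE mul0r.
Qed.

End gaussian_probability.

Lemma ip2_CS d (T : measurableType d) (R : realType)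
    (mu : {measure set T -> \bar R}) (f g : T -> R) :
  sq_int mu f -> sq_int mu g ->
  `|ip2 mu f g| <= Num.sqrt (ip2 mu f f) * Num.sqrt (ip2 mu g g).
Proof.
move=> sf sg; have sh := L2pair_semi_hilbert mu.
have Lf : L2pair mu (f, fun=> 0) by split => //; exact: sq_int0.
have Lg : L2pair mu (g, fun=> 0) by split => //; exact: sq_int0.
have := sh_cauchy_schwarz sh Lf Lg; rewrite /hnorm /ippair /=.
have z (h : T -> R) : ip2 mu (fun=> 0) h = 0.
  by rewrite /ip2 /Rintegral; under eq_integral do rewrite mul0r; rewrite integral0.
by rewrite !z !addr0.
Qed.

Section signed_shift.
Context {R : realType} {n : nat}.
Local Notation rV := 'rV[R]_n.
Local Notation mu := (lebesgue_rV R n).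

Lemma integral_shift (c : rV) (f : rV -> \bar R) : measurable_fun [set: rV] f ->
  (\int[mu]_x f (x + c)%R = \int[mu]_x f x)%E.
Proof.
move=> mf; rewrite integralE [RHS]integralE; congr (_ - _)%E.
  rewrite -[RHS](ge0_integral_shift c (measurable_funepos mf)) => [|x].
    by apply: eq_integral => x _; rewrite !funeposE.
  exact: funepos_ge0.
rewrite -[RHS](ge0_integral_shift c (measurable_funeneg mf)) => [|x].
    by apply: eq_integral => x _; rewrite !funenegE.
exact: funeneg_ge0.
Qed.

Lemma integral_flip (f : rV -> \bar R) : measurable_fun [set: rV] f ->
  (\int[mu]_x f (- x)%R = \int[mu]_x f x)%E.
Proof.
move=> mf; rewrite integralE [RHS]integralE; congr (_ - _)%E.
  rewrite -[RHS](ge0_integral_opp (measurable_funepos mf)) => [|x].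
    by apply: eq_integral => x _; rewrite !funeposE.
  exact: funepos_ge0.
rewrite -[RHS](ge0_integral_opp (measurable_funeneg mf)) => [|x].
    by apply: eq_integral => x _; rewrite !funenegE.
exact: funeneg_ge0.
Qed.

Lemma measurable_shift d (T : measurableType d) (f : rV -> T) (c : rV) :
  measurable_fun [set: rV] f -> measurable_fun [set: rV] (fun x => f (x + c)).
Proof.
move=> mf; apply: (measurableT_comp mf).
by apply: measurable_rVD; [exact: measurable_id|exact: measurable_cst].
Qed.

Lemma measurable_shiftr d (T : measurableType d) (f : rV -> T) (c : rV) :
  measurable_fun [set: rV] f -> measurable_fun [set: rV] (fun x => f (c + x)).
Proof.
by move=> /(measurable_shift c); under eq_fun do rewrite addrC.
Qed.

Lemma sqnorm_shift (f : rV -> R) (c : rV) : measurable_fun [set: rV] f ->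
  sqnorm mu (fun x => f (x + c)) = sqnorm mu f.
Proof.
move=> mf; rewrite /sqnorm (integral_shift c (f := fun x => (f x ^+ 2)%:E))//.
exact: measurable_sqr.
Qed.

Lemma sq_int_shift (f : rV -> R) (c : rV) : sq_int mu f ->
  sq_int mu (fun x => f (x + c)).
Proof.
by move=> [mf f2]; split; [exact: measurable_shift|rewrite sqnorm_shift].
Qed.

Lemma measurable_fun_addrV d (T : measurableType d) (f : rV -> T) :
  measurable_fun [set: rV] f ->
  measurable_fun setT (fun z : rV * rV => f (z.1 + z.2)).
Proof.
move=> mf; apply: (measurableT_comp mf).
by apply: measurable_rVD; [exact: measurable_fst|exact: measurable_snd].
Qed.

End signed_shift.

Section heat_operator.
Context {R : realType} {n : nat}.
Local Notation rV := 'rV[R]_n.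
Local Notation mu := (lebesgue_rV R n).
Implicit Types (x y : rV) (f g : rV -> R).

Lemma measurable_EFin_heat t : measurable_fun [set: rV] (fun y => (heat t y)%:E).
Proof. by apply/measurable_EFinP; exact: measurable_heat. Qed.

(** Completing the square in y shows that the convolution is a multiple k of a Gaussian of time t +
    s. *)
Lemma heat_conv (t s : R) x : 0 < t -> 0 < s ->
  (\int[mu]_y (heat t y * heat s (x - y))%:E = (heat (t + s) x)%:E)%E.
Proof.
move=> t0 s0; have ts0 : 0 < t + s by rewrite addr_gt0.
pose b := (t + s) / (4 * t * s).
have b0 : 0 < b by rewrite divr_gt0// !mulr_gt0.
have a0 r : 0 < r -> 0 < (4 * r)^-1 :> R by move=> r0; rewrite invr_gt0 mulr_gt0.
pose Z r := @gauZ R n (4 * r)^-1.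
have Z0 r : 0 < r -> 0 < Z r by move=> r0; rewrite gauZ_gt0// a0.
pose k := gauZ (n := n) b / (Z t * Z s).
have Zb := gauZ_gt0 (n := n) b0.
have kk : 0 <= (Z t * Z s)^-1 by rewrite invr_ge0; apply: mulr_ge0; apply/ltW/Z0.
have E z : (\int[mu]_y (heat t y * heat s (z - y))%:E = (k * gau (4 * (t + s))^-1 z)%:E)%E.
  pose c := (t / (t + s)) *: z.
  have Ey y : heat t y * heat s (z - y) =
      ((Z t * Z s)^-1 * gau (4 * (t + s))^-1 z) * gau b (y + - c).
    rewrite /heat -/(Z t) -/(Z s) mulrACA -invfM mulrC -mulrA; congr (_ * _).
    rewrite /gau -!expRD; congr expR.
    rewrite !nsqD !nsqN !dotvNr /c nsqZ dotvZr (dotvC z y) /b.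
    by field; rewrite !gt_eqF.
  have mg := measurable_EFin_gau (n := n) b.
  have ms := measurable_shift (- c) mg.
  rewrite (eq_integral (fun y => (((Z t * Z s)^-1 * gau (4 * (t + s))^-1 z)%:E *
     (gau b (y + - c))%:E)%E)) => [|y _]; last by rewrite Ey EFinM.
  rewrite (ge0_integralZ _ _ ms) => [||y]; last by rewrite lee_fin gau_ge0.
    rewrite (integral_shift (- c) mg) gauZE// -EFinM /k; congr EFin.
    by rewrite mulrAC [_ * gauZ b]mulrC.
  by rewrite mulr_ge0 ?gau_ge0.
have k0 : 0 <= k by rewrite divr_ge0 ?(ltW Zb)//; apply: mulr_ge0; apply/ltW/Z0.
(* The constant k is found by integrating both sides in x: every heat kernel has mass one. *)
suff kE : k * Z (t + s) = 1.
  rewrite E /heat -/(Z (t + s)) -[k]mulr1 -{1}(divff (lt0r_neq0 (Z0 _ ts0))).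
  by rewrite mulrA kE mul1r mulrC.
have e1 : (\int[mu]_z \int[mu]_y (heat t y * heat s (z - y))%:E = (k * Z (t + s))%:E)%E.
  rewrite (eq_integral (fun z => (k%:E * (gau (4 * (t + s))^-1 z)%:E)%E)) => [|z _]; last first.
    by rewrite E EFinM.
  rewrite (ge0_integralZ _ k0 (measurable_EFin_gau _)) => [|z]; last by rewrite lee_fin gau_ge0.
  by rewrite gauZE ?a0// EFinM.
pose F (p : rV * rV) : \bar R := (heat t p.2 * heat s (p.1 - p.2))%:E.
have mF : measurable_fun setT F.
  apply/measurable_EFinP; apply: measurable_funM.
    by apply: (measurableT_comp (measurable_heat t)); exact: measurable_snd.
  apply: (measurableT_comp (measurable_heat s)).
  by apply: measurable_rVB; [exact: measurable_fst|exact: measurable_snd].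
have F0 p : (0 <= F p)%E by rewrite lee_fin mulr_ge0// heat_ge0.
have := @fubini_tonelli _ _ rV rV R mu mu F mF F0.
move=> h; apply/EFin_inj; rewrite -e1; apply: (etrans h).
rewrite -(integral_heat (n := n) t0); apply: eq_integral => y _.
rewrite (eq_integral (fun z : rV => ((heat t y)%:E * (heat s (z + - y))%:E)%E)) => [|z _]; last first.
  by rewrite /F/= EFinM.
rewrite (ge0_integralZ _ (heat_ge0 _ t0) (measurable_shift _ (measurable_EFin_heat s))).
  have e2 : (\int[mu]_z (heat s (z - y))%:E = 1)%E.
    exact: etrans (integral_shift (- y) (measurable_EFin_heat s)) (integral_heat s0).
  by rewrite e2 mule1.
by move=> z; rewrite lee_fin heat_ge0.
Qed.

Lemma heat_le (t : R) y : 0 < t -> heat t y <= (gauZ (n := n) (4 * t)^-1)^-1.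
Proof.
move=> t0; have a0 : 0 < (4 * t)^-1 by rewrite invr_gt0 mulr_gt0.
rewrite /heat; apply: ler_piMl; first by rewrite invr_ge0 ltW// gauZ_gt0.
rewrite /gau -[leRHS]expR0 ler_expR oppr_le0.
by rewrite mulr_ge0 ?nsq_ge0// ltW.
Qed.

Lemma sq_int_heat (t : R) : 0 < t -> sq_int mu (heat t).
Proof.
move=> t0; split; first exact: measurable_heat.
have a0 : 0 < (4 * t)^-1 by rewrite invr_gt0 mulr_gt0.
have Z0 := gauZ_gt0 (n := n) a0.
apply: (@le_lt_trans _ _ (\int[mu]_y (((gauZ (n := n) (4 * t)^-1)^-1)%:E * (heat t y)%:E))%E).
  apply: le_integral_nn => y _; first by rewrite lee_fin sqr_ge0.
  by rewrite -EFinM lee_fin expr2 ler_wpM2r ?heat_ge0// heat_le.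
rewrite (ge0_integralZ _ _ (measurable_EFin_heat t)) => [||y].
- by rewrite integral_heat// mule1 ltry.
- by rewrite invr_ge0 ltW.
- by rewrite lee_fin heat_ge0.
Qed.

Definition heat_op (t : R) f x : R := \int[mu]_y (heat t y * f (x + y)).

Lemma heat_integrable (t : R) f x : 0 < t -> sq_int mu f ->
  mu.-integrable [set: rV] (fun y => (heat t y * f (x + y))%:E).
Proof.
move=> t0 sf; apply: sq_int_mul; first exact: sq_int_heat.
by have := sq_int_shift x sf; under eq_fun do rewrite addrC.
Qed.

Lemma heat_opE (t : R) f x : 0 < t -> sq_int mu f ->
  (heat_op t f x)%:E = (\int[mu]_y (heat t y * f (x + y))%:E)%E.
Proof.
move=> t0 sf; rewrite /heat_op /Rintegral fineK//.
by apply: integrable_fin_num => //; exact: heat_integrable.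
Qed.

Lemma measurable_heat_op (t : R) f : measurable_fun [set: rV] f ->
  measurable_fun [set: rV] (heat_op t f).
Proof.
move=> mf; pose F (p : rV * rV) : \bar R := (heat t p.2 * f (p.1 + p.2))%:E.
have mF : measurable_fun setT F.
  apply/measurable_EFinP; apply: measurable_funM; last exact: measurable_fun_addrV.
  by apply: (measurableT_comp (measurable_heat t)); exact: measurable_snd.
apply: measurableT_comp => //.
rewrite (_ : (fun x => _) = fun x => (\int[mu]_y F^\+ (x, y) - \int[mu]_y F^\- (x, y))%E).
  apply: emeasurable_funB.
    exact: (@measurable_fun_fubini_tonelli_F _ _ rV rV R mu (F^\+)%E (measurable_funepos mF) (@funepos_ge0 _ _ F)).
  exact: (@measurable_fun_fubini_tonelli_F _ _ rV rV R mu (F^\-)%E (measurable_funeneg mF) (@funeneg_ge0 _ _ F)).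
apply/funext => x; rewrite integralE; congr (_ - _)%E; apply: eq_integral => y _.
  by rewrite !funeposE.
by rewrite !funenegE.
Qed.

Lemma heat_op_lin (t a : R) f g x : 0 < t -> sq_int mu f -> sq_int mu g ->
  heat_op t (fun y => a * f y + g y) x = a * heat_op t f x + heat_op t g x.
Proof.
move=> t0 sf sg; have hf := heat_integrable x t0 sf; have hg := heat_integrable x t0 sg.
rewrite /heat_op -RintegralZl// -RintegralD//.
  by apply: eq_Rintegral => y _; rewrite mulrDr mulrCA.
have := integrableZl measurableT a hf.
by apply: eq_integrable => // y _ /=; rewrite EFinM.
Qed.

(** Jensen's inequality for the heat measure, as Cauchy-Schwarz applied to the square root of the
    kernel and its product with f. *)
Lemma heat_op_sqr (t : R) f x : 0 < t -> sq_int mu f ->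
  ((heat_op t f x ^+ 2)%:E <= \int[mu]_y (heat t y * f (x + y) ^+ 2)%:E)%E.
Proof.
move=> t0 sf; have h0 y := heat_ge0 y t0.
pose u y := Num.sqrt (heat t y); pose v y := u y * f (x + y).
have u2 y : u y ^+ 2 = heat t y by rewrite sqr_sqrtr.
have mu_ : measurable_fun [set: rV] u.
  apply: (measurableT_comp _ (measurable_heat t)).
  by apply: continuous_measurable_fun; exact: sqrt_continuous.
have nu : sqnorm mu u = 1%E.
  by rewrite -(integral_heat (n := n) t0); apply: eq_integral => y _; rewrite u2.
have [mf f2] := sf.
have mv : measurable_fun [set: rV] v by apply: measurable_funM => //; exact: measurable_shiftr.
have nv : sqnorm mu v = (\int[mu]_y (heat t y * f (x + y) ^+ 2)%:E)%E.
  by apply: eq_integral => y _; rewrite exprMn u2.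
rewrite -nv; have [sv|] := ltP (sqnorm mu v) +oo%E; last first.
  by rewrite leye_eq => /eqP ->; rewrite leey.
have su : sq_int mu u by split => //; rewrite nu ltry.
have s_v : sq_int mu v by [].
have := ip2_CS su s_v.
have -> : ip2 mu u u = 1 by rewrite ip2_sqr nu.
rewrite sqrtr1 mul1r -sq_int_fineK// lee_fin.
have -> : ip2 mu u v = heat_op t f x.
  by apply: eq_Rintegral => y _; rewrite /v mulrA -expr2 u2.
move=> h; rewrite -[leRHS]sqr_sqrtr ?ip2_ge0// -[leLHS]ger0_norm ?sqr_ge0//.
by rewrite normrX ler_pXn2r ?nnegrE ?sqrtr_ge0.
Qed.

Lemma heat_op_contr (t : R) f : 0 < t -> sq_int mu f ->
  (sqnorm mu (heat_op t f) <= sqnorm mu f)%E.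
Proof.
move=> t0 sf; have [mf f2] := sf.
pose F (p : rV * rV) : \bar R := (heat t p.2 * f (p.1 + p.2) ^+ 2)%:E.
have mF : measurable_fun setT F.
  apply/measurable_EFinP; apply: measurable_funM.
    by apply: (measurableT_comp (measurable_heat t)); exact: measurable_snd.
  by apply: measurable_funX; exact: measurable_fun_addrV.
have F0 p : (0 <= F p)%E by rewrite lee_fin mulr_ge0 ?heat_ge0// sqr_ge0.
apply: (@le_trans _ _ (\int[mu]_x \int[mu]_y F (x, y))%E).
  by apply: le_integral_nn => x _; [rewrite lee_fin sqr_ge0|exact: heat_op_sqr].
rewrite (@fubini_tonelli _ _ rV rV R mu mu F mF F0).
have m2 := measurable_sqr mf.
rewrite (eq_integral (fun y => (sqnorm mu f * (heat t y)%:E)%E)) => [|y _].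
  have sfE := sq_int_fineK sf; rewrite -sfE (ge0_integralZ _ _ (measurable_EFin_heat t)).
  - by rewrite integral_heat// mule1.
  - exact: ip2_ge0.
  - by move=> y; rewrite lee_fin heat_ge0.
rewrite muleC (_ : sqnorm mu f = (\int[mu]_x (f (x + y) ^+ 2)%:E)%E); last first.
  exact/esym/(integral_shift y m2).
rewrite -(ge0_integralZ _ (heat_ge0 y t0) (measurable_shift _ m2)) => [|x]; last first.
  by rewrite lee_fin sqr_ge0.
by apply: eq_integral => x _; rewrite EFinM.
Qed.

Lemma sq_int_heat_op (t : R) f : 0 < t -> sq_int mu f -> sq_int mu (heat_op t f).
Proof.
move=> t0 sf; have [mf f2] := sf; split; first exact: measurable_heat_op.
by apply: le_lt_trans f2; exact: heat_op_contr.
Qed.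

End heat_operator.

(** * Symmetry of the heat operator and the symmetric splitting *)

Section heat_symmetry.
Context {R : realType} {n : nat}.
Local Notation rV := 'rV[R]_n.
Local Notation mu := (lebesgue_rV R n).
Implicit Types (x y : rV) (f g : rV -> R).

(** From |f g| <= f^2 + g^2, translation invariance and the unit mass of the kernel. Fubini's
    theorem is applied with h the identity and with h the reflection y -> - y. *)
Lemma heat_pair_integrable (t : R) f g (h : rV -> rV) : 0 < t ->
  measurable_fun [set: rV] h -> sq_int mu f -> sq_int mu g ->
  (mu \x mu)%E.-integrable setT
    (fun p : rV * rV => (heat t p.2 * (f (p.1 + h p.2) * g p.1))%:E).
Proof.
move=> t0 mh sf sg; have [mf f2] := sf; have [mg g2] := sg.
have mf' : measurable_fun setT (fun p : rV * rV => f (p.1 + h p.2)).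
  apply: (measurableT_comp mf); apply: measurable_rVD; first exact: measurable_fst.
  by apply: (measurableT_comp mh); exact: measurable_snd.
have mg' : measurable_fun setT (fun p : rV * rV => g p.1).
  by apply: (measurableT_comp mg); exact: measurable_fst.
have mh' : measurable_fun setT (fun p : rV * rV => heat t p.2).
  by apply: (measurableT_comp (measurable_heat t)); exact: measurable_snd.
pose G (p : rV * rV) : \bar R := (heat t p.2 * (f (p.1 + h p.2) ^+ 2 + g p.1 ^+ 2))%:E.
have mG : measurable_fun setT G.
  apply/measurable_EFinP; apply: measurable_funM => //.
  by apply: measurable_funD; exact: measurable_funX.
have h0 y := heat_ge0 (n := n) y t0.
have G0 p : (0 <= G p)%E by rewrite lee_fin mulr_ge0// addr_ge0// sqr_ge0.
apply/(@integrable12ltyP _ _ rV rV R mu mu).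
  apply/measurable_EFinP; apply: measurable_funM => //; exact: measurable_funM.
apply: (@le_lt_trans _ _ (\int[mu]_x \int[mu]_y G (x, y))%E).
  apply: le_integral_nn => x _; first by apply: integral_ge0.
  apply: le_integral_nn => y _; first exact: abse_ge0.
  rewrite abse_EFin lee_fin /= normrM ger0_norm// ler_wpM2l// normrM.
  set a := f _; set b := g _; have := sqr_ge0 (`|a| - `|b|).
  have := sqr_ge0 a; have := sqr_ge0 b.
  rewrite -(real_normK (num_real a)) -(real_normK (num_real b)).
  by move: `|a| `|b| => p q; lra.
rewrite (@fubini_tonelli _ _ rV rV R mu mu G mG G0).
rewrite (eq_integral (fun y => ((ip2 mu f f + ip2 mu g g)%:E * (heat t y)%:E)%E)) => [|y _].
  rewrite (ge0_integralZ _ _ (measurable_EFin_heat t)) => [||y].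
  - by rewrite integral_heat// mule1 ltry.
  - by rewrite addr_ge0// ip2_ge0.
  - by rewrite lee_fin.
rewrite EFinD !sq_int_fineK//.
have m2 := measurable_sqr mf; have mg2 := measurable_sqr mg.
rewrite (_ : sqnorm mu f = (\int[mu]_x (f (x + h y) ^+ 2)%:E)%E); last first.
  exact/esym/(integral_shift (h y) m2).
rewrite -ge0_integralD//; first last.
- by move=> x _; rewrite lee_fin sqr_ge0.
- exact: (measurable_shift _ m2).
- by move=> x _; rewrite lee_fin sqr_ge0.
rewrite muleC -(ge0_integralZ _ (h0 y)).
- by apply: eq_integral => x _; rewrite /G /= EFinM EFinD.
- by apply: emeasurable_funD => //; exact: (measurable_shift _ m2).
- by move=> x; rewrite adde_ge0// lee_fin sqr_ge0.
Qed.

Lemma ip2_EFin f g : sq_int mu f -> sq_int mu g ->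
  (ip2 mu f g)%:E = (\int[mu]_x (f x * g x)%:E)%E.
Proof.
move=> sf sg; rewrite /ip2 /Rintegral fineK//.
by apply: integrable_fin_num => //; exact: sq_int_mul.
Qed.

Lemma heat_op_ip2 (t : R) f g : 0 < t -> sq_int mu f -> sq_int mu g ->
  (ip2 mu (heat_op t f) g)%:E =
  (\int[mu]_x \int[mu]_y (heat t y * (f (x + y) * g x))%:E)%E.
Proof.
move=> t0 sf sg; rewrite ip2_EFin//; last exact: sq_int_heat_op.
apply: eq_integral => x _; have hf := heat_integrable x t0 sf.
rewrite EFinM heat_opE// -integralZr//.
by apply: eq_integral => y _; rewrite -EFinM mulrA.
Qed.

Lemma heat_op_sym (t : R) f g : 0 < t -> sq_int mu f -> sq_int mu g ->
  ip2 mu (heat_op t f) g = ip2 mu f (heat_op t g).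
Proof.
move=> t0 sf sg; apply: EFin_inj; rewrite [in RHS]ip2C (heat_op_ip2 t0 sf sg) (heat_op_ip2 t0 sg sf).
have mopp : measurable_fun [set: rV] (fun y : rV => - y).
  by apply: measurable_rVN; exact: measurable_id.
have I1 := heat_pair_integrable t0 mopp sf sg.
have I2 := heat_pair_integrable t0 (@measurable_id _ rV setT) sg sf.
have [mf _] := sf; have [mg _] := sg.
transitivity (\int[mu]_x \int[mu]_y (heat t y * (f (x - y) * g x))%:E)%E.
  apply: eq_integral => x _; pose F y := (heat t y * (f (x + y) * g x))%:E.
  have mF : measurable_fun [set: rV] F.
    apply/measurable_EFinP; apply: measurable_funM; first exact: measurable_heat.
    by apply: measurable_funM => //; exact: measurable_shiftr.
  rewrite -[LHS](integral_flip mF); apply: eq_integral => y _.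
  by rewrite /F heatN.
rewrite (Fubini I1) (Fubini I2); apply: eq_integral => y _ /=.
pose F x := (heat t y * (g (x + y) * f x))%:E.
have mF : measurable_fun [set: rV] F.
  apply/measurable_EFinP; apply: measurable_funM; first exact: measurable_cst.
  by apply: measurable_funM => //; exact: measurable_shift.
rewrite -[RHS](integral_shift (- y) mF); apply: eq_integral => x _.
by rewrite /F subrK [g x * _]mulrC.
Qed.

Definition pot (m : nat) x : R := nsq x ^+ m.

Lemma pot_ge0 m x : 0 <= pot m x.
Proof. by rewrite exprn_ge0// nsq_ge0. Qed.

Lemma enorm_pot m x : enorm x ^+ (2 * m) = pot m x.
Proof. by rewrite exprM enorm_sqr. Qed.

Lemma measurable_pot m : measurable_fun [set: rV] (pot m).
Proof. by apply: measurable_funX; exact: measurable_nsq. Qed.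

Definition damp m (t : R) x : R := expR (- (t / 2 * pot m x)).

Lemma damp_gt0 m t x : 0 < damp m t x. Proof. exact: expR_gt0. Qed.

Lemma damp_le1 m t x : 0 <= t -> damp m t x <= 1.
Proof.
move=> t0; rewrite /damp -[leRHS]expR0 ler_expR oppr_le0.
by rewrite mulr_ge0 ?pot_ge0// divr_ge0.
Qed.

Lemma measurable_damp m t : measurable_fun [set: rV] (damp m t).
Proof.
apply: (measurableT_comp (@measurable_expR R)).
apply: measurableT_comp => //.
by apply: measurable_funM; [exact: measurable_cst|exact: measurable_pot].
Qed.

Lemma sqnorm_damp m t f : 0 <= t ->
  (sqnorm mu (fun x => (damp m t x * f x)%R) <= sqnorm mu f)%E.
Proof.
move=> t0; apply: le_sqnorm => x; rewrite exprMn ler_piMl ?sqr_ge0//.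
by rewrite expr_le1 ?damp_le1// ltW// damp_gt0.
Qed.

Lemma sq_int_damp m t f : 0 <= t -> sq_int mu f ->
  sq_int mu (fun x => damp m t x * f x).
Proof.
move=> t0 [mf f2]; split; last exact: le_lt_trans (sqnorm_damp _ _ t0) f2.
by apply: measurable_funM => //; exact: measurable_damp.
Qed.

(** Strang splitting e^{-tV/2} e^{t Delta} e^{-tV/2}, symmetric in L^2. Its iterates are discrete
    Feynman-Kac integrals. *)
Definition split_op m (t : R) f x : R :=
  damp m t x * heat_op t (fun y => damp m t y * f y) x.

Lemma sq_int_split_op m t f : 0 < t -> sq_int mu f -> sq_int mu (split_op m t f).
Proof.
move=> t0 sf; apply: sq_int_damp; first exact: ltW.
by apply: sq_int_heat_op => //; apply: sq_int_damp => //; exact: ltW.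
Qed.

Lemma split_op_le m t f : 0 < t -> sq_int mu f ->
  (sqnorm mu (split_op m t f) <= sqnorm mu (fun x => (damp m t x * f x)%R))%E.
Proof.
move=> t0 sf; apply: (le_trans (sqnorm_damp _ _ (ltW t0))).
by apply: heat_op_contr => //; apply: sq_int_damp => //; exact: ltW.
Qed.

Lemma split_op_contr m t f : 0 < t -> sq_int mu f ->
  (sqnorm mu (split_op m t f) <= sqnorm mu f)%E.
Proof.
by move=> t0 sf; apply: (le_trans (split_op_le _ t0 sf)); exact: sqnorm_damp (ltW t0).
Qed.

Lemma split_op_lin m (t a : R) f g : 0 < t -> sq_int mu f -> sq_int mu g ->
  split_op m t (fun y => a * f y + g y) =
  fun x => a * split_op m t f x + split_op m t g x.
Proof.
move=> t0 sf sg; apply/funext => x; rewrite /split_op.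
rewrite (_ : (fun y => _) = fun y => a * (damp m t y * f y) + damp m t y * g y).
  rewrite heat_op_lin//; [|exact: (sq_int_damp _ (ltW t0))..].
  by rewrite mulrDr mulrCA.
by apply/funext => y; ring.
Qed.

Lemma split_op_sym m (t : R) f g : 0 < t -> sq_int mu f -> sq_int mu g ->
  ip2 mu (split_op m t f) g = ip2 mu f (split_op m t g).
Proof.
move=> t0 sf sg; have sd h : sq_int mu h -> sq_int mu (fun x => damp m t x * h x).
  exact: (sq_int_damp _ (ltW t0)).
have E u v : ip2 mu (split_op m t u) v =
    ip2 mu (heat_op t (fun x => damp m t x * u x)) (fun x => damp m t x * v x).
  by apply: eq_Rintegral => x _; rewrite /split_op; ring.
rewrite E heat_op_sym//; [|exact: sd..].
by rewrite [RHS]ip2C E ip2C.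
Qed.

Local Notation W := ((rV -> R) * (rV -> R))%type.

Definition pair_op (A : (rV -> R) -> rV -> R) (v : W) : W := (A v.1, A v.2).

End heat_symmetry.

(** * Moments of the heat kernel *)

Section heat_moments.
Context {R : realType} {n : nat}.
Local Notation rV := 'rV[R]_n.
Local Notation mu := (lebesgue_rV R n).
Implicit Types (x y : rV) (t h u : R).

Lemma heat_integral_sum (t : R) (I : eqType) (r : seq I) (F : I -> rV -> R) : 0 < t ->
  (forall i, measurable_fun [set: rV] (F i)) -> (forall i y, 0 <= F i y) ->
  (\int[mu]_y (heat t y * \sum_(i <- r) F i y)%:E =
   \sum_(i <- r) \int[mu]_y (heat t y * F i y)%:E)%E.
Proof.
move=> t0 mF F0; rewrite -ge0_integral_sum//.
- by apply: eq_integral => y _; rewrite mulr_sumr sumEFin.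
- move=> i; apply/measurable_EFinP; apply: measurable_funM => //; exact: measurable_heat.
- by move=> i y _; rewrite lee_fin mulr_ge0// heat_ge0.
Qed.

Lemma dotv_delta (h : R) (i : 'I_n) y :
  dotv (h *: delta_mx ord0 i) y = h * y ord0 i.
Proof.
rewrite dotvZl; congr (_ * _); rewrite /dotv (bigD1 i)//= mxE !eqxx mul1r big1 ?addr0// => j ji.
by rewrite mxE eqxx (negbTE ji) mul0r.
Qed.

Lemma nsq_delta (h : R) (i : 'I_n) : nsq (h *: (delta_mx ord0 i : rV)) = h ^+ 2.
Proof. by rewrite /nsq dotv_delta !mxE !eqxx mulr1 expr2. Qed.

Lemma integral_expcoor_heat t h (i : 'I_n) : 0 < t ->
  (\int[mu]_y (heat t y * expR (h * y ord0 i))%:E = (expR (t * h ^+ 2))%:E)%E.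
Proof.
move=> t0; rewrite -(nsq_delta h i) -(integral_expdot_heat _ t0).
by apply: eq_integral => y _; rewrite dotv_delta.
Qed.

Lemma measurable_expcoor h (i : 'I_n) :
  measurable_fun [set: rV] (fun y => expR (h * y ord0 i)).
Proof.
apply: (measurableT_comp (@measurable_expR R)).
by apply: measurable_funM; [exact: measurable_cst|exact: measurable_coor].
Qed.

Lemma integral_coshcoor_heat t h (i : 'I_n) : 0 < t ->
  (\int[mu]_y (heat t y * (expR (h * y ord0 i) + expR (- (h * y ord0 i))))%:E =
   (2 * expR (t * h ^+ 2))%:E)%E.
Proof.
move=> t0; under eq_integral do rewrite mulrDr EFinD -mulNr.
have m k : measurable_fun [set: rV] (fun y => (heat t y * expR (k * y ord0 i))%:E).
  apply/measurable_EFinP; apply: measurable_funM; first exact: measurable_heat.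
  exact: measurable_expcoor.
rewrite ge0_integralD//; first last.
- by move=> y _; rewrite lee_fin mulr_ge0 ?expR_ge0 ?heat_ge0.
- by move=> y _; rewrite lee_fin mulr_ge0 ?expR_ge0 ?heat_ge0.
by rewrite !integral_expcoor_heat// sqrrN -EFinD -mulr2n mulr_natl.
Qed.

Lemma expR_abs_le u : expR `|u| <= expR u + expR (- u).
Proof.
have [u0|u0] := leP 0 u; first by rewrite ger0_norm// lerDl expR_ge0.
by rewrite ltr0_norm// lerDr expR_ge0.
Qed.

Lemma exprn_le_expR (k : nat) u : 0 <= u -> u ^+ k <= k`!%:R * expR u.
Proof.
move=> u0; rewrite -ler_pdivrMl ?ltr0n ?fact_gt0// mulrC.
case: k => [|k]; first by rewrite expr0 fact0 divr1 -[leLHS]expR0 ler_expR.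
by apply: le_trans (expR_ge1Dxn k u0); rewrite lerDr.
Qed.

Lemma rV_norm_arg (y : rV) : `|y| = 0 \/ exists i, `|y| = `|y ord0 i|.
Proof.
have [->|y0] := eqVneq `|y| 0; [by left|right].
have [[i j] /=] := mx_norm_neq0 y0.
by rewrite (ord1 i) => yj; exists j.
Qed.

(** At the scale sqrt t, a power of |y_i| is dominated by exp(y_i / sqrt t) + exp(- y_i / sqrt t),
    whose expectation 2 e does not depend on t. *)
Lemma heat_moment (k : nat) : exists2 C : R, 0 <= C & forall t, 0 < t ->
  (\int[mu]_y (heat t y * `|y| ^+ (2 * k))%:E <= (C * t ^+ k)%:E)%E.
Proof.
case: k => [|k].
  exists 1 => // t t0; rewrite muln0.
  by under eq_integral do rewrite expr0 mulr1; rewrite integral_heat// expr0 mulr1.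
exists (\sum_(i < n) ((2 * k.+1)`!%:R * (2 * expR 1))) => [|t t0].
  by rewrite sumr_ge0// => i _; rewrite !mulr_ge0// ?expR_ge0.
pose s := Num.sqrt t; have s0 : 0 < s by rewrite sqrtr_gt0.
have s2 : s ^+ 2 = t by rewrite sqr_sqrtr// ltW.
pose F (i : 'I_n) y := (2 * k.+1)`!%:R * t ^+ k.+1 *
  (expR (s^-1 * y ord0 i) + expR (- (s^-1 * y ord0 i))).
have mF i : measurable_fun [set: rV] (F i).
  apply: measurable_funM; first exact: measurable_cst.
  apply: measurable_funD; first exact: measurable_expcoor.
  by under eq_fun do rewrite -mulNr; exact: measurable_expcoor.
have F0 i y : 0 <= F i y.
  by rewrite !mulr_ge0// ?exprn_ge0 ?(ltW t0)// addr_ge0 ?expR_ge0.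
apply: (@le_trans _ _ (\int[mu]_y (heat t y * \sum_i F i y)%:E)%E).
  apply: le_integral_nn => y _; first by rewrite lee_fin mulr_ge0 ?heat_ge0// exprn_ge0.
  rewrite lee_fin ler_wpM2l ?heat_ge0//.
  have Fy i : `|y ord0 i| ^+ (2 * k.+1) <= F i y.
    have -> : `|y ord0 i| = s * `|s^-1 * y ord0 i|.
      by rewrite normrM gtr0_norm ?invr_gt0// mulrA divff ?mul1r// gt_eqF.
    rewrite exprMn exprM s2 /F [_%:R * _]mulrC -mulrA ler_wpM2l ?exprn_ge0 ?(ltW t0)//.
    apply: le_trans (exprn_le_expR _ (normr_ge0 _)) _.
    by rewrite ler_wpM2l// expR_abs_le.
  have S0 : 0 <= \sum_i F i y by rewrite sumr_ge0.
  have [->|[i ->]] := rV_norm_arg y; first by rewrite expr0n.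
  by apply: le_trans (Fy i) _; rewrite (bigD1 i)//= lerDl sumr_ge0.
rewrite heat_integral_sum// mulr_suml -sumEFin; apply: lee_sum => i _.
rewrite (eq_integral (fun y => (((2 * k.+1)`!%:R * t ^+ k.+1)%:E * (heat t y *
   (expR (s^-1 * y ord0 i) + expR (- (s^-1 * y ord0 i))))%:E)%E)) => [|y _]; last first.
  by rewrite -EFinM /F mulrCA mulrA.
have c0 : 0 <= (2 * k.+1)`!%:R * t ^+ k.+1 :> R by rewrite mulr_ge0// exprn_ge0// ltW.
rewrite (ge0_integralZ _ c0).
- rewrite integral_coshcoor_heat// exprVn s2 divff ?gt_eqF// -EFinM lee_fin.
  by rewrite [leLHS]mulrAC.
- apply/measurable_EFinP; apply: measurable_funM; first exact: measurable_heat.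
  apply: measurable_funD; first exact: measurable_expcoor.
  by under eq_fun do rewrite -mulNr; exact: measurable_expcoor.
- move=> y; rewrite lee_fin; apply: mulr_ge0; first exact: heat_ge0.
  by rewrite addr_ge0// expR_ge0.
Qed.

(** Halving: 2^k (e^{u/2^k} - e^{-u/2^k}) does not exceed e^u - e^{-u}. At u / 2^k a crude linear
    bound loses only the factor 1 + u / 2^k, which tends to 1. *)
Lemma sinh_ge u : 0 <= u -> 2 * u <= expR u - expR (- u).
Proof.
move=> u0; have base (v : R) : 0 <= v -> 2 * v <= (1 + v) * (expR v - expR (- v)).
  move=> v0; have h1 := expR_ge1Dx v; have e0 := expR_gt0 (- v).
  have : expR (- v) * expR v = 1 by rewrite -expRD addNr expR0.
  have : expR (- v) * (1 + v) <= expR (- v) * expR v by rewrite ler_wpM2l ?expR_ge0.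
  by move=> h2 h3; rewrite h3 in h2; nra.
have iter k : (2 ^+ k) * (expR (u / 2 ^+ k) - expR (- (u / 2 ^+ k))) <= expR u - expR (- u).
  elim: k => [|k IH]; first by rewrite expr0 mul1r divr1.
  apply: le_trans IH; rewrite exprSr -mulrA ler_wpM2l ?exprn_ge0// invfM mulrA.
  set w := u / 2 ^+ k; have w0 : 0 <= w / 2 by rewrite !divr_ge0// exprn_ge0.
  have -> : w = w / 2 + w / 2 by field.
  rewrite opprD !expRD; set a := expR (w / 2 + w / 2 - w / 2 - (w / 2 - w / 2)).
  have -> : (w / 2 + w / 2) / 2 = w / 2 by field.
  have ab : expR (w / 2) * expR (- (w / 2)) = 1 by rewrite -expRD subrr expR0.
  have le : expR (- (w / 2)) <= expR (w / 2) by rewrite ler_expR; lra.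
  have := expR_gt0 (w / 2); have := expR_gt0 (- (w / 2)).
  move: ab le; move: (expR (w / 2)) (expR (- (w / 2))) => p q ab le q0 p0.
  have : 2 <= p + q by have := sqr_ge0 (p - q); rewrite sqrrB; nra.
  by nra.
apply/ler_addgt0Pr => e e0.
have d0 : 0 <= expR u - expR (- u) by rewrite subr_ge0 ler_expR; lra.
set d := expR u - expR (- u) in d0 *.
have [k hk] : exists k, u * d <= e * 2 ^+ k.
  have := upper_nthrootP (leqnn (Num.bound (u * d / e))).
  by move=> hk; exists (Num.bound (u * d / e)); rewrite [e * _]mulrC -ler_pdivrMr// ltW.
have p0 : 0 < 2 ^+ k :> R by rewrite exprn_gt0.
have := base (u / 2 ^+ k) (divr_ge0 u0 (ltW p0)).
rewrite -(ler_pM2l p0) => h; have e1 : 2 ^+ k * (2 * (u / 2 ^+ k)) = 2 * u.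
  by field; rewrite gt_eqF.
rewrite e1 mulrCA in h; apply: (le_trans h).
apply: (@le_trans _ _ ((1 + u / 2 ^+ k) * d)).
  by rewrite ler_wpM2l ?iter// addr_ge0// divr_ge0// ltW.
rewrite mulrDl mul1r lerD2l mulrAC ler_pdivrMr//.
Qed.

(** The second moment is the coefficient of h^2 in the expectation 2 exp(t h^2) of e^{h y_i} + e^{-
    h y_i}. The integrand is bracketed between 2 + h^2 y_i^2 and the same plus a term of order
    h^3. *)
Lemma heat_moment2 t (i : 'I_n) : 0 < t ->
  (\int[mu]_y (heat t y * y ord0 i ^+ 2)%:E = (2 * t)%:E)%E.
Proof.
move=> t0; have h0 y := heat_ge0 (n := n) y t0.
pose c h y := expR (h * y ord0 i) + expR (- (h * y ord0 i)).
have cosh h y : c h y = (expR (h * y ord0 i / 2) - expR (- (h * y ord0 i / 2))) ^+ 2 + 2.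
  rewrite /c; have {1 2}-> : h * y ord0 i = h * y ord0 i / 2 + h * y ord0 i / 2 by field.
  rewrite opprD !expRD; set p := h * _ / 2.
  have : expR p * expR (- p) = 1 by rewrite -expRD subrr expR0.
  by rewrite sqrrB; move: (expR p) (expR (- p)) => a b ab; rewrite ab; ring.
have symm (u : R) : (expR u - expR (- u)) ^+ 2 = (expR `|u| - expR (- `|u|)) ^+ 2.
  have [u0|u0] := leP 0 u; first by rewrite ger0_norm.
  by rewrite ltr0_norm// opprK -sqrrN opprB.
have nhalf (v : R) : `|v / 2| = `|v| / 2 by rewrite normrM normfV normr_nat.
have lo h y : 0 < h -> h ^+ 2 * y ord0 i ^+ 2 + 2 <= c h y.
  move=> hp; rewrite cosh lerD2r symm -exprMn -(real_normK (num_real (h * y ord0 i))).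
  set u := h * y ord0 i; have -> : `|u| = 2 * `|u / 2| by rewrite nhalf; field.
  by rewrite ler_pXn2r ?nnegrE ?mulr_ge0 ?(le_trans _ (sinh_ge _))// ?sinh_ge// mulr_ge0.
have up h y : 0 < h -> h <= 1 ->
    c h y <= h ^+ 2 * y ord0 i ^+ 2 + 2 + h ^+ 3 * 6 * (c 2 y).
  move=> hp h1; rewrite cosh symm; set a := y ord0 i.
  set u := h * a; rewrite nhalf.
  have -> : h ^+ 2 * a ^+ 2 = `|u| ^+ 2 by rewrite -exprMn -normrX ger0_norm ?sqr_ge0.
  have u0 : 0 <= `|u| by [].
  have h2 : (expR (`|u| / 2) - expR (- (`|u| / 2))) ^+ 2 <= `|u| ^+ 2 * expR `|u|.
    have E : expR (`|u| / 2) ^+ 2 = expR `|u| by rewrite expr2 -expRD; congr expR; field.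
    rewrite -E -exprMn ler_pXn2r ?nnegrE ?subr_ge0 ?ler_expR ?mulr_ge0 ?expR_ge0//; last lra.
    have := expR_ge1Dx (- `|u|); have p0 := expR_gt0 (`|u| / 2).
    have -> : expR (- (`|u| / 2)) = expR (`|u| / 2) * expR (- `|u|).
      by rewrite -expRD; congr expR; field.
    by move: p0; move: (expR (`|u| / 2)) (expR (- `|u|)) => p q p0 hq; nra.
  rewrite addrAC lerD2r; apply: le_trans h2 _.
  have h3 : expR `|u| <= 1 + `|u| * expR `|u|.
    have := expR_ge1Dx (- `|u|); have : expR `|u| * expR (- `|u|) = 1 by rewrite -expRD subrr expR0.
    have := expR_gt0 `|u|; move: (expR `|u|) (expR (- `|u|)) => p q p0 pq hq; nra.
  apply: (le_trans (ler_wpM2l (sqr_ge0 _) h3)); rewrite mulrDr mulr1 lerD2l.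
  rewrite mulrA -exprSr normrM (gtr0_norm hp) exprMn.
  set E := expR _; rewrite -[h ^+ 3 * `|a| ^+ 3 * E]mulrA -[h ^+ 3 * 6 * _]mulrA.
  rewrite ler_wpM2l ?exprn_ge0 ?(ltW hp)// {}/E.
  apply: (@le_trans _ _ (6 * expR `|a| * expR `|a|)).
    apply: ler_pM; rewrite ?exprn_ge0 ?expR_ge0//; first exact: (exprn_le_expR 3).
    by rewrite ler_expR ler_piMl// ltW.
  rewrite -mulrA -expRD ler_wpM2l// /c -/a.
  apply: le_trans (expR_abs_le (2 * a)); rewrite ler_expR normrM normr_nat; lra.
have mc h : measurable_fun [set: rV] (c h).
  apply: measurable_funD; first exact: measurable_expcoor.
  by under eq_fun do rewrite -mulNr; exact: measurable_expcoor.
have c0 h y : 0 <= c h y by rewrite addr_ge0 ?expR_ge0.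
have mh := measurable_heat (n := n) t.
have m2 : measurable_fun [set: rV] (fun y : rV => y ord0 i ^+ 2).
  by apply: measurable_funX; exact: measurable_coor.
pose M := (\int[mu]_y (heat t y * y ord0 i ^+ 2)%:E)%E.
have mM : measurable_fun [set: rV] (fun y => (heat t y * y ord0 i ^+ 2)%:E).
  by apply/measurable_EFinP; exact: measurable_funM.
have mhc h : measurable_fun [set: rV] (fun y => (heat t y * c h y)%:E).
  by apply/measurable_EFinP; exact: measurable_funM.
have M0 y : (0 <= (heat t y * y ord0 i ^+ 2)%:E)%E by rewrite lee_fin mulr_ge0// sqr_ge0.
have H0 y : (0 <= (heat t y)%:E)%E by rewrite lee_fin.
have HC h y : (0 <= (heat t y * c h y)%:E)%E by rewrite lee_fin mulr_ge0.
have mH := measurable_EFin_heat (n := n) t.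
have Mlo h : 0 < h -> ((h ^+ 2)%:E * M + 2%:E <= (2 * expR (t * h ^+ 2))%:E)%E.
  move=> hp; rewrite -(integral_coshcoor_heat _ i t0) -/c.
  rewrite -(ge0_integralZ _ (sqr_ge0 h) mM M0).
  have -> : 2%:E = (\int[mu]_y (2%:E * (heat t y)%:E))%E :> \bar R.
    by rewrite (ge0_integralZ _ _ mH H0)// integral_heat// mule1.
  rewrite -ge0_integralD//; first last.
  - by apply: emeasurable_funM => //; exact: measurable_cst.
  - by move=> y _; rewrite mule_ge0// lee_fin.
  - by apply: emeasurable_funM => //; exact: measurable_cst.
  - by move=> y _; rewrite mule_ge0// lee_fin sqr_ge0.
  apply: le_integral_nn => y _; rewrite -!EFinM -EFinD lee_fin.
    exact: addr_ge0 (mulr_ge0 (sqr_ge0 h) (mulr_ge0 (h0 y) (sqr_ge0 _))) (mulr_ge0 (ler0n _ 2) (h0 y)).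
  by have := ler_wpM2l (h0 y) (lo h y hp); rewrite -/(c h y); nra.
have Mup h : 0 < h -> h <= 1 ->
    ((2 * expR (t * h ^+ 2))%:E <= (h ^+ 2)%:E * M + (2 + h ^+ 3 * 6 * (2 * expR (t * 2 ^+ 2)))%:E)%E.
  move=> hp h1; rewrite -(integral_coshcoor_heat _ i t0) -/c.
  have k0 : 0 <= h ^+ 3 * 6 by rewrite mulr_ge0// exprn_ge0// ltW.
  have -> : (2 + h ^+ 3 * 6 * (2 * expR (t * 2 ^+ 2)))%:E =
      (2%:E + (h ^+ 3 * 6)%:E * \int[mu]_y (heat t y * c 2 y)%:E)%E.
    by rewrite integral_coshcoor_heat// -EFinM -EFinD.
  rewrite addeA.
  rewrite -(ge0_integralZ _ (sqr_ge0 h) mM M0) -(ge0_integralZ _ k0 (mhc 2) (HC 2)).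
  have -> : 2%:E = (\int[mu]_y (2%:E * (heat t y)%:E))%E :> \bar R.
    by rewrite (ge0_integralZ _ _ mH H0)// integral_heat// mule1.
  have mZ k (g : rV -> \bar R) : measurable_fun [set: rV] g -> measurable_fun [set: rV] (fun y => (k%:E * g y)%E).
    by move=> mg; apply: emeasurable_funM => //; exact: measurable_cst.
  have pZ k (g : rV -> \bar R) y : (0 <= k)%R -> (forall y, 0 <= g y)%E -> (0 <= k%:E * g y)%E.
    by move=> kk g0; rewrite mule_ge0// lee_fin.
  rewrite -!ge0_integralD//.
  - apply: le_integral_nn => y _; first exact: HC.
    rewrite -!EFinM -!EFinD lee_fin.
    by have := ler_wpM2l (h0 y) (up h y hp h1); rewrite -/(c h y) -/(c 2 y); nra.
  - move=> y _; apply: adde_ge0; apply: mule_ge0; rewrite ?lee_fin ?sqr_ge0//.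
    exact: mulr_ge0 (h0 y) (sqr_ge0 _).
  - by apply: emeasurable_funD; exact: mZ.
  - by move=> y _; apply: mule_ge0; [rewrite lee_fin|exact: HC].
  - exact: mZ.
  - by move=> y _; apply: mule_ge0; [rewrite lee_fin sqr_ge0|exact: M0].
  - exact: mZ.
  - by move=> y _; apply: mule_ge0 => //; exact: H0.
  - exact: mZ.
have Mfin : M \is a fin_num.
  rewrite ge0_fin_numE; last by apply: integral_ge0.
  apply: le_lt_trans (ltry (2 * expR (t * 1 ^+ 2))).
  by apply: le_trans (Mlo 1 ltr01); rewrite expr1n mul1e leeDl// lee_fin.
rewrite -/M; move: Mlo Mup; rewrite -(fineK Mfin); move: (fine M) => r Mlo Mup.
have {}Mlo h : 0 < h -> h ^+ 2 * r + 2 <= 2 * expR (t * h ^+ 2).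
  by move=> /Mlo; rewrite -EFinM -EFinD lee_fin.
have {}Mup h : 0 < h -> h <= 1 -> 2 * expR (t * h ^+ 2) <= h ^+ 2 * r + (2 + h ^+ 3 * 6 * (2 * expR (t * 2 ^+ 2))).
  by move=> hp h1; have := Mup h hp h1; rewrite -EFinM -EFinD lee_fin.
(* Both inequalities come from dividing by h^2 with h small; h is chosen explicitly in terms of
   e. *)
congr EFin; apply/eqP; rewrite eq_le; apply/andP; split.
  apply/ler_addgt0Pr => e e0.
  pose K := 2 * t * (t * expR t).
  have K0 : 0 <= K by rewrite !mulr_ge0 ?expR_ge0// ltW.
  pose h := Num.min 1 (e / (K + 1)).
  have hp : 0 < h by rewrite lt_min ltr01 divr_gt0// ltr_wpDl.
  have h1 : h <= 1 by rewrite ge_min lexx.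
  have hK : h * K <= e.
    have : h <= e / (K + 1) by rewrite ge_min lexx orbT.
    rewrite ler_pdivlMr ?ltr_wpDl//; nra.
  have := Mlo h hp; set w := t * h ^+ 2.
  have w0 : 0 <= w by rewrite mulr_ge0 ?sqr_ge0// ltW.
  have ew : expR w <= 1 + w * expR w.
    have := expR_ge1Dx (- w); have : expR w * expR (- w) = 1 by rewrite -expRD subrr expR0.
    have := expR_gt0 w; move: (expR w) (expR (- w)) => p q p0 pq hq; nra.
  have wt : w <= t by rewrite ler_piMr ?(ltW t0)// exprn_ile1// ltW.
  have et : w * expR w <= w * expR t by rewrite ler_wpM2l// ler_expR.
  move=> hh; have : h ^+ 2 * r <= h ^+ 2 * (2 * t * expR w).
    have -> : h ^+ 2 * (2 * t * expR w) = 2 * (w * expR w) by rewrite /w; ring.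
    by clear -hh ew; lra.
  rewrite ler_pM2l ?exprn_gt0// => /le_trans; apply.
  have t2 : 0 <= 2 * t by rewrite mulr_ge0// ltW.
  apply: (@le_trans _ _ (2 * t * (1 + w * expR t))).
    by rewrite ler_wpM2l//; apply: (le_trans ew); rewrite lerD2l.
  rewrite mulrDr mulr1 lerD2l; apply: le_trans hK.
  have -> : 2 * t * (w * expR t) = h * (h * K) by rewrite /K /w; ring.
  by rewrite ler_piMl// mulr_ge0// ltW.
apply/ler_addgt0Pr => e e0.
pose K := 6 * (2 * expR (t * 2 ^+ 2)).
have K0 : 0 <= K by rewrite !mulr_ge0 ?expR_ge0.
pose h := Num.min 1 (e / (K + 1)).
have hp : 0 < h by rewrite lt_min ltr01 divr_gt0// ltr_wpDl.
have h1 : h <= 1 by rewrite ge_min lexx.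
have hK : h * K <= e.
  have : h <= e / (K + 1) by rewrite ge_min lexx orbT.
  rewrite ler_pdivlMr ?ltr_wpDl//; nra.
have := Mup h hp h1; have := expR_ge1Dx (t * h ^+ 2).
have -> : h ^+ 3 * 6 * (2 * expR (t * 2 ^+ 2)) = h ^+ 2 * (h * K) by rewrite /K; ring.
move: (expR _) => p hp1 hp2; have : h ^+ 2 * (2 * t) <= h ^+ 2 * (r + h * K) by nra.
by rewrite ler_pM2l ?exprn_gt0//; lra.
Qed.

End heat_moments.

Section kernel_bound.
Context {R : realType} {n : nat}.
Local Notation rV := 'rV[R]_n.
Local Notation mu := (lebesgue_rV R n).
Implicit Types (x y : rV) (t h u : R).

Lemma heat_jensen t (v : rV -> R) (c : R) : 0 < t ->
  measurable_fun [set: rV] v -> (forall y, 0 <= v y) -> 0 <= c ->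
  (c%:E <= \int[mu]_y (heat t y * v y)%:E)%E ->
  ((c ^+ 2)%:E <= \int[mu]_y (heat t y * v y ^+ 2)%:E)%E.
Proof.
move=> t0 mv v0 c0 hc; have h0 y := heat_ge0 (n := n) y t0.
pose a y := Num.sqrt (heat t y); pose b y := a y * v y.
have a2 y : a y ^+ 2 = heat t y by rewrite sqr_sqrtr.
have ma : measurable_fun [set: rV] a.
  apply: (measurableT_comp _ (measurable_heat t)).
  by apply: continuous_measurable_fun; exact: sqrt_continuous.
have na : sqnorm mu a = 1%E.
  by rewrite -(integral_heat (n := n) t0); apply: eq_integral => y _; rewrite a2.
have mb : measurable_fun [set: rV] b by exact: measurable_funM.
have nb : sqnorm mu b = (\int[mu]_y (heat t y * v y ^+ 2)%:E)%E.
  by apply: eq_integral => y _; rewrite exprMn a2.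
rewrite -nb; have [sv|] := ltP (sqnorm mu b) +oo%E; last first.
  by rewrite leye_eq => /eqP ->; rewrite leey.
have sa : sq_int mu a by split => //; rewrite na ltry.
have sb : sq_int mu b by [].
have := ip2_CS sa sb.
have -> : ip2 mu a a = 1 by rewrite ip2_sqr na.
have ce : c <= ip2 mu a b.
  rewrite -lee_fin ip2_EFin//; apply: (le_trans hc); apply: le_integral_nn => y _.
    by rewrite lee_fin mulr_ge0.
  by rewrite /b mulrA -expr2 a2.
rewrite sqrtr1 mul1r -sq_int_fineK// lee_fin => h.
rewrite -[leRHS]sqr_sqrtr ?ip2_ge0// ler_pXn2r ?nnegrE ?sqrtr_ge0//.
by apply: (le_trans ce); apply: le_trans h; exact: ler_norm.
Qed.

Definition ball_ind (r : R) x : R := (`|x| <= r)%R%:R.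

Lemma ball_ind_ge0 r x : 0 <= ball_ind r x. Proof. by []. Qed.

Lemma measurable_rV_norm : measurable_fun [set: rV] (fun x => `|x|).
Proof. by apply: measurable_fun_continuous_rV; exact: norm_continuous. Qed.

Lemma measurable_ball_ind d (T : measurableType d) (r : T -> R) (h : T -> rV) :
  measurable_fun setT r -> measurable_fun setT h ->
  measurable_fun setT (fun z => ball_ind (r z) (h z)).
Proof.
move=> mr mh; rewrite (_ : (fun z => _) =
  (fun b : bool => b%:R : R) \o (fun z => `|h z| <= r z))//.
apply: measurableT_comp => //; apply: measurable_fun_ler => //.
exact: (measurableT_comp measurable_rV_norm mh).
Qed.

Lemma integral_norm_ball (r : R) : 0 <= r ->
  (\int[mu]_x (ball_ind r x)%:E = ((2 * r) ^+ n)%:E)%E.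
Proof.
move=> r0; pose A (i : 'I_n) : set R := `[- r, r]%classic.
have mA i : measurable (A i) by exact: measurable_itv.
have mB := measurable_box mA.
transitivity (\int[mu]_x (\1_[set x : rV | forall i, A i (x ord0 i)] x)%:E)%E.
  apply: eq_integral => x _; rewrite indicE; congr ((nat_of_bool _)%:R%:E).
  apply/idP/idP => [xr|].
    rewrite inE => i; rewrite /A /= in_itv /= -ler_norml.
    exact: le_trans (rV_norm_coor x i) xr.
  rewrite inE => h; apply: rV_norm_le => // i.
  by have := h i; rewrite /A /= in_itv /= -ler_norml.
rewrite integral_indic// setIT; apply: (etrans (lebesgue_rV_box mA)).
rewrite (eq_bigr (fun=> (2 * r)%:E)) => [|i _].
  by rewrite prodEFin prodr_const card_ord.
rewrite lebesgue_measure_itv /= lte_fin; case: ltP => [_|].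
  by rewrite -EFinD; congr EFin; ring.
by move=> h; congr EFin; lra.
Qed.

(** Jensen's inequality, then Tonelli: at fixed y the cube of radius L + |y| has volume (2 (L +
    |y|))^n, which leaves moments of orders 2 k and 2 (k + n). The indicator expresses that f (x +
    y) and f x, for f supported in the cube of radius L, both vanish when |x| > L + |y|. *)
Lemma kernel_sqnorm (k : nat) (L : R) : 0 <= L ->
  exists2 C : R, 0 <= C & forall t K (F : rV -> R), 0 < t -> t <= 1 -> 0 <= K ->
  (forall x, (`|F x|%:E <=
    \int[mu]_y (heat t y * (K * (`|y| ^+ k * ball_ind (L + `|y|) x)))%:E)%E) ->
  (sqnorm mu F <= (K ^+ 2 * C * t ^+ k)%:E)%E.
Proof.
move=> L0; have [C1 C10 H1] := heat_moment (R := R) (n := n) k.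
have [C2 C20 H2] := heat_moment (R := R) (n := n) (k + n).
exists (4 ^+ n * ((L ^+ n + 1) * C1 + C2)).
  by rewrite mulr_ge0 ?exprn_ge0// addr_ge0// mulr_ge0// addr_ge0// exprn_ge0.
move=> t K F t0 t1 K0 FK; have h0 y := heat_ge0 (n := n) y t0.
pose v x y := K * (`|y| ^+ k * ball_ind (L + `|y|) x).
have v0 x y : 0 <= v x y by rewrite !mulr_ge0 ?exprn_ge0.
pose G (p : rV * rV) : \bar R := (heat t p.2 * v p.1 p.2 ^+ 2)%:E.
have mn : measurable_fun [set: rV] (fun y => `|y|) by exact: measurable_rV_norm.
have mv : measurable_fun setT (fun p : rV * rV => v p.1 p.2).
  apply: measurable_funM; first exact: measurable_cst.
  have m2 : measurable_fun setT (fun p : rV * rV => `|p.2|).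
    by apply: (measurableT_comp mn); exact: measurable_snd.
  apply: measurable_funM; first exact: measurable_funX.
  apply: measurable_ball_ind; last exact: measurable_fst.
  by apply: measurable_funD => //; exact: measurable_cst.
have mvx x : measurable_fun [set: rV] (v x).
  have h := @measurable_pair1 _ _ rV rV x; exact: (measurableT_comp mv h).
have mG : measurable_fun setT G.
  apply/measurable_EFinP; apply: measurable_funM; last exact: measurable_funX.
  by apply: (measurableT_comp (measurable_heat t)); exact: measurable_snd.
have G0 p : (0 <= G p)%E by rewrite lee_fin mulr_ge0// sqr_ge0.
apply: (@le_trans _ _ (\int[mu]_x \int[mu]_y G (x, y))%E).
  apply: le_integral_nn => x _; first by rewrite lee_fin sqr_ge0.
  rewrite -(real_normK (num_real (F x))).
  exact: (heat_jensen t0 (mvx x) (v0 x) (normr_ge0 _) (FK x)).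
rewrite (@fubini_tonelli _ _ rV rV R mu mu G mG G0).
pose c := K ^+ 2 * 4 ^+ n.
have c0 : 0 <= c by rewrite mulr_ge0 ?sqr_ge0// exprn_ge0.
have l0 : 0 <= L ^+ n + 1 by rewrite addr_ge0// exprn_ge0.
pose B y : R := c * ((L ^+ n + 1) * (heat t y * `|y| ^+ (2 * k)) + heat t y * `|y| ^+ (2 * (k + n))).
have mm j : measurable_fun [set: rV] (fun y => (heat t y * `|y| ^+ j)%:E).
  apply/measurable_EFinP; apply: measurable_funM; first exact: measurable_heat.
  exact: measurable_funX.
have pm j y : (0 <= (heat t y * `|y| ^+ j)%:E)%E by rewrite lee_fin mulr_ge0// exprn_ge0.
apply: (@le_trans _ _ (\int[mu]_y (B y)%:E)%E).
  apply: le_integral_nn => y _; first exact: integral_ge0.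
  have y0 : 0 <= `|y| by [].
  rewrite /G (eq_integral (fun x => ((heat t y * (K ^+ 2 * `|y| ^+ (2 * k)))%:E *
      (ball_ind (L + `|y|) x)%:E)%E)) => [|x _]; last first.
    rewrite -EFinM /= /v !exprMn -exprM [(k * 2)%N]mulnC; congr EFin.
    by rewrite /ball_ind; case: (`|x| <= _); rewrite ?expr1n ?expr0n !(mulr1, mulr0).
  have e0 : 0 <= heat t y * (K ^+ 2 * `|y| ^+ (2 * k)).
    by rewrite mulr_ge0// mulr_ge0 ?sqr_ge0// exprn_ge0.
  rewrite (ge0_integralZ _ e0) => [||x]; last by rewrite lee_fin.
    rewrite integral_norm_ball ?addr_ge0// -EFinM lee_fin /B /c.
    have -> : K ^+ 2 * 4 ^+ n * ((L ^+ n + 1) * (heat t y * `|y| ^+ (2 * k)) +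
        heat t y * `|y| ^+ (2 * (k + n))) =
        heat t y * (K ^+ 2 * `|y| ^+ (2 * k)) * (4 ^+ n * (L ^+ n + 1 + `|y| ^+ (2 * n))).
      by rewrite mulnDr exprD; ring.
    rewrite ler_wpM2l//.
    have -> : 4 = 2 * 2 :> R by ring.
    rewrite !exprMn -mulrA ler_wpM2l ?exprn_ge0//.
    apply: (@le_trans _ _ (2 ^+ n * (L ^+ n + `|y| ^+ n))).
      have [Ly|yL] := leP L `|y|.
        apply: (@le_trans _ _ ((2 * `|y|) ^+ n)).
          by rewrite lerXn2r ?nnegrE ?mulr_ge0 ?addr_ge0//; lra.
        by rewrite exprMn ler_wpM2l ?exprn_ge0// lerDr exprn_ge0.
      apply: (@le_trans _ _ ((2 * L) ^+ n)).
        by rewrite lerXn2r ?nnegrE ?mulr_ge0 ?addr_ge0//; lra.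
      by rewrite exprMn ler_wpM2l ?exprn_ge0// lerDl exprn_ge0.
    rewrite ler_wpM2l ?exprn_ge0// -addrA lerD2l mulnC exprM.
    by have := sqr_ge0 (`|y| ^+ n - 1); have := exprn_ge0 n y0; nra.
  by apply/measurable_EFinP; apply: measurable_ball_ind; [exact: measurable_cst|exact: measurable_id].
rewrite /B (eq_integral (fun y => (c%:E * ((L ^+ n + 1)%:E * (heat t y * `|y| ^+ (2 * k))%:E +
    (heat t y * `|y| ^+ (2 * (k + n)))%:E))%E)) => [|y _]; last by rewrite !EFinM EFinD !EFinM.
have mZ : measurable_fun [set: rV] (fun y => ((L ^+ n + 1)%:E * (heat t y * `|y| ^+ (2 * k))%:E)%E).
  by apply: emeasurable_funM => //; exact: measurable_cst.
have pZ y : (0 <= (L ^+ n + 1)%:E * (heat t y * `|y| ^+ (2 * k))%:E)%E by rewrite mule_ge0// lee_fin.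
rewrite (ge0_integralZ _ c0) => [||y]; [|exact: emeasurable_funD|exact: adde_ge0].
rewrite ge0_integralD// (ge0_integralZ _ l0)//.
apply: (@le_trans _ _ (c%:E * ((L ^+ n + 1)%:E * (C1 * t ^+ k)%:E + (C2 * t ^+ (k + n))%:E))%E).
  rewrite lee_wpmul2l ?lee_fin// leeD//; last exact: H2.
  by rewrite lee_wpmul2l ?lee_fin//; exact: H1.
rewrite -[leLHS]/((c * ((L ^+ n + 1) * (C1 * t ^+ k) + C2 * t ^+ (k + n)))%:E) lee_fin /c exprD.
have tn : t ^+ n <= 1 by rewrite exprn_ile1// ltW.
have -> : K ^+ 2 * (4 ^+ n * ((L ^+ n + 1) * C1 + C2)) * t ^+ k =
  K ^+ 2 * 4 ^+ n * ((L ^+ n + 1) * (C1 * t ^+ k) + C2 * t ^+ k) by ring.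
rewrite ler_wpM2l// lerD2l ler_wpM2l//; apply: ler_piMr => //.
by rewrite exprn_ge0// ltW.
Qed.

End kernel_bound.

(** * Taylor expansion and consistency of the splitting *)

Section line_calculus.
Context {R : realType}.
Implicit Types (g : R -> R) (s u c e : R).

Lemma mvt0 g (dg : R -> R) s : (forall u, is_derive u 1 g (dg u)) ->
  exists2 u, `|u| <= `|s| & g s - g 0 = dg u * s.
Proof.
move=> hg; have cg : continuous g.
  by move=> u; apply: differentiable_continuous; apply/derivable1_diffP; exact: ex_derive.
have cw A : {within A, continuous g} by apply: continuous_subspaceT.
have [s0|s0|->] := ltgtP s 0.
- have [c] := MVT s0 (fun x _ => hg x) (cw _).
  rewrite in_itv /= => /andP[c1 c2] E; exists c.
    by rewrite !ltr0_norm// lerN2 ltW.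
  by rewrite -opprB E sub0r mulrN opprK.
- have [c] := MVT s0 (fun x _ => hg x) (cw _).
  rewrite in_itv /= => /andP[c1 c2] E; exists c; first by rewrite !gtr0_norm// ltW.
  by rewrite E subr0.
- by exists 0; rewrite ?subrr ?mulr0.
Qed.

(** The even function g(u) + g(-u) - u^2 c has zero derivative at 0, so two applications of the mean
    value theorem suffice. *)
Lemma second_difference g (g1 g2 : R -> R) s c e :
  (forall u, is_derive u 1 g (g1 u)) -> (forall u, is_derive u 1 g1 (g2 u)) ->
  (forall u, `|u| <= `|s| -> `|g2 u - c| <= e) ->
  `|g s + g (- s) - 2 * g 0 - s ^+ 2 * c| <= 2 * s ^+ 2 * e.
Proof.
move=> h1 h2 he.
have neg (f df : R -> R) u : (forall u, is_derive u 1 f (df u)) ->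
    is_derive u 1 (fun v => f (- v)) (- df (- u)).
  by move=> hf; have := is_derive1_comp (hf (- u)) (is_deriveN (is_derive_id u 1)); rewrite mulrN1.
pose D u := g u + g (- u) - u ^+ 2 * c.
pose D1 u := g1 u - g1 (- u) - 2 * u * c.
have hD u : is_derive u 1 D (D1 u).
  have n1 := neg _ _ u h1.
  have q : is_derive u 1 (fun v : R => v ^+ 2 * c) (2 * u * c).
    have := is_deriveM (is_deriveX 2 (is_derive_id u 1)) (is_derive_cst c u 1).
    move=> h; apply: (is_derive_eq h).
    by rewrite /GRing.scale /= mulr0 add0r !mulr1 expr1; ring.
  have := is_deriveB (is_deriveD (h1 u) n1) q.
  by move=> h; apply: (is_derive_eq h).
have hD1 u : is_derive u 1 D1 (g2 u + g2 (- u) - 2 * c).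
  have n2 := is_deriveN (neg _ _ u h2).
  have q : is_derive u 1 (fun v : R => 2 * v * c) (2 * c).
    have := is_deriveM (is_deriveM (is_derive_cst (2 : R) u 1) (is_derive_id u 1)) (is_derive_cst c u 1).
    move=> h; apply: (is_derive_eq h).
    by rewrite /GRing.scale /= !mulr0 mulr1; ring.
  have := is_deriveB (is_deriveD (h2 u) n2) q.
  by move=> h; apply: (is_derive_eq h); rewrite opprK.
have [u us Du] := mvt0 s hD; have [v vu D1u] := mvt0 u hD1.
have -> : g s + g (- s) - 2 * g 0 - s ^+ 2 * c = D s - D 0.
  by rewrite /D oppr0 expr0n mul0r; ring.
have D10 : D1 0 = 0 by rewrite /D1 oppr0 mulr0 mul0r subrr subr0.
rewrite Du; move: D1u; rewrite D10 subr0 => ->.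
have vs : `|v| <= `|s| by apply: le_trans us.
have b : `|g2 v + g2 (- v) - 2 * c| <= 2 * e.
  have -> : g2 v + g2 (- v) - 2 * c = (g2 v - c) + (g2 (- v) - c) by ring.
  apply: (le_trans (ler_normD _ _)); have := he v vs.
  by have := he (- v); rewrite normrN => /(_ vs); lra.
rewrite !normrM -mulrA.
have -> : 2 * s ^+ 2 * e = 2 * e * (`|s| * `|s|) by rewrite -expr2 real_normK ?num_real//; ring.
by apply: ler_pM => //; rewrite ?mulr_ge0// ler_wpM2r.
Qed.

End line_calculus.

Section test_calculus.
Context {R : realType} {n : nat}.
Local Notation rV := 'rV[R]_n.
Implicit Types (x y z : rV) (f g : rV -> R) (i : 'I_n).
Local Notation "'e_' i" := (delta_mx ord0 i : rV) (at level 8, i at level 2).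

Lemma deriv_line f z i (s : R) : (forall x, derivable f x (e_ i)) ->
  is_derive s 1 (fun u => f (z + u *: e_ i)) (partial_derivative i f (z + s *: e_ i)).
Proof.
move=> df; have E : (fun h : R => h^-1 *:
      (((fun u => f (z + u *: e_ i)) \o shift s) (h *: (1 : R)) - f (z + s *: e_ i))) =
    (fun h : R => h^-1 *: ((f \o shift (z + s *: e_ i)) (h *: e_ i) - f (z + s *: e_ i))).
  apply/funext => h /=; congr (_ *: (f _ - _)).
  have -> : h%:A = h :> R by exact: mulr1.
  by rewrite scalerDl addrCA.
by apply: DeriveDef; [rewrite /derivable E; exact: df|rewrite /derive E].
Qed.

(** The point reached from 0 towards y after following the first k axes. Telescoping over k reduces
    increments in R^n to increments along single axes. *)
Definition mask (k : nat) y : rV := \row_j (if (j < k)%N then y ord0 j else 0).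

Lemma mask0 y : mask 0 y = 0.
Proof. by apply/rowP => j; rewrite !mxE. Qed.

Lemma mask_full y : mask n y = y.
Proof. by apply/rowP => j; rewrite !mxE ltn_ord. Qed.

Lemma maskS i y : mask i.+1 y = mask i y + y ord0 i *: e_ i.
Proof.
apply/rowP => j; rewrite !mxE eqxx ltnS leq_eqVlt -val_eqE /=.
case: eqP => [/val_inj ->|_] /=; first by rewrite ltnn add0r mulr1.
by rewrite mulr0 addr0.
Qed.

Lemma mask_norm i y (s : R) : `|s| <= `|y ord0 i| -> `|mask i y + s *: e_ i| <= `|y|.
Proof.
move=> sy; apply: rV_norm_le => // j; rewrite !mxE eqxx /=.
have [->|ji] := eqVneq j i.
  by rewrite ltnn add0r mulr1; apply: (le_trans sy); exact: rV_norm_coor.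
by rewrite mulr0 addr0; case: ifP; rewrite ?normr0// => _; exact: rV_norm_coor.
Qed.

Lemma mask_telescope f x y :
  f (x + y) - f x = \sum_(i < n) (f (x + mask i.+1 y) - f (x + mask i y)).
Proof.
rewrite -(big_mkord xpredT (fun i : nat => f (x + mask i.+1 y) - f (x + mask i y))).
by rewrite telescope_sumr// mask_full mask0 addr0.
Qed.

Lemma partial_lipschitz f (M : R) : 0 <= M ->
  (forall i x, derivable f x (e_ i)) ->
  (forall i x, `|partial_derivative i f x| <= M) ->
  forall x y, `|f (x + y) - f x| <= n%:R * M * `|y|.
Proof.
move=> M0 df bf x y; rewrite mask_telescope; apply: (le_trans (ler_norm_sum _ _ _)).
have -> : n%:R * M * `|y| = \sum_(i < n) (M * `|y|).
  by rewrite sumr_const card_ord -mulrA mulr_natl.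
apply: ler_sum => i _; rewrite maskS addrA.
have [u _] := mvt0 (y ord0 i) (fun u => deriv_line (x + mask i y) u (df i)).
rewrite scale0r addr0 => ->; rewrite normrM.
by apply: ler_pM => //; exact: rV_norm_coor.
Qed.

Lemma partial_zero f (L : R) i : (forall x, L < `|x| -> f x = 0) ->
  forall x, L < `|x| -> partial_derivative i f x = 0.
Proof.
move=> f0 x Lx; rewrite /partial_derivative.
have -> : 'D_(e_ i) f x = 'D_(e_ i) (cst 0 : rV -> R) x.
  apply: near_eq_derive; near=> z; apply: f0; near: z.
  by have /cvgr_gt/(_ _ Lx) := @norm_continuous R rV x.
by rewrite derive_cst.
Unshelve. all: by end_near.
Qed.

Lemma test_support f : test_function f -> exists2 L : R, 0 <= L &
  forall s x, L < `|x| -> iterated_partial s f x = 0.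
Proof.
move=> [_ /compact_bounded[M [Mr hM]]].
exists (`|M| + 1) => [|s]; first by rewrite addr_ge0.
elim: s => [|i s IH] x Lx /=; last exact: partial_zero IH _ Lx.
apply/eqP/negPn/negP => fx; suff : `|x| <= `|M| + 1 by rewrite leNgt Lx.
apply: hM; first by apply: (le_lt_trans (ler_norm M)); rewrite ltrDl.
exact: subset_closure.
Qed.

Lemma cont_supp_bounded g (L : R) : continuous g ->
  (forall x, L < `|x| -> g x = 0) -> exists2 M : R, 0 <= M & forall x, `|g x| <= M.
Proof.
move=> cg g0; pose B := [set x : rV | `|x| <= L].
have cB : compact B.
  apply: bounded_closed_compact.
    exists L; split; first exact: num_real.
    by move=> r Lr x /= xB; apply: (le_trans xB); exact: ltW.
  rewrite (_ : B = (fun x : rV => `|x|) @^-1` [set r | r <= L])//.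
  by apply: closed_comp; [move=> x _; exact: norm_continuous|exact: closed_le].
have /compact_bounded[M [Mr hM]] : compact (g @` B).
  by apply: continuous_compact => //; exact: continuous_subspaceT.
exists (`|M| + 1) => [|x]; first by rewrite addr_ge0.
have [xL|Lx] := leP `|x| L; last by rewrite g0// normr0 addr_ge0.
apply: hM; first by apply: (le_lt_trans (ler_norm M)); rewrite ltrDl.
by exists x.
Qed.

Lemma test_bounded f (s : seq 'I_n) : test_function f ->
  exists2 M : R, 0 <= M & forall x, `|iterated_partial s f x| <= M.
Proof.
move=> tf; have [L L0 hL] := test_support tf.
by apply: (@cont_supp_bounded _ L); [exact: (tf.1 s).1|exact: hL].
Qed.

Lemma test_bounded_partial f (s : seq 'I_n) : test_function f ->
  exists2 M : R, 0 <= M & forall i x, `|iterated_partial (i :: s) f x| <= M.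
Proof.
move=> tf; pose M i := sval (cid2 (test_bounded (i :: s) tf)).
have M0 i : 0 <= M i by rewrite /M; case: cid2.
have hM i x : `|iterated_partial (i :: s) f x| <= M i by rewrite /M; case: cid2 => /= ? _; apply.
exists (\sum_i M i) => [|i x]; first by rewrite sumr_ge0.
by apply: (le_trans (hM i x)); rewrite (bigD1 i)//= lerDl sumr_ge0.
Qed.

Lemma test_lipschitz f (s : seq 'I_n) : test_function f ->
  exists2 K : R, 0 <= K & forall x y,
    `|iterated_partial s f (x + y) - iterated_partial s f x| <= K * `|y|.
Proof.
move=> tf; have [M M0 hM] := test_bounded_partial s tf.
exists (n%:R * M) => [|x y]; first by rewrite mulr_ge0.
by apply: partial_lipschitz => // i z; exact: (tf.1 s).2.
Qed.

(* The symmetric second difference in direction [i] at the point [x + mask i y]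
   compared with the second derivative at [x]. *)
Lemma test_second_difference f i : test_function f -> exists2 K : R, 0 <= K &
  forall x y, `|f (x + mask i y + y ord0 i *: e_ i) + f (x + mask i y + (- y ord0 i) *: e_ i)
     - 2 * f (x + mask i y) - y ord0 i ^+ 2 * iterated_partial [:: i; i] f x| <=
   K * `|y| ^+ 3.
Proof.
move=> tf; have [K K0 hK] := test_lipschitz [:: i; i] tf.
exists (2 * K) => [|x y]; first by rewrite mulr_ge0.
have h1 u := deriv_line (x + mask i y) u ((tf.1 [::]).2 i).
have h2 u := deriv_line (x + mask i y) u ((tf.1 [:: i]).2 i).
have := second_difference (s := y ord0 i) (c := iterated_partial [:: i; i] f x)
  (e := K * `|y|) h1 h2; rewrite scale0r addr0 => h.
apply: (le_trans (h _)) => [u uy|].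
  rewrite -addrA; apply: (le_trans (hK _ _)); rewrite ler_wpM2l//.
  exact: mask_norm.
have yi := rV_norm_coor y i.
have -> : 2 * K * `|y| ^+ 3 = 2 * `|y| ^+ 2 * (K * `|y|) by ring.
rewrite ler_wpM2r ?mulr_ge0// ler_wpM2l//.
by rewrite -(real_normK (num_real (y ord0 i))) lerXn2r ?nnegrE.
Qed.

End test_calculus.

Section heat_expectation.
Context {R : realType} {n : nat}.
Local Notation rV := 'rV[R]_n.
Local Notation mu := (lebesgue_rV R n).
Implicit Types (x y : rV) (t r : R) (f g h : rV -> R).

(** Expectation under the heat measure as a relation, so that integrability and value are carried
    along together. *)
Definition hE t g r : Prop :=
  mu.-integrable [set: rV] (fun y => (heat t y * g y)%:E) /\
  (\int[mu]_y (heat t y * g y)%:E)%E = r%:E.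

Lemma hE_lin t a g h r s : hE t g r -> hE t h s ->
  hE t (fun y => a * g y + h y) (a * r + s).
Proof.
move=> [ig eg] [ih eh].
have ia := integrableZl measurableT a ig.
have E : (fun y => (heat t y * (a * g y + h y))%:E) =
  ((fun y => a%:E * (heat t y * g y)%:E) \+ (fun y => (heat t y * h y)%:E))%E.
  by apply/funext => y; rewrite -EFinM -EFinD; congr EFin; ring.
split; first by rewrite E; exact: integrableD.
by rewrite E integralD// integralZl// eg eh.
Qed.

Lemma hE_sum t (I : Type) (s : seq I) (G : I -> rV -> R) (r : I -> R) :
  (forall i, hE t (G i) (r i)) ->
  hE t (fun y => \sum_(i <- s) G i y) (\sum_(i <- s) r i).
Proof.
move=> hG; elim: s => [|i s IH].
  split; under eq_fun do rewrite big_nil mulr0; first exact: integrable0.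
  by rewrite big_nil integral0.
by under eq_fun do rewrite big_cons -[G i _]mul1r; rewrite big_cons -[r i]mul1r; exact: hE_lin.
Qed.

Lemma hE_cst t r : 0 < t -> hE t (fun=> r) r.
Proof.
move=> t0; have h0 y := heat_ge0 (n := n) y t0.
have i1 : mu.-integrable [set: rV] (fun y => (heat t y)%:E).
  apply/integrableP; split; first exact: measurable_EFin_heat.
  under eq_integral do rewrite gee0_abs ?lee_fin//.
  by rewrite integral_heat// ltry.
have ir := integrableZl measurableT r i1.
have E : (fun y => (heat t y * r)%:E) = (fun y => r%:E * (heat t y)%:E)%E.
  by apply/funext => y; rewrite -EFinM mulrC.
by split; rewrite E// integralZl// integral_heat// mule1.
Qed.

Lemma hE_bounded t g (M : R) : 0 < t -> measurable_fun [set: rV] g ->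
  (forall y, `|g y| <= M) -> exists r, hE t g r.
Proof.
move=> t0 mg gM; have h0 y := heat_ge0 (n := n) y t0.
have M0 : 0 <= M by apply: le_trans (gM 0).
have ig : mu.-integrable [set: rV] (fun y => (heat t y * g y)%:E).
  have [iM _] := hE_cst M t0; apply: le_integrable iM => //.
    by apply/measurable_EFinP; apply: measurable_funM => //; exact: measurable_heat.
  move=> y _; rewrite lee_fin !normrM ler_wpM2l// (ger0_norm M0); exact: gM.
exists (fine (\int[mu]_y (heat t y * g y)%:E)%E); split => //.
by rewrite fineK// integrable_fin_num.
Qed.

Lemma hE_le t g r (b : rV -> R) : 0 < t -> hE t g r ->
  (forall y, `|g y| <= b y) -> (`|r|%:E <= \int[mu]_y (heat t y * b y)%:E)%E.
Proof.
move=> t0 [ig eg] gb; have h0 y := heat_ge0 (n := n) y t0.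
rewrite -abse_EFin -eg; apply: le_trans (le_abse_integral _ measurableT _) _.
  by case/integrableP: ig.
apply: le_integral_nn => y _; first exact: abse_ge0.
by rewrite abse_EFin lee_fin normrM (ger0_norm (h0 y)) ler_wpM2l.
Qed.

Definition flip (i : 'I_n) : rV -> rV := flip_shift (fun j => j == i) 0.

Lemma flipE i y j : flip i y ord0 j = (if j == i then - y ord0 j else y ord0 j).
Proof. by rewrite !mxE addr0; case: (j == i); rewrite ?expr1 ?expr0 ?mulN1r ?mul1r. Qed.

Lemma measurable_flip i : measurable_fun [set: rV] (flip i).
Proof. exact: measurable_flip_shift. Qed.

Lemma heat_flip t i y : heat t (flip i y) = heat t y.
Proof.
rewrite /heat /gau; congr (expR (- (_ * _)) / _); apply: eq_bigr => j _.
by rewrite flipE; case: (j == i) => //; rewrite mulrNN.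
Qed.

Lemma hE_flip t i g r : measurable_fun [set: rV] g -> hE t g r -> hE t (g \o flip i) r.
Proof.
move=> mg [ig eg]; pose F y : \bar R := (heat t y * g y)%:E.
have mF : measurable_fun [set: rV] F.
  by apply/measurable_EFinP; apply: measurable_funM => //; exact: measurable_heat.
have E : (fun y => (heat t y * (g \o flip i) y)%:E) = fun y => F (flip i y).
  by apply/funext => y; rewrite /F heat_flip.
split; rewrite E.
  apply/integrableP; split; first exact: measurableT_comp mF (measurable_flip i).
  have mA : measurable_fun [set: rV] (fun y => `|F y|%E) by exact: measurableT_comp.
  have := ge0_integral_flip_shift (fun j => j == i) 0 mA (fun=> abse_ge0 _).
  by rewrite -/(flip i) => ->; case/integrableP: ig.
rewrite -eg [LHS]integralE [RHS]integralE; congr (_ - _)%E.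
  rewrite -[RHS](ge0_integral_flip_shift (fun j => j == i) 0 (measurable_funepos mF) (funepos_ge0 _)).
  by apply: eq_integral => y _; rewrite !funeposE.
rewrite -[RHS](ge0_integral_flip_shift (fun j => j == i) 0 (measurable_funeneg mF) (funeneg_ge0 _)).
by apply: eq_integral => y _; rewrite !funenegE.
Qed.

Lemma hE_coor2 t i : 0 < t -> hE t (fun y => y ord0 i ^+ 2) (2 * t).
Proof.
move=> t0; split; last exact: heat_moment2.
apply/integrableP; split.
  apply/measurable_EFinP; apply: measurable_funM; first exact: measurable_heat.
  by apply: measurable_funX; exact: measurable_coor.
rewrite (eq_integral (fun y : rV => (heat t y * y ord0 i ^+ 2)%:E)) => [|y _].
  by rewrite heat_moment2// ltry.
by rewrite gee0_abs// lee_fin; apply: mulr_ge0; [exact: heat_ge0|exact: sqr_ge0].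
Qed.

Lemma heat_op_hE t f x r : hE t (fun y => f (x + y)) r -> heat_op t f x = r.
Proof. by move=> [_ e]; rewrite /heat_op /Rintegral e. Qed.

End heat_expectation.

Section taylor.
Context {R : realType} {n : nat}.
Local Notation rV := 'rV[R]_n.
Local Notation mu := (lebesgue_rV R n).
Implicit Types (x y : rV) (t r : R) (f g h : rV -> R).

Lemma far_add (L : R) x y z : L + `|y| < `|x| -> `|z| <= `|y| -> L < `|x + z|.
Proof.
move=> h zy; have := ler_normD (x + z) (- z); rewrite addrK normrN; lra.
Qed.

Lemma measurable_test f (s : seq 'I_n) : test_function f ->
  measurable_fun [set: rV] (iterated_partial s f).
Proof. by move=> tf; apply: measurable_fun_continuous_rV; exact: (tf.1 s).1. Qed.

Lemma mask_flip (i : 'I_n) y : mask i (flip i y) = mask i y.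
Proof.
apply/rowP => j; rewrite !mxE addr0; case: ifP => // ji.
by rewrite (negbTE (_ : j != i)) ?expr0 ?mul1r// -val_eqE /= neq_ltn ji.
Qed.

Lemma measurable_mask (k : nat) : measurable_fun [set: rV] (mask k).
Proof.
apply: measurable_fun_rV => j.
rewrite [X in measurable_fun _ X](_ : _ = fun y => if (j < k)%N then y ord0 j else 0).
  by case: (j < k)%N; [exact: measurable_coor|exact: measurable_cst].
by apply/funext => y; rewrite mxE.
Qed.

(** The increment f (x + y) - f x is telescoped along the axes. Averaging each term with its image
    under the reflection of y_i leaves a symmetric second difference, so the first-order terms
    cancel; E y_i^2 = 2 t produces the Laplacian and the remainder is cubic in y. *)
Lemma heat_op_taylor f : test_function f -> exists2 L : R, 0 <= L &
  exists2 K : R, 0 <= K & forall t x, 0 < t ->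
  (`|heat_op t f x - f x - t * laplacian f x|%:E <=
   \int[mu]_y (heat t y * (K * (`|y| ^+ 3 * ball_ind (L + `|y|) x)))%:E)%E.
Proof.
move=> tf; have [L L0 hL] := test_support tf; exists L => //.
have [M M0 hM] := test_bounded [::] tf.
pose K i := sval (cid2 (test_second_difference i tf)).
have K0 i : 0 <= K i by rewrite /K; case: cid2.
have hK (i : 'I_n) x y : `|f (x + mask i y + y ord0 i *: delta_mx ord0 i)
     + f (x + mask i y + (- y ord0 i) *: delta_mx ord0 i)
     - 2 * f (x + mask i y) - y ord0 i ^+ 2 * iterated_partial [:: i; i] f x| <= K i * `|y| ^+ 3.
  by rewrite /K; case: cid2 => /= ? _; apply.
exists (\sum_i K i) => [|t x t0]; first by rewrite sumr_ge0.
have mf : measurable_fun [set: rV] f by exact: (measurable_test [::] tf).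
pose Q (i : 'I_n) y := f (x + mask i.+1 y) - f (x + mask i y).
have mQ i : measurable_fun [set: rV] (Q i).
  by apply: measurable_funB; apply: (measurableT_comp (measurable_shiftr x mf)); exact: measurable_mask.
have bQ i y : `|Q i y| <= 2 * M.
  apply: (le_trans (ler_normB _ _)); have := hM (x + mask i.+1 y); have := hM (x + mask i y).
  by rewrite /=; lra.
pose q i := sval (cid (hE_bounded t0 (mQ i) (bQ i))).
have hq i : hE t (Q i) (q i) by exact: svalP (cid (hE_bounded t0 (mQ i) (bQ i))).
pose c i := iterated_partial [:: i; i] f x.
(* The Gaussian is invariant under the flip, so both terms have expectation [q i], and half of D has
   expectation q_i - t c_i. *)
pose D i y := Q i y + (Q i \o flip i) y - y ord0 i ^+ 2 * c i.
have hD i : hE t (fun y => 2^-1 * D i y) (q i - t * c i).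
  have h1 := hE_lin 1 (hq i) (hE_flip i (mQ i) (hq i)).
  have h2 := hE_lin (2^-1) (hE_lin (- c i) (hE_coor2 i t0) h1) (hE_cst 0 t0).
  have -> : q i - t * c i = 2^-1 * (- c i * (2 * t) + (1 * q i + q i)) + 0 by field.
  rewrite (_ : (fun y => _) = fun y => 2^-1 * (- c i * y ord0 i ^+ 2 + (1 * Q i y + (Q i \o flip i) y)) + 0)//.
  by apply/funext => y; rewrite /D /=; ring.
have hDs := hE_sum (index_enum 'I_n) hD.
have -> : heat_op t f x - f x - t * laplacian f x = \sum_i (q i - t * c i).
  rewrite sumrB -mulr_sumr -/(laplacian f x); congr (_ - _).
  apply/eqP; rewrite subr_eq; apply/eqP; apply: heat_op_hE.
  have h3 := hE_lin 1 (hE_sum (index_enum 'I_n) hq) (hE_cst (f x) t0).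
  rewrite mul1r in h3; rewrite (_ : (fun y => _) = fun y => 1 * (\sum_i Q i y) + f x)//.
  by apply/funext => y; rewrite mul1r /Q -mask_telescope subrK.
apply: (hE_le t0 hDs) => y; apply: (le_trans (ler_norm_sum _ _ _)).
have DE i : D i y = f (x + mask i y + y ord0 i *: delta_mx ord0 i)
     + f (x + mask i y + (- y ord0 i) *: delta_mx ord0 i)
     - 2 * f (x + mask i y) - y ord0 i ^+ 2 * c i.
  rewrite /D /Q /= !maskS mask_flip flipE eqxx !addrA; ring.
rewrite mulr_suml; apply: ler_sum => i _; rewrite /ball_ind.
have [xL|Lx] := leP `|x| (L + `|y|).
  rewrite mulr1 normrM DE ger0_norm ?invr_ge0//; apply: le_trans (hK i x y).
  by apply: ler_piMl => //; lra.
have z w : `|w| <= `|y| -> f (x + w) = 0 by move=> wy; apply: (hL [::]); exact: far_add Lx wy.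
have mi := mask_norm (i := i) (y := y).
rewrite DE -!addrA !z; first last.
- by have := mi 0; rewrite scale0r addr0 normr0 => /(_ (normr_ge0 _)).
- exact: mi.
- by apply: mi; rewrite normrN.
have -> : c i = 0 by apply: hL; apply: le_lt_trans Lx; rewrite lerDl.
by rewrite !(mulr0, add0r, subr0, oppr0) normr0.
Qed.

End taylor.

Section consistency.
Context {R : realType} {n : nat}.
Local Notation rV := 'rV[R]_n.
Local Notation mu := (lebesgue_rV R n).
Implicit Types (x y : rV) (t r : R) (f g h : rV -> R).

(** The squared norm is O(t), so the norm itself is O(sqrt t), which is enough for convergence to
    0. *)
Definition L2small (F : R -> rV -> R) : Prop :=
  exists2 C : R, 0 <= C & forall t, 0 < t -> t <= 1 ->
    sq_int mu (F t) /\ (sqnorm mu (F t) <= (C * t)%:E)%E.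

Lemma L2small_lin a F G : L2small F -> L2small G ->
  L2small (fun t x => a * F t x + G t x).
Proof.
move=> [C C0 hF] [D D0 hG]; exists (2 * (a ^+ 2 * C) + 2 * D).
  by apply: addr_ge0; apply: mulr_ge0 => //; exact: mulr_ge0 (sqr_ge0 a) C0.
move=> t t0 t1; have [sF bF] := hF t t0 t1; have [sG bG] := hG t t0 t1.
split; first exact: sq_int_lin.
have [mF _] := sF; have [mG _] := sG.
have maF : measurable_fun [set: rV] (fun x => a * F t x).
  by apply: measurable_funM => //; exact: measurable_cst.
have -> : ((2 * (a ^+ 2 * C) + 2 * D) * t)%:E =
    (2%:E * ((a ^+ 2)%:E * (C * t)%:E) + 2%:E * (D * t)%:E)%E.
  by rewrite -[RHS]/((2 * (a ^+ 2 * (C * t)) + 2 * (D * t))%:E); congr EFin; ring.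
apply: le_trans (sqnormD_le mu maF mG) _; rewrite sqnormZ//; apply: leeD.
  by rewrite lee_wpmul2l ?lee_fin// lee_wpmul2l ?lee_fin ?sqr_ge0.
by rewrite lee_wpmul2l ?lee_fin.
Qed.

Lemma L2small_damp m F : L2small F -> L2small (fun t x => damp m t x * F t x).
Proof.
move=> [C C0 hF]; exists C => // t t0 t1; have [sF bF] := hF t t0 t1.
split; first exact: (sq_int_damp _ (ltW t0)).
exact: le_trans (sqnorm_damp _ _ (ltW t0)) bF.
Qed.

Lemma L2small_heat F : L2small F -> L2small (fun t => heat_op t (F t)).
Proof.
move=> [C C0 hF]; exists C => // t t0 t1; have [sF bF] := hF t t0 t1.
split; first exact: sq_int_heat_op.
exact: le_trans (heat_op_contr t0 sF) bF.
Qed.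

Lemma sqnorm_ball (L M : R) f : 0 <= L -> 0 <= M ->
  (forall x, `|f x| <= M * ball_ind L x) ->
  (sqnorm mu f <= (M ^+ 2 * (2 * L) ^+ n)%:E)%E.
Proof.
move=> L0 M0 hf; rewrite EFinM -(integral_norm_ball L0).
rewrite -(ge0_integralZ _ (sqr_ge0 M)) => [||x]; last by rewrite lee_fin.
  apply: le_integral_nn => x _; first by rewrite lee_fin sqr_ge0.
  rewrite -EFinM lee_fin -(real_normK (num_real (f x))).
  have : `|f x| ^+ 2 <= (M * ball_ind L x) ^+ 2 by rewrite lerXn2r ?nnegrE ?mulr_ge0 ?ball_ind_ge0.
  by rewrite exprMn /ball_ind; case: (`|x| <= L); rewrite ?expr1n ?expr0n.
by apply/measurable_EFinP; apply: measurable_ball_ind; [exact: measurable_cst|exact: measurable_id].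
Qed.

Lemma sq_int_ball (L M : R) f : 0 <= L -> 0 <= M -> measurable_fun [set: rV] f ->
  (forall x, `|f x| <= M * ball_ind L x) -> sq_int mu f.
Proof.
by move=> L0 M0 mf hf; split => //; apply: le_lt_trans (sqnorm_ball L0 M0 hf) (ltry _).
Qed.

Lemma L2small_ball (L M : R) (F : R -> rV -> R) : 0 <= L -> 0 <= M ->
  (forall t, measurable_fun [set: rV] (F t)) ->
  (forall t x, 0 < t -> `|F t x| <= t * (M * ball_ind L x)) -> L2small F.
Proof.
move=> L0 M0 mF hF; exists (M ^+ 2 * (2 * L) ^+ n) => [|t t0 t1].
  by rewrite mulr_ge0 ?sqr_ge0// exprn_ge0// mulr_ge0.
have tM : 0 <= t * M by rewrite mulr_ge0// ltW.
have h x : `|F t x| <= t * M * ball_ind L x by rewrite -mulrA hF.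
split; first exact: (sq_int_ball L0 tM).
apply: le_trans (sqnorm_ball L0 tM h) _; rewrite lee_fin exprMn -!mulrA [leRHS]mulrC -mulrA.
have t2 : t ^+ 2 <= t by rewrite expr2 ler_piMr// ltW.
have P : 0 <= M ^+ 2 * (2 * L) ^+ n by rewrite mulr_ge0 ?sqr_ge0// exprn_ge0// mulr_ge0.
by rewrite mulrA [leRHS]mulrC -mulrA [leRHS]mulrC -mulrA; nra.
Qed.

Lemma nsq_le x (L : R) : `|x| <= L -> nsq x <= n%:R * L ^+ 2.
Proof.
move=> xL; have L0 : 0 <= L by apply: le_trans xL.
have -> : n%:R * L ^+ 2 = \sum_(i < n) L ^+ 2 by rewrite sumr_const card_ord mulr_natl.
apply: ler_sum => i _; rewrite -expr2 -(real_normK (num_real (x ord0 i))).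
by rewrite lerXn2r ?nnegrE// (le_trans (rV_norm_coor x i)).
Qed.

Lemma pot_le m x (L : R) : `|x| <= L -> pot m x <= (n%:R * L ^+ 2) ^+ m.
Proof.
move=> xL; have h := nsq_le xL; have h0 := nsq_ge0 x.
by rewrite /pot lerXn2r ?nnegrE// (le_trans h0).
Qed.

Lemma exp_taylor1 (u : R) : 0 <= u -> `|1 - expR (- u)| <= u.
Proof.
move=> u0; have := expR_ge1Dx (- u).
have : expR (- u) <= 1 by rewrite -[leRHS]expR0 ler_expR oppr_le0.
by move=> h1 h2; rewrite ger0_norm; lra.
Qed.

Lemma exp_taylor2 (u : R) : 0 <= u -> `|1 - expR (- u) - u| <= u ^+ 2.
Proof.
move=> u0; have h1 := expR_ge1Dx (- u); have h2 := expR_ge1Dx u.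
have e : expR u * expR (- u) = 1 by rewrite -expRD subrr expR0.
have h4 : 0 < expR (- u) by exact: expR_gt0.
have h3 : expR (- u) * (1 + u) <= 1 by rewrite -[leRHS]e [leRHS]mulrC ler_wpM2l// ltW.
by rewrite ler0_norm; [nra|lra].
Qed.

Lemma lipschitz_pow (a b W : R) m : 0 <= a <= W -> 0 <= b <= W ->
  `|a ^+ m - b ^+ m| <= m%:R * W ^+ m.-1 * `|a - b|.
Proof.
move=> /andP[a0 aW] /andP[b0 bW]; rewrite subrXX normrM mulrC.
rewrite ler_wpM2r// ger0_norm; last by rewrite sumr_ge0// => i _; rewrite mulr_ge0 ?exprn_ge0.
have -> : m%:R * W ^+ m.-1 = \sum_(i < m) W ^+ m.-1 by rewrite sumr_const card_ord mulr_natl.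
apply: ler_sum => i _; have W0 : 0 <= W by apply: le_trans aW.
have -> : W ^+ m.-1 = W ^+ (m - i.+1) * W ^+ i.
  by rewrite -exprD subnS -subnS; congr (_ ^+ _); have := ltn_ord i; case: m i => [[]//|m i] /= h; rewrite subSS subnK.
have -> : (m.-1 - i = m - i.+1)%N by rewrite -subn1 -subnDA add1n.
by apply: ler_pM; rewrite ?exprn_ge0 ?lerXn2r ?nnegrE.
Qed.

Lemma pot_lipschitz m (L : R) : 0 <= L -> exists2 K : R, 0 <= K &
  forall x z, `|x| <= L -> `|z| <= L -> `|pot m z - pot m x| <= K * `|z - x|.
Proof.
move=> L0; pose W := n%:R * L ^+ 2; have W0 : 0 <= W by rewrite mulr_ge0// sqr_ge0.
exists (m%:R * W ^+ m.-1 * (n%:R * (2 * L))) => [|x z xL zL].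
  by rewrite !mulr_ge0// exprn_ge0.
apply: le_trans (lipschitz_pow m (W := W) _ _) _; rewrite ?nsq_ge0 ?nsq_le//.
rewrite -[leRHS]mulrA ler_wpM2l ?mulr_ge0 ?exprn_ge0// /nsq /dotv -sumrB.
apply: le_trans (ler_norm_sum _ _ _) _.
have -> : n%:R * (2 * L) * `|z - x| = \sum_(i < n) (2 * L * `|z - x|).
  by rewrite sumr_const card_ord -mulrA mulr_natl.
apply: ler_sum => i _; have -> : z ord0 i * z ord0 i - x ord0 i * x ord0 i =
   (z ord0 i + x ord0 i) * (z - x) ord0 i by rewrite !mxE; ring.
rewrite normrM; apply: ler_pM => //; last exact: rV_norm_coor.
apply: le_trans (ler_normD _ _) _; have := rV_norm_coor z i; have := rV_norm_coor x i; lra.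
Qed.

Lemma laplacian_ball f (L : R) : test_function f ->
  (forall s x, L < `|x| -> iterated_partial s f x = 0) ->
  exists2 M : R, 0 <= M & forall x, `|laplacian f x| <= M * ball_ind L x.
Proof.
move=> tf hL; pose M i := sval (cid2 (test_bounded [:: i; i] tf)).
have M0 i : 0 <= M i by rewrite /M; case: cid2.
have hM i x : `|iterated_partial [:: i; i] f x| <= M i by rewrite /M; case: cid2 => /= ? _; apply.
exists (\sum_i M i) => [|x]; first by rewrite sumr_ge0.
rewrite /ball_ind; have [xL|Lx] := leP `|x| L.
  by rewrite mulr1; apply: le_trans (ler_norm_sum _ _ _) _; apply: ler_sum => i _.
by rewrite mulr0 /laplacian big1 ?normr0// => i _; exact: hL.
Qed.

Lemma test_ball f (L : R) : test_function f ->
  (forall s x, L < `|x| -> iterated_partial s f x = 0) ->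
  exists2 M : R, 0 <= M & forall x, `|f x| <= M * ball_ind L x.
Proof.
move=> tf hL; have [M M0 hM] := test_bounded [::] tf; exists M => // x.
rewrite /ball_ind; have [xL|Lx] := leP `|x| L; first by rewrite mulr1; exact: hM.
have -> : f x = 0 by exact: (hL [::]).
by rewrite mulr0 normr0.
Qed.

Lemma measurable_laplacian f : test_function f -> measurable_fun [set: rV] (laplacian f).
Proof.
by move=> tf; apply: measurable_sum => i; exact: (measurable_test [:: i; i] tf).
Qed.

Lemma pot_test_ball m f (L M : R) k : 0 <= M -> (forall x, `|f x| <= M * ball_ind L x) ->
  forall x, pot m x ^+ k * `|f x| <= (n%:R * L ^+ 2) ^+ m ^+ k * M * ball_ind L x.
Proof.
move=> M0 hf x; have := hf x; rewrite /ball_ind; have [xL|Lx] := leP `|x| L => h.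
  rewrite mulr1 in h; rewrite mulr1; have p := pot_le m xL; have p0 := pot_ge0 m x.
  by apply: ler_pM => //; [rewrite exprn_ge0|rewrite lerXn2r ?nnegrE// (le_trans p0)].
have -> : `|f x| = 0 by apply/eqP; rewrite eq_le normr_ge0 andbT (le_trans h)// mulr0.
by rewrite !mulr0.
Qed.

Lemma sq_int_test f : test_function f -> sq_int mu f.
Proof.
move=> tf; have [L L0 hL] := test_support tf; have [M M0 hM] := test_ball tf hL.
exact: (sq_int_ball L0 M0 (measurable_test [::] tf)).
Qed.

Lemma sq_int_laplacian f : test_function f -> sq_int mu (laplacian f).
Proof.
move=> tf; have [L L0 hL] := test_support tf; have [M M0 hM] := laplacian_ball tf hL.
exact: (sq_int_ball L0 M0 (measurable_laplacian tf)).
Qed.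

Lemma sq_int_pot_test m f : test_function f -> sq_int mu (fun x => pot m x * f x).
Proof.
move=> tf; have [L L0 hL] := test_support tf; have [M M0 hM] := test_ball tf hL.
have W0 : 0 <= (n%:R * L ^+ 2) ^+ m ^+ 1 * M by rewrite mulr_ge0// !exprn_ge0// mulr_ge0// sqr_ge0.
apply: (sq_int_ball L0 W0) => [|x].
  by apply: measurable_funM; [exact: measurable_pot|exact: (measurable_test [::] tf)].
by rewrite normrM ger0_norm ?pot_ge0//; exact: (pot_test_ball m 1 M0 hM).
Qed.

Lemma heat_op_small f (L K : R) : 0 <= L -> 0 <= K -> sq_int mu f ->
  (forall x y, `|f (x + y) - f x| <= K * (`|y| * ball_ind (L + `|y|) x)) ->
  L2small (fun t x => heat_op t f x - f x).
Proof.
move=> L0 K0 sf hf; have [C C0 hC] := kernel_sqnorm (n := n) 1 L0.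
exists (K ^+ 2 * C) => [|t t0 t1]; first by rewrite mulr_ge0// sqr_ge0.
split.
  have := sq_int_lin (-1) sf (sq_int_heat_op t0 sf).
  by under eq_fun do rewrite mulN1r addrC.
rewrite -[in (_ * t)](expr1 t); apply: hC => // x.
have h1 : hE t (fun y => f (x + y)) (heat_op t f x).
  by split; [exact: heat_integrable|rewrite heat_opE].
have := hE_lin (-1) (hE_cst (f x) t0) h1; rewrite mulN1r addrC => h2.
apply: (hE_le t0 h2) => y; rewrite addrC expr1; exact: hf.
Qed.

(** With chi = t^{-1}(1 - damp) f and psi = V f / 2, the defect is an exact sum of six small terms:
    chi - psi, the Taylor remainder of the heat operator, (1 - damp) Laplacian f, the heat image of
    chi - psi, the heat increment of psi, and (damp - 1) psi. *)
Lemma split_op_consistent m f : test_function f ->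
  L2small (fun t x => t^-1 * (f x - split_op m t f x) - schrodinger_expr m f x).
Proof.
move=> tf; have [L L0 hL] := test_support tf.
have [M M0 hM] := test_ball tf hL; have [N N0 hN] := laplacian_ball tf hL.
have mf : measurable_fun [set: rV] f := measurable_test [::] tf.
have mp := measurable_pot (R := R) (n := n) m.
have md t := measurable_damp (R := R) (n := n) m t.
have mlap := measurable_laplacian tf.
pose W := (n%:R * L ^+ 2) ^+ m.
have W0 : 0 <= W by rewrite exprn_ge0// mulr_ge0// sqr_ge0.
pose psi x := pot m x / 2 * f x.
have mpsi : measurable_fun [set: rV] psi.
  by apply: measurable_funM => //; apply: measurable_funM => //; exact: measurable_cst.
pose chi t x := t^-1 * ((1 - damp m t x) * f x).
have mchi t : measurable_fun [set: rV] (chi t).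
  apply: measurable_funM; first exact: measurable_cst.
  by apply: measurable_funM => //; apply: measurable_funB => //; exact: measurable_cst.
have p0 x := pot_ge0 m x.
have S1 : L2small (fun t x => chi t x - psi x).
  apply: (@L2small_ball L (W ^+ 2 * M)) => //.
  - by rewrite mulr_ge0// exprn_ge0.
  - by move=> t; apply: measurable_funB.
  move=> t x t0; have u0 : 0 <= t / 2 * pot m x by rewrite mulr_ge0// divr_ge0// ltW.
  have -> : chi t x - psi x = t^-1 * ((1 - damp m t x - t / 2 * pot m x) * f x).
    by rewrite /chi /psi; field; rewrite gt_eqF.
  rewrite !normrM ger0_norm ?invr_ge0 ?(ltW t0)// ler_pdivrMl//.
  apply: (@le_trans _ _ ((t / 2 * pot m x) ^+ 2 * `|f x|)).
    by rewrite ler_wpM2r//; exact: exp_taylor2.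
  have := pot_test_ball m 2 M0 hM x; rewrite -/W => h.
  apply: (@le_trans _ _ (t ^+ 2 * (pot m x ^+ 2 * `|f x|))).
    have : 0 <= t ^+ 2 * (pot m x ^+ 2 * `|f x|).
      exact: mulr_ge0 (sqr_ge0 t) (mulr_ge0 (sqr_ge0 _) (normr_ge0 _)).
    have -> : (t / 2 * pot m x) ^+ 2 * `|f x| = 4^-1 * (t ^+ 2 * (pot m x ^+ 2 * `|f x|)) by field.
    by lra.
  by rewrite expr2 -mulrA; do 2 (rewrite ler_wpM2l ?(ltW t0)//).
have S2 : L2small (fun t x => t^-1 * (heat_op t f x - f x - t * laplacian f x)).
  have [L' L'0 [K K0 hK]] := heat_op_taylor tf.
  have [C C0 hC] := kernel_sqnorm (n := n) 3 L'0.
  exists (K ^+ 2 * C) => [|t t0 t1]; first by rewrite mulr_ge0// sqr_ge0.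
  have sG : sq_int mu (fun x => heat_op t f x - f x - t * laplacian f x).
    have s1 := sq_int_lin (-1) (sq_int_test tf) (sq_int_heat_op t0 (sq_int_test tf)).
    have := sq_int_lin (- t) (sq_int_laplacian tf) s1.
    by congr sq_int; apply/funext => x; ring.
  split.
    have := sq_int_lin (t^-1) sG (sq_int0 mu).
    by under eq_fun do rewrite addr0.
  rewrite sqnormZ; last by case: sG.
  have := hC t K _ t0 t1 K0 (fun x => hK t x t0); rewrite -/(sqnorm _ _) => h.
  apply: le_trans (lee_wpmul2l _ h) _; first by rewrite lee_fin sqr_ge0.
  rewrite -EFinM lee_fin le_eqVlt; apply/orP; left; apply/eqP; field.
  by rewrite gt_eqF.
have S3 : L2small (fun t x => (1 - damp m t x) * laplacian f x).
  apply: (@L2small_ball L (W * N)) => //.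
  - by rewrite mulr_ge0.
  - by move=> t; apply: measurable_funM => //; apply: measurable_funB => //; exact: measurable_cst.
  move=> t x t0; have u0 : 0 <= t / 2 * pot m x by rewrite mulr_ge0// divr_ge0// ltW.
  have := pot_test_ball m 1 N0 hN x; rewrite !expr1 -/W => h.
  rewrite normrM; apply: (@le_trans _ _ (t / 2 * pot m x * `|laplacian f x|)).
    by rewrite ler_wpM2r//; exact: exp_taylor1.
  have q : 0 <= pot m x * `|laplacian f x| by rewrite mulr_ge0.
  rewrite -!mulrA ler_wpM2l ?(ltW t0)// mulrA.
  by lra.
have [K K0 hK] := pot_lipschitz m L0; have [K1 K10 hK1] := test_lipschitz [::] tf.
have psi_sq : sq_int mu psi.
  have := sq_int_lin (2^-1) (sq_int_pot_test m tf) (sq_int0 mu).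
  by congr sq_int; apply/funext => x; rewrite /psi addr0; ring.
have S5 : L2small (fun t x => heat_op t psi x - psi x).
  apply: (@heat_op_small _ L (W * K1 + K * M)) => // [|x y].
    by rewrite addr_ge0// mulr_ge0.
  have f0 (z : rV) : L < `|z| -> f z = 0 by move=> Lz; exact: (hL [::]).
  have fM (z : rV) : `|f z| <= M.
    apply: le_trans (hM z) _; rewrite /ball_ind.
    by have [_|_] := leP `|z| L; rewrite ?mulr1 ?mulr0.
  have lf : `|f (x + y) - f x| <= K1 * `|y| by exact: hK1.
  have P : 0 <= W * K1 * `|y| by rewrite !mulr_ge0.
  have Q : 0 <= K * M * `|y| by rewrite !mulr_ge0.
  have pW (z : rV) : `|z| <= L -> pot m z <= W by exact: pot_le.
  rewrite /ball_ind; have [xLy|Lx] := leP `|x| (L + `|y|); last first.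
    have xy : L < `|x + y| by exact: far_add Lx _.
    have xL : L < `|x| by apply: le_lt_trans Lx; rewrite lerDl.
    by rewrite /psi !f0// !mulr0 subrr normr0.
  rewrite mulr1 mulrDl; have [xy|xy] := leP `|x + y| L; have [xL|xL] := leP `|x| L.
  - have -> : psi (x + y) - psi x = 2^-1 * (pot m (x + y) * (f (x + y) - f x) + (pot m (x + y) - pot m x) * f x).
      by rewrite /psi; field.
    rewrite normrM ger0_norm ?invr_ge0//.
    have a1 : `|pot m (x + y) * (f (x + y) - f x)| <= W * K1 * `|y|.
      by rewrite normrM (ger0_norm (p0 _)) -mulrA; apply: ler_pM => //; exact: pW.
    have a2 : `|(pot m (x + y) - pot m x) * f x| <= K * M * `|y|.
      rewrite normrM mulrAC; apply: ler_pM => //.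
      by have := hK x (x + y) xL xy; rewrite [x + y - x]addrAC subrr add0r.
    have := ler_normD (pot m (x + y) * (f (x + y) - f x)) ((pot m (x + y) - pot m x) * f x); lra.
  - rewrite /psi (f0 x)// mulr0 subr0; rewrite (f0 x)// subr0 in lf.
    rewrite normrM ger0_norm ?divr_ge0//.
    have : pot m (x + y) * `|f (x + y)| <= W * (K1 * `|y|) by apply: ler_pM => //; exact: pW.
    have : 0 <= pot m (x + y) * `|f (x + y)| by rewrite mulr_ge0.
    by rewrite mulrA; lra.
  - rewrite /psi (f0 (x + y))// mulr0 sub0r normrN; rewrite (f0 (x + y))// sub0r normrN in lf.
    rewrite normrM ger0_norm ?divr_ge0//.
    have : pot m x * `|f x| <= W * (K1 * `|y|) by apply: ler_pM => //; exact: pW.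
    have : 0 <= pot m x * `|f x| by rewrite mulr_ge0.
    by rewrite mulrA; lra.
  - by rewrite /psi !f0// !mulr0 subrr normr0 addr_ge0.
have S6 : L2small (fun t x => (damp m t x - 1) * psi x).
  apply: (@L2small_ball L (W ^+ 2 * M)) => //.
  - by rewrite mulr_ge0// exprn_ge0.
  - by move=> t; apply: measurable_funM => //; apply: measurable_funB => //; exact: measurable_cst.
  move=> t x t0; have u0 : 0 <= t / 2 * pot m x by rewrite mulr_ge0// divr_ge0// ltW.
  have := pot_test_ball m 2 M0 hM x; rewrite -/W => h.
  rewrite normrM distrC; apply: (@le_trans _ _ (t / 2 * pot m x * `|psi x|)).
    by rewrite ler_wpM2r//; exact: exp_taylor1.
  rewrite /psi normrM (ger0_norm (x := pot m x / 2)) ?divr_ge0//.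
  have q : 0 <= pot m x ^+ 2 * `|f x| by exact: mulr_ge0 (sqr_ge0 _) (normr_ge0 _).
  have -> : t / 2 * pot m x * (pot m x / 2 * `|f x|) = t * (4^-1 * (pot m x ^+ 2 * `|f x|)) by field.
  by rewrite ler_wpM2l ?(ltW t0)//; lra.
have T4 := L2small_damp m (L2small_heat S1).
have := L2small_lin 1 S1 (L2small_lin (-1) (L2small_damp m S2)
  (L2small_lin 1 S3 (L2small_lin 1 T4 (L2small_lin 1 (L2small_damp m S5) S6)))).
move=> [C C0 hC]; exists C => // t t0 t1; have [] := hC t t0 t1.
have chi_sq : sq_int mu (chi t).
  have s1 := sq_int_lin (-1) (sq_int_damp m (ltW t0) (sq_int_test tf)) (sq_int_test tf).
  have := sq_int_lin (t^-1) s1 (sq_int0 mu).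
  by congr sq_int; apply/funext => x; rewrite /chi addr0; ring.
suff -> : (fun x => t^-1 * (f x - split_op m t f x) - schrodinger_expr m f x) =
  (fun x => 1 * (chi t x - psi x) +
     (-1 * (damp m t x * (t^-1 * (heat_op t f x - f x - t * laplacian f x))) +
      (1 * ((1 - damp m t x) * laplacian f x) +
       (1 * (damp m t x * heat_op t (fun y => chi t y - psi y) x) +
        (1 * (damp m t x * (heat_op t psi x - psi x)) + (damp m t x - 1) * psi x))))) by [].
apply/funext => x; rewrite /split_op.
have -> : heat_op t (fun y => damp m t y * f y) x = - t * heat_op t (chi t) x + heat_op t f x.
  rewrite -heat_op_lin//; last exact: sq_int_test.
  by congr heat_op; apply/funext => y; rewrite /chi; field; rewrite gt_eqF.
have -> : heat_op t (fun y => chi t y - psi y) x = heat_op t (chi t) x - heat_op t psi x.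
  rewrite -[RHS]addrC -mulN1r -heat_op_lin//.
  by congr (heat_op _ _ _); apply/funext => y; rewrite mulN1r addrC.
rewrite /schrodinger_expr enorm_pot /chi /psi.
move: (heat_op t (fun _ => _) x) (heat_op t _ x) (heat_op t f x) (damp m t x) (laplacian f x) => a b c d e.
by field; rewrite gt_eqF.
Qed.

End consistency.

(** * The product formula for the Schrödinger semigroup *)

Section test_space.
Context {R : realType} {n : nat}.
Local Notation rV := 'rV[R]_n.
Local Notation mu := (lebesgue_rV R n).
Implicit Types (f g : rV -> R) (i : 'I_n) (s : seq 'I_n) (a t : R).

Lemma iterated_partial_lin a f g s : smooth f -> smooth g ->
  iterated_partial s (fun x => a * f x + g x) =
  fun x => a * iterated_partial s f x + iterated_partial s g x.
Proof.
move=> sf sg; elim: s => //= i s ->; apply/funext => x; rewrite /partial_derivative.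
have df := (sf s).2 i x; have dg := (sg s).2 i x.
have -> : (fun x => a * iterated_partial s f x + iterated_partial s g x) =
  a *: iterated_partial s f + iterated_partial s g by apply/funext.
by rewrite deriveD ?deriveZ//; exact: derivableZ.
Qed.

Lemma smooth_lin a f g : smooth f -> smooth g -> smooth (fun x => a * f x + g x).
Proof.
move=> sf sg s; rewrite iterated_partial_lin//.
have [cf df] := sf s; have [cg dg] := sg s; split=> [x|i x].
  exact: (cvgD (cvgM (cvg_cst a) (cf x)) (cg x)).
have -> : (fun x => a * iterated_partial s f x + iterated_partial s g x) =
  a *: iterated_partial s f + iterated_partial s g by apply/funext.
by apply: derivableD => //; exact: derivableZ.
Qed.

Lemma compact_support_ball f (L : R) : (forall x, L < `|x| -> f x = 0) ->
  compact (closure [set x : rV | f x != 0]).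
Proof.
move=> f0; apply: bounded_closed_compact; last exact: closed_closure.
have sub : closure [set x : rV | f x != 0] `<=` [set x : rV | `|x| <= L].
  have cB : closed [set x : rV | `|x| <= L].
    rewrite (_ : [set x | _] = (fun x : rV => `|x|) @^-1` [set r | r <= L])//.
    by apply: closed_comp; [move=> x _; exact: norm_continuous|exact: closed_le].
  rewrite [X in _ `<=` X](iffLR (closure_id _) cB); apply: closure_subset => x /= fx.
  by rewrite leNgt; apply: contra fx => /f0 ->.
exists L; split; first exact: num_real.
by move=> r Lr x /sub /= xB; apply: (le_trans xB); exact: ltW.
Qed.

Lemma test_function_lin a f g : test_function f -> test_function g ->
  test_function (fun x => a * f x + g x).
Proof.
move=> tf tg; split; first exact: smooth_lin tf.1 tg.1.
have [L L0 hL] := test_support tf; have [M M0 hM] := test_support tg.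
apply: (@compact_support_ball _ (L + M)) => x Lx.
have -> : f x = 0 by apply: (hL [::]); apply: le_lt_trans Lx; rewrite lerDl.
have -> : g x = 0 by apply: (hM [::]); apply: le_lt_trans Lx; rewrite lerDr.
by rewrite mulr0 addr0.
Qed.

Lemma test_function0 : test_function (fun _ : rV => 0 : R).
Proof.
have E s : iterated_partial s (fun _ : rV => 0 : R) = cst 0.
  elim: s => //= i s ->; apply/funext => x; exact: derive_cst.
split; last by apply: (@compact_support_ball _ 0).
by move=> s; rewrite E; split => [x|i x]; [exact: cst_continuous|exact: derivable_cst].
Qed.

Lemma schrodinger_expr_lin m a f g : test_function f -> test_function g ->
  schrodinger_expr m (fun x => a * f x + g x) =
  fun x => a * schrodinger_expr m f x + schrodinger_expr m g x.
Proof.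
move=> tf tg; apply/funext => x; rewrite /schrodinger_expr.
have -> : laplacian (fun x => a * f x + g x) x = a * laplacian f x + laplacian g x.
  rewrite /laplacian mulr_sumr -big_split; apply: eq_bigr => i _ /=.
  have := iterated_partial_lin a [:: i; i] tf.1 tg.1 => /= ->; by [].
move: (enorm x ^+ (2 * m)) (laplacian f x) (laplacian g x) (f x) (g x) => b c d p q.
ring.
Qed.

Lemma sq_int_schrodinger_expr m f : test_function f -> sq_int mu (schrodinger_expr m f).
Proof.
move=> tf; have := sq_int_lin (-1) (sq_int_laplacian tf) (sq_int_pot_test m tf).
by congr sq_int; apply/funext => x; rewrite /schrodinger_expr enorm_pot mulN1r.
Qed.

Local Notation V := ((rV -> R) * (rV -> R))%type.
Local Notation L := (L2pair mu).
Local Notation ip := (ippair mu).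

Definition test_pair (v : V) : Prop := test_function v.1 /\ test_function v.2.

Lemma hnorm_pair_split (f1 f2 : rV -> R) (e : R) : 0 <= e -> sq_int mu f1 -> sq_int mu f2 ->
  (sqnorm mu f1 <= (e ^+ 2 / 2)%:E)%E -> (sqnorm mu f2 <= (e ^+ 2 / 2)%:E)%E ->
  hnorm ip (f1, f2) <= e.
Proof.
move=> e0 s1 s2 h1 h2; rewrite hnorm_pair_le//=.
move: h1 h2; rewrite -!sq_int_fineK// !lee_fin; lra.
Qed.

Lemma le_hnorm_pair (v w : V) : L v -> L w ->
  (sqnorm mu v.1 <= sqnorm mu w.1)%E -> (sqnorm mu v.2 <= sqnorm mu w.2)%E ->
  hnorm ip v <= hnorm ip w.
Proof.
move=> [v1 v2] [w1 w2]; rewrite -!sq_int_fineK// !lee_fin => h1 h2.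
by rewrite /hnorm ler_wsqrtr// lerD.
Qed.

Lemma split_semi_approx m :
  semi_approx L ip test_pair (pair_op (schrodinger_expr m)) (fun t => pair_op (split_op m t)).
Proof.
have sh := L2pair_semi_hilbert mu; split.
- by split; exact: test_function0.
- by move=> a x y [x1 x2] [y1 y2]; split; exact: test_function_lin.
- by move=> x [x1 x2]; split; exact: sq_int_test.
- by move=> x [x1 x2]; split; exact: sq_int_schrodinger_expr.
- move=> a x y [x1 x2] [y1 y2]; rewrite /pair_op.
  by congr pair; exact: schrodinger_expr_lin.
- by move=> t x t0 [x1 x2]; split; exact: sq_int_split_op.
- move=> t a x y t0 [x1 x2] [y1 y2]; rewrite /pair_op.
  by congr pair; exact: split_op_lin.
- move=> t x t0 [x1 x2]; apply: le_hnorm_pair => //=.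
  + by split; exact: sq_int_split_op.
  + exact: split_op_contr.
  + exact: split_op_contr.
- by move=> t x y t0 [x1 x2] [y1 y2]; rewrite /ippair /= !split_op_sym.
- move=> x e [x1 x2] e0.
  have [C1 C10 h1] := split_op_consistent m x1.
  have [C2 C20 h2] := split_op_consistent m x2.
  have e2 : 0 < e ^+ 2 / 2 by rewrite divr_gt0 ?exprn_gt0.
  have k1 : 0 < C1 + C2 + 1 by rewrite ltr_wpDl// addr_ge0.
  exists (Num.min 1 (e ^+ 2 / 2 / (C1 + C2 + 1))) => [|t t0].
    by rewrite lt_min ltr01 divr_gt0.
  rewrite lt_min => /andP[t1]; rewrite ltr_pdivlMr// => tC.
  have [s1 b1] := h1 t t0 (ltW t1); have [s2 b2] := h2 t t0 (ltW t1).
  apply: (hnorm_pair_split (ltW e0) s1 s2).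
    by apply: (le_trans b1); rewrite lee_fin; nra.
  by apply: (le_trans b2); rewrite lee_fin; nra.
Qed.

(** The distributional definition tests real and imaginary parts separately; pairs with one
    component zero translate between it and the adjoint relation for [ippair]. *)
Lemma schrodinger_pair_generator m (S : R -> (rV -> R[i]) -> rV -> R[i]) :
  schrodinger_semigroup m S -> forall x g : V,
  semi_generator L ip (pair_semigroup S) x g <->
  [/\ L x, L g & forall phi, test_pair phi ->
     ip x (pair_op (schrodinger_expr m) phi) = - ip g phi].
Proof.
move=> [c0 hS] x g; rewrite pair_semigroup_generator// hS.
have Lc v : L v <-> L2 (cfun_of v) by rewrite L2_pairP cfun_ofK.
have ip2N (f h : rV -> R) : sq_int mu f -> sq_int mu h ->
    ip2 mu (fun y => - f y) h = - ip2 mu f h.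
  move=> sf sh'; rewrite /ip2 -mulN1r -RintegralZl//; last exact: sq_int_mul.
  by apply: eq_Rintegral => y _; rewrite mulN1r mulNr.
have ip20 (f : rV -> R) : ip2 mu f (fun=> 0) = 0.
  by rewrite /ip2 /Rintegral; under eq_integral do rewrite mulr0; rewrite integral0.
have H0 : schrodinger_expr m (fun _ : rV => 0 : R) = fun=> 0.
  apply/funext => y; rewrite /schrodinger_expr mulr0 addr0 /laplacian big1 ?oppr0// => i _.
  rewrite /= /partial_derivative (_ : 'D_(delta_mx ord0 i) (fun _ : rV => 0 : R) = cst 0) ?derive_cst//.
  by apply/funext => z; exact: derive_cst.
have LN : L2 (fun y => - cfun_of g y) <-> L g.
  rewrite L2_pairP; split=> h.
    have := shN (L2pair_semi_hilbert mu) h; congr L.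
    by rewrite /cfun_of /pair_of /=; case: (g) => g1 g2; congr pair; apply/funext => y /=; exact: opprK.
  by have := shN (L2pair_semi_hilbert mu) h.
split.
  move=> [Lx /LN Lg h]; split; [exact/Lc|exact: Lg|].
  move=> phi [p1 p2]; have [e1 _] := h _ p1; have [_ e2] := h _ p2.
  rewrite /ippair /= opprD -(ip2N _ _ Lg.1 (sq_int_test p1)) -(ip2N _ _ Lg.2 (sq_int_test p2)); congr (_ + _); first exact: e1.
  exact: e2.
move=> [Lx Lg h]; split; [exact/Lc|exact/LN|] => phi tp.
have h1 : ip x (pair_op (schrodinger_expr m) (phi, fun=> 0)) = - ip g (phi, fun=> 0).
  by apply: h; split => //; exact: test_function0.
have h2 : ip x (pair_op (schrodinger_expr m) (fun=> 0, phi)) = - ip g (fun=> 0, phi).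
  by apply: h; split => //; exact: test_function0.
move: h1 h2; rewrite /ippair /= H0 !ip20 !addr0 !add0r.
rewrite -(ip2N _ _ Lg.1 (sq_int_test tp)) -(ip2N _ _ Lg.2 (sq_int_test tp)) => h1 h2.
by split; [exact: h1|exact: h2].
Qed.

(** The bridge from the generator, through which the semigroup is given, to explicit path
    integrals. *)
Lemma schrodinger_chernoff m (S : R -> (rV -> R[i]) -> rV -> R[i]) :
  schrodinger_semigroup m S -> forall (f : V) (s e : R), L f -> 0 < s -> 0 < e ->
  exists k0 : nat, forall k, (k0 <= k)%N ->
    hnorm ip (iter (2 ^ k) (pair_op (split_op m (s / (2 ^ k)%:R))) f - pair_semigroup S s f) <= e.
Proof.
move=> hS; apply: (chernoff_limit (L2pair_semi_hilbert mu) (pair_semigroup_c0 hS.1)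
  (split_semi_approx m)).
exact: schrodinger_pair_generator.
Qed.

End test_space.

(** * Cauchy estimates and functionals killing polynomials *)

Section cauchy_estimate.
Variable R : realType.
Local Notation C := R[i].
Implicit Types (z w : C) (p q : {poly R}).
Import ComplexField.Normc.

Lemma normc_ge0 z : 0 <= normc z.
Proof. by case: z => a b; exact: sqrtr_ge0. Qed.

Lemma normcX z k : normc (z ^+ k) = normc z ^+ k.
Proof. by elim: k => [|k IH]; rewrite ?expr0 ?normc1// !exprS normcM IH. Qed.

Lemma normc_real (a : R) : normc a%:C%C = `|a|.
Proof. by rewrite /normc /= expr0n /= addr0 sqrtr_sqr. Qed.

Lemma normc_sum (I : Type) (s : seq I) (F : I -> C) :
  normc (\sum_(i <- s) F i) <= \sum_(i <- s) normc (F i).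
Proof.
elim: s => [|i s IH]; first by rewrite !big_nil normc0.
by rewrite !big_cons; apply: le_trans (le_normcD _ _) _; rewrite lerD2l.
Qed.

Lemma normc_natr k : normc (k%:R : C) = k%:R.
Proof.
have -> : (k%:R : C) = (k%:R : R)%:C%C by rewrite rmorph_nat.
by rewrite normc_real ger0_norm.
Qed.

Lemma prim_root_2X k : exists z : C, (2 ^ k.+1).-primitive_root z.
Proof.
have [z zk] : exists z : C, z ^+ (2 ^ k) = -1.
  elim: k => [|k [z zk]]; first by exists (-1); rewrite expr1.
  by exists (sqrtC z); rewrite expnS exprM sqrtCK.
exists z; have z1 : z ^+ (2 ^ k.+1) = 1 by rewrite expnSr exprM zk sqrrN expr1n.
have [d dz] := prim_order_exists (expn_gt0 2 k.+1) z1.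
move=> /(dvdn_pfactor _ _ (isT : prime 2))[j jk dE]; move: jk.
rewrite leq_eqVlt => /orP[/eqP jE|jk]; first by rewrite -jE -dE.
have : z ^+ (2 ^ k) = 1.
  apply/eqP; rewrite -(prim_order_dvd dz) dE; exact: dvdn_exp2l.
rewrite zk => /eqP; rewrite eq_sym -subr_eq0 opprK -mulr2n pnatr_eq0//.
Qed.

Lemma sum_prim_root N z r : (0 < N)%N -> N.-primitive_root z ->
  \sum_(j < N) z ^+ (r * j) = if (N %| r)%N then N%:R else 0.
Proof.
move=> N0 pz; case: ifPn => [/dvdnP[k ->]|Nr].
  rewrite (eq_bigr (fun=> 1)) => [|j _]; first by rewrite sumr_const card_ord.
  by rewrite -mulnA mulnCA exprM (prim_expr_order pz) expr1n.
have zr : z ^+ r - 1 != 0 by rewrite subr_eq0 -(prim_order_dvd pz).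
apply: (mulfI zr); rewrite mulr0.
under eq_bigr do rewrite exprM.
by rewrite -subrX1 -exprM mulnC exprM (prim_expr_order pz) expr1n subrr.
Qed.

(** The Cauchy integral is replaced by the average over the N-th roots of unity, which is exact once
    N exceeds the size of p. Taking N a power of 2 makes a primitive root available by repeated
    square roots. *)
Lemma cauchy_coef (p : {poly C}) (rho M : R) (i : nat) : 0 <= rho ->
  (forall z, normc z <= rho -> normc p.[z] <= M) -> normc p`_i * rho ^+ i <= M.
Proof.
move=> rho0 pM; have M0 : 0 <= M.
  by apply: le_trans (normc_ge0 _) (pM 0 _); rewrite normc0.
have [ip|/(nth_default 0) ->] := ltnP i (size p); last by rewrite normc0 mul0r.
have [z] := prim_root_2X (size p); set N := (2 ^ (size p).+1)%N => pz.
have pN : (size p < N)%N.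
  by apply: (@leq_trans (2 ^ size p)%N); [exact: ltn_expl|rewrite leq_exp2l].
have N0 : (0 < N)%N by rewrite expn_gt0.
have iN : (i < N)%N := ltn_trans ip pN.
have nz : normc z = 1.
  have h : normc z ^+ N = 1 by rewrite -normcX prim_expr_order// normc1.
  by apply/eqP; rewrite -(pexpr_eq1 (n := N)) ?h ?normc_ge0.
have E : \sum_(j < N) p.[rho%:C%C * z ^+ j] * z ^+ ((N - i) * j) =
    N%:R * (p`_i * rho%:C%C ^+ i).
  under eq_bigr => j _.
    rewrite horner_coef mulr_suml.
    under eq_bigr => l _.
      rewrite exprMn -exprM [(j * l)%N]mulnC mulrA -mulrA -exprD -mulnDl.
      over.
    over.
  rewrite exchange_big /=.
  under eq_bigr => l _ do rewrite -mulr_sumr sum_prim_root//.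
  rewrite (bigD1 (Ordinal ip))//= big1 ?addr0 => [|l li].
    by rewrite subnKC ?(ltnW iN)// dvdnn mulrC.
  case: ifPn => [|_]; last by rewrite mulr0.
  rewrite addnBA ?(ltnW iN)//.
  have lN : (l < N)%N := ltn_trans (ltn_ord l) pN.
  have [il|li'] := leqP i l.
    rewrite -addnBAC// dvdn_addl// => h; move: li; rewrite -val_eqE /=.
    have : (l - i)%N = 0%N.
      by apply/eqP; move: h; apply: contraTT; rewrite -lt0n => h; rewrite gtnNdvd// (leq_ltn_trans (leq_subr _ _)).
    by move=> /eqP; rewrite subn_eq0 => li2; rewrite eqn_leq li2 il.
  move=> h; exfalso; move: h; rewrite gtnNdvd//.
    by move: (N) iN lN li' => N'; lia.
  by move: (N) iN lN li' => N'; lia.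
have : normc (N%:R * (p`_i * rho%:C%C ^+ i)) <= N%:R * M.
  rewrite -E; apply: le_trans (normc_sum _ _) _.
  have -> : N%:R * M = \sum_(j < N) M by rewrite sumr_const card_ord mulr_natl.
  apply: ler_sum => j _; rewrite normcM !normcX nz expr1n mulr1; apply: pM.
  by rewrite normcM normcX nz expr1n mulr1 normc_real ger0_norm.
rewrite !normcM normc_natr normcX normc_real ger0_norm// ler_pM2l// ltr0n//.
Qed.

End cauchy_estimate.

Section annihilating_functional.
Variable R : realType.
Local Notation C := R[i].
Implicit Types (z w : C) (p q : {poly R}) (x y rho M B : R) (s : seq (R * R)).
Import ComplexField.Normc.

Definition cpoly p : {poly C} := map_poly (real_complex R) p.

(** A finite signed measure on the line, as a list of pairs of a weight and a node. *)
Definition linfun_seq s (phi : R -> R) : R := \sum_(wz <- s) wz.1 * phi wz.2.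

Definition kills s (D : nat) : Prop :=
  forall k, (k <= D)%N -> linfun_seq s (fun x => x ^+ k) = 0.

(** For nodes in |x| <= rho / 2, twice this number bounds the action of the measure on the Taylor
    remainder of order D + 1 of a function bounded by 1 on the disc of radius rho. *)
Definition tail_weight s (D : nat) rho : R :=
  \sum_(wz <- s) `|wz.1| * (`|wz.2| / rho) ^+ D.+1.

Lemma tail_weight_ge0 s D rho : 0 <= rho -> 0 <= tail_weight s D rho.
Proof.
by move=> r0; apply: sumr_ge0 => wz _; rewrite mulr_ge0// exprn_ge0// divr_ge0.
Qed.

Lemma geometric_tail (r : R) (D n : nat) : 0 <= r -> r <= 2^-1 ->
  \sum_(D <= i < n) r ^+ i <= 2 * r ^+ D.
Proof.
move=> r0 r2; have [nD|Dn] := leqP n D.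
  by rewrite big_geq// mulr_ge0// exprn_ge0.
rewrite -{1}[D]add0n big_addn.
under eq_bigr do rewrite exprD.
rewrite -mulr_suml ler_wpM2r ?exprn_ge0// big_mkord.
have h : 0 < 1 - r by lra.
rewrite -(ler_pM2l h) -opprB mulNr -subrX1 opprB.
have := exprn_ge0 (n - D) r0; lra.
Qed.

(** The terms of degree at most D are killed. The others are bounded by Cauchy's estimate |p_i| <= M
    rho^{-i} and a geometric series of ratio at most 1/2. *)
Lemma functional_poly s D p rho M : 0 < rho -> kills s D ->
  (forall wz, wz \in s -> `|wz.2| <= rho / 2) ->
  (forall z, normc z <= rho -> normc (cpoly p).[z] <= M) ->
  `|linfun_seq s (fun x => p.[x])| <= 2 * tail_weight s D rho * M.
Proof.
move=> rho0 kD sr pM; have M0 : 0 <= M.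
  by apply: le_trans (normc_ge0 _) (pM 0 _); rewrite normc0 ltW.
have coef i : `|p`_i| * rho ^+ i <= M.
  have := cauchy_coef i (ltW rho0) pM.
  by rewrite coef_map normc_real.
have E : linfun_seq s (fun x => p.[x]) =
    \sum_(wz <- s) wz.1 * \sum_(D.+1 <= i < size p) p`_i * wz.2 ^+ i.
  transitivity (\sum_(i < size p) p`_i * linfun_seq s (fun x => x ^+ i)).
    rewrite /linfun_seq; under eq_bigr do rewrite horner_coef mulr_sumr.
    rewrite exchange_big; apply: eq_bigr => i _ /=; rewrite mulr_sumr.
    by apply: eq_bigr => wz _; rewrite mulrCA.
  under [RHS]eq_bigr do rewrite mulr_sumr.
  rewrite [RHS]exchange_big /= -(big_mkord xpredT (fun i => p`_i * linfun_seq s (fun x => x ^+ i))).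
  have E2 i : \sum_(wz <- s) wz.1 * (p`_i * wz.2 ^+ i) = p`_i * linfun_seq s (fun x => x ^+ i).
    by rewrite /linfun_seq mulr_sumr; apply: eq_bigr => wz _; rewrite mulrCA.
  under [RHS]eq_bigr do rewrite E2.
  have [Dp|pD] := leqP D.+1 (size p).
    rewrite (big_cat_nat (n := D.+1))//= big1_seq ?add0r// => i.
    by rewrite mem_index_iota ltnS => /andP[_ /andP[_ iD]]; rewrite kD// mulr0.
  rewrite [RHS]big_geq ?(ltnW pD)// big1_seq// => i; rewrite mem_index_iota => /andP[_ /andP[_ ip]].
  by rewrite kD ?mulr0//; move: (leq_trans ip (ltnW pD)); rewrite ltnS.
rewrite E; apply: le_trans (ler_norm_sum _ _ _) _.
rewrite /tail_weight mulrAC mulr_sumr big_seq [leRHS]big_seq.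
apply: ler_sum => wz wzs; rewrite normrM.
set r := `|wz.2| / rho; have r0 : 0 <= r by rewrite divr_ge0// ltW.
have r2 : r <= 2^-1 by rewrite ler_pdivrMr// mulrC sr.
have -> : 2 * M * (`|wz.1| * r ^+ D.+1) = `|wz.1| * (M * (2 * r ^+ D.+1)) by ring.
rewrite ler_wpM2l//; apply: le_trans (ler_norm_sum _ _ _) _.
apply: le_trans (ler_wpM2l M0 (geometric_tail D.+1 (size p) r0 r2)).
rewrite mulr_sumr; apply: ler_sum => i _; rewrite normrM normrX.
have -> : `|wz.2| = r * rho by rewrite /r mulfVK// gt_eqF.
by rewrite exprMn mulrCA [leRHS]mulrC ler_wpM2l ?exprn_ge0.
Qed.

Lemma expR_pow_bounds x (K : nat) : (0 < K)%N -> `|x| < K%:R ->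
  expR x * (1 - x ^+ 2 / K%:R) <= (1 + x / K%:R) ^+ K <= expR x.
Proof.
move=> K0 xK; have k0 : 0 < K%:R :> R by rewrite ltr0n.
have up (u : R) : `|u| < K%:R -> (1 + u / K%:R) ^+ K <= expR u.
  move=> uK; have -> : expR u = expR (u / K%:R) ^+ K.
    by rewrite -expRM_natl mulrC mulfVK ?gt_eqF.
  have : -1 < u / K%:R by rewrite ltr_pdivlMr//; move: uK; rewrite ltr_norml => /andP[]; lra.
  by move=> h; rewrite lerXn2r ?nnegrE ?expR_ge0 ?expR_ge1Dx//; lra.
rewrite up// andbT.
have := up (- x); rewrite normrN => /(_ xK) h.
have xk1 : -1 < x / K%:R by rewrite ltr_pdivlMr//; move: xK; rewrite ltr_norml => /andP[]; lra.
have xk2 : x / K%:R < 1 by rewrite ltr_pdivrMr//; move: xK; rewrite ltr_norml => /andP[]; lra.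
have b : 1 - x ^+ 2 / K%:R <= (1 - (x / K%:R) ^+ 2) ^+ K.
  have y0 : 0 <= (x / K%:R) ^+ 2 by rewrite sqr_ge0.
  have y1 : (x / K%:R) ^+ 2 <= 1 by rewrite expr2; nra.
  have -> : x ^+ 2 / K%:R = K%:R * (x / K%:R) ^+ 2 by field; rewrite gt_eqF.
  move: ((x / K%:R) ^+ 2) y0 y1 => y y0 y1; elim: {K0 xK h up k0 xk1 xk2} K => [|K IH].
    by rewrite mul0r subr0.
  rewrite exprS -natr1; have : (1 - y) * (1 - K%:R * y) <= (1 - y) * (1 - y) ^+ K.
    by rewrite ler_wpM2l//; lra.
  have : 0 <= K%:R * y * y :> R by rewrite !mulr_ge0.
  by move: (K%:R : R) ((1 - y) ^+ K) => a c; nra.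
apply: (@le_trans _ _ (expR x * ((1 + x / K%:R) ^+ K * (1 - x / K%:R) ^+ K))).
  rewrite -exprMn (_ : (1 + x / K%:R) * (1 - x / K%:R) = 1 - (x / K%:R) ^+ 2); last by ring.
  by rewrite ler_wpM2l ?expR_ge0.
have p0 : 0 <= (1 + x / K%:R) ^+ K by rewrite exprn_ge0//; lra.
rewrite mulrCA ler_piMr//; apply: (@le_trans _ _ (expR x * expR (- x))).
  by rewrite ler_wpM2l ?expR_ge0// -mulNr.
by rewrite -expRD subrr expR0.
Qed.

Lemma cvg_pow_expR x : (1 + x / k.+1%:R) ^+ k.+1 @[k --> \oo] --> expR x.
Proof.
apply/cvgrPdist_le => e e0.
pose K0 := Num.bound (`|x| + expR x * x ^+ 2 / e).
have q0 : 0 <= expR x * x ^+ 2 / e.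
  exact: divr_ge0 (mulr_ge0 (expR_ge0 x) (sqr_ge0 x)) (ltW e0).
near=> k; have kK : `|x| + expR x * x ^+ 2 / e < k.+1%:R.
  apply: (lt_le_trans (archi_boundP _)).
    exact: addr_ge0.
  by rewrite ler_nat; apply: leqW; near: k; exact: nbhs_infty_ge.
have xk : `|x| < k.+1%:R by lra.
have /andP[h1 h2] := expR_pow_bounds (ltn0Sn k) xk.
rewrite ger0_norm ?subr_ge0//.
apply: (@le_trans _ _ (expR x * (x ^+ 2 / k.+1%:R))).
  by move: h1; move: (_ ^+ k.+1) (x ^+ 2 / _) => P a; lra.
rewrite mulrA ler_pdivrMr// mulrC -ler_pdivrMl// mulrC.
have := normr_ge0 x; lra.
Unshelve. all: by end_near.
Qed.

Lemma normc_pow_le w (K : nat) : (0 < K)%N ->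
  normc ((1 + w / K%:R) ^+ K) <= expR (complex.Re w + normc w ^+ 2 / (2 * K%:R)).
Proof.
move=> K0; have k0 : 0 < K%:R :> R by rewrite ltr0n.
rewrite normcX.
have -> : complex.Re w + normc w ^+ 2 / (2 * K%:R) =
    K%:R * ((complex.Re w + normc w ^+ 2 / (2 * K%:R)) / K%:R).
  by rewrite [RHS]mulrC mulfVK// gt_eqF.
rewrite expRM_natl lerXn2r ?nnegrE ?normc_ge0 ?expR_ge0//.
rewrite -(ler_pXn2r (n := 2)) ?nnegrE ?normc_ge0 ?expR_ge0// -expRM_natl.
case: w => a b; have -> : (a +i* b)%C / K%:R = ((a / K%:R) +i* (b / K%:R))%C.
  have kE : (K%:R : C) = (K%:R : R)%:C%C by rewrite rmorph_nat.
  by rewrite kE -fmorphV; apply/eqP; rewrite eq_complex /= !mulr0 subr0 add0r !eqxx.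
rewrite /normc /= add0r !sqr_sqrtr ?addr_ge0 ?sqr_ge0//.
apply: le_trans (expR_ge1Dx _).
rewrite le_eqVlt; apply/orP; left; apply/eqP; field; rewrite gt_eqF//.
Qed.

(** The polynomials (1 + q / K)^K have modulus at most exp(Re q + |q|^2 / (2 K)) on the disc, so the
    polynomial case applies to them. Letting K tend to infinity yields the exponential without any
    complex exponential function. *)
Lemma functional_expR s D q rho B : 0 < rho -> kills s D ->
  (forall wz, wz \in s -> `|wz.2| <= rho / 2) ->
  (forall z, normc z <= rho -> complex.Re (cpoly q).[z] <= B) ->
  `|linfun_seq s (fun x => expR q.[x])| <= 2 * tail_weight s D rho * expR B.
Proof.
move=> rho0 kD sr qB.
pose W := \sum_(i < size q) `|q`_i| * rho ^+ i.
have W0 : 0 <= W by rewrite sumr_ge0// => i _; rewrite mulr_ge0// exprn_ge0// ltW.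
have qW z : normc z <= rho -> normc (cpoly q).[z] <= W.
  move=> zr; rewrite horner_coef size_map_poly; apply: le_trans (normc_sum _ _) _.
  apply: ler_sum => i _; rewrite coef_map normcM normc_real normcX ler_wpM2l//.
  by rewrite lerXn2r ?nnegrE ?normc_ge0 ?(ltW rho0).
pose pK (k : nat) : {poly R} := (1 + k.+1%:R^-1 *: q) ^+ k.+1.
have pKE k x : (pK k).[x] = (1 + q.[x] / k.+1%:R) ^+ k.+1.
  by rewrite /pK horner_exp !hornerE mulrC.
have h k : `|linfun_seq s (fun x => (pK k).[x])| <=
    2 * tail_weight s D rho * expR (B + W ^+ 2 / (2 * k.+1%:R)).
  apply: functional_poly => // z zr.
  have -> : (cpoly (pK k)).[z] = (1 + (cpoly q).[z] / k.+1%:R) ^+ k.+1.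
    rewrite /cpoly /pK rmorphXn /= rmorphD rmorph1 /= map_polyZ /= horner_exp !hornerE.
    by rewrite fmorphV rmorph_nat mulrC.
  apply: le_trans (normc_pow_le _ _) _ => //; rewrite ler_expR lerD ?qB//.
  rewrite ler_pM2r ?invr_gt0 ?mulr_gt0 ?ltr0n//.
  by rewrite lerXn2r ?nnegrE ?normc_ge0 ?qW.
have c1 : linfun_seq s (fun x => (pK k).[x]) @[k --> \oo] --> linfun_seq s (fun x => expR q.[x]).
  rewrite /linfun_seq; elim: (s) => [|wz s' IH].
    by under eq_fun do rewrite big_nil; rewrite big_nil; exact: cvg_cst.
  under eq_fun do rewrite big_cons; rewrite big_cons; apply: cvgD => //.
  apply: cvgM; first exact: cvg_cst.
  by under eq_fun do rewrite pKE; exact: cvg_pow_expR.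
have c2 : 2 * tail_weight s D rho * expR (B + W ^+ 2 / (2 * k.+1%:R)) @[k --> \oo] -->
    2 * tail_weight s D rho * expR B.
  apply: cvgM; first exact: cvg_cst.
  apply: continuous_cvg; first exact: continuous_expR.
  rewrite -[X in _ --> X]addr0; apply: cvgD; first exact: cvg_cst.
  under eq_fun do rewrite invfM mulrA.
  rewrite -(mulr0 (W ^+ 2 / 2)); apply: cvgM; [exact: cvg_cst|exact: cvg_harmonic].
by apply: ler_cvg_to (cvg_norm c1) c2 _; near=> k; exact: h.
Unshelve. all: by end_near.
Qed.

End annihilating_functional.

Section cpoly_morphism.
Variable R : realType.
Implicit Types (p q : {poly R}) (a : R).

Lemma cpolyD p q : cpoly (p + q) = cpoly p + cpoly q.
Proof. exact: rmorphD. Qed.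

Lemma cpolyB p q : cpoly (p - q) = cpoly p - cpoly q.
Proof. exact: rmorphB. Qed.

Lemma cpolyZ a p : cpoly (a *: p) = a%:C%C *: cpoly p.
Proof. exact: map_polyZ. Qed.

Lemma cpolyX : cpoly ('X : {poly R}) = 'X.
Proof. exact: map_polyX. Qed.

Lemma cpolyXn k : cpoly ('X^k : {poly R}) = 'X^k.
Proof. exact: map_polyXn. Qed.

End cpoly_morphism.

(** * Path integrals displaced along a complex line *)

Section line_potential.
Context {R : realType} {n : nat}.
Local Notation rV := 'rV[R]_n.
Local Notation C := R[i].
Implicit Types (x y e : rV) (z : C) (c rho r b : R) (m k : nat).
Import ComplexField.Normc.

Lemma dotv_sqr_le x e : dotv x e ^+ 2 <= nsq x * nsq e.
Proof.
have h t : 0 <= nsq x + 2 * t * dotv x e + t ^+ 2 * nsq e.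
  by have := nsq_ge0 (x + t *: e); rewrite nsqD dotvZr nsqZ mulrA.
have [e0|e0] := eqVneq (nsq e) 0.
  rewrite e0 mulr0; have [->|d0] := eqVneq (dotv x e) 0; first by rewrite expr0n.
  have := h (- (nsq x + 1) / dotv x e); rewrite e0 mulr0 addr0.
  have -> : 2 * (- (nsq x + 1) / dotv x e) * dotv x e = - 2 * (nsq x + 1).
    by field.
  have := nsq_ge0 x; lra.
have ep : 0 < nsq e by rewrite lt_def e0 nsq_ge0.
have := h (- dotv x e / nsq e).
have -> : nsq x + 2 * (- dotv x e / nsq e) * dotv x e + (- dotv x e / nsq e) ^+ 2 * nsq e =
   (nsq x * nsq e - dotv x e ^+ 2) / nsq e by field.
by rewrite pmulr_lge0 ?invr_gt0// subr_ge0.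
Qed.

Definition potP m x e c : {poly R} :=
  ((nsq x)%:P + (2 * c * dotv x e) *: 'X + (c ^+ 2 * nsq e) *: 'X^2) ^+ m.

Lemma horner_potP m x e c (u : R) : (potP m x e c).[u] = pot m (x + (c * u) *: e).
Proof.
rewrite /potP /pot horner_exp nsqD dotvZr nsqZ; congr (_ ^+ m).
by rewrite !(hornerD, hornerZ, hornerC, hornerX, hornerXn); ring.
Qed.

Definition CV m : R := (1 + (4 * m)%:R) ^+ (2 * m).

Lemma CV_ge0 m : 0 <= CV m.
Proof. by rewrite exprn_ge0// addr_ge0. Qed.

(** Either 2 k b <= r, and then (r + b)^k <= 2 r^k by Bernoulli, or r < 2 k b and (r + b)^k is
    dominated by ((1 + 2 k) b)^k. *)
Lemma double_pow_ge r b k : 0 <= r -> 0 <= b ->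
  - ((1 + (2 * k)%:R) * b) ^+ k <= 2 * r ^+ k - (r + b) ^+ k.
Proof.
move=> r0 b0; case: k => [|k]; first by rewrite !expr0; lra.
set K := k.+1; have k0 : 0 < K%:R :> R by rewrite ltr0n.
rewrite natrM; have [h|h] := leP (2 * K%:R * b) r.
  suff : (r + b) ^+ K <= 2 * r ^+ K.
    have : 0 <= ((1 + 2 * K%:R) * b) ^+ K by rewrite exprn_ge0// mulr_ge0// addr_ge0// mulr_ge0// ltW.
    by lra.
  pose u : R := (2 * K%:R)^-1; have u0 : 0 < u by rewrite invr_gt0 mulr_gt0.
  have u1 : u <= 2^-1 by rewrite lef_pV2 ?posrE ?mulr_gt0// ler_peMr// ler1n.
  apply: (@le_trans _ _ ((1 + u) ^+ K * r ^+ K)).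
    rewrite -exprMn lerXn2r ?nnegrE ?addr_ge0 ?mulr_ge0 ?addr_ge0 ?(ltW u0)//.
    rewrite mulrDl mul1r lerD2l /u ler_pdivlMl ?mulr_gt0//.
  rewrite ler_wpM2r ?exprn_ge0//.
  have bern : 2^-1 <= (1 - u) ^+ K.
    have -> : 2^-1 = 1 - K%:R * u :> R by rewrite /u; field; rewrite gt_eqF.
    have u1' : u <= 1 by lra.
    elim: (K) => [|j IH]; first by rewrite mul0r subr0.
    rewrite exprS -natr1; have : (1 - u) * (1 - j%:R * u) <= (1 - u) * (1 - u) ^+ j.
      by rewrite ler_wpM2l//; lra.
    have : 0 <= j%:R * u * u :> R by rewrite !mulr_ge0// ltW.
    by move: (j%:R : R) ((1 - u) ^+ j) => a d; nra.
  have p : (1 + u) ^+ K * (1 - u) ^+ K <= 1.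
    rewrite -exprMn (_ : (1 + u) * (1 - u) = 1 - u ^+ 2); last by ring.
    have : 0 <= u ^+ 2 <= 1 by rewrite sqr_ge0 expr2; nra.
    by move=> /andP[a1 a2]; rewrite exprn_ile1//; lra.
  have : 0 <= (1 + u) ^+ K by rewrite exprn_ge0// addr_ge0// ltW.
  by nra.
have : (r + b) ^+ K <= ((1 + 2 * K%:R) * b) ^+ K.
  rewrite lerXn2r ?nnegrE ?addr_ge0// ?mulr_ge0// ?addr_ge0// ?mulr_ge0// ?(ltW k0)//; lra.
have : 0 <= r ^+ K by rewrite exprn_ge0.
by lra.
Qed.

Lemma normc_Re_le z : `|complex.Re z| <= normc z.
Proof.
case: z => a b /=; rewrite -sqrtr_sqr ler_wsqrtr// lerDl sqr_ge0//.
Qed.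

(** At x + c (a + i b) e the quadratic form is A + eta, where A = |X|^2 for the real point X = x + c
    a e. Cauchy-Schwarz gives A + |eta| <= (sqrt A + be)^2 with be <= rho. Expanding the power, the
    real part is at least 2 A^m - (sqrt A + be)^{2m}, to which [double_pow_ge] applies. The bound
    does not depend on x. *)
Lemma Re_potP_ge m x e c rho z : 0 <= c <= 1 -> nsq e <= 1 -> normc z <= rho ->
  - (CV m * rho ^+ (2 * m)) <= complex.Re (cpoly (potP m x e c)).[z].
Proof.
move=> /andP[c0 c1] e1 zr; case: z zr => a b zr.
have rho0 : 0 <= rho by apply: le_trans (normc_ge0 _) zr.
pose X := x + (c * a) *: e; pose A := nsq X; have A0 : 0 <= A := nsq_ge0 X.
pose d := 2 * c * b * dotv X e; pose b2 := c ^+ 2 * b ^+ 2 * nsq e.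
pose eta : C := (- b2 +i* d)%C.
have E : (cpoly (potP m x e c)).[(a +i* b)%C] = (A%:C%C + eta) ^+ m.
  rewrite /cpoly /potP rmorphXn /= !rmorphD /= !map_polyZ /= map_polyC map_polyX map_polyXn.
  rewrite horner_exp !hornerE; congr (_ ^+ m).
  apply/eqP; rewrite eq_complex /= /A /X /d /b2 nsqD nsqZ !dotvE -/(nsq e).
  by apply/andP; split; apply/eqP; ring.
have h1 : normc ((A%:C%C + eta) ^+ m - A%:C%C ^+ m) <= (A + normc eta) ^+ m - A ^+ m.
  rewrite !subrXX addrAC subrr add0r [A + _ - A]addrAC subrr add0r normcM.
  rewrite ler_wpM2l ?normc_ge0//; apply: le_trans (normc_sum _ _) _.
  apply: ler_sum => i _; rewrite normcM !normcX normc_real (ger0_norm A0).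
  rewrite ler_wpM2r ?exprn_ge0// lerXn2r ?nnegrE ?normc_ge0 ?addr_ge0 ?normc_ge0//.
  by apply: le_trans (le_normcD _ _) _; rewrite normc_real ger0_norm.
have h2 : A ^+ m - normc ((A%:C%C + eta) ^+ m - A%:C%C ^+ m) <= complex.Re ((A%:C%C + eta) ^+ m).
  have := normc_Re_le ((A%:C%C + eta) ^+ m - A%:C%C ^+ m).
  rewrite raddfB /= -rmorphXn /= ler_norml => /andP[h _]; lra.
rewrite E; apply: le_trans h2; apply: (@le_trans _ _ (2 * A ^+ m - (A + normc eta) ^+ m)); last by lra.
pose r := Num.sqrt A; pose be := Num.sqrt b2.
have r2 : r ^+ 2 = A by rewrite sqr_sqrtr.
have b20 : 0 <= b2 by rewrite mulr_ge0 ?nsq_ge0// mulr_ge0 ?sqr_ge0.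
have be2 : be ^+ 2 = b2 by rewrite sqr_sqrtr.
have r0 : 0 <= r by exact: sqrtr_ge0.
have be0 : 0 <= be by exact: sqrtr_ge0.
have d2 : `|d| <= 2 * be * r.
  rewrite -(ler_pXn2r (n := 2)) ?nnegrE ?mulr_ge0// real_normK ?num_real//.
  have dE : d ^+ 2 = 2 ^+ 2 * c ^+ 2 * b ^+ 2 * dotv X e ^+ 2 by rewrite /d !exprMn.
  rewrite dE !exprMn r2 be2 /b2.
  have := dotv_sqr_le X e; rewrite -/A => h.
  have -> : 2 ^+ 2 * (c ^+ 2 * b ^+ 2 * nsq e) * A = 2 ^+ 2 * c ^+ 2 * b ^+ 2 * (A * nsq e) by ring.
  by rewrite ler_wpM2l// -!exprMn sqr_ge0.
have ne : normc eta <= b2 + 2 * be * r.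
  have -> : eta = (- b2)%:C%C + 'i%C * d%:C%C.
    by apply/eqP; rewrite eq_complex /=; apply/andP; split; apply/eqP; ring.
  apply: le_trans (le_normcD _ _) _; rewrite normcM !normc_real normrN (ger0_norm b20) lerD2l.
  by rewrite [normc 'i%C](_ : _ = 1) ?mul1r// /normc /= expr0n expr1n add0r sqrtr1.
have h3 : A + normc eta <= (r + be) ^+ 2 by rewrite sqrrD r2 be2; lra.
have h4 : (A + normc eta) ^+ m <= (r + be) ^+ (2 * m).
  by rewrite exprM lerXn2r ?nnegrE ?sqr_ge0// addr_ge0// normc_ge0.
have h5 := double_pow_ge (2 * m) r0 be0.
have ber : be <= rho.
  rewrite -(ler_pXn2r (n := 2)) ?nnegrE// be2.
  have hb : b ^+ 2 <= rho ^+ 2.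
    have : normc (a +i* b)%C ^+ 2 <= rho ^+ 2 by rewrite lerXn2r ?nnegrE ?normc_ge0.
    by rewrite /normc sqr_sqrtr ?addr_ge0 ?sqr_ge0//; have := sqr_ge0 a; lra.
  have hc : c ^+ 2 * nsq e <= 1.
    rewrite -[leRHS](mulr1 1); apply: ler_pM; rewrite ?sqr_ge0 ?nsq_ge0// exprn_ile1//.
  have -> : b2 = (c ^+ 2 * nsq e) * b ^+ 2 by rewrite /b2; ring.
  by apply: le_trans hb; apply: ler_piMl => //; exact: sqr_ge0.
apply: (@le_trans _ _ (2 * r ^+ (2 * m) - (r + be) ^+ (2 * m))).
  apply: le_trans h5; rewrite lerN2 /CV exprMn mulnA ler_wpM2l ?exprn_ge0 ?addr_ge0//.
  by rewrite lerXn2r ?nnegrE.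
by rewrite [r ^+ _]exprM r2; lra.
Qed.

End line_potential.

Section path_functional.
Context {R : realType} {n : nat}.
Local Notation rV := 'rV[R]_n.
Local Notation mu := (lebesgue_rV R n).
Local Notation C := R[i].
Implicit Types (x y : rV) (z : C).
Import ComplexField.Normc.

(** Cameron-Martin formula in one Gaussian step: the translation by c costs the density exp((2 y.c -
    |c|^2) / 4t). *)
Lemma hE_shift (t : R) (h : rV -> R) (c : rV) (r : R) : 0 < t ->
  measurable_fun [set: rV] h -> hE t h r ->
  hE t (fun y => expR ((2 * dotv y c - nsq c) / (4 * t)) * h (y - c)) r.
Proof.
move=> t0 mh [ih eh]; pose F y : \bar R := (heat t y * h y)%:E.
have mF : measurable_fun [set: rV] F.
  by apply/measurable_EFinP; apply: measurable_funM => //; exact: measurable_heat.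
have E : (fun y => (heat t y * (expR ((2 * dotv y c - nsq c) / (4 * t)) * h (y - c)))%:E) =
    fun y => F (y + - c).
  apply/funext => y; rewrite /F mulrA; congr ((_ * _)%:E).
  rewrite /heat /gau mulrAC -expRD; congr (expR _ / _).
  by rewrite nsqD nsqN dotvNr; field; rewrite gt_eqF.
split; rewrite E; last by rewrite (integral_shift (- c) mF).
apply/integrableP; split; first exact: measurable_shift.
have mA : measurable_fun [set: rV] (fun y => `|F y|%E) by exact: measurableT_comp.
by have := integral_shift (- c) mA => ->; case/integrableP: ih.
Qed.

Variables (m : nat) (tau : R) (N : nat) (e : rV) (rho : R) (g : rV -> R).
Variables (sw : seq (R * R)) (D : nat).
Hypotheses (tau0 : 0 < tau) (N0 : (0 < N)%N) (e1 : nsq e <= 1) (rho0 : 0 < rho).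
Hypotheses (sg : sq_int mu g) (kD : kills sw D).
Hypothesis swr : forall wz, wz \in sw -> `|wz.2| <= rho / 2.

Let s : R := N%:R * tau.
Let N0r : 0 < N%:R :> R. Proof. by rewrite ltr0n. Qed.
Let s0 : 0 < s. Proof. by rewrite mulr_gt0. Qed.
Let kappa : R := rho ^+ 2 / (4 * s * N%:R) + tau * (CV m * rho ^+ (2 * m)).
Let F j := iter j (split_op m tau) g.

Let sF j : sq_int mu (F j).
Proof. by elim: j => // j IH; exact: sq_int_split_op. Qed.

(** Majorant of the path integral over j steps. The argument t is the coefficient of the linear term
    in u collected from the Cameron-Martin densities; on the disc it costs at most exp(rho |t|). *)
Fixpoint path_weight (j : nat) (x : rV) (t : R) : \bar R :=
  if j is j'.+1 then
    (\int[mu]_y ((heat tau y)%:E * path_weight j' (x + y)%R (t + dotv y e / (2 * s))%R))%E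
  else (expR (rho * `|t|) * `|g x|)%:E.

Lemma path_weight_ge0 j x t : (0 <= path_weight j x t)%E.
Proof.
elim: j x t => [|j IH] x t /=; first by rewrite lee_fin mulr_ge0 ?expR_ge0.
by apply: integral_ge0 => y _; rewrite mule_ge0// lee_fin heat_ge0.
Qed.

Let ratio j : R := j%:R / N%:R.

(** The point of the path with j steps left is displaced by (j / N) u e: the evaluation point moves
    by u e while the argument of g is not displaced. Each step then contributes to the exponent a
    polynomial in u, made of the Cameron-Martin density and the potential at the displaced
    points. *)
Lemma path_step j (q : {poly R}) x : (j < N)%N ->
  hE tau (fun y => linfun_seq sw (fun u =>
     expR (q + (dotv y e / (2 * s)) *: 'X - (nsq e / (4 * s * N%:R)) *: 'X^2
       - (tau / 2) *: (potP m x e (ratio j.+1) + potP m (x + y) e (ratio j))).[u] *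
     F j (x + y + (ratio j * u) *: e)))
   (linfun_seq sw (fun u => expR q.[u] * F j.+1 (x + (ratio j.+1 * u) *: e))).
Proof.
move=> jN; apply: hE_sum => -[w u] /=.
(* The displacement drops from [ratio j.+1] to [ratio j] within the step, so the Gaussian increment
   absorbs the difference c = (u / N) e. *)
pose x' := x + (ratio j.+1 * u) *: e; pose c := (u / N%:R) *: e.
have sd := sq_int_damp m (ltW tau0) (sF j).
have h1 : hE tau (fun y => damp m tau (x' + y) * F j (x' + y))
    (heat_op tau (fun y => damp m tau y * F j y) x').
  by split; [exact: (heat_integrable x' tau0 sd)|rewrite (heat_opE x' tau0 sd)].
have mh : measurable_fun [set: rV] (fun y => damp m tau (x' + y) * F j (x' + y)).
  exact: (measurable_shiftr x' sd.1).
have h2 := hE_shift c tau0 mh h1.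
have := hE_lin (w * expR q.[u] * damp m tau x') h2 (hE_cst 0 tau0).
rewrite addr0 => h3.
have -> : w * (expR q.[u] * F j.+1 x') = w * expR q.[u] * damp m tau x' *
    heat_op tau (fun y => damp m tau y * F j y) x' by rewrite /F iterS /split_op; ring.
congr (hE _ _ _): h3; apply/funext => y.
have E1 : x' + (y - c) = x + y + (ratio j * u) *: e.
  apply/rowP => k; rewrite /x' /c !mxE /ratio -natr1; field.
  by rewrite gt_eqF.
rewrite E1 addr0 !(hornerD, hornerN, hornerZ, hornerX, hornerXn) !horner_potP.
rewrite -/x' /damp; set G := F j _.
have -> : expR (q.[u] + dotv y e / (2 * s) * u - nsq e / (4 * s * N%:R) * u ^+ 2 -
    tau / 2 * (pot m x' + pot m (x + y + (ratio j * u) *: e))) =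
  expR q.[u] * expR (- (tau / 2 * pot m x')) *
  (expR ((2 * dotv y c - nsq c) / (4 * tau)) *
   expR (- (tau / 2 * pot m (x + y + (ratio j * u) *: e)))).
  rewrite -!expRD; congr expR; rewrite /c dotvZr nsqZ /s.
  by field; rewrite !gt_eqF.
ring.
Qed.

Definition path_kernel (t : R) (Y : rV) : R := expR (rho * `|t + dotv Y e / (2 * s)|).

Lemma measurable_path_kernel t : measurable_fun [set: rV] (path_kernel t).
Proof.
apply: (measurableT_comp (@measurable_expR R)).
apply: measurable_funM; first exact: measurable_cst.
apply: measurableT_comp => //; apply: measurable_funD; first exact: measurable_cst.
apply: measurable_funM; last exact: measurable_cst.
by apply: measurable_dotv; [exact: measurable_id|exact: measurable_cst].
Qed.

Let mK t x : measurable_fun [set: rV] (fun Y => path_kernel t Y * `|g (x + Y)|).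
Proof.
apply: measurable_funM; first exact: measurable_path_kernel.
by apply: measurableT_comp => //; exact: (measurable_shiftr x sg.1).
Qed.

Let K0 t x Y : 0 <= path_kernel t Y * `|g (x + Y)|.
Proof. by rewrite mulr_ge0 ?expR_ge0. Qed.

(** The weight depends on the path only through its total increment Y, so the convolution law of the
    heat kernels merges all steps into one. *)
Lemma path_weight_kernel j x t : path_weight j.+1 x t =
  (\int[mu]_Y (heat (j.+1%:R * tau) Y * (path_kernel t Y * `|g (x + Y)|))%:E)%E.
Proof.
elim: j x t => [|j IH] x t.
  by apply: eq_integral => y _; rewrite mul1r -EFinM.
have jt : 0 < j.+1%:R * tau by rewrite mulr_gt0 ?ltr0n.
pose Phi (p : rV * rV) : \bar R :=
  ((heat tau p.2 * heat (j.+1%:R * tau) (p.1 - p.2)) * (path_kernel t p.1 * `|g (x + p.1)|))%:E.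
have mPhi : measurable_fun setT Phi.
  apply/measurable_EFinP; apply: measurable_funM; last first.
    by apply: (measurableT_comp (mK t x)); exact: measurable_fst.
  apply: measurable_funM.
    by apply: (measurableT_comp (measurable_heat tau)); exact: measurable_snd.
  apply: (measurableT_comp (measurable_heat _)).
  by apply: measurable_rVB; [exact: measurable_fst|exact: measurable_snd].
have Phi0 p : (0 <= Phi p)%E by rewrite lee_fin mulr_ge0// mulr_ge0// heat_ge0.
transitivity (\int[mu]_y \int[mu]_Z Phi (Z, y))%E.
  apply: eq_integral => y _; rewrite -/(path_weight j.+1 (x + y) _) IH.
  pose H (Z : rV) : \bar R :=
    (heat (j.+1%:R * tau) (Z - y) * (path_kernel t Z * `|g (x + Z)|))%:E.
  have mH : measurable_fun [set: rV] H.
    apply/measurable_EFinP; apply: measurable_funM => //.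
    exact: (measurable_shift (- y) (measurable_heat _)).
  have H0 Z : (0 <= H Z)%E by rewrite lee_fin mulr_ge0// heat_ge0.
  have -> : (\int[mu]_Y (heat (j.+1%:R * tau) Y *
      (path_kernel (t + dotv y e / (2 * s)) Y * `|g (x + y + Y)|))%:E = \int[mu]_Z H Z)%E.
    rewrite -(integral_shift y mH); apply: eq_integral => Y _; rewrite /H addrK.
    congr (_ * (expR (rho * `|_|) * `|g _|))%:E; last by rewrite -addrA [y + Y]addrC.
    by rewrite dotvDl; move: (dotv Y e) (dotv y e) ((2 * s)^-1) => p q r; ring.
  rewrite -(ge0_integralZ _ (heat_ge0 y tau0) mH H0).
  by apply: eq_integral => Z _; rewrite /Phi /= -[LHS]/((heat tau y *
    (heat (j.+1%:R * tau) (Z - y) * (path_kernel t Z * `|g (x + Z)|)))%:E) mulrA.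
rewrite -(@fubini_tonelli _ _ rV rV R mu mu Phi mPhi Phi0); apply: eq_integral => Z _.
rewrite /Phi /= (eq_integral (fun y : rV => ((path_kernel t Z * `|g (x + Z)|)%:E *
   (heat tau y * heat (j.+1%:R * tau) (Z - y))%:E)%E)) => [|y _]; last by rewrite -EFinM mulrC.
rewrite (ge0_integralZ _ (K0 t x Z)) => [||y]; last by rewrite lee_fin mulr_ge0// heat_ge0.
  rewrite (heat_conv Z tau0 jt).
  have -> : tau + j.+1%:R * tau = j.+2%:R * tau by rewrite -[j.+2%:R]natr1 mulrDl mul1r addrC.
  rewrite -[LHS]/((path_kernel t Z * `|g (x + Z)| * heat (j.+2%:R * tau) Z)%:E).
  by rewrite mulrC.
apply/measurable_EFinP; apply: measurable_funM; first exact: measurable_heat.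
apply: (measurableT_comp (measurable_heat _)).
by apply: measurable_rVB; [exact: measurable_cst|exact: measurable_id].
Qed.

Lemma measurable_path_weight j x t :
  measurable_fun [set: rV] (fun y => path_weight j (x + y) (t + dotv y e / (2 * s))).
Proof.
case: j => [|j].
  apply/measurable_EFinP; exact: mK.
rewrite (_ : (fun y => _) = fun y : rV => (\int[mu]_Y (heat (j.+1%:R * tau) Y *
   (path_kernel t (y + Y) * `|g (x + (y + Y))|))%:E)%E); last first.
  apply/funext => y; rewrite path_weight_kernel; apply: eq_integral => Y _.
  congr (_ * (expR (rho * `|_|) * `|g _|))%:E; last by rewrite addrA.
  by rewrite dotvDl; move: (dotv Y e) (dotv y e) ((2 * s)^-1) => p q r; ring.
pose Phi (p : rV * rV) : \bar R :=
  (heat (j.+1%:R * tau) p.2 * (path_kernel t (p.1 + p.2) * `|g (x + (p.1 + p.2))|))%:E.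
have mPhi : measurable_fun setT Phi.
  apply/measurable_EFinP; apply: measurable_funM.
    by apply: (measurableT_comp (measurable_heat _)); exact: measurable_snd.
  exact: (measurable_fun_addrV (mK t x)).
have jt : 0 < j.+1%:R * tau by rewrite mulr_gt0 ?ltr0n.
have Phi0 p : (0 <= Phi p)%E by rewrite lee_fin mulr_ge0// heat_ge0.
exact: (@measurable_fun_fubini_tonelli_F _ _ rV rV R mu Phi mPhi Phi0).
Qed.

(** Cauchy-Schwarz in Y: one factor [heat s] is bounded by its maximum 1/Z, and the remaining
    integral is an exponential moment. *)
Lemma path_kernel_bound x :
  (path_weight N x 0 <= (Num.sqrt (2 / gauZ (n := n) (4 * s)^-1) * expR (rho ^+ 2 / (2 * s)) *
    Num.sqrt (ip2 mu g g))%:E)%E.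
Proof.
rewrite -(prednK N0) path_weight_kernel prednK// -/s.
have a0 : 0 < (4 * s)^-1 by rewrite invr_gt0 mulr_gt0.
set Z := gauZ _; have Z0 : 0 < Z by exact: gauZ_gt0.
pose a Y := heat s Y * path_kernel 0 Y; pose b Y := `|g (x + Y)|.
have ma : measurable_fun [set: rV] a.
  by apply: measurable_funM; [exact: measurable_heat|exact: measurable_path_kernel].
have na : (sqnorm mu a <= (2 / Z * expR (rho ^+ 2 / s))%:E)%E.
  pose c : rV := (rho / s) *: e.
  have mexp (d : rV) : measurable_fun [set: rV] (fun Y => (heat s Y * expR (dotv d Y))%:E).
    apply/measurable_EFinP; apply: measurable_funM; first exact: measurable_heat.
    apply: (measurableT_comp (@measurable_expR R)).
    by apply: measurable_dotv; [exact: measurable_cst|exact: measurable_id].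
  have pexp (d Y : rV) : (0 <= (heat s Y * expR (dotv d Y))%:E)%E.
    by rewrite lee_fin mulr_ge0 ?expR_ge0 ?heat_ge0.
  apply: (@le_trans _ _ (\int[mu]_Y (Z^-1%:E * ((heat s Y * expR (dotv c Y))%:E +
     (heat s Y * expR (dotv (- c) Y))%:E)))%E).
    apply: le_integral_nn => Y _; first by rewrite lee_fin sqr_ge0.
    rewrite -EFinD -EFinM lee_fin /a exprMn expr2 -mulrDr mulrA.
    have h0 := heat_ge0 Y s0; apply: ler_pM; [exact: mulr_ge0|exact: sqr_ge0| |].
      by rewrite ler_wpM2r//; exact: heat_le.
    rewrite /path_kernel add0r -expRM_natl dotvNl.
    have -> : 2%:R * (rho * `|dotv Y e / (2 * s)|) = `|dotv c Y|.
      rewrite /c dotvZl dotvC !normrM (ger0_norm (x := rho)) ?(ltW rho0)//.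
      by rewrite !normfV (gtr0_norm s0) normrM (gtr0_norm s0) normr_nat; field; rewrite gt_eqF.
    exact: expR_abs_le.
  have iz : 0 <= Z^-1 by rewrite invr_ge0 ltW.
  rewrite (ge0_integralZ _ iz) => [||Y]; [|exact: emeasurable_funD|exact: adde_ge0].
  rewrite ge0_integralD// !integral_expdot_heat// nsqN -EFinD -EFinM lee_fin.
  rewrite (_ : _ * (_ + _) = 2 / Z * expR (s * nsq c)); last by ring.
  rewrite ler_wpM2l ?divr_ge0 ?(ltW Z0)// ler_expR /c nsqZ.
  have -> : s * ((rho / s) ^+ 2 * nsq e) = rho ^+ 2 / s * nsq e by field; rewrite gt_eqF.
  by rewrite ler_piMr// divr_ge0 ?sqr_ge0// ltW.
have sa : sq_int mu a by split => //; apply: le_lt_trans na (ltry _).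
have sb0 : sq_int mu (fun Y => g (x + Y)).
  by have := sq_int_shift x sg; under eq_fun do rewrite addrC.
have sb : sq_int mu b.
  split; first by apply: measurableT_comp => //; case: sb0.
  rewrite /sqnorm; under eq_integral do rewrite real_normK ?num_real//; by case: sb0.
have ebb : ip2 mu b b = ip2 mu g g.
  apply: EFin_inj; rewrite !sq_int_fineK// -(sqnorm_shift x sg.1).
  by apply: eq_integral => Y _; rewrite /b real_normK ?num_real// addrC.
have -> : (\int[mu]_Y (heat s Y * (path_kernel 0 Y * `|g (x + Y)|))%:E)%E = (ip2 mu a b)%:E.
  by rewrite ip2_EFin//; apply: eq_integral => Y _; rewrite /a /b mulrA.
rewrite lee_fin; apply: le_trans (ler_norm _) _; apply: le_trans (ip2_CS sa sb) _.
rewrite ebb ler_wpM2r ?sqrtr_ge0//.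
have -> : expR (rho ^+ 2 / (2 * s)) = Num.sqrt (expR (rho ^+ 2 / s)).
  have -> : expR (rho ^+ 2 / s) = expR (rho ^+ 2 / (2 * s)) ^+ 2.
    by rewrite -expRM_natl; congr expR; field; rewrite gt_eqF.
  by rewrite sqrtr_sqr ger0_norm ?expR_ge0.
rewrite -sqrtrM ?divr_ge0 ?(ltW Z0)// ler_wsqrtr//.
by rewrite -lee_fin sq_int_fineK.
Qed.

Let Q := 2 * tail_weight sw D rho.

(** The induction needs an arbitrary polynomial q in the exponent, known only through Re q <= b + t
    Re z on the disc. Each step adds kappa to b, from the quadratic Cameron-Martin term and the
    lower bound of the potential, and (y.e) / (2 s) to t. With no step left [functional_expR]
    applies. *)
Lemma path_bound_tilted j : (j <= N)%N -> forall (q : {poly R}) (b t : R) x,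
  (forall z, normc z <= rho -> complex.Re (cpoly q).[z] <= b + t * complex.Re z) ->
  (`|linfun_seq sw (fun u => expR q.[u] * F j (x + (ratio j * u) *: e))|%:E <=
   (Q * expR (b + j%:R * kappa))%:E * path_weight j x t)%E.
Proof.
have Q0 : 0 <= Q by rewrite mulr_ge0// tail_weight_ge0// ltW.
elim: j => [|j IH] jN q b t x hq.
  have E : linfun_seq sw (fun u => expR q.[u] * F 0 (x + (ratio 0 * u) *: e)) =
      linfun_seq sw (fun u => expR q.[u]) * g x.
    rewrite /linfun_seq mulr_suml; apply: eq_bigr => wz _.
    by rewrite /ratio !mul0r scale0r addr0 mulrA.
  rewrite E normrM /= mul0r addr0 -EFinM lee_fin mulrA ler_wpM2r//.
  rewrite -mulrA -expRD; apply: (functional_expR rho0 kD swr) => z zr.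
  apply: (le_trans (hq z zr)); rewrite lerD2l; apply: (le_trans (ler_norm _)).
  rewrite normrM mulrC ler_wpM2r//; exact: le_trans (normc_Re_le z) zr.
have [iL eL] := path_step q x jN.
have bound : (`|linfun_seq sw (fun u => expR q.[u] * F j.+1 (x + (ratio j.+1 * u) *: e))|%:E <=
   \int[mu]_y ((Q * expR (b + j.+1%:R * kappa))%:E * ((heat tau y)%:E *
     path_weight j (x + y)%R (t + dotv y e / (2 * s))%R)))%E.
  rewrite -abse_EFin -eL; apply: le_trans (le_abse_integral _ measurableT _) _.
    by case/integrableP: iL.
  apply: le_integral_nn => y _; first exact: abse_ge0.
  rewrite abse_EFin normrM (ger0_norm (heat_ge0 y tau0)) EFinM muleCA lee_wpmul2l ?lee_fin ?heat_ge0//.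
  have -> : b + j.+1%:R * kappa = (b + kappa) + j%:R * kappa by rewrite -natr1; ring.
  apply: IH => [|z zr]; first exact: ltnW.
  rewrite !(cpolyB, cpolyD, cpolyZ, cpolyX, cpolyXn) !(hornerD, hornerN, hornerZ, hornerX, hornerXn).
  have hz := hq z zr.
  have jN1 : 0 <= ratio j <= 1.
    by rewrite divr_ge0// ler_pdivrMr// mul1r ler_nat ltnW.
  have jN2 : 0 <= ratio j.+1 <= 1.
    by rewrite divr_ge0// ler_pdivrMr// mul1r ler_nat.
  have v1 := Re_potP_ge m x jN2 e1 zr; have v2 := Re_potP_ge m (x + y) jN1 e1 zr.
  have z2 : - (rho ^+ 2) <= complex.Re (z ^+ 2).
    have : normc (z ^+ 2) <= rho ^+ 2 by rewrite normcX lerXn2r ?nnegrE ?normc_ge0 ?(ltW rho0).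
    have := normc_Re_le (z ^+ 2); rewrite ler_norml => /andP[]; lra.
  have ReZ (a : R) (w : C) : complex.Re (a%:C%C * w) = a * complex.Re w.
    by case: w => w1 w2 /=; rewrite mul0r subr0.
  have ReD (a w : C) : complex.Re (a + w) = complex.Re a + complex.Re w by case: a => ??; case: w.
  have ReN (w : C) : complex.Re (- w) = - complex.Re w by case: w.
  rewrite !(ReD, ReN, ReZ).
  have k1 : - (nsq e / (4 * s * N%:R) * complex.Re (z ^+ 2)) <= rho ^+ 2 / (4 * s * N%:R).
    have p4 : (0 : R) < 4 by [].
    have p : 0 <= (4 * s * N%:R)^-1.
      by rewrite invr_ge0; apply: ltW; exact: (mulr_gt0 (mulr_gt0 p4 s0) N0r).
    rewrite mulrAC -mulNr ler_wpM2r//.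
    have p1 : 0 <= nsq e * (complex.Re (z ^+ 2) + rho ^+ 2).
      by rewrite mulr_ge0 ?nsq_ge0//; lra.
    have e1' : 0 <= 1 - nsq e by rewrite subr_ge0.
    have p2 := mulr_ge0 e1' (sqr_ge0 rho).
    by lra.
  rewrite /kappa; move: v1 v2 hz k1.
  move: (complex.Re (cpoly (potP m x e (ratio j.+1))).[z]) (complex.Re (cpoly (potP m (x + y) e (ratio j))).[z]).
  move: (complex.Re (cpoly q).[z]) (complex.Re z) (CV m * rho ^+ (2 * m)) => q1 z1 V p1 p2 v1 v2 hz k1.
  have h1 : 0 <= tau * (p1 + p2 + 2 * V) by rewrite mulr_ge0 ?(ltW tau0)//; lra.
  have : - (tau / 2 * (p1 + p2)) <= tau * V by lra.
  by move: k1; move: (nsq e / _ * _) (rho ^+ 2 / _) (tau * V) (tau / 2 * _) => *; lra.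
apply: (le_trans bound); rewrite /=.
have P := mulr_ge0 Q0 (expR_ge0 (b + j.+1%:R * kappa)).
rewrite (ge0_integralZ _ P)//.
  apply: emeasurable_funM; first exact: measurable_EFin_heat.
  exact: measurable_path_weight.
by move=> y; apply: mule_ge0; [rewrite lee_fin heat_ge0|exact: path_weight_ge0].
Qed.

(** The case q = 0. The iterate behaves on the line as a function holomorphic on |z| <= rho would,
    with a bound proportional to the L^2 norm of the data. *)
Theorem path_bound x :
  `|linfun_seq sw (fun u => iter N (split_op m tau) g (x + u *: e))| <=
  2 * tail_weight sw D rho * Num.sqrt (2 / gauZ (n := n) (4 * s)^-1) *
  expR (rho ^+ 2 / s + s * (CV m * rho ^+ (2 * m))) * Num.sqrt (ip2 mu g g).
Proof.
have h0 (z : C) : normc z <= rho -> complex.Re (cpoly 0).[z] <= 0 + 0 * complex.Re z.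
  by move=> _; rewrite /cpoly map_poly0 horner0 mul0r addr0.
have := path_bound_tilted (leqnn N) x h0.
have E : linfun_seq sw (fun u => expR (0 : {poly R}).[u] * F N (x + (ratio N * u) *: e)) =
    linfun_seq sw (fun u => iter N (split_op m tau) g (x + u *: e)).
  apply: eq_bigr => wz _; rewrite horner0 expR0 mul1r /ratio divff ?mul1r//.
  by rewrite gt_eqF.
have Q0 : 0 <= Q by rewrite mulr_ge0// tail_weight_ge0// ltW.
have P : 0 <= Q * expR (0 + N%:R * kappa) by rewrite mulr_ge0 ?expR_ge0.
rewrite E => /le_trans/(_ (lee_wpmul2l _ (path_kernel_bound x))).
rewrite lee_fin => /(_ P); rewrite -EFinM lee_fin => /le_trans; apply.
have E2 : expR (0 + N%:R * kappa) * expR (rho ^+ 2 / (2 * s)) <=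
    expR (rho ^+ 2 / s + s * (CV m * rho ^+ (2 * m))).
  rewrite -expRD ler_expR add0r /kappa mulrDr.
  have -> : N%:R * (rho ^+ 2 / (4 * s * N%:R)) = 4^-1 * (rho ^+ 2 / s).
    by field; rewrite !gt_eqF.
  have -> : N%:R * (tau * (CV m * rho ^+ (2 * m))) = s * (CV m * rho ^+ (2 * m)).
    by rewrite /s mulrA.
  have -> : rho ^+ 2 / (2 * s) = 2^-1 * (rho ^+ 2 / s) by field; rewrite gt_eqF.
  have : 0 <= rho ^+ 2 / s by exact: divr_ge0 (sqr_ge0 rho) (ltW s0).
  lra.
have alg (q a b c S G : R) : 0 <= q -> 0 <= S -> 0 <= G -> a * b <= c ->
    q * a * (S * b * G) <= q * S * c * G.
  move=> q0 S0 G0 abc; have -> : q * a * (S * b * G) = q * S * (a * b) * G by ring.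
  by rewrite ler_wpM2r// ler_wpM2l// mulr_ge0.
exact: (alg Q _ _ _ _ _ Q0 (sqrtr_ge0 _) (sqrtr_ge0 _) E2).
Qed.

End path_functional.

(** * Log-convexity of the norms and concentration of the mass *)

Section log_convex.
Context {R : realType}.
Implicit Types (b : nat -> R).

Lemma ratio_nondecreasing b : (forall i, 0 < b i) ->
  (forall i, b i.+1 ^+ 2 <= b i * b i.+2) ->
  forall i j, (i <= j)%N -> b i.+1 / b i <= b j.+1 / b j.
Proof.
move=> b0 bc i; elim=> [|j IH]; first by rewrite leqn0 => /eqP ->.
rewrite leq_eqVlt => /orP[/eqP ->//|]; rewrite ltnS => /IH /le_trans; apply.
by rewrite ler_pdivrMr// mulrAC ler_pdivlMr// -expr2 mulrC.
Qed.

Lemma prod_ratio b i j : (forall i, 0 < b i) -> (i <= j)%N ->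
  \prod_(i <= l < j) (b l.+1 / b l) = b j / b i.
Proof.
move=> b0; elim: j => [|j IH]; first by rewrite leqn0 => /eqP ->; rewrite big_geq// divff ?gt_eqF.
rewrite leq_eqVlt => /orP[/eqP <-|]; first by rewrite big_geq// divff ?gt_eqF.
rewrite ltnS => ij; rewrite big_nat_recr//= IH// mulrC mulrA mulfVK// gt_eqF//.
Qed.

Lemma log_convex_interp b N i : (forall i, 0 < b i) ->
  (forall i, b i.+1 ^+ 2 <= b i * b i.+2) -> (i <= N)%N ->
  b i ^+ N <= b 0%N ^+ (N - i) * b N ^+ i.
Proof.
move=> b0 bc iN; pose r := b i.+1 / b i.
have r0 : 0 < r by rewrite divr_gt0.
have h1 : b i / b 0%N <= r ^+ i.
  rewrite -(prod_ratio b0 (leq0n i)).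
  have -> : r ^+ i = \prod_(0 <= l < i) r by rewrite prodr_const_nat subn0.
  rewrite big_nat [leRHS]big_nat; apply: ler_prod => l /andP[_ li].
  apply/andP; split; first exact: divr_ge0 (ltW (b0 _)) (ltW (b0 _)).
  by apply: (ratio_nondecreasing b0 bc); exact: ltnW.
have h2 : r ^+ (N - i) <= b N / b i.
  rewrite -(prod_ratio b0 iN).
  have -> : r ^+ (N - i) = \prod_(i <= l < N) r by rewrite prodr_const_nat.
  rewrite big_nat [leRHS]big_nat; apply: ler_prod => l /andP[il _].
  by rewrite (ltW r0)/=; exact: (ratio_nondecreasing b0 bc).
have h3 : (b i / b 0%N) ^+ (N - i) <= (b N / b i) ^+ i.
  apply: (@le_trans _ _ (r ^+ i ^+ (N - i))).
    by rewrite lerXn2r ?nnegrE ?exprn_ge0 ?divr_ge0 ?(ltW (b0 _)) ?(ltW r0).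
  by rewrite exprAC lerXn2r ?nnegrE ?exprn_ge0 ?divr_ge0 ?(ltW (b0 _)) ?(ltW r0).
move: h3; rewrite !expr_div_n ler_pdivrMr ?exprn_gt0// mulrAC ler_pdivlMr ?exprn_gt0//.
by rewrite -exprD subnK// mulrC.
Qed.

(** The successive ratios are nondecreasing, so the product of the first N of them is at most the
    N-th power of the next one. *)
Lemma log_convex_last b N : (forall i, 0 < b i) ->
  (forall i, b i.+1 ^+ 2 <= b i * b i.+2) ->
  b N / b 0%N <= (b N.+1 / b N) ^+ N.
Proof.
move=> b0 bc; rewrite -(prod_ratio b0 (leq0n N)).
have -> : (b N.+1 / b N) ^+ N = \prod_(0 <= l < N) (b N.+1 / b N) by rewrite prodr_const_nat subn0.
rewrite big_nat [leRHS]big_nat; apply: ler_prod => l /andP[_ li].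
apply/andP; split; first exact: divr_ge0 (ltW (b0 _)) (ltW (b0 _)).
by apply: (ratio_nondecreasing b0 bc); exact: ltnW.
Qed.

End log_convex.

Section L2_norm.
Context {R : realType} {n : nat}.
Local Notation rV := 'rV[R]_n.
Local Notation mu := (lebesgue_rV R n).
Implicit Types (f g h : rV -> R).

Definition nrm f : R := Num.sqrt (ip2 mu f f).

Lemma nrm_ge0 f : 0 <= nrm f. Proof. exact: sqrtr_ge0. Qed.

Lemma nrm_sqr f : nrm f ^+ 2 = ip2 mu f f.
Proof. by rewrite sqr_sqrtr// ip2_ge0. Qed.

Lemma nrm_sqrE f : sq_int mu f -> (nrm f ^+ 2)%:E = sqnorm mu f.
Proof. by move=> sf; rewrite nrm_sqr sq_int_fineK. Qed.

Lemma nrm_pair f : hnorm (ippair mu) (f, fun=> 0) = nrm f.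
Proof.
rewrite /hnorm /ippair /=; congr Num.sqrt.
have -> : ip2 mu (fun=> 0) (fun=> 0) = 0.
  by rewrite /ip2 /Rintegral; under eq_integral do rewrite mul0r; rewrite integral0.
by rewrite addr0.
Qed.

Lemma nrm_le f (c : R) : sq_int mu f -> 0 <= c -> (nrm f <= c) = (sqnorm mu f <= (c ^+ 2)%:E)%E.
Proof.
move=> sf c0; rewrite -nrm_sqrE// lee_fin.
by apply/idP/idP => h; [rewrite lerXn2r ?nnegrE ?nrm_ge0|rewrite -(ler_pXn2r (n := 2)) ?nnegrE ?nrm_ge0].
Qed.

Let pair0 f : sq_int mu f -> L2pair mu (f, fun=> 0).
Proof. by move=> sf; split => //; exact: sq_int0. Qed.

Lemma nrmD f g : sq_int mu f -> sq_int mu g -> nrm (fun x => f x + g x) <= nrm f + nrm g.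
Proof.
move=> sf sg; have := hnorm_triangle (L2pair_semi_hilbert mu) (pair0 sf) (pair0 sg).
rewrite -!nrm_pair; congr (hnorm _ _ <= _); congr pair.
by apply/funext => x; exact: addr0.
Qed.

Lemma nrmZ a f : sq_int mu f -> nrm (fun x => a * f x) = `|a| * nrm f.
Proof.
move=> [mf f2]; rewrite /nrm ip2_sqr sqnormZ// -sq_int_fineK//=.
by rewrite sqrtrM ?sqr_ge0// sqrtr_sqr.
Qed.

Lemma nrm_shift f c : sq_int mu f -> nrm (fun x => f (x + c)) = nrm f.
Proof. by move=> [mf f2]; rewrite /nrm !ip2_sqr sqnorm_shift. Qed.

Lemma nrmB_sym f g : nrm (fun x => f x - g x) = nrm (fun x => g x - f x).
Proof.
rewrite /nrm !ip2_sqr; congr (Num.sqrt (fine _)); apply: eq_integral => x _.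
by rewrite -sqrrN opprB.
Qed.

Lemma sq_intB f g : sq_int mu f -> sq_int mu g -> sq_int mu (fun x => f x - g x).
Proof.
by move=> sf sg; have := sq_int_lin (-1) sg sf; under eq_fun do rewrite mulN1r addrC.
Qed.

Lemma nrmB_le f g : sq_int mu f -> sq_int mu g -> nrm f <= nrm (fun x => f x - g x) + nrm g.
Proof.
move=> sf sg; have := nrmD (sq_intB sf sg) sg.
by under eq_fun do rewrite subrK.
Qed.

Lemma nrm_dist f g : sq_int mu f -> sq_int mu g -> `|nrm f - nrm g| <= nrm (fun x => f x - g x).
Proof.
move=> sf sg; have := nrmB_le sf sg; have := nrmB_le sg sf.
by rewrite (nrmB_sym g f) ler_norml => h1 h2; apply/andP; split; lra.
Qed.

Lemma nrm_split_contr m t f : 0 < t -> sq_int mu f -> nrm (split_op m t f) <= nrm f.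
Proof.
move=> t0 sf; rewrite nrm_le ?nrm_ge0 ?nrm_sqrE//; first exact: split_op_contr.
exact: sq_int_split_op.
Qed.

Lemma ip2_nrm f g : sq_int mu f -> sq_int mu g -> ip2 mu f g <= nrm f * nrm g.
Proof. by move=> sf sg; apply: le_trans (ler_norm _) _; exact: ip2_CS. Qed.

End L2_norm.

Section discrete_flow.
Context {R : realType} {n : nat}.
Local Notation rV := 'rV[R]_n.
Local Notation mu := (lebesgue_rV R n).
Variables (m : nat) (tau : R) (g : rV -> R).
Hypotheses (tau0 : 0 < tau) (sg : sq_int mu g).

Let F j := iter j (split_op m tau) g.
Let b j := nrm (F j).

Lemma sq_int_iter j : sq_int mu (F j).
Proof. by elim: j => // j IH; exact: sq_int_split_op. Qed.

Lemma nrm_iter_le i j : (i <= j)%N -> b j <= b i.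
Proof.
elim: j => [|j IH]; first by rewrite leqn0 => /eqP ->.
rewrite leq_eqVlt => /orP[/eqP ->//|]; rewrite ltnS => /IH; apply: le_trans.
by apply: nrm_split_contr => //; exact: sq_int_iter.
Qed.

(** By symmetry the squared norm of the (j+1)-st iterate is the inner product of its two
    neighbours. *)
Lemma nrm_iter_convex j : b j.+1 ^+ 2 <= b j * b j.+2.
Proof.
rewrite nrm_sqr [ip2 _ _ _](_ : _ = ip2 mu (F j) (F j.+2)).
  by apply: ip2_nrm; exact: sq_int_iter.
exact: (split_op_sym m tau0 (sq_int_iter j) (sq_int_iter j.+1)).
Qed.

Lemma nrm_iter_gt0 j i : 0 < b j.+1 -> 0 < b i.
Proof.
move=> bj; suff h k : 0 < b (j.+1 + k)%N.
  have [ij|ji] := leqP i j.+1; first by apply: lt_le_trans bj (nrm_iter_le ij).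
  by have := h (i - j.+1)%N; rewrite subnKC// ltnW.
elim: k => [|k IH]; first by rewrite addn0.
have [k' kE] : exists k', (j.+1 + k = k'.+1)%N by exists (j + k)%N; rewrite addSn.
rewrite addnS kE in IH *.
rewrite lt_def nrm_ge0 andbT; apply/eqP => h.
have := nrm_iter_convex k'; rewrite h mulr0 leNgt exprn_gt0//.
Qed.

(** Interpolation at the fraction 1 - 2^{-l} of the time interval: the norm there exceeds the final
    one by at most the factor (b_0 / b_N)^{1/2^l}. *)
Lemma iter_mid k l : (l <= k)%N -> 0 < b (2 ^ k)%N ->
  b (2 ^ k - 2 ^ (k - l))%N ^+ (2 ^ l) <= b 0%N * b (2 ^ k)%N ^+ (2 ^ l - 1).
Proof.
move=> lk bN; set N := (2 ^ k)%N; set j := (2 ^ (k - l))%N.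
have Nj : N = (2 ^ l * j)%N by rewrite /N /j -expnD subnKC.
have j0 : (0 < j)%N by rewrite expn_gt0.
have b0 i : 0 < b i.
  have N0 : (0 < N)%N by rewrite expn_gt0.
  by apply: (@nrm_iter_gt0 N.-1); rewrite prednK.
have jN : (N - j <= N)%N by exact: leq_subr.
have jN2 : (j <= N)%N by rewrite Nj leq_pmull// expn_gt0.
have := log_convex_interp b0 nrm_iter_convex jN; rewrite subKn// => h.
have e1 : ((2 ^ l - 1) * j = N - j)%N by rewrite mulnBl mul1n -Nj.
have x0 : 0 <= b (N - j)%N ^+ (2 ^ l) by rewrite exprn_ge0// ltW.
have y0 : 0 <= b 0%N * b N ^+ (2 ^ l - 1) by rewrite mulr_ge0 ?exprn_ge0 ?ltW.
by rewrite -(ler_pXn2r j0) ?nnegrE// exprMn -!exprM -Nj e1.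
Qed.

Definition far_ind (H : R) (x : rV) : R := (H <= pot m x)%R%:R.

Lemma measurable_far_ind H : measurable_fun [set: rV] (far_ind H).
Proof.
rewrite (_ : far_ind H = (fun b : bool => b%:R : R) \o (fun x => H <= pot m x))//.
apply: measurableT_comp => //; apply: measurable_fun_ler; first exact: measurable_cst.
exact: measurable_pot.
Qed.

(** By log-convexity one more step loses at most the fraction 2 ln(b_0 / b_N) / N of the squared
    norm, whereas damping alone removes at least tau H / 2 of the mass lying where V >= H. *)
Lemma iter_tail N (H : R) : (0 < N)%N -> 0 < b N -> 0 < H -> tau * H <= 1 ->
  (\int[mu]_x (far_ind H x * F N x ^+ 2)%:E <=
   (4 * ln (b 0%N / b N) / (N%:R * tau * H) * b N ^+ 2)%:E)%E.
Proof.
move=> N0 bN H0 tH.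
have b0 i : 0 < b i by apply: (@nrm_iter_gt0 N.-1); rewrite prednK.
have sF := sq_int_iter N; have [mF F2] := sF.
pose y := (b N.+1 / b N) ^+ 2.
have r0 : 0 < b N.+1 / b N by rewrite divr_gt0.
have y0 : 0 < y by rewrite exprn_gt0.
have N0r : 0 < N%:R :> R by rewrite ltr0n.
have hy : 1 - y <= 2 * ln (b 0%N / b N) / N%:R.
  have h1 := log_convex_last N b0 nrm_iter_convex.
  have h2 : ln (b N / b 0%N) <= N%:R * ln (b N.+1 / b N).
    by rewrite mulr_natl -lnXn// ler_ln ?posrE ?exprn_gt0 ?divr_gt0.
  have -> : ln (b 0%N / b N) = - ln (b N / b 0%N) by rewrite -lnV ?posrE ?divr_gt0// invf_div.
  have h3 : 1 + ln y <= y by have := expR_ge1Dx (ln y); rewrite lnK.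
  rewrite ler_pdivlMr//; have : ln y = 2 * ln (b N.+1 / b N) by rewrite /y lnXn// mulr_natl.
  have alg (k q r L z : R) : 0 < k -> r <= k * q -> 1 + L <= z -> L = 2 * q ->
      (1 - z) * k <= 2 * - r.
    move=> k0 a1 a2 a3; have : (1 - z) * k <= - L * k by rewrite ler_wpM2r ?(ltW k0)//; lra.
    by rewrite a3; lra.
  exact: alg.
have h2 : (sqnorm mu (F N.+1) <= sqnorm mu (fun x => (damp m tau x * F N x)%R))%E.
  exact: split_op_le.
have sd := sq_int_damp m (ltW tau0) sF; have [md d2] := sd.
have u0 : 0 < tau * H by rewrite mulr_gt0.
pose c := tau * H / 2; have c0 : 0 <= c by rewrite divr_ge0// ltW.
have mfar := measurable_far_ind H.
have mt : measurable_fun [set: rV] (fun x => (far_ind H x * F N x ^+ 2)%:E).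
  by apply/measurable_EFinP; apply: measurable_funM => //; exact: measurable_funX.
have far0 x : 0 <= far_ind H x by [].
have t0 x : (0 <= (far_ind H x * F N x ^+ 2)%:E)%E by rewrite lee_fin mulr_ge0 ?sqr_ge0.
have h3 : (sqnorm mu (fun x => (damp m tau x * F N x)%R) +
    c%:E * \int[mu]_x (far_ind H x * F N x ^+ 2)%:E <= sqnorm mu (F N))%E.
  rewrite -(ge0_integralZ _ c0 mt t0) -ge0_integralD//; first last.
  - by apply: emeasurable_funM => //; exact: measurable_cst.
  - by move=> x _; rewrite mule_ge0// lee_fin.
  - exact: measurable_sqr.
  - by move=> x _; rewrite lee_fin sqr_ge0.
  apply: le_integral_nn => x _.
    by apply: adde_ge0; [rewrite lee_fin sqr_ge0|rewrite mule_ge0// lee_fin].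
  rewrite -[X in (X <= _)%E]/(((damp m tau x * F N x) ^+ 2 + c * (far_ind H x * F N x ^+ 2))%:E).
  rewrite lee_fin exprMn [c * _]mulrA -mulrDl ler_piMl ?sqr_ge0//.
  have d1 := damp_le1 m x (ltW tau0); have d0 := ltW (damp_gt0 m tau x).
  rewrite /far_ind; have [HV|_] := leP H (pot m x); last by rewrite mulr0 addr0 exprn_ile1.
  rewrite mulr1; have -> : damp m tau x ^+ 2 = expR (- (tau * pot m x)).
    by rewrite /damp -expRM_natl; congr expR; field.
  have e1 : expR (- (tau * pot m x)) <= expR (- (tau * H)).
    by rewrite ler_expR lerN2 ler_wpM2l// ltW.
  have e2 := expR_ge1Dx (tau * H); have e3 : expR (tau * H) * expR (- (tau * H)) = 1.
    by rewrite -expRD subrr expR0.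
  have e4 := expR_gt0 (- (tau * H)).
  move: e1 e2 e3 e4; rewrite /c; move: (tau * H) u0 tH => u u0 u1.
  move: (expR u) (expR (- u)) (expR _) => p q r hr hp pq q0.
  have : (1 + u) * q <= 1 by rewrite -[leRHS]pq ler_wpM2r// ltW.
  by nra.
set T := (\int[mu]_x _)%E in h3 *.
have T0 : (0 <= T)%E by exact: integral_ge0.
have Tfin : T \is a fin_num.
  rewrite ge0_fin_numE//; apply: le_lt_trans F2; apply: le_integral_nn => x _ //.
  by rewrite lee_fin ler_piMl ?sqr_ge0// /far_ind; have [_|_] := leP H (pot m x).
rewrite -(fineK Tfin) in h3 *; rewrite -!nrm_sqrE// in h2 h3; last exact: sq_int_iter.
have {}h2 : b N.+1 ^+ 2 <= nrm (fun x => damp m tau x * F N x) ^+ 2 by rewrite -lee_fin.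
have {}h3 : nrm (fun x => damp m tau x * F N x) ^+ 2 + c * fine T <= b N ^+ 2 by rewrite -lee_fin.
have yE : b N.+1 ^+ 2 = y * b N ^+ 2 by rewrite /y expr_div_n mulfVK// gt_eqF// exprn_gt0.
rewrite lee_fin; have : c * fine T <= (2 * ln (b 0%N / b N) / N%:R) * b N ^+ 2.
  by apply: (@le_trans _ _ ((1 - y) * b N ^+ 2)); [rewrite mulrBl mul1r -yE; lra|rewrite ler_wpM2r ?sqr_ge0].
have c1 : 0 < c by rewrite divr_gt0.
rewrite -ler_pdivlMl// => /le_trans; apply; rewrite le_eqVlt; apply/orP; left; apply/eqP.
by rewrite /c; field; rewrite !gt_eqF.
Qed.

End discrete_flow.

(** What is retained of the real or imaginary part of a solution: square integrability, continuity
    at positive times, and the product formula started at any time s. *)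
Record schr_flow (R : realType) (n m : nat) (v : R -> 'rV[R]_n -> R) : Prop := {
  fl_sq : forall t, 0 <= t -> sq_int (lebesgue_rV R n) (v t) ;
  fl_cont : forall t, 0 < t -> continuous (v t) ;
  fl_lim : forall s t e, 0 <= s -> 0 < t -> 0 < e -> exists k0 : nat, forall k, (k0 <= k)%N ->
    nrm (fun x => iter (2 ^ k) (split_op m (t / (2 ^ k)%:R)) (v s) x - v (s + t) x) <= e }.

Section flow.
Context {R : realType} {n : nat}.
Local Notation rV := 'rV[R]_n.
Local Notation mu := (lebesgue_rV R n).
Variables (m : nat) (v : R -> rV -> R) (s t : R).
Hypotheses (fv : schr_flow m v) (s0 : 0 <= s) (t0 : 0 < t).

Let tau k : R := t / (2 ^ k)%:R.
Let F k j := iter j (split_op m (tau k)) (v s).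
Let w := v (s + t).
Let a := nrm w.
Let a0 := nrm (v s).

Let p2 k : 0 < (2 ^ k)%:R :> R. Proof. by rewrite ltr0n expn_gt0. Qed.
Let tau0 k : 0 < tau k. Proof. by rewrite divr_gt0. Qed.
Let sv : sq_int mu (v s). Proof. exact: fl_sq fv _ s0. Qed.
Let sw : sq_int mu w. Proof. by apply: (fl_sq fv); rewrite addr_ge0// ltW. Qed.
Let sF k j : sq_int mu (F k j). Proof. by apply: sq_int_iter. Qed.

Lemma flow_norm_cvg e : 0 < e -> exists k0 : nat, forall k, (k0 <= k)%N ->
  `|nrm (F k (2 ^ k)) - a| <= e.
Proof.
move=> e0; have [k0 h] := fl_lim fv s0 t0 e0; exists k0 => k /h; apply: le_trans.
exact: nrm_dist.
Qed.

Lemma flow_contr : a <= a0.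
Proof.
apply/ler_addgt0Pr => e e0; have [k0 h] := flow_norm_cvg e0.
have := h k0 (leqnn _); rewrite distrC => /(le_trans (ler_norm _)).
have : nrm (F k0 (2 ^ k0)) <= a0 by have := nrm_iter_le m (tau0 k0) sv (leq0n (2 ^ k0)).
by lra.
Qed.

Hypothesis a_gt0 : 0 < a.

Lemma flow_tail (H : R) : 0 < H -> 64 * (1 + ln (a0 / a)) <= t * H ->
  (\int[mu]_x (far_ind m H x * w x ^+ 2)%:E <= (a ^+ 2 / 2)%:E)%E.
Proof.
move=> H0 tH; pose e := a / 4; have e0 : 0 < e by rewrite divr_gt0.
have [k1 h1] := flow_norm_cvg e0; have [k2 h2] := fl_lim fv s0 t0 e0.
pose k := maxn (maxn k1 k2) (Num.bound (t * H)).
have kk1 : (k1 <= k)%N by rewrite !leq_max leqnn.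
have kk2 : (k2 <= k)%N by rewrite !leq_max leqnn !orbT.
have bN := h1 k kk1; set b := nrm (F k (2 ^ k)) in bN.
have wF := h2 k kk2; rewrite -/(F k (2 ^ k)) -/w in wF.
move: bN; rewrite ler_norml => /andP[b1 b2].
have alg (p q : R) : 0 < q -> - (q / 4) <= p - q -> p - q <= q / 4 ->
    [/\ 0 < p, q <= 2 * p & p ^+ 2 <= 2 * q ^+ 2].
  by move=> q0 h3 h4; split; [lra|lra|nra].
have [b_gt0 ab b2a] := alg b a a_gt0 b1 b2.
have tauH : tau k * H <= 1.
  rewrite /tau mulrAC ler_pdivrMr// mul1r natrX; apply: ltW.
  by apply: upper_nthrootP; rewrite !leq_max leqnn !orbT.
have N0 : (0 < 2 ^ k)%N by rewrite expn_gt0.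
have := iter_tail (tau0 k) sv N0 b_gt0 H0 tauH.
rewrite -/(F k (2 ^ k)) -/b -/a0 (_ : (2 ^ k)%:R * tau k = t); last first.
  by rewrite /tau mulrC divfK// gt_eqF.
(* The discrete final norm b is at least a / 2, which costs at most 1 in the logarithm; hence the
   summand 1 in the hypothesis. *)
move=> tail; have lnb : ln (a0 / b) <= 1 + ln (a0 / a).
  have a00 : 0 < a0 by apply: lt_le_trans a_gt0 flow_contr.
  have -> : a0 / b = (a0 / a) * (a / b) by field; rewrite !gt_eqF.
  rewrite lnM ?posrE ?divr_gt0// addrC lerD2r.
  have := expR_ge1Dx (ln (a / b)); rewrite lnK ?posrE ?divr_gt0// => h.
  have : a / b <= 2 by rewrite ler_pdivrMr.
  by lra.
have far0 (x : rV) : 0 <= far_ind m H x by [].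
have mfar := measurable_far_ind (n := n) m H.
have m2 f : sq_int mu f -> measurable_fun [set: rV] (fun x => (far_ind m H x * f x ^+ 2)%:E).
  by move=> [mf _]; apply/measurable_EFinP; apply: measurable_funM => //; exact: measurable_funX.
have n2 f x : (0 <= (far_ind m H x * f x ^+ 2)%:E)%E by rewrite lee_fin mulr_ge0 ?sqr_ge0.
have sd := sq_intB (sF k (2 ^ k)) sw.
apply: (@le_trans _ _ (2%:E * (\int[mu]_x (far_ind m H x * F k (2 ^ k) x ^+ 2)%:E) +
   2%:E * sqnorm mu (fun x => (F k (2 ^ k) x - w x)%R))%E).
  rewrite -(ge0_integralZ (k := 2) _ _ (m2 _ (sF _ _)))//.
  rewrite -(ge0_integralZ (k := 2) _ _ (measurable_sqr sd.1))//; last first.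
    by move=> x; rewrite lee_fin sqr_ge0.
  rewrite -ge0_integralD//; first last.
  - by apply: emeasurable_funM; [exact: measurable_cst|exact: measurable_sqr sd.1].
  - by move=> x _; rewrite mule_ge0// lee_fin sqr_ge0.
  - by apply: emeasurable_funM; [exact: measurable_cst|exact: m2].
  - by move=> x _; rewrite mule_ge0.
  apply: le_integral_nn => x _; first exact: n2.
  rewrite -!EFinM -EFinD lee_fin; set f := F k _ x; set u := w x.
  have := sqr_ge0 (2 * f - u); have := sqr_ge0 (f - u).
  by rewrite /far_ind; have [_|_] := leP H (pot m x); rewrite ?mul1r ?mul0r; lra.
rewrite -nrm_sqrE//.
apply: (@le_trans _ _ (2%:E * (4 * ln (a0 / b) / (t * H) * b ^+ 2)%:E + 2%:E * (e ^+ 2)%:E)%E).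
  rewrite leeD// lee_wpmul2l ?lee_fin//.
  by rewrite lerXn2r ?nnegrE ?nrm_ge0 ?(ltW e0).
rewrite -!EFinM -EFinD lee_fin.
have tH0 : 0 < t * H by rewrite mulr_gt0.
have q : 4 * ln (a0 / b) / (t * H) <= 16^-1.
  rewrite ler_pdivrMr//; have : 64 * ln (a0 / b) <= t * H by lra.
  by lra.
have : 4 * ln (a0 / b) / (t * H) * b ^+ 2 <= 16^-1 * (2 * a ^+ 2).
  apply: (@le_trans _ _ (16^-1 * b ^+ 2)); first by rewrite ler_wpM2r ?sqr_ge0.
  by rewrite ler_wpM2l.
have -> : e ^+ 2 = a ^+ 2 / 16 by rewrite /e expr_div_n; congr (_ / _); ring.
have := sqr_ge0 a; move: (_ * b ^+ 2) (a ^+ 2) => y1 y2 y3 y4; lra.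
Qed.

(** At most half of the squared norm lies where V >= H. If w^2 stayed below a^2 / (4 (2 r)^n) on the
    rest, which is contained in a cube of side 2 r, that rest would carry at most a quarter. *)
Lemma flow_point (H r : R) : 0 < H -> 64 * (1 + ln (a0 / a)) <= t * H -> 0 < r ->
  (forall x : rV, pot m x < H -> `|x| <= r) ->
  exists2 y : rV, pot m y < H & a ^+ 2 <= 4 * (2 * r) ^+ n * w y ^+ 2.
Proof.
move=> H0 tH r0 Hr; apply: contrapT => ny.
have small y : pot m y < H -> 4 * (2 * r) ^+ n * w y ^+ 2 < a ^+ 2.
  by move=> yH; rewrite ltNge; apply/negP => h; apply: ny; exists y.
have tail := flow_tail H0 tH.
have far0 (x : rV) : 0 <= far_ind m H x by [].
have mfar := measurable_far_ind (n := n) m H.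
have mw : measurable_fun [set: rV] (fun x => (far_ind m H x * w x ^+ 2)%:E).
  by apply/measurable_EFinP; apply: measurable_funM => //; exact: (measurable_funX 2 sw.1).
pose V := (2 * r) ^+ n; have V0 : 0 < V by rewrite exprn_gt0// mulr_gt0.
pose c := a ^+ 2 / (4 * V).
have c0 : 0 <= c by rewrite divr_ge0 ?sqr_ge0// mulr_ge0// ltW.
have mb : measurable_fun [set: rV] (fun x : rV => (ball_ind r x)%:E).
  by apply/measurable_EFinP; apply: measurable_ball_ind; [exact: measurable_cst|exact: measurable_id].
have : (sqnorm mu w <= (a ^+ 2 / 2)%:E + (c * V)%:E)%E.
  apply: (@le_trans _ _ (\int[mu]_x (far_ind m H x * w x ^+ 2)%:E +
     \int[mu]_x (c%:E * (ball_ind r x)%:E))%E); last first.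
    by rewrite leeD// (ge0_integralZ _ c0 mb) ?integral_norm_ball ?(ltW r0)// => x; rewrite lee_fin.
  rewrite -ge0_integralD//; first last.
  - by apply: emeasurable_funM => //; exact: measurable_cst.
  - by move=> x _; rewrite mule_ge0// lee_fin.
  - by move=> x _; rewrite lee_fin mulr_ge0 ?sqr_ge0.
  apply: le_integral_nn => x _; first by rewrite lee_fin sqr_ge0.
  rewrite -EFinM -EFinD lee_fin /far_ind; have [HV|VH] := leP H (pot m x).
    by rewrite mul1r lerDl mulr_ge0.
  rewrite mul0r add0r /ball_ind Hr// mulr1 /c.
  have := small x VH; rewrite -/V => h.
  by rewrite ler_pdivlMr ?mulr_gt0// mulrC ltW.
rewrite -nrm_sqrE// -EFinD lee_fin -/a => h.
have : c * V <= a ^+ 2 / 4.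
  by rewrite le_eqVlt; apply/orP; left; apply/eqP; rewrite /c; field; rewrite gt_eqF.
have : 0 < a ^+ 2 by rewrite exprn_gt0.
by move: h; move: (a ^+ 2) (c * V) => p q; lra.
Qed.

End flow.

(** * Analyticity along lines for the flow *)

Section flow_line_bound.
Context {R : realType} {n : nat}.
Local Notation rV := 'rV[R]_n.
Local Notation mu := (lebesgue_rV R n).
Implicit Types (x y e : rV).

Lemma linfun_seq_sq (sw : seq (R * R)) (h : rV -> R) e : sq_int mu h ->
  sq_int mu (fun x => linfun_seq sw (fun u => h (x + u *: e))) /\
  nrm (fun x => linfun_seq sw (fun u => h (x + u *: e))) <= (\sum_(wz <- sw) `|wz.1|) * nrm h.
Proof.
move=> sh; elim: sw => [|[c u] sw [IH1 IH2]].
  have -> : (fun x => linfun_seq [::] (fun u => h (x + u *: e))) = fun=> 0.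
    by apply/funext => x; rewrite /linfun_seq big_nil.
  split; first exact: sq_int0.
  rewrite big_nil mul0r /nrm /ip2 /Rintegral; under eq_integral do rewrite mul0r.
  by rewrite integral0 sqrtr0.
have -> : (fun x => linfun_seq ((c, u) :: sw) (fun u => h (x + u *: e))) =
    fun x => c * h (x + u *: e) + linfun_seq sw (fun u => h (x + u *: e)).
  by apply/funext => x; rewrite /linfun_seq big_cons.
have s1 := sq_int_shift (u *: e) sh.
split; first exact: sq_int_lin.
have s2 : sq_int mu (fun x => c * h (x + u *: e)).
  by have := sq_int_lin c s1 (sq_int0 mu); under eq_fun do rewrite addr0.
apply: le_trans (nrmD s2 IH1) _.
by rewrite nrmZ// (nrm_shift _ sh) big_cons /= mulrDl lerD2l.
Qed.

Lemma continuous_linfun_seq (sw : seq (R * R)) (w : rV -> R) e : continuous w ->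
  continuous (fun x => linfun_seq sw (fun u => w (x + u *: e))).
Proof.
move=> cw x; rewrite /linfun_seq; elim: sw => [|[c u] sw IH].
  rewrite (_ : (fun _ => _) = fun=> 0); last by apply/funext => y; rewrite big_nil.
  exact: cst_continuous.
rewrite (_ : (fun _ => _) = fun y => c * w (y + u *: e) + \sum_(wz <- sw) wz.1 * w (y + wz.2 *: e)); last first.
  by apply/funext => y; rewrite big_cons.
apply: (@continuousD R R^o rV); last exact: IH.
apply: continuousM; first exact: cst_continuous.
apply: (@continuous_comp rV rV R (fun y : rV => y + u *: e) w); last exact: cw.
by apply: (@continuousD R rV rV); [exact: cvg_id|exact: cst_continuous].
Qed.

(* A continuous function which is an [L2]-limit of functions bounded by [M]
   inherits the bound: otherwise the limit exceeds it on a whole ball. *)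
Lemma continuous_L2_bound (phi : rV -> R) (M : R) : sq_int mu phi -> continuous phi ->
  (forall d : R, 0 < d -> exists2 f, sq_int mu f & (forall x, `|f x| <= M + d) /\ nrm (fun x => f x - phi x) <= d) ->
  forall x, `|phi x| <= M.
Proof.
move=> sphi cphi app x; rewrite leNgt; apply/negP => Mx.
pose eta := (`|phi x| - M) / 4; have eta0 : 0 < eta by rewrite divr_gt0// subr_gt0.
have [r r0 hr] : exists2 r : R, 0 < r & forall y, `|y - x| <= r -> M + 2 * eta <= `|phi y|.
  have : \forall y \near x, M + 2 * eta < `|phi y|.
    have cn : `|phi y| @[y --> x] --> `|phi x| by apply: cvg_norm (cphi x).
    by apply: (cvgr_gt _ cn); rewrite /eta; lra.
  move=> /nbhs_ballP[d /= d0 hd]; exists (d / 2) => [|y yx]; first by rewrite divr_gt0.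
  apply/ltW/hd; rewrite -ball_normE /ball_ /= distrC; apply: le_lt_trans yx _; lra.
pose V := (2 * r) ^+ n; have V0 : 0 < V by rewrite exprn_gt0// mulr_gt0.
pose c := eta * Num.sqrt V; have c0 : 0 < c by rewrite mulr_gt0// sqrtr_gt0.
pose e := Num.min eta (c / 2); have e0 : 0 < e by rewrite lt_min eta0 divr_gt0.
have [f sf [fM fphi]] := app e e0.
have e1 : e <= eta by rewrite ge_min lexx.
have e2 : e <= c / 2 by rewrite ge_min lexx orbT.
have sd := sq_intB sf sphi.
have : ((eta ^+ 2 * V)%:E <= sqnorm mu (fun y => (f y - phi y)%R))%E.
  have mb : measurable_fun [set: rV] (fun y : rV => (ball_ind r y)%:E).
    by apply/measurable_EFinP; apply: measurable_ball_ind; [exact: measurable_cst|exact: measurable_id].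
  rewrite EFinM -(integral_norm_ball (n := n) (ltW r0)).
  rewrite -(ge0_integralZ _ (sqr_ge0 eta) mb) => [|y]; last by rewrite lee_fin.
  rewrite /sqnorm -(integral_shift x (f := fun y => ((f y - phi y) ^+ 2)%:E)); last exact: measurable_sqr sd.1.
  apply: le_integral_nn => y _; first by rewrite mule_ge0// lee_fin ?sqr_ge0.
  rewrite -EFinM lee_fin /ball_ind; have [yr|_] := leP `|y| r; last by rewrite mulr0 sqr_ge0.
  rewrite mulr1 -(real_normK (num_real (_ - _))) lerXn2r ?nnegrE ?(ltW eta0)//.
  have := hr (y + x); rewrite addrK => /(_ yr) h1; have h2 := fM (y + x).
  have := ler_normD (phi (y + x) - f (y + x)) (f (y + x)); rewrite subrK distrC => h3.
  by lra.
rewrite -nrm_sqrE// lee_fin => h.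
have : c ^+ 2 <= (c / 2) ^+ 2.
  rewrite {1}/c exprMn sqr_sqrtr ?(ltW V0)//; apply: le_trans h _.
  by rewrite lerXn2r ?nnegrE ?nrm_ge0 ?divr_ge0 ?(ltW c0)// (le_trans fphi).
have : 0 < c ^+ 2 by rewrite exprn_gt0.
by rewrite expr_div_n; move: (c ^+ 2) => p; lra.
Qed.

Definition path_const m (s rho : R) : R :=
  Num.sqrt (2 / gauZ (n := n) (4 * s)^-1) * expR (rho ^+ 2 / s + s * (CV m * rho ^+ (2 * m))).

Lemma path_const_ge0 m s rho : 0 <= path_const m s rho.
Proof. by rewrite mulr_ge0 ?sqrtr_ge0 ?expR_ge0. Qed.

(** [path_bound] is applied to the last t / 2^l of the time interval only. The norm of the data at
    its beginning is compared with the final norm by [iter_mid], and the bound passes to the L^2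
    limit by continuity. *)
Lemma flow_line_bound m (v : R -> rV -> R) (s t : R) (l : nat) e (rho : R)
    (sw : seq (R * R)) (D : nat) :
  schr_flow m v -> 0 <= s -> 0 < t -> 0 < nrm (v (s + t)) ->
  nsq e <= 1 -> 0 < rho -> kills sw D -> (forall wz, wz \in sw -> `|wz.2| <= rho / 2) ->
  forall x, `|linfun_seq sw (fun u => v (s + t) (x + u *: e))| <=
    2 * tail_weight sw D rho * (path_const m (t / (2 ^ l)%:R) rho *
     (nrm (v (s + t)) * expR (ln (nrm (v s) / nrm (v (s + t))) / (2 ^ l)%:R))).
Proof.
move=> fv s0 t0 a0 e1 rho0 kD sr.
set w := v (s + t); set a := nrm w; set b := nrm (v s).
have st : 0 < s + t by rewrite ltr_wpDl.
have sv := fl_sq fv s0; have sw_ := fl_sq fv (ltW st); rewrite -/w in sw_.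
have ba : a <= b := flow_contr fv s0 t0.
have b0 : 0 < b := lt_le_trans a0 ba.
set s' := t / _; set P := path_const m s' rho.
pose T := 2 * tail_weight sw D rho; rewrite -/T.
have T0 : 0 <= T by rewrite mulr_ge0// tail_weight_ge0// ltW.
have P0 : 0 <= P := path_const_ge0 _ _ _.
pose L := (2 ^ l)%:R : R; have L0 : 0 < L by rewrite ltr0n expn_gt0.
have [s1 n1] := linfun_seq_sq sw e sw_.
apply: continuous_L2_bound => //.
  by apply: continuous_linfun_seq; exact: (fl_cont fv).
move=> eps eps0.
pose K := \sum_(wz <- sw) `|wz.1|; have K0 : 0 <= K by rewrite sumr_ge0.
pose E := expR (ln (b / a) / L).
(* the bound obtained from a discrete norm [c] close to [a] *)
have [d d0 hd] : exists2 d : R, 0 < d & forall c, `|c - a| <= d -> 0 < c ->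
    T * (P * (c * expR (ln (b / c) / L))) <= T * (P * (a * E)) + eps.
  pose G c := T * (P * (c * expR (ln (b / c) / L))).
  have cG : G c @[c --> a] --> G a.
    apply: cvgM; first exact: cvg_cst.
    apply: cvgM; first exact: cvg_cst.
    apply: cvgM; first exact: cvg_id.
    apply: continuous_cvg; first exact: continuous_expR.
    apply: cvgM; last exact: cvg_cst.
    apply: continuous_cvg; first by apply: continuous_ln; rewrite divr_gt0.
    apply: cvgM; first exact: cvg_cst.
    by apply: cvgV; [rewrite gt_eqF|exact: cvg_id].
  have : \forall c \near a, G c < G a + eps by apply: (cvgr_lt _ cG); rewrite ltrDl.
  move=> /nbhs_ballP[d /= d0 hd]; exists (d / 2) => [|c ca c0]; first by rewrite divr_gt0.
  apply/ltW/hd; rewrite -ball_normE /ball_ /= distrC; apply: le_lt_trans ca _; lra.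
pose e2 := eps / (K + 1); have e20 : 0 < e2 by rewrite divr_gt0// ltr_wpDl.
have [k1 h1] := flow_norm_cvg fv s0 t0 d0.
have a20 : 0 < a / 2 by rewrite divr_gt0.
have [k2 h2] := flow_norm_cvg fv s0 t0 a20.
have [k3 h3] := fl_lim fv s0 t0 e20.
pose k := maxn (maxn k1 k2) (maxn k3 l).
have kk1 : (k1 <= k)%N by rewrite !leq_max leqnn.
have kk2 : (k2 <= k)%N by rewrite !leq_max leqnn !orbT.
have kk3 : (k3 <= k)%N by rewrite !leq_max leqnn !orbT.
have lk : (l <= k)%N by rewrite !leq_max leqnn !orbT.
pose tau := t / (2 ^ k)%:R.
have tau0 : 0 < tau by rewrite divr_gt0// ltr0n expn_gt0.
pose N := (2 ^ k)%N; pose j := (2 ^ (k - l))%N.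
have Nj : N = (2 ^ l * j)%N by rewrite /N /j -expnD subnKC.
have jN : (j <= N)%N by rewrite Nj leq_pmull// expn_gt0.
have j0 : (0 < j)%N by rewrite expn_gt0.
(* f is the full iterate, and g the data left after all but the last j steps. *)
pose f := iter N (split_op m tau) (v s); pose g := iter (N - j) (split_op m tau) (v s).
have sf : sq_int mu f := sq_int_iter m tau0 sv N.
have sg : sq_int mu g := sq_int_iter m tau0 sv (N - j).
have [s2 _] := linfun_seq_sq sw e sf.
exists (fun x => linfun_seq sw (fun u => f (x + u *: e))) => //; split => [x|].
  have c2 := h2 k kk2; rewrite -/N -/tau -/f -/w -/a in c2.
  have c0 : 0 < nrm f by move: c2; rewrite ler_norml => /andP[c3 _]; move: (nrm f) a0 c3 => p; lra.
  have c1 := h1 k kk1; rewrite -/N -/tau -/f -/w -/a in c1.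
  apply: le_trans (hd _ c1 c0).
  have -> : f = iter j (split_op m tau) g by rewrite /f /g -iterD subnKC.
  have := path_bound m tau0 j0 e1 rho0 sg kD sr x.
  have -> : j%:R * tau = s'.
    rewrite /tau /s' -/N Nj natrM; field.
    by rewrite !gt_eqF// ltr0n.
  move=> /le_trans; apply.
  have -> : 2 * tail_weight sw D rho * Num.sqrt (2 / gauZ (n := n) (4 * s')^-1) *
     expR (rho ^+ 2 / s' + s' * (CV m * rho ^+ (2 * m))) * Num.sqrt (ip2 mu g g) = T * (P * nrm g).
    by rewrite /T /P /path_const /nrm; ring.
  rewrite ler_wpM2l// ler_wpM2l//.
  have -> : iter j (split_op m tau) g = f by rewrite /f /g -iterD subnKC.
  have := iter_mid tau0 sv lk c0; rewrite -/N -/j -/f -/g -/b => hm.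
  have q0 : (0 < 2 ^ l)%N by rewrite expn_gt0.
  rewrite -(ler_pXn2r q0) ?nnegrE ?nrm_ge0 ?mulr_ge0 ?nrm_ge0 ?expR_ge0//.
  apply: (le_trans hm); rewrite exprMn -expRM_natl -/L.
  rewrite [L * _]mulrC divfK ?gt_eqF// lnK ?posrE ?divr_gt0//.
  rewrite -[in leRHS](subnK q0) addn1 exprSr.
  by rewrite -[leRHS]mulrA [nrm f * _]mulrC divfK ?gt_eqF// mulrC.
have E3 : (fun x => linfun_seq sw (fun u => f (x + u *: e)) - linfun_seq sw (fun u => w (x + u *: e))) =
   fun x => linfun_seq sw (fun u => (fun y => f y - w y) (x + u *: e)).
  apply/funext => x; rewrite /linfun_seq -sumrB; apply: eq_bigr => wz _.
  by rewrite mulrBr.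
rewrite E3; have [_ n3] := linfun_seq_sq sw e (sq_intB sf sw_).
apply: (le_trans n3); rewrite -/K.
have := h3 k kk3; rewrite -/N -/tau -/f -/w => h4.
apply: (@le_trans _ _ (K * e2)); first by rewrite ler_wpM2l.
rewrite /e2 mulrA ler_pdivrMr ?ltr_wpDl// mulrC ler_wpM2l ?(ltW eps0)//.
by rewrite lerDl.
Qed.

End flow_line_bound.

(** * Propagation of smallness by Lagrange interpolation *)

Section lagrange_propagation.
Context {R : realType}.
Implicit Types (x : nat -> R) (y b c X Y M rho : R).

Lemma prod_distn D i : (i <= D)%N ->
  (\prod_(j < D.+1 | j != i :> nat) (i - j + (j - i)) = i`! * (D - i)`!)%N.
Proof.
move=> iD; rewrite -(big_mkord (fun j => j != i) (fun j => i - j + (j - i))%N).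
have iD2 : (i <= D.+1)%N by exact: leqW.
rewrite (big_cat_nat (leq0n i) iD2); congr muln.
  rewrite big_mkord -ffactnn ffact_prod; apply: eq_big => [j|j _]; first by rewrite (ltn_eqF (ltn_ord j)).
  by have := ltn_ord j; lia.
rewrite big_ltn_cond// eqxx /= fact_prod -(subSn iD).
have -> : (\prod_(i.+1 <= j < D.+1 | j != i) (i - j + (j - i)) = \prod_(1 + i <= j < D.+1) (j - i))%N.
  rewrite add1n big_nat_cond [RHS]big_nat_cond; apply: eq_big => [j|j /andP[/andP[ij _] _]]; last by lia.
  by have [ij|//] := ltnP i j; rewrite (gtn_eqF ij) andbT.
by rewrite big_addn; apply: eq_bigr => j _; rewrite addnK.
Qed.

Definition lagr x D (i : 'I_D.+1) y : R :=
  (\prod_(j < D.+1 | j != i :> nat) (x i - x j))^-1 * \prod_(j < D.+1 | j != i :> nat) (y - x j).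

Lemma lagr_sum x D k y : {in [pred i | (i <= D)%N] &, injective x} -> (k <= D)%N ->
  \sum_(i < D.+1) lagr x i y * x i ^+ k = y ^+ k.
Proof.
move=> xinj kD; pose X := \sum_(j < D.+1) `|x j|.
have xX i : (i <= D)%N -> x i <= X.
  move=> iD; apply: le_trans (ler_norm _) _.
  by rewrite /X (bigD1 (Ordinal (iD : (i < D.+1)%N)))//= lerDl sumr_ge0.
(* The interpolation formula is applied to a globally injective sequence, so the indices beyond D
   are sent to distinct points above all the nodes. *)
pose x' i := if (i <= D)%N then x i else X + i.+1%:R.
have gtX i j : (i <= D)%N -> x i <> X + j.+1%:R.
  move=> iD h; have := xX i iD; rewrite h gerDl leNgt ltr0n//.
have inj' : injective x'.
  move=> i j; rewrite /x'; have [iD|iD] := leqP i D; have [jD|jD] := leqP j D.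
  - exact: xinj.
  - by move=> /(gtX i j iD).
  - by move=> /esym /(gtX j i jD).
  - by move=> /addrI /eqP; rewrite eqr_nat => /eqP[].
have x'E (i : 'I_D.+1) : x' i = x i by rewrite /x' -ltnS ltn_ord.
have sX : (size ('X^k : {poly R}) <= D.+1)%N by rewrite size_polyXn ltnS.
have := lagrange_gen (ltn0Sn D) inj' sX.
move=> /(congr1 (fun p => p.[y])); rewrite hornerXn horner_sum => ->.
apply: eq_bigr => i _; rewrite hornerM hornerC hornerXn lagrangeE//= hornerM hornerC x'E mulrC; congr (_ * (_^-1 * _)).
  by rewrite horner_prod; apply: eq_big => // j _; rewrite hornerXsubC !x'E.
by rewrite horner_prod; apply: eq_big => // j _; rewrite hornerXsubC !x'E.
Qed.

(** The separation is a power p of the one of an arithmetic progression, for which the product of (D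
    + 1) / |i - j| over j is (D + 1)^D / (i! (D - i)!), at most (2 e)^{D+1}. *)
Lemma lagr_bound x D (p : nat) c X Y (i : 'I_D.+1) y : 0 < c -> 0 <= X -> 0 <= Y ->
  (forall i j, (i < j)%N -> (j <= D)%N -> c * ((j - i)%:R / D.+1%:R) ^+ p <= `|x j - x i|) ->
  (forall i, (i <= D)%N -> `|x i| <= X) -> `|y| <= Y ->
  `|lagr x i y| <= ((X + Y) / c) ^+ D * (2 * expR 1) ^+ (p * D.+1).
Proof.
move=> c0 X0 Y0 sep xX yY; set q := (X + Y) / c.
have q0 : 0 <= q by rewrite divr_ge0 ?addr_ge0// ltW.
pose d (j : nat) : R := (i - j + (j - i))%N%:R.
have d0 j : j != i :> nat -> 0 < d j by move=> ji; rewrite /d ltr0n; lia.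
have xd (j : 'I_D.+1) : j != i :> nat -> c * (d j / D.+1%:R) ^+ p <= `|x i - x j|.
  move=> ji; have [ij|ji'] := ltnP i j.
    rewrite distrC /d (_ : i - j + (j - i) = j - i)%N; last by lia.
    by apply: sep => //; rewrite -ltnS.
  rewrite /d (_ : i - j + (j - i) = i - j)%N; last by lia.
  by apply: sep; [lia|rewrite -ltnS].
have D0 : 0 < D.+1%:R :> R by rewrite ltr0n.
rewrite /lagr normrM normfV !normr_prod -prodfV -big_split /=.
apply: (@le_trans _ _ (\prod_(j < D.+1 | j != i :> nat) (q * (D.+1%:R / d j) ^+ p))).
  apply: ler_prod => j ji; have h := xd j ji; have dj := d0 _ ji.
  have e0 : 0 < c * (d j / D.+1%:R) ^+ p by rewrite mulr_gt0// exprn_gt0// divr_gt0.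
  rewrite mulr_ge0 ?invr_ge0//=.
  have -> : q * (D.+1%:R / d j) ^+ p = (c * (d j / D.+1%:R) ^+ p)^-1 * (X + Y).
    by rewrite /q invfM -exprVn invf_div; ring.
  apply: ler_pM => //.
    by rewrite lef_pV2 ?posrE// (lt_le_trans e0).
  apply: (le_trans (ler_normB _ _)); rewrite addrC lerD//.
  by apply: xX; rewrite -ltnS.
have card : #|[pred j : 'I_D.+1 | j != i :> nat]| = D.
  have -> : #|[pred j : 'I_D.+1 | j != i :> nat]| = #|predC1 i| by apply: eq_card => j; rewrite !inE.
  by rewrite cardC1 card_ord.
rewrite big_split /= prodr_const card ler_wpM2l ?exprn_ge0// prodrXl mulnC exprM.
rewrite lerXn2r ?nnegrE ?exprn_ge0 ?mulr_ge0 ?expR_ge0//.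
  by rewrite prodr_ge0// => j ji; rewrite divr_ge0// ltW// d0.
rewrite big_split /= prodr_const card prodfV.
have -> : \prod_(j < D.+1 | j != i :> nat) d j = (i`! * (D - i)`!)%:R.
  by rewrite -(prod_distn (ltn_ord i : (i <= D)%N)) natr_prod.
have f0 : 0 < (i`! * (D - i)`!)%:R :> R by rewrite ltr0n muln_gt0 !fact_gt0.
rewrite ler_pdivrMr//; apply: le_trans (exprn_le_expR D (ltW D0)) _.
have iD : (i <= D)%N by rewrite -ltnS.
rewrite -(bin_fact iD) natrM exprMn -[in leLHS](mulr1 D.+1%:R) expRM_natl.
have : 'C(D, i)%:R <= 2 ^+ D.+1 :> R.
  rewrite -natrX ler_nat; apply: leq_trans (_ : 2 ^ D <= _)%N; last by rewrite leq_exp2l.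
  have -> : (2 ^ D = \sum_(j < D.+1) 'C(D, j))%N.
    by rewrite -[2%N]/(1 + 1)%N expnDn; apply: eq_bigr => j _; rewrite !exp1n !muln1.
  by rewrite (bigD1 i)//= leq_addr.
have : 0 < expR 1 ^+ D.+1 :> R by rewrite exprn_gt0 ?expR_gt0.
move: ('C(_, _)%:R) (2 ^+ _) (expR 1 ^+ _) (_%:R) f0 => u t s f f0 s0 ut.
have : 0 <= (t - u) * (s * f) by rewrite mulr_ge0 ?subr_ge0// mulr_ge0// ltW.
by nra.
Qed.

(** The functional evaluating at y minus the interpolant kills the polynomials of degree at most D.
    The interpolant is bounded through the sum of the |lagr|, at most Q^{D+1}, and as rho is at
    least 2 Q X the remainder is of order 2^{-D}. *)
Lemma propagate (phi : R -> R) M rho D x y b c (p : nat) X Y :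
  (forall sw, kills sw D -> (forall wz, wz \in sw -> `|wz.2| <= rho / 2) ->
    `|linfun_seq sw phi| <= 2 * tail_weight sw D rho * M) ->
  0 <= M -> 0 < c -> c <= X -> 0 <= Y ->
  (forall i j, (i < j)%N -> (j <= D)%N -> c * ((j - i)%:R / D.+1%:R) ^+ p <= `|x j - x i|) ->
  (forall i, (i <= D)%N -> `|x i| <= X) -> `|y| <= Y ->
  (forall i, (i <= D)%N -> `|phi (x i)| <= b) ->
  2 * (2 * ((X + Y) / c) * (2 * expR 1) ^+ p) * X <= rho ->
  `|phi y| <= (2 * ((X + Y) / c) * (2 * expR 1) ^+ p) ^+ D.+1 * b + 4 * M / 2 ^+ D.+1.
Proof.
move=> hphi M0 c0 cX Y0 sep xX yY phib; set Q := 2 * ((X + Y) / c) * _ => QX.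
have X0 : 0 < X by apply: lt_le_trans cX.
have e1 : 1 <= (2 * expR 1 : R) ^+ p.
  by rewrite exprn_ege1//; have := expR_ge1Dx (1 : R); lra.
have XY1 : 1 <= (X + Y) / c by rewrite ler_pdivlMr// mul1r (le_trans cX)// lerDl.
have Q0 : 0 < Q by rewrite /Q; move: (_ / c) (_ ^+ p) XY1 e1 => u t u1 t1; nra.
have b0 : 0 <= b by apply: le_trans (phib 0%N (leq0n _)).
have YQ : Y <= Q * X.
  apply: (@le_trans _ _ (((X + Y) / c) * X)).
    rewrite mulrAC ler_pdivlMr//.
    have : (X - c) * Y >= 0 by rewrite mulr_ge0// subr_ge0.
    by nra.
  rewrite ler_wpM2r ?(ltW X0)// /Q; move: (_ / c) (_ ^+ p) XY1 e1 => u t u1 t1; nra.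
have rho0 : 0 < rho by apply: lt_le_trans QX; apply: mulr_gt0 => //; exact: mulr_gt0.
have QX2 : Q * X <= rho / 2 by rewrite ler_pdivlMr// mulrC mulrA.
have XQ : X <= Q * X.
  rewrite ler_peMl ?(ltW X0)// /Q; move: (_ / c) (_ ^+ p) XY1 e1 => u t u1 t1; nra.
have xinj : {in [pred i | (i <= D)%N] &, injective x}.
  have lt i j : (i < j)%N -> (j <= D)%N -> x j <> x i.
    move=> ij jD h; have := sep i j ij jD; rewrite h subrr normr0 leNgt mulr_gt0//.
    by rewrite exprn_gt0// divr_gt0 ?ltr0n ?subn_gt0.
  move=> i j; rewrite !inE => iD jD h.
  by have [/lt /(_ jD) /(_ (esym h))|/lt /(_ iD)|] := ltngtP i j.
pose sw := (1, y) :: [seq (- lagr x i y, x i) | i <- index_enum 'I_D.+1].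
have linE (psi : R -> R) : linfun_seq sw psi = psi y - \sum_(i < D.+1) lagr x i y * psi (x i).
  rewrite /linfun_seq big_cons mul1r big_map /= -sumrN.
  by congr (_ + _); apply: eq_bigr => i _; rewrite mulNr.
have kD : kills sw D by move=> k kD; rewrite linE lagr_sum// subrr.
have sr wz : wz \in sw -> `|wz.2| <= rho / 2.
  rewrite inE => /orP[/eqP ->/=|/mapP[i _ -> /=]]; first by rewrite (le_trans yY)// (le_trans YQ).
  by rewrite (le_trans (xX _ _))// ?(le_trans XQ)// -ltnS.
have := hphi sw kD sr; rewrite linE.
have LQ : \sum_(i < D.+1) `|lagr x i y| <= Q ^+ D.+1.
  apply: (@le_trans _ _ (\sum_(i < D.+1) ((X + Y) / c) ^+ D * (2 * expR 1) ^+ (p * D.+1))).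
    by apply: ler_sum => i _; apply: lagr_bound => //; exact: ltW.
  rewrite sumr_const card_ord -[_ *+ _]mulr_natl exprM mulrA /Q [leRHS]exprMn.
  apply: ler_wpM2r; first by rewrite !exprn_ge0// mulr_ge0 ?expR_ge0.
  rewrite [leRHS]exprMn; apply: ler_pM; rewrite ?exprn_ge0 ?(le_trans ler01 XY1)//.
    by rewrite -natrX ler_nat ltnW// ltn_expl.
  by rewrite ler_weXn2l.
set T := tail_weight _ _ _.
have half : (Q * X / rho) ^+ D.+1 <= (2 ^+ D.+1)^-1.
  have QX0 : 0 <= Q * X / rho by apply: divr_ge0 (ltW rho0); apply: mulr_ge0; exact: ltW.
  by rewrite -exprVn lerXn2r ?nnegrE ?invr_ge0// ler_pdivrMr// [leRHS]mulrC.
have T2 : T <= 2 * (2 ^+ D.+1)^-1.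
  rewrite /T /tail_weight big_cons big_map /= normr1 mul1r mulr_natl mulr2n lerD//.
    have QX1 : 0 <= Q * X by apply: mulr_ge0; exact: ltW.
    apply: le_trans half; rewrite lerXn2r ?nnegrE ?divr_ge0 ?(ltW rho0)//.
    by rewrite ler_wpM2r ?invr_ge0 ?(ltW rho0)// (le_trans yY).
  apply: le_trans half; rewrite -mulrA exprMn.
  apply: (@le_trans _ _ ((\sum_(i < D.+1) `|lagr x i y|) * (X / rho) ^+ D.+1)); last first.
    by rewrite ler_wpM2r// exprn_ge0// divr_ge0 ?(ltW X0) ?(ltW rho0).
  rewrite mulr_suml; apply: ler_sum => i _; rewrite normrN ler_wpM2l//.
  rewrite lerXn2r ?nnegrE ?divr_ge0 ?(ltW X0) ?(ltW rho0)// ler_wpM2r ?invr_ge0 ?(ltW rho0)//.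
  by apply: xX; rewrite -ltnS.
move=> h; set S := \sum_(i < D.+1) _ in h.
have S1 : `|S| <= Q ^+ D.+1 * b.
  apply: (@le_trans _ _ ((\sum_(i < D.+1) `|lagr x i y|) * b)); last by rewrite ler_wpM2r.
  apply: (le_trans (ler_norm_sum _ _ _)); rewrite mulr_suml; apply: ler_sum => i _.
  by rewrite normrM ler_wpM2l// phib// -ltnS.
have := ler_normD (phi y - S) S; rewrite subrK => /le_trans; apply.
rewrite addrC lerD//; apply: le_trans h _.
have -> : 4 * M / 2 ^+ D.+1 = 2 * (2 * (2 ^+ D.+1)^-1) * M by ring.
by rewrite ler_wpM2r// ler_wpM2l.
Qed.

End lagrange_propagation.

(** * Quantiles of a finite measure *)

Section quantiles.
Context {R : realType} {T : finType}.
Variables (pos w : T -> R).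
Hypothesis w0 : forall i, 0 <= w i.

(* the [k]-th node is the smallest position whose cumulative mass exceeds
   [k m / (D + 1)], [m] being the total mass *)
Lemma quantile_nodes D : 0 < \sum_i w i -> exists f : nat -> T, forall k l, (k < l)%N -> (l <= D)%N ->
  pos (f k) <= pos (f l) /\
  (l - k)%:R / D.+1%:R * (\sum_i w i) <= \sum_(i | (pos (f k) <= pos i) && (pos i <= pos (f l))) w i.
Proof.
set m := \sum_i w i => m0.
pose F t := \sum_(i | pos i <= t) w i.
pose th (k : nat) := k%:R / D.+1%:R * m.
have D0 : 0 < D.+1%:R :> R by rewrite ltr0n.
have [i0 _] : exists i0 : T, true.
  apply: contrapT => h; move: m0; rewrite /m big1 ?ltxx// => i _; case: h; by exists i.
pose im := [arg max_(i > i0) pos i]%O.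
have Fm : F (pos im) = m.
  rewrite /F /m; apply: eq_bigl => i; rewrite /im; case: arg_maxP => // j _ /(_ i); exact.
have thm k : (k <= D)%N -> th k < F (pos im).
  move=> kD; rewrite Fm /th mulrAC ltr_pdivrMr// mulrC ltr_pM2l// ltr_nat ltnS//.
pose f k := [arg min_(i < im | th k < F (pos i)) pos i]%O.
exists f => k l kl lD; have kD : (k <= D)%N by rewrite (leq_trans (ltnW kl)).
have thkl : th k <= th l by rewrite /th ler_wpM2r ?(ltW m0)// ler_wpM2r ?invr_ge0 ?(ltW D0)// ler_nat ltnW.
have [fk1 fk2] : th k < F (pos (f k)) /\ forall i, th k < F (pos i) -> pos (f k) <= pos i.
  by rewrite /f; case: arg_minP; first exact: thm.
have [fl1 fl2] : th l < F (pos (f l)) /\ forall i, th l < F (pos i) -> pos (f l) <= pos i.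
  by rewrite /f; case: arg_minP; first exact: thm.
have fkl : pos (f k) <= pos (f l) by apply: fk2; exact: le_lt_trans fl1.
split => //.
pose G := \sum_(i | pos i < pos (f k)) w i.
have Gk : G <= th k.
  have [[j jk]|none] := pselect (exists j, pos j < pos (f k)); last first.
    rewrite /G big1 => [|i ik]; first by rewrite /th !mulr_ge0 ?invr_ge0 ?(ltW D0) ?(ltW m0).
    by case: none; exists i.
  pose i1 := [arg max_(i > j | pos i < pos (f k)) pos i]%O.
  have [i1k i1max] : pos i1 < pos (f k) /\ forall i, pos i < pos (f k) -> pos i <= pos i1.
    by rewrite /i1; case: arg_maxP.
  have -> : G = F (pos i1).
    apply: eq_bigl => i; apply/idP/idP => [/i1max//|ii1]; exact: le_lt_trans i1k.
  rewrite leNgt; apply/negP => /fk2; by rewrite leNgt i1k.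
have : F (pos (f l)) = G + \sum_(i | (pos (f k) <= pos i) && (pos i <= pos (f l))) w i.
  rewrite /F (bigID (fun i => pos i < pos (f k))) /=; congr (_ + _); apply: eq_bigl => i.
    by rewrite andbC; have [h|//] := ltP (pos i) (pos (f k)); rewrite /= (le_trans (ltW h)).
  by rewrite -leNgt andbC.
have : (l - k)%:R / D.+1%:R * m = th l - th k.
  by rewrite /th natrB ?(ltnW kl)// !mulrBl.
by move=> -> h; rewrite h in fl1; lra.
Qed.

End quantiles.

(** * Frostman measures from Hausdorff content *)

Section greedy_weights.
Context {R : realType} {T : finType} {L : eqType}.
Variables (K : nat) (c : nat -> T -> L) (tau : nat -> R).
Hypothesis tau0 : forall l, 0 <= tau l.

Definition cell_mass (w : T -> R) l a : R := \sum_(i | c l i == a) w i.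

(** Points are treated one at a time. Each receives the smallest slack among its cells of levels 0
    to K: no cell overflows, and one of its cells becomes saturated and remains so. *)
Lemma greedy_weights (s : seq T) : exists w : T -> R, [/\ forall i, 0 <= w i,
  forall l a, (l <= K)%N -> cell_mass w l a <= tau l &
  forall i, i \in s -> exists2 l, (l <= K)%N & cell_mass w l (c l i) = tau l].
Proof.
elim: s => [|i s [w [w0 wt ws]]].
  by exists (fun=> 0); split=> // l a _; rewrite /cell_mass big1.
pose slack (l : 'I_K.+1) := tau l - cell_mass w l (c l i).
pose l0 := [arg min_(l < ord0) slack l]%O.
have l0min l : slack l0 <= slack l by rewrite /l0; case: arg_minP => // j _; apply.
have s0 : 0 <= slack l0 by rewrite subr_ge0 wt// -ltnS.
pose w' j := w j + (j == i)%:R * slack l0.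
have massE l a : cell_mass w' l a = cell_mass w l a + (c l i == a)%:R * slack l0.
  rewrite /cell_mass big_split /= -mulr_suml; congr (_ + _ * _).
  have [e|ne] := eqVneq (c l i) a.
    by rewrite (bigD1 i) ?e//= eqxx big1 ?addr0// => j /andP[_ /negPf ->].
  by rewrite big1// => j /eqP cj; case: (eqVneq j i) => // ji; rewrite -cj ji eqxx in ne.
have w't l a : (l <= K)%N -> cell_mass w' l a <= tau l.
  move=> lK; rewrite massE; have [<-|_] := eqVneq (c l i) a; last by rewrite mul0r addr0 wt.
  by have := l0min (Ordinal (lK : (l < K.+1)%N)); rewrite /slack /= mul1r => h; rewrite addrC -lerBrDr.
exists w'; split => [j|//|j].
  by rewrite addr_ge0// mulr_ge0.
rewrite inE => /orP[/eqP ->|/ws[l lK h]].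
  by exists l0; [rewrite -ltnS|rewrite massE eqxx mul1r addrC subrK].
exists l => //; apply/eqP; rewrite eq_le w't// massE h lerDl mulr_ge0//.
Qed.

Hypothesis nest : forall l l' i j, (l <= l')%N -> c l' i = c l' j -> c l i = c l j.

(* Maximal saturated cells are disjoint and cover everything. *)
Lemma saturated_total (w : T -> R) :
  (forall i, exists2 l, (l <= K)%N & cell_mass w l (c l i) = tau l) ->
  exists (P : pred T) (lv : T -> nat), [/\ forall i, (lv i <= K)%N,
    forall i, exists2 j, P j & c (lv j) i = c (lv j) j &
    \sum_i w i = \sum_(j | P j) tau (lv j)].
Proof.
move=> sat; pose S i l := (l <= K)%N && (cell_mass w l (c l i) == tau l).
have exS i : exists l, S i l by have [l lK h] := sat i; exists l; rewrite /S lK h eqxx.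
pose lv i := ex_minn (exS i).
have lvS i : S i (lv i) by rewrite /lv; case: ex_minnP.
have lvmin i l : S i l -> (lv i <= l)%N by rewrite /lv; case: ex_minnP => m _; apply.
have same i j : c (lv j) i = c (lv j) j -> lv i = lv j.
  move=> h; have ij : (lv i <= lv j)%N.
    by apply: lvmin; have := lvS j; rewrite /S h.
  apply/eqP; rewrite eqn_leq ij lvmin//; have := lvS i; rewrite /S.
  by rewrite (nest ij h).
pose lab i := (lv i, c (lv i) i).
pose rep i := odflt i [pick k | lab k == lab i].
have lab_rep i : lab (rep i) = lab i.
  by rewrite /rep; case: pickP => [k /eqP ->//|//].
have rep_lab i j : lab i = lab j -> rep i = rep j.
  rewrite /rep => h; rewrite h; case: pickP => [k //|/(_ j)]; by rewrite eqxx.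
have labE i j : (lab i == lab j) = (c (lv j) i == c (lv j) j).
  apply/eqP/eqP => [[h1 h2]|h]; first by rewrite -[in LHS]h1.
  by rewrite /lab (same _ _ h) h.
exists (fun j => rep j == j), lv; split.
- by move=> i; have /andP[] := lvS i.
- move=> i; exists (rep i); first by apply/eqP/rep_lab.
  by apply/eqP; rewrite -labE lab_rep.
rewrite (partition_big rep (fun j => rep j == j)) /= => [|i _]; last first.
  by apply/eqP/rep_lab.
apply: eq_bigr => j /eqP rj; have /andP[_ /eqP <-] := lvS j.
apply: eq_bigl => i; rewrite -labE; apply/eqP/eqP => [<-|/rep_lab ->//].
by rewrite lab_rep.
Qed.

End greedy_weights.

Section grid_cells.
Context {R : realType} {n : nat}.
Local Notation rV := 'rV[R]_n.
Implicit Types (x y : rV).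

Definition grid_cell (N : nat) x : {ffun 'I_n -> int} :=
  [ffun k => Num.floor (x ord0 k * N%:R)].

Lemma floor_nest (N d : nat) (u v : R) : (0 < d)%N ->
  Num.floor (u * (N * d)%:R) = Num.floor (v * (N * d)%:R) ->
  Num.floor (u * N%:R) <= Num.floor (v * N%:R).
Proof.
move=> d0 h; have dr : 0 < d%:R :> R by rewrite ltr0n.
rewrite floor_ge_int -(ler_pM2r dr) -mulrA -natrM.
have -> : (Num.floor (u * N%:R))%:~R * d%:R = (Num.floor (u * N%:R) * d%:Z)%:~R :> R.
  by rewrite intrM.
rewrite -floor_ge_int -h floor_ge_int intrM natrM mulrA ler_wpM2r ?(ltW dr)//.
exact: floor_le.
Qed.

Lemma grid_cell_nest N d x y : (0 < d)%N ->
  grid_cell (N * d) x = grid_cell (N * d) y -> grid_cell N x = grid_cell N y.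
Proof.
move=> d0 h; apply/ffunP => k; rewrite !ffunE.
have := congr1 (fun f : {ffun 'I_n -> int} => f k) h; rewrite !ffunE => hk.
by apply/eqP; rewrite eq_le !(@floor_nest N d).
Qed.

Lemma grid_cell_dist N x y k : (0 < N)%N -> grid_cell N x = grid_cell N y ->
  `|x ord0 k - y ord0 k| < N%:R^-1.
Proof.
move=> N0 h; have Nr : 0 < N%:R :> R by rewrite ltr0n.
have := congr1 (fun f : {ffun 'I_n -> int} => f k) h; rewrite !ffunE => hk.
have x1 := floor_le (x ord0 k * N%:R); have x2 := floorD1_gt (x ord0 k * N%:R).
have y1 := floor_le (y ord0 k * N%:R); have y2 := floorD1_gt (y ord0 k * N%:R).
rewrite hk in x1 x2; rewrite -[ltRHS]mul1r ltr_pdivlMr// -(gtr0_norm Nr) -normrM mulrBl.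
move: x1 x2 y1 y2; rewrite intrD; move: (_ * _) (_ * _) (_%:~R) => u v t h1 h2 h3 h4.
by rewrite ltr_norml; apply/andP; split; lra.
Qed.

Lemma enorm_grid N x y : (0 < n)%N -> (0 < N)%N -> grid_cell N x = grid_cell N y ->
  enorm (x - y) < n%:R / N%:R.
Proof.
move=> n0 N0 h; have Nr : 0 < N%:R :> R by rewrite ltr0n.
have nr : 1 <= n%:R :> R by rewrite ler1n.
have b0 : 0 < n%:R / N%:R :> R by rewrite divr_gt0// (lt_le_trans ltr01).
rewrite /enorm -(gtr0_norm b0) -sqrtr_sqr ltr_sqrt ?exprn_gt0//.
apply: (@lt_le_trans _ _ (\sum_(i < n) N%:R ^- 2)); last first.
  rewrite sumr_const card_ord -[_ *+ _]mulr_natl expr_div_n ler_wpM2r ?invr_ge0 ?exprn_ge0//.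
  by rewrite expr2 ler_peMl// (le_trans ler01).
apply: ltr_sum; first by apply/hasP; exists (Ordinal n0) => //; rewrite mem_index_enum.
move=> i _; rewrite !mxE -(real_normK (num_real _)) -exprVn.
by rewrite ltr_pXn2r// ?nnegrE ?invr_ge0// (grid_cell_dist _ N0 h).
Qed.

Lemma floor_near (B : nat) (u v : R) : `|u - v| <= B%:R ->
  exists j : 'I_(2 * B).+1, Num.floor u = Num.floor v + j%:Z - B%:Z.
Proof.
rewrite ler_norml => /andP[h1 h2].
have u1 : Num.floor u < Num.floor v + B%:Z + 1.
  have := floorD1_gt v; rewrite floor_lt_int !intrD => h; move: h h2.
  by rewrite -[B%:~R]/(B%:R : R); move: (_%:~R) (_%:~R) => a b; lra.
have u2 : Num.floor v - B%:Z <= Num.floor u.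
  have := floor_le v; rewrite floor_ge_int intrB => h; move: h h1.
  by rewrite -[B%:~R]/(B%:R : R); move: (_%:~R) => a; lra.
move: (Num.floor u) (Num.floor v) u1 u2 => p q u1 u2.
have jlt : (`|(p - q + B%:Z)%R|%N < (2 * B).+1)%N by lia.
by exists (Ordinal jlt) => /=; lia.
Qed.

(** Along each axis, a ball of radius B / N meets at most 2 B + 1 grid intervals of length 1 / N. *)
Lemma cell_ball (T : finType) (pt : T -> rV) (w : T -> R) (N B : nat) (x : rV) (t : R) :
  (forall i, 0 <= w i) -> (0 < N)%N ->
  (forall a, cell_mass (fun=> grid_cell N \o pt) w 0 a <= t) ->
  \sum_(i | `|pt i - x| <= B%:R / N%:R) w i <= ((2 * B).+1 ^ n)%:R * t.
Proof.
move=> w0 N0 ht; have Nr : 0 < N%:R :> R by rewrite ltr0n.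
pose lab (f : {ffun 'I_n -> 'I_(2 * B).+1}) : {ffun 'I_n -> int} :=
  [ffun k => Num.floor (x ord0 k * N%:R) + (f k)%:Z - B%:Z].
apply: (@le_trans _ _ (\sum_i \sum_f (grid_cell N (pt i) == lab f)%:R * w i)).
  rewrite big_mkcond; apply: ler_sum => i _; case: ifPn => [h|_]; last first.
    by apply: sumr_ge0 => f _; rewrite mulr_ge0.
  have ex k : exists j : 'I_(2 * B).+1,
      Num.floor (pt i ord0 k * N%:R) = Num.floor (x ord0 k * N%:R) + j%:Z - B%:Z.
    apply: floor_near; rewrite -mulrBl normrM (gtr0_norm Nr) -ler_pdivlMr//.
    by apply: le_trans h; have := rV_norm_coor (pt i - x) k; rewrite !mxE.
  pose f := [ffun k => projT1 (cid (ex k))].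
  have fE : grid_cell N (pt i) == lab f.
    apply/eqP/ffunP => k; rewrite !ffunE; case: cid => j /=; exact.
  by rewrite (bigD1 f)//= fE mul1r lerDl; apply: sumr_ge0 => g _; rewrite mulr_ge0.
rewrite exchange_big /=.
have -> : ((2 * B).+1 ^ n)%:R * t = \sum_(f : {ffun 'I_n -> 'I_(2 * B).+1}) t.
  by rewrite sumr_const card_ffun !card_ord -[RHS]mulr_natl.
apply: ler_sum => f _; apply: le_trans (ht (lab f)).
by rewrite /cell_mass [leRHS]big_mkcond /=; apply: ler_sum => i _; case: eqVneq; rewrite ?mul1r ?mul0r.
Qed.

End grid_cells.

Section content.
Context {R : realType} {n : nat}.
Local Notation rV := 'rV[R]_n.
Variables (a : R) (Theta : set rV).
Hypothesis a0 : 0 < a.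

Lemma ediameter_ball (c : rV) r : (ediameter (open_eball c r) <= (2 * r)%:E)%E.
Proof.
apply: ge_ereal_sup => _ [[x y] [/= hx hy] <-]; rewrite lee_fin.
have r0 : 0 <= r by apply: le_trans (ltW hx); exact: sqrtr_ge0.
have r2 : 0 <= 2 * r by rewrite mulr_ge0.
have e0 (z : rV) : 0 <= enorm z by exact: sqrtr_ge0.
rewrite -(@ler_pXn2r _ 2) ?nnegrE// enorm_sqr.
have hx2 : nsq (x - c) <= r ^+ 2 by rewrite -enorm_sqr lerXn2r ?nnegrE// ltW.
have hy2 : nsq (y - c) <= r ^+ 2 by rewrite -enorm_sqr lerXn2r ?nnegrE// ltW.
have par : nsq (x - y) + nsq ((x - c) + (y - c)) = 2 * nsq (x - c) + 2 * nsq (y - c).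
  have -> : x - y = (x - c) + - (y - c) by rewrite opprB addrA subrK.
  by rewrite [in LHS]nsqD [nsq (x - c + (y - c))]nsqD nsqN dotvNr; ring.
have := nsq_ge0 ((x - c) + (y - c)); rewrite exprMn; move: par hx2 hy2.
by move: (nsq _) (nsq _) (nsq _) (nsq _) (r ^+ 2) => p q s t u; lra.
Qed.

Lemma sum_cut (f : nat -> R) N k : (forall j, 0 <= f j) ->
  \sum_(0 <= j < N) (if (j < k)%N then f j else 0) <= \sum_(0 <= j < k) f j.
Proof.
move=> f0; have -> : \sum_(0 <= j < N) (if (j < k)%N then f j else 0) = \sum_(0 <= j < minn N k) f j.
  elim: N => [|N IH]; first by rewrite min0n !big_geq.
  rewrite big_nat_recr//= IH; have [Nk|kN] := ltnP N k.
    by rewrite (minn_idPl Nk) big_nat_recr.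
  by rewrite addr0 (minn_idPr (leqW kN)).
rewrite [leRHS](big_cat_nat (leq0n _) (geq_minr N k)) lerDl.
by apply: sumr_ge0.
Qed.

(** The content is an infimum over infinite families of true balls. A finite cover is completed by
    balls so small that together they contribute at most c / 4. *)
Lemma content_finite_cover : (0 < hausdorff_content a Theta)%E ->
  exists2 c0 : R, 0 < c0 & forall s : seq (rV * R), (forall z, z \in s -> 0 < z.2) ->
    (forall x, Theta x -> exists2 z, z \in s & open_eball z.1 z.2 x) ->
    c0 <= \sum_(z <- s) (2 * z.2) `^ a.
Proof.
set H := hausdorff_content a Theta => H0.
(* The content may be infinite; a positive real lower bound is enough, and 1 serves in that case. *)
have [c c0 cH] : exists2 c : R, 0 < c & (c%:E <= H)%E.
  move: H0; case: H => [r r0|_|//]; last by exists 1; rewrite ?leey.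
  by exists r => //; rewrite -lte_fin.
exists (c / 2); first by rewrite divr_gt0.
move=> s s0 scov; rewrite leNgt; apply/negP => sc.
have a1 : a != 0 by rewrite gt_eqF.
pose t j : R := c / 4 * 2^-1 ^+ j.+1.
have t0 j : 0 < t j by rewrite mulr_gt0 ?divr_gt0 ?exprn_gt0.
pose z0 : rV * R := (0, 1).
pose z j : rV * R := if (j < size s)%N then nth z0 s j else (0, t j `^ a^-1 / 2).
have z2 j : 0 < (z j).2.
  by rewrite /z; case: ifPn => h; [rewrite s0// mem_nth|rewrite divr_gt0// powR_gt0].
pose B j := open_eball (z j).1 (z j).2.
have part N : \sum_(j < N) (2 * (z j).2) `^ a <= \sum_(z <- s) (2 * z.2) `^ a + \sum_(j < N) t j.
  apply: (@le_trans _ _ (\sum_(j < N) ((if (j < size s)%N then (2 * (nth z0 s j).2) `^ a else 0) + t j))).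
    apply: ler_sum => j _; rewrite /z; case: ifPn => h /=; first by rewrite lerDl ltW.
    by rewrite add0r mulrC divfK// -powRrM mulVf// powRr1// ltW.
  rewrite big_split /= lerD2r.
  rewrite (big_nth z0) -(big_mkord xpredT (fun j => if (j < size s)%N then (2 * (nth z0 s j).2) `^ a else 0)).
  apply: (sum_cut (f := fun j => (2 * (nth z0 s j).2) `^ a)) => j; exact: powR_ge0.
have tsum N : \sum_(j < N) t j <= c / 4.
  have tel : \sum_(j < N) t j = c / 4 * (1 - 2^-1 ^+ N).
    elim: N => [|N IH]; first by rewrite big_ord0 expr0 subrr mulr0.
    by rewrite big_ord_recr /= IH /t exprS; field.
  by rewrite tel ler_piMr ?divr_ge0 ?(ltW c0)// gerBl exprn_ge0.
have : (H <= (c / 2 + c / 4)%:E)%E.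
  apply: ge_ereal_inf; exists (\sum_(0 <= j <oo) ediameter (B j) `^ a)%E.
    exists B => //; split => [j|x /scov[p ps px]].
      by exists (z j).1, (z j).2.
    have js : (index p s < size s)%N by rewrite index_mem.
    by exists (index p s) => //; rewrite /B /z js nth_index.
  have p0 j : (0 <= ediameter (B j) `^ a)%E by exact: poweR_ge0.
  apply: lime_le; first by apply: is_cvg_nneseries => j _ _; exact: p0.
  apply: nearW => N; apply: (@le_trans _ _ (\sum_(j < N) (2 * (z j).2) `^ a)%:E).
    rewrite big_mkord -sumEFin; apply: lee_sum => j _; rewrite -poweR_EFin.
    apply: gt0_ler_poweR; rewrite ?(ltW a0) ?in_itv/= ?leey ?andbT ?lee_fin ?mulr_ge0 ?(ltW (z2 j))//.
    - apply: (@le_trans _ _ (enorm ((z j).1 - (z j).1))%:E); first by rewrite lee_fin sqrtr_ge0.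
      have cz : B j (z j).1 by rewrite /B /open_eball /= subrr /enorm big1 ?sqrtr0// => i _; rewrite mxE expr0n.
      by apply: ereal_sup_ubound; exists ((z j).1, (z j).1).
    - exact: ediameter_ball.
  rewrite lee_fin; apply: (le_trans (part N)); rewrite lerD ?(ltW sc)//.
by move=> /(le_trans cH); rewrite lee_fin; move: c0; lra.
Qed.

End content.

Section frostman.
Context {R : realType} {n : nat}.
Local Notation rV := 'rV[R]_n.
Variables (a : R) (Theta : set rV) (q : nat) (tau : nat -> R) (c0 : R).
Hypotheses (n0 : (0 < n)%N) (q0 : (0 < q)%N).
Hypothesis Theta1 : forall x, Theta x -> `|x| <= 1.
Hypothesis tau_ge : forall l, ((q ^ l)%:R^-1) `^ a <= tau l.
Hypothesis cover : forall s : seq (rV * R), (forall z, z \in s -> 0 < z.2) ->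
  (forall x, Theta x -> exists2 z, z \in s & open_eball z.1 z.2 x) ->
  c0 <= \sum_(z <- s) (2 * z.2) `^ a.

(** One point of Theta is chosen in each finest cell that meets Theta, and the weights are greedy.
    The total mass is the sum of the capacities of the maximal saturated cells. Balls around these
    cells cover Theta, so the covering bound makes the sum large. *)
Lemma frostman K : exists (T : finType) (pt : T -> rV) (w : T -> R), [/\
  forall i, Theta (pt i), forall i, 0 <= w i, c0 <= (2 * n%:R) `^ a * \sum_i w i &
  forall l B x, (l <= K)%N ->
    \sum_(i | `|pt i - x| <= B%:R / (q ^ l)%:R) w i <= ((2 * B).+1 ^ n)%:R * tau l].
Proof.
have tau0 l : 0 <= tau l by apply: le_trans (tau_ge l); exact: powR_ge0.
pose N := (q ^ K)%N; have N0 : (0 < N)%N by rewrite expn_gt0 q0.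
pose F : finType := {ffun 'I_n -> 'I_(2 * N).+1}.
(* The finest cell as an element of a finite type; [inord] is faithful on Theta because coordinates
   lie in [-1, 1]. *)
pose enc (x : rV) : F := [ffun k => inord `|(Num.floor (x ord0 k * N%:R) + N%:Z)%R|%N].
have encE x y : Theta x -> Theta y -> enc x = enc y -> grid_cell N x = grid_cell N y.
  have bnd z k : Theta z -> 0 <= Num.floor (z ord0 k * N%:R) + N%:Z /\
      (`|(Num.floor (z ord0 k * N%:R) + N%:Z)%R|%N < (2 * N).+1)%N.
    move=> /Theta1 z1; have zk : `|z ord0 k * N%:R - 0| <= N%:R.
      rewrite subr0 normrM normr_nat ler_piMl//.
      exact: le_trans (rV_norm_coor _ _) z1.
    have [j ->] := floor_near zk; rewrite floor0; have := ltn_ord j.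
    by move: (nat_of_ord j) => j' hj; split; lia.
  move=> Tx Ty h; apply/ffunP => k; rewrite !ffunE.
  have := congr1 (fun f : F => f k) h; rewrite !ffunE => /(congr1 val) /=.
  have [x0 xb] := bnd x k Tx; have [y0 yb] := bnd y k Ty.
  rewrite !inordK//; move: (Num.floor _) (Num.floor _) x0 y0 {xb yb} => u v; lia.
pose T : finType := {f : F | `[< exists x, Theta x /\ enc x = f >]}.
have pick (f : T) : exists x, Theta x /\ enc x = val f by exact: (asboolP _ (valP f)).
pose pt f := projT1 (cid (pick f)).
have ptT f : Theta (pt f) by rewrite /pt; case: cid => x [].
have pte f : enc (pt f) = val f by rewrite /pt; case: cid => x [].
pose c l f := grid_cell (q ^ l) (pt f).
have nestx l l' (x y : rV) : (l <= l')%N -> grid_cell (q ^ l') x = grid_cell (q ^ l') y ->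
    grid_cell (q ^ l) x = grid_cell (q ^ l) y.
  move=> ll'; rewrite -(subnKC ll') expnD; apply: grid_cell_nest.
  by rewrite expn_gt0 q0.
have nest l l' i j : (l <= l')%N -> c l' i = c l' j -> c l i = c l j by exact: nestx.
have [w [w0 wt ws]] := greedy_weights K c tau0 (enum T).
have sat i : exists2 l, (l <= K)%N & cell_mass c w l (c l i) = tau l by apply: ws; rewrite mem_enum.
have [P [lv [lvK Prep Ptot]]] := saturated_total nest sat.
exists T, pt, w; split => //.
(* A grid cell of level l lies in the open Euclidean ball of radius n / q^l around any of its
   points. *)
- pose s := [seq (pt j, n%:R / (q ^ lv j)%:R : R) | j <- enum P].
  have qr l : 0 < (q ^ l)%:R :> R by rewrite ltr0n expn_gt0 q0.
  have nr : 0 < n%:R :> R by rewrite ltr0n.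
  apply: (@le_trans _ _ (\sum_(z <- s) (2 * z.2) `^ a)).
    apply: cover => [z /mapP[j _ ->] /=|x Tx]; first by rewrite divr_gt0.
    have px : `[< exists y, Theta y /\ enc y = enc x >] by apply/asboolP; exists x.
    pose i : T := Sub (enc x) px.
    have [j Pj ij] := Prep i; exists (pt j, n%:R / (q ^ lv j)%:R).
      by apply/mapP; exists j => //; rewrite mem_enum.
    rewrite /open_eball /=; apply: enorm_grid => //; first by rewrite expn_gt0 q0.
    rewrite -[RHS]ij; apply: (nestx _ _ _ _ (lvK j)); apply: (encE x (pt i) Tx (ptT i)).
    by rewrite (pte i).
  rewrite big_map big_enum Ptot mulr_sumr; apply: ler_sum => j _ /=.
  rewrite mulrA powRM ?mulr_ge0 ?invr_ge0 ?(ltW nr) ?(ltW (qr _))//.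
  by rewrite ler_wpM2l ?powR_ge0.
- move=> l B x lK; apply: cell_ball => //; first by rewrite expn_gt0 q0.
  by move=> b; exact: wt.
Qed.

End frostman.

(** * Slicing a measure by lines through a point *)

Section counting.
Context {R : realType}.

(** The values i D / N form an arithmetic progression of step |D| / N, of which an interval of
    length 2 tau contains at most 2 tau N / |D| + 1. *)
Lemma count_affine (N : nat) (A D tau : R) : (0 < N)%N -> D != 0 -> 0 <= tau ->
  #|[pred i : 'I_N | `|A - i%:R / N%:R * D| <= tau]|%:R <= 2 * tau * N%:R / `|D| + 1.
Proof.
move=> N0 D0 tau0; set S := [pred i | _]; have Nr : 0 < N%:R :> R by rewrite ltr0n.
have Dp : 0 < `|D| by rewrite normr_gt0.
have [i1 Si1|S0] := pickP S; last first.
  by rewrite eq_card0// addr_ge0// divr_ge0 ?(ltW Dp)// !mulr_ge0 ?(ltW Nr).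
pose lo := [arg min_(i < i1 | S i) (i : nat)]%O; pose hi := [arg max_(i > i1 | S i) (i : nat)]%O.
have [Slo lomin] : S lo /\ forall i, S i -> (lo <= i)%N by rewrite /lo; case: arg_minP.
have [Shi himax] : S hi /\ forall i, S i -> (i <= hi)%N by rewrite /hi; case: arg_maxP.
have lohi : (lo <= hi)%N by exact: himax.
have card : (#|S| <= (hi - lo).+1)%N.
  rewrite cardE -(size_map (@nat_of_ord N)) -(size_iota lo (hi - lo).+1); apply: uniq_leq_size.
    by rewrite map_inj_uniq ?enum_uniq//; exact: ord_inj.
  apply/allP; rewrite all_map; apply/allP => i; rewrite mem_enum => Si /=.
  by rewrite -[_ :: _]/(iota lo (hi - lo).+1) mem_iota lomin//= addnS subnKC// ltnS himax.
apply: (@le_trans _ _ ((hi - lo).+1%:R)); first by rewrite ler_nat.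
rewrite -natr1 lerD2r ler_pdivlMr// natrB//.
move: Slo Shi; rewrite /S !inE !ler_norml => /andP[l1 l2] /andP[h1 h2].
have : `|(hi%:R - lo%:R) / N%:R * D| <= 2 * tau.
  rewrite ler_norml; apply/andP; rewrite !mulrBl; split; lra.
rewrite normrM ger0_norm; last by rewrite divr_ge0 ?(ltW Nr)// subr_ge0 ler_nat.
by rewrite mulrAC ler_pdivrMr.
Qed.

Lemma sum_card (T : finType) (P : pred T) : \sum_s (P s)%:R = #|P|%:R :> R.
Proof.
rewrite -sum1_card natr_sum [RHS]big_mkcond; apply: eq_bigr => s _.
by rewrite -[s \in P]/(P s); case: (P s).
Qed.

Lemma pick_below_average (T : finType) (P : pred T) (F : T -> R) (e : R) :
  (forall i, 0 <= F i) -> (0 < #|P|)%N -> \sum_i F i <= #|P|%:R * e -> exists2 i, P i & F i <= e.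
Proof.
move=> F0 P0 h; apply: contrapT => no.
have lt i : P i -> e < F i by move=> Pi; rewrite ltNge; apply/negP => Fe; apply: no; exists i.
have : \sum_(i | P i) e < \sum_(i | P i) F i.
  apply: ltr_sum => //; have /card_gt0P[i iP] := P0.
  by apply/hasP; exists i => //; rewrite mem_index_enum.
rewrite sumr_const -[_ *+ _]mulr_natl ltNge; apply/negP; rewrite negbK; apply: le_trans h.
by rewrite [leLHS]big_mkcond /=; apply: ler_sum => i _; case: ifP.
Qed.

End counting.

Definition slice_const (R : realType) (k q B : nat) (G C1 c0 : R) : R :=
  2 ^+ k.+1 * C1 * (3 * B.+1%:R * (2 * G ^+ 2 * q%:R + 1)) ^+ k / c0 + 1.

Section slicing.
Context {R : realType} {k : nat} {T : finType}.
Local Notation rV := 'rV[R]_k.+1.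
Variables (pt : T -> rV) (W : T -> R) (N K q B Bn : nat) (h0 G C1 c0 : R).
Hypotheses (W0 : forall i, 0 <= W i) (c00 : 0 < c0) (Wc0 : c0 <= \sum_i W i).
Hypotheses (q0 : (0 < q)%N) (N0 : (0 < N)%N) (qN : (q ^ K <= N)%N) (B1 : (1 <= B)%N).
Hypotheses (ptB : forall i, `|pt i| <= B%:R) (h0B : B%:R + 1 <= h0) (hG : h0 + B%:R <= G).
Hypothesis BnG : (B.+1 * (2 * B))%:R + G <= Bn%:R.
Hypotheses (C10 : 0 <= C1).
Hypothesis ball : forall l i, (l <= K)%N ->
  \sum_(j | `|pt j - pt i| <= Bn%:R / (q ^ l)%:R) W j <= C1 * (4 * (q ^ k)%:R) ^- l.

Let ht i : R := pt i ord0 ord0.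
Let co (j : 'I_k) i : R := pt i ord0 (lift ord0 j).
(** Points are seen from (h0, a), which lies above all of them. The j-th slope is measured along the
    height, so points with equal slopes are on one line through (h0, a). *)
Definition slope (j : 'I_k) i (a : R) : R := (co j i - a) / (h0 - ht i).
Let U : R := (2 * B)%:R.
Let qr l : 0 < (q ^ l)%:R :> R. Proof. by rewrite ltr0n expn_gt0 q0. Qed.

Let ht_bound i : `|ht i| <= B%:R. Proof. exact: le_trans (rV_norm_coor _ _) (ptB i). Qed.
Let co_bound j i : `|co j i| <= B%:R. Proof. exact: le_trans (rV_norm_coor _ _) (ptB i). Qed.
Let gap i : 1 <= h0 - ht i <= G.
Proof.
have := ht_bound i; rewrite ler_norml => /andP[h1 h2]; move: h0B hG => h3 h4.
by apply/andP; split; lra.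
Qed.
Let gap0 i : 0 < h0 - ht i. Proof. by have /andP[h _] := gap i; apply: lt_le_trans h. Qed.

Let slope_bound j i a : 0 <= a <= 1 -> `|slope j i a| <= B.+1%:R.
Proof.
move=> /andP[a0 a1]; rewrite normrM normfV (gtr0_norm (gap0 i)) ler_pdivrMr//.
apply: (@le_trans _ _ B.+1%:R); last by rewrite ler_peMr//; have /andP[] := gap i.
by apply: (le_trans (ler_normB _ _)); rewrite -natr1 lerD// ger0_norm.
Qed.

Let exlv i i' : exists l, (l <= K)%N && (`|ht i - ht i'| <= U / (q ^ l)%:R).
Proof.
exists 0%N; rewrite leq0n expn0 divr1/= /U natrM mulr_natl mulr2n.
by apply: (le_trans (ler_normB _ _)); rewrite lerD.
Qed.
Let lvK i i' l : (l <= K)%N && (`|ht i - ht i'| <= U / (q ^ l)%:R) -> (l <= K)%N.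
Proof. by case/andP. Qed.
(** The finest scale, up to K, at which the heights of the two points are indistinguishable. *)
Let lv i i' := ex_maxn (exlv i i') (@lvK i i').
Let lvP i i' : (lv i i' <= K)%N /\ `|ht i - ht i'| <= U / (q ^ lv i i')%:R.
Proof. by rewrite /lv; case: ex_maxnP => l /andP[]. Qed.
Let lv_max i i' l : (l <= K)%N -> `|ht i - ht i'| <= U / (q ^ l)%:R -> (l <= lv i i')%N.
Proof. by move=> lK h; rewrite /lv; case: ex_maxnP => m _; apply; rewrite lK. Qed.

Let same j i i' a := Num.floor (slope j i a * (q ^ K)%:R) == Num.floor (slope j i' a * (q ^ K)%:R).
Let G3 : R := 2 * G ^+ 2 * q%:R + 1.
Let Q i i' : R := G3 * (q ^ lv i i')%:R / (q ^ K)%:R.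
Let G0 : 0 < G. Proof.
apply: lt_le_trans hG; rewrite ltr_wpDr ?ler0n//; apply: lt_le_trans h0B.
by rewrite ltr_wpDl.
Qed.
Let G30 : 1 <= G3. Proof. by rewrite /G3 lerDr; apply: mulr_ge0 => //; apply: mulr_ge0 => //; exact: sqr_ge0. Qed.
Let Q0 i i' : 0 <= Q i i'.
Proof. by rewrite /Q divr_ge0// mulr_ge0// (le_trans _ G30). Qed.

Let same_dist j i i' a : same j i i' a -> `|slope j i a - slope j i' a| <= (q ^ K)%:R^-1.
Proof.
move=> /eqP h; rewrite -[leRHS]mul1r ler_pdivlMr// -(gtr0_norm (qr K)) -normrM mulrBl.
have := floor_le (slope j i a * (q ^ K)%:R); have := floorD1_gt (slope j i a * (q ^ K)%:R).
have := floor_le (slope j i' a * (q ^ K)%:R); have := floorD1_gt (slope j i' a * (q ^ K)%:R).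
rewrite h intrD; move: (_ * _) (_ * _) (_%:~R) => u v w h1 h2 h3 h4.
by rewrite ler_norml; apply/andP; split; lra.
Qed.

(** The difference of the two slopes is affine in a, with coefficient D = 1/(h0 - ht i) - 1/(h0 - ht
    i') of size at least |ht i - ht i'| / G^2. Hence the slopes agree at precision q^{-K} for a
    proportion of the grid of order q^{lv} / q^K. *)
Let same_count j i i' : #|[pred s : 'I_N | same j i i' (s%:R / N%:R)]|%:R <= N%:R * Q i i'.
Proof.
have Nr : 0 < N%:R :> R by rewrite ltr0n.
have [lK hl] := lvP i i'.
have [lK1|lK1] := leqP K (lv i i').
  have lvE : lv i i' = K by apply/eqP; rewrite eqn_leq lK.
  apply: (@le_trans _ _ N%:R); last by rewrite /Q lvE mulfK ?gt_eqF// ler_peMr// ltW.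
  by rewrite ler_nat -[leqRHS]card_ord max_card.
have far : U / (q ^ (lv i i').+1)%:R < `|ht i - ht i'|.
  by rewrite ltNge; apply/negP => /(lv_max lK1); rewrite ltnn.
have U1 : 1 <= U by rewrite ler1n muln_gt0.
have U0 : 0 < U by exact: lt_le_trans U1.
have dh0 : 0 < `|ht i - ht i'| by apply: le_lt_trans far; rewrite divr_ge0 ?(ltW U0).
pose D := (h0 - ht i)^-1 - (h0 - ht i')^-1.
have DE : D = (ht i - ht i') / ((h0 - ht i) * (h0 - ht i')).
  by rewrite /D; field; rewrite !gt_eqF.
have Dlow : `|ht i - ht i'| / G ^+ 2 <= `|D|.
  rewrite DE normrM normfV (gtr0_norm (mulr_gt0 (gap0 _) (gap0 _))) ler_wpM2l//.
  rewrite lef_pV2 ?posrE ?exprn_gt0 ?mulr_gt0// expr2.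
  by apply: ler_pM; rewrite ?(ltW (gap0 _))//; [have /andP[] := gap i|have /andP[] := gap i'].
have D0 : 0 < `|D| by apply: lt_le_trans Dlow; rewrite divr_gt0// exprn_gt0.
have Dn0 : D != 0 by rewrite -normr_gt0.
pose A := co j i / (h0 - ht i) - co j i' / (h0 - ht i').
have t0 : 0 <= (q ^ K)%:R^-1 :> R by rewrite invr_ge0.
apply: (@le_trans _ _ #|[pred s : 'I_N | `|A - s%:R / N%:R * D| <= (q ^ K)%:R^-1]|%:R).
  rewrite ler_nat; apply: subset_leq_card; apply/fintype.subsetP => s; rewrite !inE => /same_dist.
  by rewrite (_ : slope j i _ - slope j i' _ = A - s%:R / N%:R * D)// /slope /A /D; ring.
apply: (le_trans (count_affine A N0 Dn0 t0)).
have h1 : `|D|^-1 <= G ^+ 2 * (q%:R * (q ^ lv i i')%:R).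
  apply: (@le_trans _ _ (`|ht i - ht i'| / G ^+ 2)^-1).
    by rewrite lef_pV2 ?posrE// divr_gt0// exprn_gt0.
  rewrite invf_div ler_wpM2l ?exprn_ge0 ?(ltW G0)// -natrM -expnS.
  rewrite -[leRHS]invrK lef_pV2 ?posrE ?invr_gt0//; apply: le_trans (ltW far).
  by rewrite ler_peMl ?invr_ge0.
have h2 : 1 <= N%:R / (q ^ K)%:R :> R by rewrite ler_pdivlMr// mul1r ler_nat.
have h3 : 1 <= (q ^ lv i i')%:R :> R by rewrite ler1n expn_gt0 q0.
rewrite (_ : N%:R * Q i i' = 2 * (N%:R / (q ^ K)%:R) * (G ^+ 2 * (q%:R * (q ^ lv i i')%:R)) + N%:R / (q ^ K)%:R * (q ^ lv i i')%:R); last first.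
  have alg (u b c d g : R) : u * ((2 * g * b + 1) * c * d) = 2 * (u * d) * (g * (b * c)) + u * d * c by ring.
  by rewrite /Q /G3 alg.
rewrite (_ : 2 * (q ^ K)%:R^-1 * N%:R / `|D| = 2 * (N%:R / (q ^ K)%:R) * `|D|^-1); last by ring.
apply: lerD; first by rewrite ler_wpM2l// mulr_ge0// divr_ge0 ?ltW.
by rewrite -[leLHS]mulr1; apply: ler_pM.
Qed.

(** Points on nearly the same line are close in all coordinates when their heights are close, so
    pairs on a common line satisfy this condition. It lets the Frostman bound for balls control the
    energy. *)
Let near i i' := `|pt i' - pt i| <= Bn%:R / (q ^ lv i i')%:R.
Let kern i i' : R := W i * W i' * ((near i i')%:R * 2 ^+ lv i i').
Let kern0 i i' : 0 <= kern i i'.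
Proof. by rewrite /kern !mulr_ge0// exprn_ge0. Qed.

Let S (j : nat) (x : rV) i i' := [forall l : 'I_k, (l < j)%N ==> same l i i' (x ord0 (lift ord0 l))].
(** Energy of the pairs that remain aligned after j coordinates of x have been chosen; the power of
    Q anticipates the effect of the k - j choices still to be made. *)
Let E (j : nat) (x : rV) : R := \sum_i \sum_i' kern i i' * (S j x i i')%:R * Q i i' ^+ (k - j).

Definition upd (x : rV) (l : 'I_k.+1) (a : R) : rV := \row_i (if i == l then a else x ord0 i).

(** By [same_count] the next coordinate keeps a pair aligned for a proportion at most Q of its
    values, which is exactly the factor dropped from the energy. *)
Let E_avg (j : 'I_k) x : \sum_(s < N) E j.+1 (upd x (lift ord0 j) (s%:R / N%:R)) <= N%:R * E j x.
Proof.
rewrite /E exchange_big mulr_sumr /=; apply: ler_sum => i _.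
rewrite exchange_big mulr_sumr /=; apply: ler_sum => i' _.
have SE s : S j.+1 (upd x (lift ord0 j) s) i i' = S j x i i' && same j i i' s.
  apply/forallP/andP => [h|[/forallP h hs] l].
    split; last by have := h j; rewrite ltnSn /= mxE eqxx.
    apply/forallP => l; apply/implyP => lj; have := h l; rewrite ltnS (ltnW lj) /= mxE.
    by rewrite (inj_eq lift_inj) (_ : (l == j) = false)//; apply/eqP => lj'; rewrite lj' ltnn in lj.
  rewrite mxE (inj_eq lift_inj); have [->|lj] := eqVneq l j; first by rewrite hs implybT.
  apply/implyP; rewrite ltnS leq_eqVlt (negPf lj : (l == j :> nat) = false) /= => lj'.
  by have := h l; rewrite lj'.
rewrite (eq_bigr (fun s : 'I_N => kern i i' * (S j x i i')%:R * Q i i' ^+ (k - j.+1) * (same j i i' (s%:R / N%:R))%:R)); last first.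
  by move=> s _; rewrite SE -mulnb natrM; ring.
rewrite -mulr_sumr.
have -> : \sum_(s < N) (same j i i' (s%:R / N%:R))%:R = #|[pred s : 'I_N | same j i i' (s%:R / N%:R)]|%:R :> R.
  by rewrite -sum_card.
have kj : (k - j = (k - j.+1).+1)%N by rewrite subnS prednK// subn_gt0.
rewrite kj exprS.
rewrite (_ : N%:R * (_ * _) = kern i i' * (S j x i i')%:R * Q i i' ^+ (k - j.+1) * (N%:R * Q i i')); last by ring.
by rewrite ler_wpM2l ?same_count// !mulr_ge0// exprn_ge0.
Qed.

Let Wt := \sum_i W i.
(** The ball bound q^{-lk} 4^{-l} compensates q^{lk} from Q^k and 2^l from the kernel, and the sum
    over the levels of what is left, 2^{-l}, is at most 2. *)
Let E0_bound x : E 0 x <= 2 * Wt * C1 * G3 ^+ k / (q ^ K)%:R ^+ k.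
Proof.
have G3p : 0 <= G3 by exact: le_trans G30.
rewrite /E subn0; pose A := G3 ^+ k / (q ^ K)%:R ^+ k.
have A0 : 0 <= A by rewrite divr_ge0// exprn_ge0.
apply: (@le_trans _ _ (\sum_i W i * (2 * C1 * A))); last first.
  by rewrite -mulr_suml -/Wt /A le_eqVlt; apply/orP; left; apply/eqP; ring.
apply: ler_sum => i _.
apply: (@le_trans _ _ (\sum_(l < K.+1) W i * (A * (2 ^+ l * (q ^ l)%:R ^+ k) *
    \sum_(j | `|pt j - pt i| <= Bn%:R / (q ^ l)%:R) W j))).
  rewrite -mulr_sumr (eq_bigr (fun i' => W i * (W i' * ((near i i')%:R * 2 ^+ lv i i') * (S 0 x i i')%:R * Q i i' ^+ k))); last first.
    by move=> i' _; rewrite /kern !mulrA.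
  rewrite -mulr_sumr ler_wpM2l//.
  rewrite (eq_bigr (fun l : 'I_K.+1 => \sum_j A * (2 ^+ l * (q ^ l)%:R ^+ k) * ((`|pt j - pt i| <= Bn%:R / (q ^ l)%:R)%R%:R * W j))); last first.
    move=> l _; rewrite -mulr_sumr; congr (_ * _); rewrite [LHS]big_mkcond /=.
    by apply: eq_bigr => j _; case: ifP; rewrite ?mul1r ?mul0r.
  rewrite exchange_big /=; apply: ler_sum => i' _.
  have [lK _] := lvP i i'; rewrite (bigD1 (Ordinal (lK : (lv i i' < K.+1)%N)))//= -/(near i i').
  rewrite -[leLHS]addr0 lerD//; last first.
    by apply: sumr_ge0 => l _; rewrite !mulr_ge0// ?exprn_ge0.
  apply: (@le_trans _ _ (W i' * ((near i i')%:R * 2 ^+ lv i i') * 1 * Q i i' ^+ k)).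
    rewrite ler_wpM2r ?exprn_ge0// ler_wpM2l ?mulr_ge0 ?exprn_ge0//.
    by case: (S 0 x i i').
  have alg (w u t g c d : R) : w * (u * t) * 1 * (g * c * d) = g * d * (t * c) * (u * w) by ring.
  by rewrite /Q /A 2!exprMn exprVn alg.
rewrite -mulr_sumr ler_wpM2l//.
apply: (@le_trans _ _ (\sum_(l < K.+1) A * C1 * 2^-1 ^+ l)).
  apply: ler_sum => l _; have lK : (l <= K)%N by rewrite -ltnS.
  rewrite -mulrA -[leRHS]mulrA ler_wpM2l//; apply: (le_trans (ler_wpM2l _ (ball i lK))).
    by rewrite mulr_ge0 ?exprn_ge0.
  have e : (q ^ l)%:R ^+ k = (q ^ k)%:R ^+ l :> R by rewrite !natrX -!exprM mulnC.
  rewrite e exprMn (_ : 4 = 2 * 2 :> R); last by ring.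
  rewrite exprMn exprVn le_eqVlt; apply/orP; left; apply/eqP; field.
  by rewrite !gt_eqF// ?exprn_gt0.
rewrite -mulr_sumr (_ : 2 * C1 * A = A * C1 * 2); last by ring.
rewrite (ler_wpM2l (mulr_ge0 A0 C10))//.
suff -> : \sum_(l < K.+1) 2^-1 ^+ l = 2 - 2^-1 ^+ K :> R by rewrite gerBl exprn_ge0.
elim: (K) => [|K' IH]; first by rewrite big_ord1 !expr0; ring.
by rewrite big_ord_recr /= IH !exprS; field.
Qed.

Variable Good : nat -> rV -> Prop.
Hypothesis good_step : forall (j : 'I_k) x, Good j x -> x ord0 ord0 = h0 ->
  (N <= 2 * #|[pred s : 'I_N | `[< Good j.+1 (upd x (lift ord0 j) (s%:R / N%:R)) >]]|)%N.

(** At least half of the values of each coordinate are good, so one of them is good with an energy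
    at most twice the average. *)
Let good_point x0 : Good 0 x0 -> x0 ord0 ord0 = h0 -> forall j, (j <= k)%N ->
  exists x, [/\ Good j x, x ord0 ord0 = h0,
    forall l : 'I_k, (l < j)%N -> 0 <= x ord0 (lift ord0 l) <= 1 & E j x <= 2 ^+ j * E 0 x0].
Proof.
move=> g0 x00; elim=> [|j IH] jk; first by exists x0; rewrite expr0 mul1r; split.
have [x [gx xh x01 Ex]] := IH (ltnW jk).
pose j' : 'I_k := Ordinal jk; have gs := good_step (j := j') gx xh.
set P := [pred s | _] in gs.
have P0 : (0 < #|P|)%N by have := leq_trans N0 gs; rewrite muln_gt0.
have E00 y l : 0 <= E l y.
  by apply: sumr_ge0 => i _; apply: sumr_ge0 => i' _; rewrite !mulr_ge0// exprn_ge0.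
have [s Ps Es] : exists2 s, P s & E j.+1 (upd x (lift ord0 j') (s%:R / N%:R)) <= 2 * E j x.
  apply: pick_below_average => //; apply: (le_trans (E_avg j' x)).
  by rewrite mulrA ler_wpM2r// -natrM ler_nat mulnC.
exists (upd x (lift ord0 j') (s%:R / N%:R)); split.
- by move/asboolP: Ps.
- by rewrite mxE.
- move=> l; rewrite ltnS mxE (inj_eq lift_inj); case: eqVneq => [_ _|lj].
    have Nr : 0 < N%:R :> R by rewrite ltr0n.
    by rewrite divr_ge0//= ler_pdivrMr// mul1r ler_nat ltnW.
  by rewrite leq_eqVlt (negPf lj : (l == j :> nat) = false) /=; exact: x01.
- by apply: (le_trans Es); rewrite exprS -mulrA ler_wpM2l.
Qed.

Let C2 : R := slice_const k q B G C1 c0.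

(** The points are sorted by the cells of their k slopes. There are about q^{Kk} classes and the
    energy is of order q^{-Kk}, so by Cauchy-Schwarz some class has energy at most C2 times its
    squared mass, with C2 independent of K. This is a bound of positive dimension for the heights in
    that class. *)
Lemma slicing x0 : Good 0 x0 -> x0 ord0 ord0 = h0 ->
  exists x : rV, [/\ Good k x, x ord0 ord0 = h0, forall l : 'I_k, 0 <= x ord0 (lift ord0 l) <= 1 &
  exists (b : pred T) (m : R), [/\ 0 < m, m / 2 <= \sum_(i | b i) W i,
    forall i i' j, b i -> b i' ->
      `|slope j i (x ord0 (lift ord0 j)) - slope j i' (x ord0 (lift ord0 j))| <= (q ^ K)%:R^-1 &
    forall i l, b i -> (l <= K)%N ->
      2 ^+ l * \sum_(i' | b i' && (`|ht i - ht i'| <= U / (q ^ l)%:R)) W i' <= 2 * C2 * m]].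
Proof.
move=> g0 x00; have [x [gx xh x01 Ex]] := good_point g0 x00 (leqnn k).
exists x; split => // [l|]; first exact: x01.
pose a (j : 'I_k) := x ord0 (lift ord0 j).
pose M := (B.+1 * q ^ K)%N.
pose F : finType := {ffun 'I_k -> 'I_(2 * M).+1}.
have ex i j : exists c : 'I_(2 * M).+1, Num.floor (slope j i (a j) * (q ^ K)%:R) = c%:Z - M%:Z.
  have [|c ->] := @floor_near R M (slope j i (a j) * (q ^ K)%:R) 0.
    by rewrite subr0 normrM (gtr0_norm (qr K)) natrM ler_wpM2r ?(ltW (qr K))// slope_bound// x01.
  by exists c; rewrite floor0 add0r.
pose lab i : F := [ffun j => projT1 (cid (ex i j))].
have labE i j : Num.floor (slope j i (a j) * (q ^ K)%:R) = (lab i j)%:Z - M%:Z.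
  by rewrite ffunE; case: cid.
have labS i i' : S k x i i' = (lab i == lab i').
  apply/forallP/eqP => [h|h l].
    apply/ffunP => j; have := h j; rewrite ltn_ord /= /same !labE => /eqP.
    by move=> /addIr [e]; apply/val_inj.
  by rewrite ltn_ord /= /same !labE h.
pose mb b := \sum_(i | lab i == b) W i.
pose Eb b := \sum_(i | lab i == b) \sum_(i' | lab i' == b) W i * W i' * 2 ^+ lv i i'.
have nearS i i' : lab i = lab i' -> near i i'.
  move=> h; have [lK hl] := lvP i i'.
  have Bq : (B.+1 * (2 * B))%:R / (q ^ lv i i')%:R + G / (q ^ lv i i')%:R <= Bn%:R / (q ^ lv i i')%:R :> R.
    by rewrite -mulrDl ler_wpM2r// invr_ge0 ltW.
  have lqK : (q ^ K)%:R^-1 <= (q ^ lv i i')%:R^-1 :> R by rewrite lef_pV2 ?posrE// ler_nat leq_pexp2l.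
  apply: (rV_norm_le (divr_ge0 (ler0n _ _) (ltW (qr _)))) => c; apply: le_trans Bq.
  case: (unliftP ord0 c) => [j ->|->]; rewrite !mxE -?/(ht i) -?/(ht i') -?/(co j i) -?/(co j i').
    have Sj : same j i i' (a j) by move: h => /eqP; rewrite -labS => /forallP /(_ j); rewrite ltn_ord.
    have := same_dist Sj; set s := slope j i _; set s' := slope j i' _ => ds.
    have coE l : co j l = a j + slope j l (a j) * (h0 - ht l).
      by rewrite /slope divfK ?gt_eqF// addrC subrK.
    have hs' : `|s'| <= B.+1%:R by apply: slope_bound; exact: x01.
    have -> : co j i' - co j i = s' * (ht i - ht i') + (s' - s) * (h0 - ht i).
      by rewrite !coE -/s -/s'; move: (co j i) (co j i') (ht i) (ht i') => *; ring.
    move: ds hs'; move: s s' {coE} => s s' ds hs'.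
    apply: (le_trans (ler_normD _ _)); rewrite !normrM; apply: lerD.
      by rewrite natrM -mulrA; apply: ler_pM.
    rewrite mulrC (gtr0_norm (gap0 i)) distrC; apply: ler_pM; rewrite ?(ltW (gap0 _))//.
      by have /andP[] := gap i.
    exact: le_trans lqK.
  rewrite distrC; apply: (le_trans hl); rewrite -[leLHS]addr0 lerD//; last by rewrite divr_ge0// ltW.
  by rewrite ler_wpM2r ?invr_ge0 ?(ltW (qr _))// ler_nat leq_pmull.
have EE : E k x = \sum_b Eb b.
  rewrite /E subnn; under eq_bigr do under eq_bigr do rewrite expr0 mulr1 labS.
  rewrite (partition_big lab predT) //=; apply: eq_bigr => b _; apply: eq_bigr => i /eqP ib.
  rewrite [RHS]big_mkcond /=; apply: eq_bigr => i' _; rewrite ib eq_sym.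
  case: eqVneq => [h|_]; last by rewrite mulr0.
  by rewrite mulr1 /kern nearS ?ib// mul1r.
have mtot : \sum_b mb b = Wt by rewrite /Wt (partition_big lab predT).
have mb0 b : 0 <= mb b by apply: sumr_ge0.
have Wt0 : 0 < Wt by exact: lt_le_trans Wc0.
have G3p : 0 <= G3 by exact: le_trans G30.
have C21 : 0 <= 2 ^+ k.+1 * C1 * (3 * B.+1%:R * G3) ^+ k / c0.
  by rewrite divr_ge0 ?(ltW c00)// mulr_ge0 ?exprn_ge0 ?mulr_ge0 ?exprn_ge0.
have C20 : 0 < C2 by rewrite /C2 /slice_const ltr_wpDl.
have [b mbp Ebm] : exists2 b, 0 < mb b & Eb b <= C2 * mb b ^+ 2.
  apply: contrapT => no.
  have big b : C2 * mb b ^+ 2 <= Eb b.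
    have [mb00|mbn] := eqVneq (mb b) 0.
      rewrite mb00 expr0n mulr0; apply: sumr_ge0 => i _; apply: sumr_ge0 => i' _.
      by rewrite !mulr_ge0// exprn_ge0.
    rewrite leNgt; apply/negP => /ltW h; apply: no; exists b => //.
    by rewrite lt_def mbn mb0.
  pose f : R := #|F|%:R; have f0 : 0 < f.
    by rewrite ltr0n card_ffun !card_ord expn_gt0.
  (* Cauchy-Schwarz over the classes, written as the nonnegativity of the squared deviations from
     the mean th. *)
  have sq : Wt ^+ 2 / f <= \sum_b mb b ^+ 2.
    pose th := Wt / f.
    have : \sum_b (2 * th * mb b - th ^+ 2) <= \sum_b mb b ^+ 2.
      by apply: ler_sum => b _; have := sqr_ge0 (mb b - th); rewrite sqrrB; move: (mb b) => u; lra.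
    apply: le_trans; rewrite sumrB -mulr_sumr mtot sumr_const -[_ *+ _]mulr_natl -/f.
    by rewrite /th le_eqVlt; apply/orP; left; apply/eqP; field; rewrite gt_eqF.
  have fle : f <= (3 * B.+1%:R * (q ^ K)%:R) ^+ k.
    rewrite /f card_ffun !card_ord natrX lerXn2r ?nnegrE//.
    rewrite -!natrM ler_nat -mulnA -/M; have : (0 < M)%N by rewrite muln_gt0 expn_gt0 q0.
    by move=> M0; rewrite ltn_pmul2r.
  have : C2 * (Wt ^+ 2 / f) <= 2 ^+ k * (2 * Wt * C1 * G3 ^+ k / (q ^ K)%:R ^+ k).
    apply: (@le_trans _ _ (E k x)).
      rewrite EE; apply: (@le_trans _ _ (\sum_b C2 * mb b ^+ 2)); last exact: ler_sum.
      by rewrite -mulr_sumr ler_wpM2l// ltW.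
    by apply: (le_trans Ex); rewrite ler_wpM2l ?exprn_ge0.
  have X0 : 0 < (3 * B.+1%:R * (q ^ K)%:R) ^+ k :> R by rewrite exprn_gt0// !mulr_gt0// ltr0n.
  have h1 : C2 * (Wt ^+ 2 / (3 * B.+1%:R * (q ^ K)%:R) ^+ k) <= C2 * (Wt ^+ 2 / f).
    by rewrite ler_wpM2l ?(ltW C20)// ler_wpM2l ?sqr_ge0// lef_pV2 ?posrE.
  move=> /(le_trans h1); rewrite mulrA ler_pdivrMr//.
  have -> : 2 ^+ k * (2 * Wt * C1 * G3 ^+ k / (q ^ K)%:R ^+ k) * (3 * B.+1%:R * (q ^ K)%:R) ^+ k =
     Wt * (2 ^+ k.+1 * C1 * (3 * B.+1%:R * G3) ^+ k).
    by rewrite !exprMn exprS; field; rewrite gt_eqF// exprn_gt0.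
  rewrite expr2 mulrCA ler_pM2l// leNgt => /negP; apply.
  rewrite /C2 /slice_const -/G3; set Z := 2 ^+ k.+1 * _ * _.
  have Z0 : 0 <= Z by move: C21; rewrite -/Z pmulr_lge0// invr_gt0.
  apply: (@le_lt_trans _ _ (Z / c0 * Wt)); last by rewrite ltr_pM2r// ltrDl.
  by rewrite mulrAC ler_pdivlMr// ler_wpM2l.
(* Energy of one point inside the class. By Markov's inequality the points where it exceeds 2 C2 m
   carry at most half of the mass m. *)
pose e i := \sum_(i' | lab i' == b) W i' * 2 ^+ lv i i'.
have e0 i : 0 <= e i by apply: sumr_ge0 => i' _; rewrite mulr_ge0// exprn_ge0.
exists (fun i => (lab i == b) && (e i <= 2 * C2 * mb b)), (mb b); split => //.
- have bad : \sum_(i | (lab i == b) && ~~ (e i <= 2 * C2 * mb b)) W i <= mb b / 2.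
    have EbE : Eb b = \sum_(i | lab i == b) W i * e i.
      by apply: eq_bigr => i _; rewrite mulr_sumr; apply: eq_bigr => i' _; rewrite mulrA.
    have p0 : 0 < 2 * C2 * mb b by rewrite !mulr_gt0.
    rewrite -(ler_pM2r p0); apply: (@le_trans _ _ (Eb b)); last first.
      by apply: (le_trans Ebm); rewrite le_eqVlt; apply/orP; left; apply/eqP; field.
    rewrite EbE [leRHS](bigID (fun i => e i <= 2 * C2 * mb b)) /= mulr_suml.
    rewrite -[leLHS]add0r lerD//; first by apply: sumr_ge0 => i _; rewrite mulr_ge0.
    by apply: ler_sum => i /andP[_]; rewrite -ltNge => h; rewrite ler_wpM2l// ltW.
  have mE : mb b = \sum_(i | (lab i == b) && (e i <= 2 * C2 * mb b)) W i + \sum_(i | (lab i == b) && ~~ (e i <= 2 * C2 * mb b)) W i.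
    by rewrite {1}/mb (bigID (fun i => e i <= 2 * C2 * mb b)).
  have alg (u v w : R) : u = v + w -> w <= u / 2 -> u / 2 <= v by lra.
  exact: alg mE bad.
- move=> i i' j /andP[/eqP ib _] /andP[/eqP ib' _]; apply: same_dist.
  have : S k x i i' by rewrite labS ib ib'.
  by move=> /forallP /(_ j); rewrite ltn_ord.
- move=> i l /andP[ib ie] lK; apply: le_trans ie.
  rewrite mulr_sumr /e [leLHS]big_mkcond [leRHS]big_mkcond /=; apply: ler_sum => i' _.
  case: (lab i' == b) => //=; case: ifP => [/andP[_ h]|_]; last by rewrite mulr_ge0// exprn_ge0.
  by rewrite mulrC ler_wpM2l// ler_weXn2l ?ler1n// lv_max.
Qed.

End slicing.

(** * Propagation along axes and along the selected line *)

Section path_class.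
Context {R : realType} {n : nat}.
Local Notation rV := 'rV[R]_n.
Implicit Types (v : rV -> R) (M rho : R).

(** Real-variable substitute for a holomorphic extension bounded by M to the disc of radius rho
    along every line with direction of norm at most 1. *)
Definition path_class v M rho : Prop := forall x e sw D, nsq e <= 1 -> kills sw D ->
  (forall wz, wz \in sw -> `|wz.2| <= rho / 2) ->
  `|linfun_seq sw (fun u => v (x + u *: e))| <= 2 * tail_weight sw D rho * M.

Lemma nsq_sup_le (x : rV) (c : R) : (forall i, `|x ord0 i| <= c) -> nsq x <= n%:R * c ^+ 2.
Proof.
move=> h; rewrite /nsq /dotv.
apply: (@le_trans _ _ (\sum_(i < n) c ^+ 2)); last by rewrite sumr_const card_ord -[_ *+ _]mulr_natl.
apply: ler_sum => i _; rewrite -expr2 -(real_normK (num_real _)).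
have c0 : 0 <= c := le_trans (normr_ge0 _) (h i).
by rewrite lerXn2r ?nnegrE.
Qed.

(** The case D = 0: the difference of two evaluations kills the constants. *)
Lemma path_class_lipschitz v M rho (x y : rV) (d : R) : path_class v M rho -> 0 < rho -> 0 < d ->
  n%:R * d <= rho / 2 -> (forall i, `|y ord0 i - x ord0 i| <= d) ->
  `|v x - v y| <= 2 * (n%:R * d / rho) * M.
Proof.
move=> pv rho0 d0 dr xy; have [n0|n0] := posnP n.
  have -> : y = x by apply/rowP => i; have := ltn_ord i; rewrite {2}n0.
  by rewrite subrr normr0 n0 !mul0r mulr0 mul0r.
have nr : 1 <= n%:R :> R by rewrite ler1n.
have D0 : 0 < n%:R * d by rewrite mulr_gt0// (lt_le_trans ltr01).
pose e : rV := (n%:R * d)^-1 *: (y - x).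
have e1 : nsq e <= 1.
  have := nsq_sup_le (x := e) (c := n%:R^-1); set P := (X in (X -> _) -> _) => h.
  have /h /le_trans : forall i, `|e ord0 i| <= n%:R^-1.
    move=> i; rewrite !mxE normrM normfV (gtr0_norm D0) invfM -mulrA ler_piMr//.
    by rewrite ler_pdivrMl// mulr1.
  apply; rewrite exprVn expr2 invfM mulrA mulfV ?mul1r ?invf_le1// ?(lt_le_trans ltr01)//.
  by rewrite gt_eqF// (lt_le_trans ltr01).
pose sw : seq (R * R) := [:: (1, 0); (-1, n%:R * d)].
have kD : kills sw 0.
  by move=> k; rewrite leqn0 => /eqP ->; rewrite /linfun_seq !big_cons big_nil !expr0 !mulr1 addr0 subrr.
have sr wz : wz \in sw -> `|wz.2| <= rho / 2.
  rewrite !inE => /orP[|] /eqP ->/=; first by rewrite normr0 divr_ge0// ltW.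
  by rewrite gtr0_norm.
have := pv x e sw 0%N e1 kD sr.
rewrite /linfun_seq /tail_weight !big_cons !big_nil /= scale0r addr0 mul1r mulN1r addr0.
have -> : x + (n%:R * d) *: e = y by rewrite /e scalerA mulfV ?gt_eqF// scale1r addrC subrK.
rewrite normr0 mul0r expr1 mulr0 add0r addr0.
by rewrite normrN normr1 mul1r expr1 (gtr0_norm D0) addrC.
Qed.

End path_class.

Section coordinate_step.
Context {R : realType} {k : nat}.
Local Notation rV := 'rV[R]_k.+1.
Variables (v : rV -> R) (M rho : R).
Hypotheses (pv : path_class v M rho) (M0 : 0 <= M).

Lemma nsq_unit (l : 'I_k.+1) : nsq (delta_mx ord0 l : rV) = 1.
Proof.
rewrite /nsq /dotv (bigD1 l)//= !mxE !eqxx mulr1 big1 ?addr0// => i il.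
by rewrite !mxE (negPf il) andbF mul0r.
Qed.

Lemma upd_line (x : rV) l c u : upd x l c + u *: delta_mx ord0 l = upd x l (c + u).
Proof.
apply/rowP => i; rewrite !mxE eqxx /=; case: eqVneq => _; first by rewrite mulr1.
by rewrite mulr0 addr0.
Qed.

Lemma upd_self (x : rV) l : upd x l (x ord0 l) = x.
Proof. by apply/rowP => i; rewrite !mxE; case: eqVneq => // ->. Qed.

Definition Q1 (Y : R) : R := 2 * ((1 + Y) / 4^-1) * (2 * expR 1) ^+ 1.

Lemma coord_step D N (x : rV) l (c Y kap kap' : R) : (4 * D.+1 <= N)%N -> 0 <= Y ->
  `|x ord0 l - c| <= Y -> 2 * Q1 Y * 1 <= rho ->
  Q1 Y ^+ D.+1 * kap' + 4 * M / 2 ^+ D.+1 < kap -> kap <= `|v x| ->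
  (N <= 2 * #|[pred s : 'I_N | (kap' < `|v (upd x l (c + s%:R / N%:R))|)%R]|)%N.
Proof.
move=> DN Y0 xY Qr kk kx; have N0 : (0 < N)%N by apply: leq_trans DN.
have Nr : 0 < N%:R :> R by rewrite ltr0n.
rewrite leqNgt; apply/negP => few.
pose bad (s : 'I_N) := `|v (upd x l (c + s%:R / N%:R))| <= kap'.
pose T : finType := {s : 'I_N | bad s}.
have cT : (N <= 2 * #|T|)%N.
  have := cardC [pred s : 'I_N | (kap' < `|v (upd x l (c + s%:R / N%:R))|)%R].
  rewrite card_ord card_sig; have -> : #|[predC [pred s : 'I_N | (kap' < `|v (upd x l (c + s%:R / N%:R))|)%R]]| = #|[pred s | bad s]|.
    by apply: eq_card => s; rewrite !inE -leNgt.
  have alg (a1 a2 a3 : nat) : (2 * a1 < a3 -> a1 + a2 = a3 -> a3 <= 2 * a2)%N by lia.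
  exact: alg few.
pose pos (t : T) : R := (val t)%:R / N%:R.
have totE : \sum_(t : T) 1 = #|T|%:R :> R by rewrite sumr_const.
have tot0 : 0 < \sum_(t : T) 1 :> R by rewrite totE ltr0n; lia.
have [f fP] := quantile_nodes pos D tot0.
have D0 : 0 < D.+1%:R :> R by rewrite ltr0n.
have := @propagate R (fun u => v (upd x l c + u *: delta_mx ord0 l)) M rho D
  (fun i => pos (f i)) (x ord0 l - c) kap' 4^-1 1 1 Y.
have vE : v (upd x l c + (x ord0 l - c) *: delta_mx ord0 l) = v x by rewrite upd_line addrC subrK upd_self.
rewrite -/(Q1 Y) vE => prop.
have : `|v x| <= Q1 Y ^+ D.+1 * kap' + 4 * M / 2 ^+ D.+1.
  apply: prop => //; first by move=> sw kD sr; apply: pv => //; rewrite nsq_unit.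
  - by rewrite invf_le1// ler1n.
  (* Between two quantiles lies a fraction (j - i) / (D + 1) of at least N / 2 grid values, while an
     interval [a, b] contains at most (b - a) N + 1 of them; N >= 4 (D + 1) absorbs the unit. *)
  - move=> i j ij jD; have [le1 le2] := fP i j ij jD.
    rewrite ger0_norm ?subr_ge0// expr1.
    set a := pos (f i) in le1 le2 *; set b := pos (f j) in le1 le2 *.
    have ab0 : 0 <= (b - a) / 2 by rewrite divr_ge0// subr_ge0.
    have cnt : \sum_(t : T | (a <= pos t) && (pos t <= b)) 1 <= (b - a) * N%:R + 1 :> R.
      rewrite sumr_const; apply: (@le_trans _ _ #|[pred s : 'I_N | `|(a + b) / 2 - s%:R / N%:R * 1| <= (b - a) / 2]|%:R).
        rewrite ler_nat -(card_imset _ val_inj); apply: subset_leq_card; apply/fintype.subsetP => s.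
        move=> /imsetP[t]; rewrite !inE => /andP[t1 t2] ->.
        by rewrite mulr1 -/(pos t) ler_norml; apply/andP; split; lra.
      apply: le_trans (count_affine _ N0 (oner_neq0 R) ab0) _.
      by rewrite normr1 divr1 [2 * _]mulrC divfK.
    have h1 : (j - i)%:R / D.+1%:R * (N%:R / 2) <= (b - a) * N%:R + 1.
      apply: le_trans cnt; apply: le_trans le2; rewrite totE ler_wpM2l ?divr_ge0 ?(ltW D0)//.
      by rewrite ler_pdivrMr// mulrC -natrM ler_nat.
    have h2 : 1 <= (j - i)%:R :> R by rewrite ler1n subn_gt0.
    have h3 : 4 * D.+1%:R <= N%:R :> R by rewrite -natrM ler_nat.
    set z := (j - i)%:R / D.+1%:R in h1 *.
    have h4 : 4 <= z * N%:R.
      rewrite /z mulrAC ler_pdivlMr//; apply: le_trans h3 _.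
      by rewrite ler_peMl// ltW.
    rewrite -(ler_pM2r Nr); move: h1 h4; move: (N%:R) (b - a) z => u w z h1 h4.
    have -> : 4^-1 * z * u = z * u / 4 by ring.
    have e : z * (u / 2) = z * u / 2 by ring.
    by rewrite e in h1; move: (z * u) h1 h4 => zu; lra.
  - move=> i _; rewrite ger0_norm ?divr_ge0//; rewrite ler_pdivrMr// mul1r ler_nat.
    exact: ltnW.
  - by move=> i _; rewrite upd_line; exact: (valP (f i)).
by move=> /(le_trans kx) /(lt_le_trans kk); rewrite ltxx.
Qed.

End coordinate_step.

Section line_step.
Context {R : realType} {k : nat} {T : finType}.
Local Notation rV := 'rV[R]_k.+1.
Variables (v : rV -> R) (M rho : R).
Hypotheses (pv : path_class v M rho) (M0 : 0 <= M) (rho0 : 0 < rho).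
Variables (pt : T -> rV) (W : T -> R) (K p B : nat) (h0 G C m : R) (b : pred T) (x : rV).
Hypotheses (W0 : forall i, 0 <= W i) (B1 : (1 <= B)%N) (ptB : forall i, `|pt i| <= B%:R)
  (h0B : B%:R + 1 <= h0) (hG : h0 + B%:R <= G) (C1 : 1 <= C) (m0 : 0 < m).
Hypotheses (xh : x ord0 ord0 = h0) (x01 : forall l : 'I_k, 0 <= x ord0 (lift ord0 l) <= 1).
Local Notation q := (2 ^ p)%N.
Hypothesis mb : m / 2 <= \sum_(i | b i) W i.
Hypothesis sl : forall i i' j, b i -> b i' ->
  `|slope pt h0 j i (x ord0 (lift ord0 j)) - slope pt h0 j i' (x ord0 (lift ord0 j))| <= (q ^ K)%:R^-1.
Hypothesis mass : forall i l, b i -> (l <= K)%N ->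
  2 ^+ l * \sum_(i' | b i' && (`|pt i ord0 ord0 - pt i' ord0 ord0| <= (2 * B)%:R / (q ^ l)%:R)) W i' <= C * m.

(** Slopes are at most B + 1, so dividing by this number makes the direction of the line have norm
    at most 1. *)
Definition line_len : R := k.+1%:R * B.+1%:R.
Definition line_sep : R := line_len * ((2 * B)%:R / q%:R / (2 * C) ^+ p).
Definition Q2 : R := 2 * ((line_len * G + 0) / line_sep) * (2 * expR 1) ^+ p.

Let ht i : R := pt i ord0 ord0.
Let qr l : 0 < (q ^ l)%:R :> R. Proof. by rewrite ltr0n !expn_gt0. Qed.
Let ht_bound i : `|ht i| <= B%:R. Proof. exact: le_trans (rV_norm_coor _ _) (ptB i). Qed.
Let gap i : 1 <= h0 - ht i <= G.
Proof.
have := ht_bound i; rewrite ler_norml => /andP[h1 h2]; move: h0B hG => h3 h4.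
by apply/andP; split; lra.
Qed.
Let gap0 i : 0 < h0 - ht i. Proof. by have /andP[h _] := gap i; apply: lt_le_trans h. Qed.

(** The nodes are quantiles of the mass of the class, located on the line through x by their
    heights; the decay of the mass yields their separation. At the nodes v is close to its value at
    the actual points, at distance of order q^{-K}, where it is at most lam; hence the factor 2. *)
Lemma line_step D (lam : R) : 2 * C * D.+1%:R < 2 ^+ K -> (forall i, b i -> `|v (pt i)| <= lam) ->
  k.+1%:R * (G / (q ^ K)%:R) <= rho / 2 ->
  2 * (k.+1%:R * (G / (q ^ K)%:R) / rho) * M <= lam ->
  2 * Q2 * (line_len * G) <= rho ->
  `|v x| <= Q2 ^+ D.+1 * (2 * lam) + 4 * M / 2 ^+ D.+1.
Proof.
move=> KD ptl Gr Glam Qr.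
have C0 : 0 < C := lt_le_trans ltr01 C1.
have Br : 1 <= B%:R :> R by rewrite ler1n.
have G0 : 0 < G by move: Br h0B hG => u1 u2 u3; lra.
have L1 : 0 < line_len by rewrite mulr_gt0// ltr0n.
have [i0 bi0] : exists i, b i.
  apply: contrapT => no; move: mb; rewrite big1 ?leNgt ?divr_gt0// => i bi.
  by case: no; exists i.
pose S : finType := {i : T | b i}.
pose pos (t : S) : R := line_len * (h0 - ht (val t)).
pose w (t : S) : R := W (val t).
have sumS (P : pred T) : \sum_(t : S | P (val t)) w t = \sum_(i | b i && P i) W i.
  by rewrite [RHS](big_sub_cond b).
have totE : \sum_(t : S) w t = \sum_(i | b i) W i.
  rewrite -[LHS]/(\sum_(t : S | xpredT (val t)) w t) sumS.
  by apply: eq_bigl => i; rewrite andbT.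
have tot0 : 0 < \sum_(t : S) w t by rewrite totE; apply: lt_le_trans mb; rewrite divr_gt0.
have [f fP] := quantile_nodes pos D tot0.
pose s j := slope pt h0 j i0 (x ord0 (lift ord0 j)).
(* Direction from x towards the reference point i0, with height decreasing: the parameter line_len
   (h0 - h) reaches the height h. *)
pose e : rV := line_len^-1 *: \row_i (if unlift ord0 i is Some j then s j else -1).
have sB j : `|s j| <= B.+1%:R.
  rewrite /s /slope -/(ht i0) normrM normfV (gtr0_norm (gap0 i0)) ler_pdivrMr//.
  apply: (@le_trans _ _ B.+1%:R); last by rewrite ler_peMr//; have /andP[] := gap i0.
  apply: (le_trans (ler_normB _ _)); rewrite -natr1 lerD//.
    exact: le_trans (rV_norm_coor _ _) (ptB i0).
  by have /andP[h1 h2] := x01 j; rewrite ger0_norm.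
have e1 : nsq e <= 1.
  apply: (le_trans (nsq_sup_le (c := k.+1%:R^-1) _)).
    move=> i; rewrite !mxE normrM normfV (gtr0_norm L1) /line_len invfM -mulrA ler_piMr ?invr_ge0//.
    rewrite ler_pdivrMl ?ltr0n// mulr1; case: unliftP => [j _|_]; first exact: sB.
    by rewrite normrN normr1 ler1n.
  rewrite expr2 mulrA mulfV ?pnatr_eq0// mul1r invf_le1 ?ltr0n// ler1n//.
have D0 : 0 < D.+1%:R :> R by rewrite ltr0n.
have := @propagate R (fun u => v (x + u *: e)) M rho D (fun i => pos (f i)) 0 (2 * lam) line_sep p (line_len * G) 0.
rewrite -/Q2 scale0r addr0 normr0; apply => //.
- by move=> sw kD sr; exact: pv.
- rewrite mulr_gt0// !divr_gt0 ?ltr0n ?muln_gt0 ?expn_gt0// exprn_gt0// mulr_gt0//.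
- rewrite ler_wpM2l ?(ltW L1)//.
  have c1 : 1 <= (2 * C) ^+ p by rewrite exprn_ege1// (le_trans C1)// ler_peMl ?ler1n ?(ltW C0).
  rewrite ler_pdivrMr ?(lt_le_trans ltr01)//.
  apply: (@le_trans _ _ (2 * B)%:R).
    by rewrite ler_piMr// invf_le1 ?ltr0n ?expn_gt0// ler1n expn_gt0.
  apply: (@le_trans _ _ G); last by rewrite ler_peMr// ltW.
  by rewrite natrM; move: h0B hG Br => u1 u2 u3; lra.
- move=> i j ij jD; have [le1 le2] := fP i j ij jD.
  pose d := `|ht (val (f i)) - ht (val (f j))|.
  have dE : `|pos (f j) - pos (f i)| = line_len * d.
    by rewrite /pos -mulrBr normrM (gtr0_norm L1); congr (_ * `|_|); ring.
  rewrite dE /line_sep -mulrA ler_wpM2l ?(ltW L1)//.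
  pose U : R := (2 * B)%:R.
  have exl : exists l, (l <= K)%N && (d <= U / (q ^ l)%:R).
    exists 0%N; rewrite expn0 divr1 /= /U natrM mulr_natl mulr2n.
    by apply: (le_trans (ler_normB _ _)); rewrite lerD.
  have bl l : (l <= K)%N && (d <= U / (q ^ l)%:R) -> (l <= K)%N by case/andP.
  have [l /andP[lK dl] lmax] := ex_maxnP exl bl.
  have jir : 1 <= (j - i)%:R :> R by rewrite ler1n subn_gt0.
  (* The mass between the two quantiles lies within U / q^l of the height of the first one, so the
     mass bound limits 2^l. Raised to the power p this limits q^l, which is the separation with
     exponent p. *)
  have l2 : 2 ^+ l <= 2 * C * (D.+1%:R / (j - i)%:R).
    have h1 := mass (valP (f i)) lK.
    have h2 : (j - i)%:R / D.+1%:R * (m / 2) <=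
       \sum_(i' | b i' && (`|pt (val (f i)) ord0 ord0 - pt i' ord0 ord0| <= U / (q ^ l)%:R)) W i'.
      apply: (@le_trans _ _ ((j - i)%:R / D.+1%:R * \sum_(t : S) w t)).
        by rewrite totE ler_wpM2l// divr_ge0// ltW.
      apply: (le_trans le2).
      rewrite -(sumS (fun i' => `|pt (val (f i)) ord0 ord0 - pt i' ord0 ord0| <= U / (q ^ l)%:R)).
      rewrite [leLHS]big_mkcond [leRHS]big_mkcond /=; apply: ler_sum => t _.
      case: ifP => [/andP[t1 t2]|_]; last by case: ifP => // _; exact: W0.
      rewrite ifT// (le_trans _ dl)//.
      move: t1 t2; rewrite /pos !ler_pM2l// => t1 t2; rewrite /d -/(ht (val t)) -/(ht (val (f i))).
      move: t1 t2; move: (ht (val t)) (ht _) (ht _) => u1 u2 u3 t1 t2.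
      by rewrite !ger0_norm; lra.
    have h3 : 2 ^+ l * ((j - i)%:R / D.+1%:R * (m / 2)) <= C * m.
      by apply: le_trans h1; rewrite ler_wpM2l ?exprn_ge0.
    have z0 : 0 < (j - i)%:R / D.+1%:R :> R by rewrite divr_gt0// (lt_le_trans ltr01).
    rewrite -[D.+1%:R / _]invf_div ler_pdivlMr//.
    have : 2 ^+ l * ((j - i)%:R / D.+1%:R) / 2 * m <= C * m.
      by apply: le_trans h3; rewrite le_eqVlt; apply/orP; left; apply/eqP; ring.
    by rewrite ler_pM2r//; move: (2 ^+ l * _) => u; lra.
  have lltK : (l < K)%N.
    rewrite ltn_neqAle lK andbT; apply/eqP => lKe; move: l2; rewrite lKe leNgt => /negP; apply.
    by apply: le_lt_trans KD; rewrite ler_wpM2l ?mulr_ge0 ?(ltW C0)// ler_pdivrMr ?(lt_le_trans ltr01)// ler_peMr// ltW.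
  have far : U / (q ^ l.+1)%:R < d.
    by rewrite ltNge; apply/negP => h; have := lmax l.+1; rewrite lltK h ltnn => /(_ isT).
  apply: le_trans (ltW far); rewrite -/U expnS natrM.
  have -> : U / (q%:R * (q ^ l)%:R) = U / q%:R * ((2 ^+ l) ^+ p)^-1.
    by rewrite invfM mulrA -natrX -natrX -!expnM [(p * l)%N]mulnC.
  rewrite -[leLHS]mulrA ler_wpM2l ?divr_ge0//.
  have z0 : 0 < 2 * C * (D.+1%:R / (j - i)%:R).
    by apply: mulr_gt0; [exact: mulr_gt0|apply: divr_gt0 => //; exact: lt_le_trans jir].
  have -> : (2 * C) ^- p * ((j - i)%:R / D.+1%:R) ^+ p = ((2 * C * (D.+1%:R / (j - i)%:R)) ^+ p)^-1.
    by rewrite -[in RHS]exprVn [(2 * C * _)^-1]invfM [(_ / (_ - _)%:R)^-1]invf_div [RHS]exprMn [(2 * C)^-1 ^+ p]exprVn.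
  by rewrite lef_pV2 ?posrE ?exprn_gt0// lerXn2r ?nnegrE ?exprn_ge0// ltW.
- move=> i _; rewrite /pos normrM (gtr0_norm L1) ler_wpM2l ?(ltW L1)// gtr0_norm//.
  by have /andP[] := gap (val (f i)).
- move=> i _; set t := val (f i); have bt : b t := valP (f i).
  have := ptl t bt; set z := x + _; have : `|v z - v (pt t)| <= lam.
    apply: le_trans Glam; apply: path_class_lipschitz => //; first by rewrite divr_gt0.
    move=> c; rewrite !mxE /pos -/t mulrA [line_len * _]mulrC mulfK ?gt_eqF//.
    case: (unliftP ord0 c) => [j ->|->]; last first.
      have -> : pt t ord0 ord0 - (x ord0 ord0 + (h0 - ht t) * -1) = 0.
        by rewrite xh -/(ht t); move: (ht t) => u; ring.
      by rewrite normr0 divr_ge0// ltW.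
    have -> : pt t ord0 (lift ord0 j) = x ord0 (lift ord0 j) + slope pt h0 j t (x ord0 (lift ord0 j)) * (h0 - ht t).
      by rewrite /slope divfK ?gt_eqF ?gap0// addrC subrK.
    have -> : x ord0 (lift ord0 j) + slope pt h0 j t (x ord0 (lift ord0 j)) * (h0 - ht t) -
       (x ord0 (lift ord0 j) + (h0 - ht t) * s j) = (slope pt h0 j t (x ord0 (lift ord0 j)) - s j) * (h0 - ht t).
      by move: (slope _ _ _ _ _) (s j) (ht t) => *; ring.
    rewrite normrM (gtr0_norm (gap0 t)) mulrC; apply: ler_pM; rewrite ?(ltW (gap0 _))//.
      by have /andP[] := gap t.
    exact: sl.
  have := ler_normD (v z - v (pt t)) (v (pt t)); rewrite subrK.
  by move: (`|v z|) (`|_ - _|) (`|_|) => *; lra.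
Qed.

End line_step.

(** * Measures on the sphere and on the cone *)

(** F is an arbitrary nonnegative function, so its integral is bounded below through a step function
    lying under it. *)
Lemma step_integral (R : realType) (N : nat) (al be c : 'I_N -> R) (a b : R) (F : R -> \bar R) :
  (forall r, (0 <= F r)%E) ->
  (forall g, [/\ 0 <= c g, al g <= be g, a <= al g & be g <= b]) ->
  (forall g g' r, al g < r < be g -> al g' < r < be g' -> g = g') ->
  (forall g r, al g < r < be g -> ((c g)%:E <= F r)%E) ->
  ((\sum_g c g * (be g - al g))%:E <= \int[lebesgue_measure]_(r in `]a, b[) F r)%E.
Proof.
move=> F0 cg dis cF.
pose f g r : \bar R := ((c g)%:E * (\1_(`]al g, be g[%classic : set R) r)%:E)%E.
have f0 g r : (0 <= f g r)%E by have [c0 _ _ _] := cg g; rewrite mule_ge0// lee_fin.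
have -> : ((\sum_g c g * (be g - al g))%:E = \int[lebesgue_measure]_r (\sum_g f g r))%E.
  rewrite ge0_integral_sum//; last first.
    move=> g; apply: emeasurable_funM; first exact: measurable_cst.
    by apply/measurable_EFinP; exact: measurable_indic.
  rewrite -sumEFin; apply: eq_bigr => g _; have [c0 ab _ _] := cg g.
  rewrite ge0_integralZl_EFin//; last by apply/measurable_EFinP; exact: measurable_indic.
  rewrite integral_indic// setIT EFinM; congr (_ * _)%E.
  apply/esym; apply: etrans (lebesgue_measure_itv `]al g, be g[) _.
  rewrite /= lte_fin; case: ltP => h; first by rewrite EFinB.
  have -> : be g = al g by apply/eqP; rewrite eq_le h ab.
  by rewrite subrr.
rewrite [leRHS]integral_mkcond; apply: le_integral_nn => r _.
  by rewrite sume_ge0.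
have [[g gr]|none] := pselect (exists g, al g < r < be g); last first.
  rewrite big1 => [|g _].
    by rewrite /patch; case: ifP.
  rewrite /f indicE memNset ?mule0// /= in_itv /= => h; apply: none; by exists g.
rewrite (bigD1 g)//= big1 ?adde0 => [|g' g'g]; last first.
  rewrite /f indicE memNset ?mule0// /= in_itv /= => h.
  by move: g'g; rewrite (dis g' g r h gr) eqxx.
have [c0 ab aa bb] := cg g; have /andP[gr1 gr2] := gr.
rewrite /f indicE mem_set /= ?in_itv/= ?gr// mule1 /patch mem_set; first exact: cF.
by rewrite /= in_itv /= (le_lt_trans aa gr1) (lt_le_trans gr2 bb).
Qed.

Section sphere_weights.
Context {R : realType} {k : nat}.
Local Notation rV := 'rV[R]_k.+1.
Variables (delta : R) (Theta : set rV).
Hypotheses (k1 : (1 <= k)%N) (d0 : 0 < delta) (Tsub : Theta `<=` unit_sphere).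
Hypothesis content0 : (0 < hausdorff_content (k.+1%:R - 2 + delta) Theta)%E.

Lemma unit_nsq (x : rV) : unit_sphere x -> nsq x = 1.
Proof. by rewrite /unit_sphere /= -enorm_sqr => ->; rewrite expr1n. Qed.

Lemma unit_coor (x : rV) i : unit_sphere x -> `|x ord0 i| <= 1.
Proof.
move=> /unit_nsq; rewrite /nsq /dotv => x1.
rewrite -(@ler_pXn2r _ 2) ?nnegrE// expr1n real_normK ?num_real// -x1 (bigD1 i)//= expr2 lerDl.
by apply: sumr_ge0 => j _; rewrite -expr2 sqr_ge0.
Qed.

(** The exponent of the content is k - 1 + delta. With q = 2^p and p delta >= 2, the part q^{-l
    delta} of the Frostman bound is at most 4^{-l}, the form that slicing consumes. *)
Lemma sphere_weights : exists (p : nat) (c0 : R), [/\ (0 < p)%N, 0 < c0 &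
  forall K, exists (T : finType) (pt : T -> rV) (w : T -> R), [/\
  forall i, Theta (pt i), forall i, 0 <= w i, c0 <= \sum_i w i &
  forall l B x, (l <= K)%N -> \sum_(i | `|pt i - x| <= B%:R / ((2 ^ p) ^ l)%:R) w i <=
    ((2 * B).+1 ^ k.+1)%:R * (4 * ((2 ^ p) ^ k.-1)%:R) ^- l]].
Proof.
pose a : R := k.+1%:R - 2 + delta.
have aE : a = k.-1%:R + delta by rewrite /a -{1}(prednK k1) -!natr1; ring.
have a0 : 0 < a by rewrite aE ltr_wpDl.
have [c0 c00 cov] := content_finite_cover a0 content0.
(* Large enough that q^delta >= 4 for q = 2^p. *)
pose p := Num.bound (2 / delta).
have pd : 2 <= p%:R * delta.
  by rewrite -ler_pdivrMr// ltW// archi_boundP// divr_ge0// ltW.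
have p0 : (0 < p)%N by rewrite lt0n; apply/eqP => p0; move: pd; rewrite p0 mul0r leNgt ltr0n.
pose q := (2 ^ p)%N; have q0 : (0 < q)%N by rewrite expn_gt0.
have qr l : 0 < (q ^ l)%:R :> R by rewrite ltr0n expn_gt0 q0.
pose tau (l : nat) : R := (4 * (q ^ k.-1)%:R) ^- l.
have tau_ge l : ((q ^ l)%:R^-1) `^ a <= tau l.
  have qi : 0 < (q ^ l)%:R^-1 :> R by rewrite invr_gt0.
  rewrite aE powRD; last by apply/implyP => _; rewrite gt_eqF.
  rewrite powR_mulrn ?(ltW qi)// /tau exprMn invfM mulrC.
  have -> : ((q ^ k.-1)%:R ^+ l)^-1 = (q ^ l)%:R^-1 ^+ k.-1 :> R.
    have e : ((q ^ k.-1) ^ l = (q ^ l) ^ k.-1)%N by rewrite -[LHS]expnM -[RHS]expnM mulnC.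
    by rewrite exprVn -[(q ^ k.-1)%:R ^+ l]natrX -[(q ^ l)%:R ^+ _]natrX e.
  rewrite ler_wpM2r ?exprn_ge0 ?(ltW qi)//.
  have -> : (q ^ l)%:R^-1 = expR (- (l%:R * (p%:R * ln 2))) :> R.
    rewrite expRN; congr (_^-1); rewrite expRM_natl expRM_natl lnK ?posrE//.
    by rewrite -!natrX -expnM.
  rewrite /powR gt_eqF ?expR_gt0// expRK.
  have -> : (4 ^+ l)^-1 = expR (- (l%:R * (2 * ln 2))) :> R.
    rewrite expRN; congr (_^-1); rewrite expRM_natl -[2 * ln 2]/(2%:R * ln 2) expRM_natl lnK ?posrE//.
    by congr (_ ^+ l); rewrite expr2; ring.
  have ln2 : 0 <= ln 2 :> R by rewrite ln_ge0// ler1n.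
  rewrite ler_expR mulrN lerN2 [leRHS](_ : _ = l%:R * ln 2 * (p%:R * delta)); last by ring.
  rewrite [leLHS](_ : _ = l%:R * ln 2 * 2); last by ring.
  by rewrite ler_wpM2l// mulr_ge0.
have T1 x : Theta x -> `|x| <= 1.
  by move=> /Tsub ux; apply: rV_norm_le => // i; exact: unit_coor.
have D0 : 0 < (2 * k.+1%:R) `^ a :> R by rewrite powR_gt0// mulr_gt0.
exists p, (c0 / (2 * k.+1%:R) `^ a); split => //; first by rewrite divr_gt0.
move=> K; have [T [pt [w [h1 h2 h3 h4]]]] := frostman (ltn0Sn k) q0 T1 tau_ge cov K.
by exists T, pt, w; split => //; rewrite ler_pdivrMr// mulrC.
Qed.

End sphere_weights.

Section cone_weights.
Context {R : realType} {k : nat} {T : finType}.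
Local Notation rV := 'rV[R]_k.+1.
Variables (r0 r1 : R) (om : T -> rV) (w : T -> R) (K q Bn B' Ng : nat) (rad : 'I_Ng -> R) (good : pred 'I_Ng).
Hypotheses (k1 : (1 <= k)%N) (r00 : 0 < r0) (r01 : r0 < r1) (q0 : (0 < q)%N) (Ng0 : (0 < Ng)%N) (NgK : (q ^ K <= Ng)%N).
Hypotheses (w0 : forall i, 0 <= w i) (om1 : forall i, unit_sphere (om i)).
Let h : R := (r1 - r0) / Ng%:R.
Hypothesis radP : forall g, good g -> r0 + g%:R * h < rad g < r0 + g.+1%:R * h.
Let Ar : R := k.+1%:R * r1 / r0.
Hypothesis B'P : (1 + Ar) / r0 * Bn%:R <= B'%:R.
Hypothesis omball : forall l i, (l <= K)%N ->
  \sum_(j | `|om j - om i| <= B'%:R / (q ^ l)%:R) w j <=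
  ((2 * B').+1 ^ k.+1)%:R * (4 * (q ^ k.-1)%:R) ^- l.

Definition cone_type : finType := ({g : 'I_Ng | good g} * T)%type.
Definition cone_pt (t : cone_type) : rV := rad (val t.1) *: om t.2.
Definition cone_wt (t : cone_type) : R := w t.2 / Ng%:R.
Definition cone_const : R := (2 * (Ar * Bn%:R) / (r1 - r0) + 3) * ((2 * B').+1 ^ k.+1)%:R.

Let Nr : 0 < Ng%:R :> R. Proof. by rewrite ltr0n. Qed.
Let L0 : 0 < r1 - r0. Proof. by rewrite subr_gt0. Qed.
Let h0 : 0 < h. Proof. by rewrite divr_gt0. Qed.
Let qr l : 0 < (q ^ l)%:R :> R. Proof. by rewrite ltr0n expn_gt0 q0. Qed.

Lemma cone_rad g : good g -> r0 < rad g < r1.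
Proof.
move=> /radP /andP[h1 h2]; apply/andP; split.
  by apply: le_lt_trans h1; rewrite lerDl mulr_ge0// ltW.
apply: lt_le_trans h2 _; have gN : g.+1%:R <= Ng%:R :> R by rewrite ler_nat.
have : g.+1%:R * h <= Ng%:R * h by rewrite ler_wpM2r// ltW.
have -> : Ng%:R * h = r1 - r0 by rewrite /h mulrC divfK// gt_eqF.
by lra.
Qed.

Lemma cone_pt_bound t : `|cone_pt t| <= r1.
Proof.
have /andP[h1 h2] := cone_rad (valP t.1).
have r10 : 0 < r1 by apply: lt_trans r01.
apply: rV_norm_le => [|i]; first exact: ltW.
rewrite mxE normrM gtr0_norm ?(lt_trans r00)//.
apply: (@le_trans _ _ (r1 * 1)); last by rewrite mulr1.
by apply: ler_pM; rewrite ?(ltW h2) ?unit_coor ?(ltW (lt_trans r00 h1)).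
Qed.

Lemma cone_wt_total (c0 : R) : c0 <= \sum_i w i -> 0 <= c0 -> (Ng <= 2 * #|good|)%N ->
  c0 / 2 <= \sum_t cone_wt t.
Proof.
move=> wc c00 gN.
rewrite -(pair_bigA _ (fun (g : {g : 'I_Ng | good g}) i => w i / Ng%:R)) /=.
rewrite sumr_const card_sig -mulr_suml -[leRHS]mulr_natl.
have : Ng%:R <= 2 * #|good|%:R :> R by rewrite -natrM ler_nat.
rewrite -/#|good|; move: (#|good|%:R) (ler0n R #|good|) => u u0 Nu.
rewrite mulrA ler_pdivlMr//; apply: (@le_trans _ _ (c0 / 2 * (2 * u))).
  by rewrite ler_wpM2l// divr_ge0.
have -> : c0 / 2 * (2 * u) = u * c0 by field.
by rewrite ler_wpM2l.
Qed.

(** Polar coordinates are bi-Lipschitz away from the origin. As the directions are unit vectors, the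
    difference of the squared radii is the sum over the coordinates of difference times sum. *)
Let dist_rad g g' i i' (eps : R) : good g -> good g' ->
  `|rad g *: om i - rad g' *: om i'| <= eps ->
  `|rad g - rad g'| <= Ar * eps /\ `|om i - om i'| <= (1 + Ar) / r0 * eps.
Proof.
move=> gg gg' he; have /andP[a1 a2] := cone_rad gg; have /andP[b1 b2] := cone_rad gg'.
have eps0 : 0 <= eps by apply: le_trans he.
have he' j : `|rad g * om i ord0 j - rad g' * om i' ord0 j| <= eps.
  by apply: le_trans he; have := rV_norm_coor (rad g *: om i - rad g' *: om i') j; rewrite !mxE.
have r10 : 0 < r1 by apply: lt_trans r01.
have e1 : `|rad g - rad g'| <= Ar * eps.
  have : `|(rad g - rad g') * (rad g + rad g')| <= k.+1%:R * (eps * (2 * r1)).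
    have -> : (rad g - rad g') * (rad g + rad g') =
        \sum_j (rad g * om i ord0 j - rad g' * om i' ord0 j) * (rad g * om i ord0 j + rad g' * om i' ord0 j).
      rewrite (eq_bigr (fun j => rad g ^+ 2 * (om i ord0 j * om i ord0 j) - rad g' ^+ 2 * (om i' ord0 j * om i' ord0 j))); last first.
        by move=> j _; ring.
      rewrite sumrB -!mulr_sumr.
      have := unit_nsq (om1 i); have := unit_nsq (om1 i'); rewrite /nsq /dotv => -> ->.
      by ring.
    apply: (le_trans (ler_norm_sum _ _ _)).
    apply: (@le_trans _ _ (\sum_(j < k.+1) eps * (2 * r1))).
      apply: ler_sum => j _; rewrite normrM; apply: ler_pM => //.
      apply: (le_trans (ler_normD _ _)); rewrite !normrM (gtr0_norm (lt_trans r00 a1)) (gtr0_norm (lt_trans r00 b1)).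
      have u1 : rad g * `|om i ord0 j| <= r1 * 1.
        by apply: ler_pM; rewrite ?(ltW a2) ?unit_coor ?(ltW (lt_trans r00 a1)).
      have u2 : rad g' * `|om i' ord0 j| <= r1 * 1.
        by apply: ler_pM; rewrite ?(ltW b2) ?unit_coor ?(ltW (lt_trans r00 b1)).
      by lra.
    by rewrite sumr_const card_ord -[_ *+ _]mulr_natl.
  have s0 : 2 * r0 <= rad g + rad g' by lra.
  rewrite normrM (gtr0_norm (lt_le_trans (mulr_gt0 (ltr0Sn R 1) r00) s0)).
  move=> hh; rewrite /Ar mulrAC ler_pdivlMr//.
  have : `|rad g - rad g'| * (2 * r0) <= k.+1%:R * (eps * (2 * r1)).
    by apply: le_trans hh; rewrite ler_wpM2l.
  by move: (`|_|) (k.+1%:R) => u n'; lra.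
split => //; apply: rV_norm_le.
  by rewrite mulr_ge0// divr_ge0 ?(ltW r00)// addr_ge0// divr_ge0 ?mulr_ge0 ?(ltW r10) ?(ltW r00).
move=> j; rewrite !mxE.
have e2 : `|rad g * (om i ord0 j - om i' ord0 j)| <= eps + Ar * eps.
  have -> : rad g * (om i ord0 j - om i' ord0 j) =
     (rad g * om i ord0 j - rad g' * om i' ord0 j) - (rad g - rad g') * om i' ord0 j by ring.
  apply: (le_trans (ler_normB _ _)); apply: lerD => //; rewrite normrM.
  by apply: le_trans e1; rewrite ler_piMr// unit_coor.
rewrite mulrAC ler_pdivlMr//; apply: le_trans (_ : eps + Ar * eps <= _); last by rewrite mulrDl mul1r.
apply: le_trans e2; rewrite normrM mulrC ler_wpM2r// gtr0_norm ?(lt_trans r00)//.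
exact: ltW.
Qed.

(** Close points of the cone have close radii and close directions. The proportion of the radii at
    distance q^{-l} supplies the additional factor q^{-l}, which raises the dimension by one. *)
Lemma cone_ball l t : (l <= K)%N ->
  \sum_(t' | `|cone_pt t' - cone_pt t| <= Bn%:R / (q ^ l)%:R) cone_wt t' <=
  cone_const * (4 * (q ^ k)%:R) ^- l.
Proof.
move=> lK; pose eps : R := Bn%:R / (q ^ l)%:R.
have eps0 : 0 <= eps by rewrite divr_ge0.
have r10 : 0 < r1 by apply: lt_trans r01.
have Ar0 : 0 <= Ar by rewrite divr_ge0 ?mulr_ge0 ?(ltW r10) ?(ltW r00).
pose P (g : {g : 'I_Ng | good g}) := `|rad (val g) - rad (val t.1)| <= Ar * eps.
pose Q i := `|om i - om t.2| <= B'%:R / (q ^ l)%:R.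
apply: (@le_trans _ _ (\sum_(g | P g) \sum_(i | Q i) w i / Ng%:R)).
  rewrite pair_big_dep /= [leLHS]big_mkcond [leRHS]big_mkcond /=; apply: ler_sum => -[g i] _ /=.
  case: ifP => [hh|_]; last by case: ifP => // _; rewrite divr_ge0.
  have [e1 e2] := dist_rad (valP g) (valP t.1) hh.
  rewrite ifT// /P e1 /= /Q; apply: (le_trans e2).
  by rewrite mulrA ler_wpM2r ?invr_ge0 ?(ltW (qr _)).
rewrite sumr_const -mulr_suml -[leLHS]mulr_natl.
have Ln : r1 - r0 != 0 by rewrite gt_eqF.
have cnt : #|[pred g | P g]|%:R <= 2 * (Ar * eps + h) * Ng%:R / `|r1 - r0| + 1.
  have ah0 : 0 <= Ar * eps + h by exact: addr_ge0 (mulr_ge0 Ar0 eps0) (ltW h0).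
  apply: le_trans (count_affine ((val t.1)%:R / Ng%:R * (r1 - r0)) Ng0 Ln ah0).
  rewrite ler_nat -(card_imset _ val_inj); apply: subset_leq_card; apply/fintype.subsetP => s.
  move=> /imsetP[g]; rewrite !inE /P => Pg ->.
  have /andP[u1 u2] := radP (valP g); have /andP[u3 u4] := radP (valP t.1).
  have hE j : j%:R / Ng%:R * (r1 - r0) = j%:R * h by rewrite /h; ring.
  rewrite !hE; move: Pg u1 u2 u3 u4; rewrite !ler_norml -!natr1 !mulrDl !mul1r.
  move: (_ * h) (_ * h) (rad _) (rad _) (Ar * eps) => x1 x2 x3 x4 x5 /andP[y1 y2] y3 y4 y5 y6.
  by apply/andP; split; lra.
have ql1 : 1 <= Ng%:R / (q ^ l)%:R :> R.
  by rewrite ler_pdivlMr// mul1r ler_nat (leq_trans _ NgK)// leq_pexp2l.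
have c1 : #|[pred g | P g]|%:R / Ng%:R <= (2 * (Ar * Bn%:R) / (r1 - r0) + 3) / (q ^ l)%:R.
  rewrite ler_pdivrMr//; apply: (le_trans cnt); rewrite (gtr0_norm L0).
  have -> : 2 * (Ar * eps + h) * Ng%:R / (r1 - r0) + 1 = 2 * (Ar * Bn%:R) / (r1 - r0) / (q ^ l)%:R * Ng%:R + 3.
    by rewrite /eps /h; field; rewrite !gt_eqF// ltr0n.
  have alg (u a b : R) : (u + 3) / a * b = u / a * b + 3 * (b / a) by ring.
  by rewrite alg lerD2l; move: ql1; move: (_ / _) => u ?; lra.
have ob := omball t.2 lK.
apply: (@le_trans _ _ (((2 * (Ar * Bn%:R) / (r1 - r0) + 3) / (q ^ l)%:R) * (((2 * B').+1 ^ k.+1)%:R * (4 * (q ^ k.-1)%:R) ^- l))).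
  rewrite mulrA [leLHS]mulrAC; apply: ler_pM; [exact: divr_ge0 (ler0n _ _) (ltW Nr)|by apply: sumr_ge0|exact: c1|exact: ob].
have -> : (4 * (q ^ k)%:R) ^+ l = (q ^ l)%:R * (4 * (q ^ k.-1)%:R) ^+ l :> R.
  by rewrite -{1}(prednK k1) expnS natrM mulrCA exprMn [(q ^ l)%:R]natrX.
rewrite /cone_const invfM le_eqVlt; apply/orP; left; apply/eqP.
have alg (u1 u2 u3 u4 : R) : u1 * u2 * (u3 * u4) = u1 * u3 * (u2 * u4) by ring.
exact: alg.
Qed.

End cone_weights.

(** * Lower bound for the observation at a fixed time *)

Section radius_arithmetic.
Context {R : realType}.
Implicit Types b r u z : R.

Lemma radius_le_mul b r : 0 <= (b + 3) * (r - 1) -> 1 + (r + b + 2) <= (b + 4) * r.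
Proof. by lra. Qed.

Lemma height_dist_le u b r : u <= r -> u + (b + 1) <= r + b + 2.
Proof. by lra. Qed.

Lemma height_itv b z : 0 <= z -> z <= 1 -> b + 1 <= b + 1 + z <= b + 2.
Proof. by move=> h1 h2; apply/andP; split; lra. Qed.

Lemma height_le b z r : z <= 1 -> 1 <= r -> b + 1 + z <= r + b + 2.
Proof. by lra. Qed.

Lemma height_gap_le u b : u <= b + 2 -> u + b <= 2 * b + 2.
Proof. by lra. Qed.

End radius_arithmetic.

Section static_bound.
Context {R : realType} {k : nat}.
Local Notation rV := 'rV[R]_k.+1.
Variables (delta r0 r1 : R) (Theta : set rV).
Hypotheses (k1 : (1 <= k)%N) (d0 : 0 < delta) (r00 : 0 < r0) (r01 : r0 < r1).
Hypothesis Tsub : Theta `<=` unit_sphere.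
Hypothesis content0 : (0 < hausdorff_content (k.+1%:R - 2 + delta) Theta)%E.

(** One propagation step with degree D of order 8 l: Q^{D+1} is at most e^{9 A l}, so a smallness
    e^{-13 A l} at the nodes survives it, and the interpolation error 2^{-D-1} is at most e^{-4 l}.
    The outcome stays below e^{-l}. *)
Lemma chain_step (Q A l M : R) : 0 <= Q -> Q <= expR A -> 1 <= A -> 1 <= l -> 0 < M ->
  Q ^+ (Num.truncn (8 * l)).+1 * (2 * (M * expR (- (13 * A * l)))) +
  4 * M / 2 ^+ (Num.truncn (8 * l)).+1 < M * expR (- l).
Proof.
move=> Q0 QA A1 l1 M0; set D := Num.truncn _.
have l8 : 0 <= 8 * l by rewrite mulr_ge0// (le_trans ler01).
have /andP[D1 D2] := truncn_itv l8; rewrite -/D in D1 D2.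
have D3 : D.+1%:R <= 9 * l by rewrite -[D.+1%:R]natr1; move: (D%:R) D1 => u; lra.
have Al : l <= A * l by rewrite ler_peMl// (le_trans ler01).
have q1 : Q ^+ D.+1 <= expR (9 * A * l).
  apply: (@le_trans _ _ (expR A ^+ D.+1)); first by rewrite lerXn2r ?nnegrE ?expR_ge0.
  rewrite -expRM_natl ler_expR [leRHS]mulrAC ler_wpM2r//.
  exact: le_trans A1.
have q2 : (2 ^+ D.+1)^-1 <= expR (- (4 * l)).
  have h : 2^-1 <= expR (- 2^-1) :> R by apply: le_trans (expR_ge1Dx _); lra.
  rewrite -exprVn; apply: (@le_trans _ _ (expR (- 2^-1) ^+ D.+1)).
    by rewrite lerXn2r ?nnegrE ?expR_ge0.
  by rewrite -expRM_natl ler_expR; move: (D.+1%:R) D2 => u; lra.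
have q3 : expR (- (4 * l)) <= 8^-1 * expR (- l).
  have -> : - (4 * l) = - (3 * l) + - l by ring.
  rewrite expRD ler_wpM2r ?expR_ge0// expRN lef_pV2 ?posrE ?expR_gt0//.
  apply: (@le_trans _ _ (expR 3)); last by rewrite ler_expR; lra.
  have -> : expR 3 = expR 1 ^+ 3 :> R by rewrite -expRM_natl mulr1.
  have h : 2 <= expR 1 :> R by apply: le_trans (expR_ge1Dx _); lra.
  apply: (@le_trans _ _ (2 ^+ 3)); first by rewrite !exprS expr0; lra.
  by rewrite lerXn2r ?nnegrE ?expR_ge0.
have q4 : expR (9 * A * l) * expR (- (13 * A * l)) <= expR (- (4 * l)).
  by rewrite -expRD ler_expR -!mulrA; move: (A * l) Al => u; lra.
have e0 := expR_gt0 (- l); have e1 := expR_gt0 (- (13 * A * l)).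
apply: (@le_lt_trans _ _ (2 * M * expR (- (4 * l)) + 4 * M * expR (- (4 * l)))).
  apply: lerD; last by rewrite ler_wpM2l// mulr_ge0// ltW.
  apply: (@le_trans _ _ (2 * M * (expR (9 * A * l) * expR (- (13 * A * l))))); last first.
    by rewrite ler_wpM2l// mulr_ge0// ltW.
  have -> : Q ^+ D.+1 * (2 * (M * expR (- (13 * A * l)))) = 2 * M * (Q ^+ D.+1 * expR (- (13 * A * l))) by ring.
  by rewrite ler_wpM2l ?mulr_ge0 ?(ltW M0)// ler_wpM2r// ltW.
have : M * expR (- (4 * l)) <= M * (8^-1 * expR (- l)) by rewrite ler_wpM2l// ltW.
have : 0 < M * expR (- l) by rewrite mulr_gt0.
rewrite mulrCA -!mulrA; move: (M * expR (- l)) (M * expR _) => u u'; lra.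
Qed.

Lemma half_complement (a b c : nat) : (2 * a < c -> a + b = c -> c <= 2 * b)%N.
Proof. by lia. Qed.

(** If v is below lam on Theta for radii in at least half of the radial cells, these points carry a
    Frostman measure on the cone. Starting from y, one propagation fixes the height, k more fix the
    other coordinates, and a last one along the selected line contradicts the smallness on the cone:
    k + 2 steps, each multiplying the exponent by 13 A. *)
Lemma static_bound : exists2 Cs : R, 1 <= Cs &
  forall (v : rV -> R) (M rho Rr A ell : R) (y : rV) (F : R -> \bar R),
  path_class v M rho -> 0 < M -> 1 <= Rr -> Cs * Rr <= rho -> Cs * Rr <= expR A -> 1 <= A -> 1 <= ell ->
  `|y| <= Rr -> M <= `|v y| * expR ell -> (forall r, (0 <= F r)%E) ->
  (forall r lam, r0 < r < r1 -> 0 < lam ->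
    (forall w, Theta w -> `|v (r *: w)| <= lam) \/ ((lam ^+ 2)%:E <= F r)%E) ->
  (((M * expR (- ((13 * A) ^+ k.+2 * ell))) ^+ 2 * ((r1 - r0) / 2))%:E <=
    \int[lebesgue_measure]_(r in `]r0, r1[) F r)%E.
Proof.
have [p [c0 [p0 c00 fr]]] := sphere_weights k1 d0 Tsub content0.
have r10 : 0 < r1 by apply: lt_trans r01.
pose q := (2 ^ p)%N; have q0 : (0 < q)%N by rewrite expn_gt0.
pose B := (Num.bound r1).+1; have B1 : (1 <= B)%N by [].
have rB : r1 <= B%:R.
  by apply: (le_trans (ltW (archi_boundP (ltW r10)))); rewrite ler_nat.
clearbody B; pose G : R := (2 * B + 2)%:R; have G0 : 0 < G by rewrite ltr0n addn_gt0 orbT.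
pose Bn := (B.+1 * (2 * B) + (2 * B + 2))%N.
pose Ar := k.+1%:R * r1 / r0.
have Ar0 : 0 <= Ar by rewrite divr_ge0 ?mulr_ge0 ?(ltW r10) ?(ltW r00).
pose B' := Num.bound ((1 + Ar) / r0 * Bn%:R).
have B'P : (1 + Ar) / r0 * Bn%:R <= B'%:R.
  by apply/ltW/archi_boundP; rewrite mulr_ge0// divr_ge0 ?(ltW r00)// addr_ge0.
pose C1 := cone_const (k := k) r0 r1 Bn B'.
have L0 : 0 < r1 - r0 by rewrite subr_gt0.
have C10 : 0 <= C1.
  rewrite /C1 /cone_const -/Ar mulr_ge0// addr_ge0// divr_ge0 ?(ltW L0)// mulr_ge0// mulr_ge0//.
have c20 : 0 < c0 / 2 by rewrite divr_gt0.
pose C := 2 * slice_const k q B G C1 (c0 / 2).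
have C_1 : 1 <= C.
  rewrite /C /slice_const; set u := _ / (c0 / 2); suff : 0 <= u by lra.
  apply: divr_ge0 (ltW c20); apply: mulr_ge0; first by rewrite mulr_ge0// exprn_ge0.
  by rewrite exprn_ge0// mulr_ge0// addr_ge0// !mulr_ge0// sqr_ge0.
pose X : R := line_len (k := k) B * G.
have X0 : 0 < X by rewrite mulr_gt0// mulr_gt0// ltr0n.
pose Q2c := Q2 (k := k) p B G C.
have Q20 : 0 <= Q2c.
  rewrite /Q2c /Q2 -/X addr0; apply: mulr_ge0; last by rewrite exprn_ge0// mulr_ge0// expR_ge0.
  apply: mulr_ge0 => //; apply: divr_ge0 (ltW X0) _; apply: mulr_ge0; first exact: mulr_ge0.
  apply: divr_ge0; first exact: divr_ge0.
  by rewrite exprn_ge0// mulr_ge0// (le_trans ler01).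
pose Cq : R := 16 * expR 1 * (B%:R + 4).
have Cq0 : 0 <= Cq by apply: mulr_ge0; [rewrite mulr_ge0// expR_ge0|rewrite addr_ge0].
pose Cs := 2 * Cq + 2 * Q2c * X + Q2c + 1.
have QX0 : 0 <= 2 * Q2c * X by rewrite mulr_ge0 ?(ltW X0)// mulr_ge0.
exists Cs; first by rewrite /Cs; lra.
move=> v M rho Rr A ell y F pv M0 R1 Csr CsA A1 ell1 yR My F0 FT.
have CsR : Cs <= Cs * Rr by rewrite ler_peMr// /Cs; lra.
have rho0 : 0 < rho by apply: lt_le_trans Csr; apply: lt_le_trans CsR; rewrite /Cs; lra.
have Q2A : Q2c <= expR A by apply: le_trans CsA; apply: le_trans CsR; rewrite /Cs; lra.
have Q2r : 2 * Q2c * X <= rho by apply: le_trans Csr; apply: le_trans CsR; rewrite /Cs; lra.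
pose Y := Rr + B%:R + 2.
have Br0 : 0 <= B%:R :> R by [].
have Y0 : 0 <= Y by rewrite /Y; lra.
have Q1Y : Q1 Y <= Cq * Rr.
  have -> : Q1 Y = 16 * expR 1 * (1 + Y) by rewrite /Q1 invrK expr1; ring.
  rewrite /Cq -[leRHS]mulrA; apply: ler_wpM2l; first by rewrite mulr_ge0// expR_ge0.
  rewrite /Y.
  have : 0 <= (B%:R + 3) * (Rr - 1) by apply: mulr_ge0; [exact: addr_ge0|rewrite subr_ge0].
  exact: radius_le_mul.
have Q10 : 0 <= Q1 Y by rewrite /Q1 invrK expr1 !mulr_ge0 ?expR_ge0// addr_ge0.
have CqR : 2 * (Cq * Rr) <= Cs * Rr.
  by rewrite mulrA ler_wpM2r ?(le_trans ler01)// /Cs; lra.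
have CqR0 : 0 <= Cq * Rr by rewrite mulr_ge0// (le_trans ler01).
have Q1A : Q1 Y <= expR A by apply: le_trans CsA; lra.
have Q1r : 2 * Q1 Y * 1 <= rho by apply: le_trans Csr; lra.
(* The thresholds kap i = M e^{-l_ i}: index 0 is for y, 1 for the choice of the height, 2 to k + 1
   for the other coordinates, and k + 2 for the observation set. *)
pose l_ i := (13 * A) ^+ i * ell.
have A13 : 1 <= 13 * A by lra.
have l1 i : 1 <= l_ i.
  by rewrite -[leLHS]mulr1; apply: ler_pM => //; rewrite exprn_ege1.
pose kap i := M * expR (- l_ i).
have kap0 i : 0 < kap i by rewrite mulr_gt0 ?expR_gt0.
pose D i := Num.truncn (8 * l_ i).
have chain Q i : 0 <= Q -> Q <= expR A -> Q ^+ (D i).+1 * (2 * kap i.+1) + 4 * M / 2 ^+ (D i).+1 < kap i.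
  move=> Q0 QA; have := chain_step Q0 QA A1 (l1 i) M0.
  have e : l_ i.+1 = 13 * A * l_ i by rewrite /l_ exprS mulrA.
  by rewrite /kap e.
pose lam := kap k.+2.
pose g1 : R := k.+1%:R * G; have g10 : 0 < g1 by rewrite mulr_gt0// ltr0n.
(* The finest scale q^{-K} must meet three requirements of [line_step]. K may depend on v, rho and
   lam, because the constants of slicing do not depend on K. *)
pose Z := 2 * C * (D k.+1).+1%:R + 2 * g1 / rho + 2 * g1 / rho * M / lam.
pose K := Num.bound Z.
have Z1 : 0 <= 2 * C * (D k.+1).+1%:R by apply: mulr_ge0 => //; apply: mulr_ge0 => //; apply: le_trans C_1.
have Z2 : 0 <= 2 * g1 / rho by rewrite divr_ge0 ?mulr_ge0 ?(ltW g10) ?(ltW rho0).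
have Z3 : 0 <= 2 * g1 / rho * M / lam by rewrite divr_ge0 ?(ltW (kap0 _))// mulr_ge0// ltW.
have ZK : Z < 2 ^+ K by exact: upper_nthrootP.
have qK : 2 ^+ K <= (q ^ K)%:R :> R.
  by rewrite -natrX ler_nat leq_exp2r ?expn_gt0 ?ltnS//; rewrite -[leqLHS]expn1 leq_exp2l.
have qKr : 0 < (q ^ K)%:R :> R by rewrite ltr0n expn_gt0 q0.
pose N := (q ^ K + \sum_(i < k.+1) 4 * (D i).+1)%N.
have N0 : (0 < N)%N by rewrite addn_gt0 expn_gt0 q0.
have ND i : (i <= k)%N -> (4 * (D i).+1 <= N)%N.
  move=> ik; rewrite /N (bigD1 (Ordinal (ik : (i < k.+1)%N)))//= addnCA leq_addr//.
pose Ng := (q ^ K)%N; have Ng0 : (0 < Ng)%N by rewrite expn_gt0 q0.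
have Nr : 0 < Ng%:R :> R by rewrite ltr0n.
pose h : R := (r1 - r0) / Ng%:R; have h0 : 0 < h by rewrite divr_gt0.
have hN : Ng%:R * h = r1 - r0 by rewrite /h mulrC divfK// gt_eqF.
pose good (g : 'I_Ng) := `[< exists r, r0 + g%:R * h < r < r0 + g.+1%:R * h /\ forall w, Theta w -> `|v (r *: w)| <= lam >].
have itv_in (g : 'I_Ng) : r0 <= r0 + g%:R * h /\ r0 + g.+1%:R * h <= r1.
  split; first by rewrite lerDl mulr_ge0// ltW.
  have : g.+1%:R * h <= Ng%:R * h by rewrite ler_wpM2r ?(ltW h0)// ler_nat.
  by rewrite hN -lerBrDl.
(* When fewer than half of the radial cells contain a radius where v is at most lam on Theta, F is
   at least lam^2 on all the others and the integral bound is immediate. *)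
have [many|few] := leqP Ng (2 * #|good|); last first.
  pose c g : R := if good g then 0 else lam ^+ 2.
  have := @step_integral R Ng (fun g => r0 + g%:R * h) (fun g => r0 + g.+1%:R * h) c r0 r1 F F0.
  move=> st; apply: le_trans (st _ _ _).
  - rewrite lee_fin -/(kap k.+2) -/lam.
    rewrite (eq_bigr (fun g => c g * h)); last by move=> g _; rewrite -natr1; congr (_ * _); ring.
    rewrite -mulr_suml.
    have -> : \sum_g c g = #|[predC good]|%:R * lam ^+ 2.
      rewrite mulr_natl -sumr_const [RHS]big_mkcond; apply: eq_bigr => g _.
      by rewrite /c -[g \in _]/(~~ good g); case: (good g).
    have : Ng%:R / 2 <= #|[predC good]|%:R :> R.
      have := cardC good; rewrite card_ord => e.
      rewrite ler_pdivrMr// mulrC -natrM ler_nat.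
      exact: half_complement few e.
    move=> hc; have -> : lam ^+ 2 * ((r1 - r0) / 2) = Ng%:R / 2 * lam ^+ 2 * h.
      by rewrite -hN; ring.
    by rewrite ler_wpM2r ?(ltW h0)// ler_wpM2r ?sqr_ge0.
  - move=> g; have [i1 i2] := itv_in g; split => //.
      by rewrite /c; case: ifP => // _; exact: sqr_ge0.
    by rewrite lerD2l ler_wpM2r ?(ltW h0)// ler_nat.
  - move=> g g' r /andP[a1 a2] /andP[b1 b2]; apply/val_inj/eqP.
    have lt1 (i j : nat) : r0 + i%:R * h < r -> r < r0 + j.+1%:R * h -> (i <= j)%N.
      move=> e1 e2; have := lt_trans e1 e2; rewrite ltrD2l ltr_pM2r// ltr_nat ltnS.
      exact.
    by rewrite eqn_leq !lt1.
  - move=> g r gr; rewrite /c; case: (asboolP (good g)) => [gg|ng]; first by rewrite gg.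
    have ngf : good g = false by apply/negP.
    rewrite ngf; have [i1 i2] := itv_in g; have /andP[gr1 gr2] := gr.
    have r01' : r0 < r < r1 by rewrite (le_lt_trans i1 gr1) (lt_le_trans gr2 i2).
    have [sm|//] := FT r lam r01' (kap0 _).
    by case: ng; apply/asboolP; exists r.
exfalso.
have /choice[rad radP] : forall g : 'I_Ng, exists r, good g ->
    r0 + g%:R * h < r < r0 + g.+1%:R * h /\ forall w, Theta w -> `|v (r *: w)| <= lam.
  move=> g; have [/asboolP[r hr]|ng] := boolP (good g); first by exists r.
  by exists 0.
have radI g : good g -> r0 + g%:R * h < rad g < r0 + g.+1%:R * h by move=> /radP[].
have [T [om [w [omT w0 wc omball]]]] := fr K.
have om1 i : unit_sphere (om i) by exact: Tsub.
pose pt := cone_pt om rad (good := good); pose W := cone_wt w (Ng := Ng) (good := good).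
have W0 t : 0 <= W t by rewrite divr_ge0.
have ptB t : `|pt t| <= B%:R by apply: le_trans rB; apply: (@cone_pt_bound _ _ _ r0).
have wt : c0 / 2 <= \sum_t W t by apply: cone_wt_total => //; exact: ltW.
have ball l t : (l <= K)%N -> \sum_(t' | `|pt t' - pt t| <= Bn%:R / (q ^ l)%:R) W t' <=
    C1 * (4 * (q ^ k)%:R) ^- l.
  have ob l' i : (l' <= K)%N -> \sum_(j | `|om j - om i| <= B'%:R / (q ^ l')%:R) w j <=
      ((2 * B').+1 ^ k.+1)%:R * (4 * (q ^ k.-1)%:R) ^- l' by exact: omball.
  by apply: (@cone_ball _ _ _ r0 r1 om w K q Bn B' Ng rad good).
have kap_y : kap 0%N <= `|v y|.
  by rewrite /kap /l_ expr0 mul1r expRN ler_pdivrMr ?expR_gt0.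
(* A height between B + 1 and B + 2 lies above every point of the cone by at least 1, which keeps
   all slopes bounded. *)
have [x0 [x0h x0v x0R]] : exists x0 : rV, [/\ B%:R + 1 <= x0 ord0 ord0 <= B%:R + 2,
    kap 1%N <= `|v x0| & `|x0| <= Rr + B%:R + 2].
  have yc : `|y ord0 ord0 - (B%:R + 1)| <= Y.
    apply: (le_trans (ler_normB _ _)); rewrite [`|_ + 1|]ger0_norm ?addr_ge0//.
    exact: height_dist_le (le_trans (rV_norm_coor y ord0) yR).
  have ch : Q1 Y ^+ (D 0%N).+1 * kap 1%N + 4 * M / 2 ^+ (D 0%N).+1 < kap 0%N.
    apply: le_lt_trans (chain _ 0%N Q10 Q1A); rewrite lerD2r ler_wpM2l ?exprn_ge0//.
    by rewrite ler_peMl ?ler1n ?ltW.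
  have := coord_step pv (ltW M0) (ND 0%N (leq0n _)) Y0 yc Q1r ch kap_y.
  set P := [pred s | _] => NP; have : (0 < #|P|)%N by have := leq_trans N0 NP; rewrite muln_gt0.
  move=> /card_gt0P[s]; rewrite inE => sP; exists (upd y ord0 (B%:R + 1 + s%:R / N%:R)).
  have Nrr : 0 < N%:R :> R by rewrite ltr0n.
  have s0 : 0 <= (nat_of_ord s)%:R / N%:R :> R by rewrite divr_ge0.
  have s1 : (nat_of_ord s)%:R / N%:R <= 1 :> R by rewrite ler_pdivrMr// mul1r ler_nat ltnW.
  move: s0 s1 sP; move: (_ / _) => z z0 z1 zP.
  split; [|exact: ltW|].
    by rewrite mxE eqxx; exact: height_itv.
  apply: rV_norm_le => [|i]; first by apply: addr_ge0 => //; apply: addr_ge0 => //; exact: le_trans R1.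
  rewrite mxE; case: eqVneq => _.
    rewrite ger0_norm; last by apply: addr_ge0 => //; exact: addr_ge0.
    exact: height_le.
  apply: le_trans (le_trans (rV_norm_coor y i) yR) _; rewrite -addrA lerDl; exact: addr_ge0.
have /andP[h01 h02] := x0h.
pose Good (j : nat) (x : rV) := kap j.+1 <= `|v x| /\ `|x| <= Rr + B%:R + 2.
have good_step (j : 'I_k) x : Good j x -> x ord0 ord0 = x0 ord0 ord0 ->
   (N <= 2 * #|[pred s : 'I_N | `[< Good j.+1 (upd x (lift ord0 j) (s%:R / N%:R)) >]]|)%N.
  move=> [xv xR] _.
  have xc : `|x ord0 (lift ord0 j) - 0| <= Y.
    by rewrite subr0; apply: le_trans (rV_norm_coor x _) _.
  have ch : Q1 Y ^+ (D j.+1).+1 * kap j.+2 + 4 * M / 2 ^+ (D j.+1).+1 < kap j.+1.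
    apply: le_lt_trans (chain _ j.+1 Q10 Q1A); rewrite lerD2r ler_wpM2l ?exprn_ge0//.
    by rewrite ler_peMl ?ler1n ?ltW.
  apply: (leq_trans (coord_step pv (ltW M0) (ND j.+1 (ltn_ord j)) Y0 xc Q1r ch xv)).
  rewrite leq_mul2l /=; apply: subset_leq_card; apply/fintype.subsetP => s; rewrite !inE add0r => sv.
  split; first exact: ltW.
  have Nrr : 0 < N%:R :> R by rewrite ltr0n.
  have s0 : 0 <= (nat_of_ord s)%:R / N%:R :> R by rewrite divr_ge0.
  have s1 : (nat_of_ord s)%:R / N%:R <= 1 :> R by rewrite ler_pdivrMr// mul1r ler_nat ltnW.
  apply: rV_norm_le => [|i]; first by apply: addr_ge0 => //; apply: addr_ge0 => //; exact: le_trans R1.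
  rewrite mxE; case: eqVneq => _; last exact: le_trans (rV_norm_coor x i) _.
  rewrite ger0_norm//; apply: (le_trans s1); apply: (le_trans R1).
  by rewrite -addrA lerDl; exact: addr_ge0.
have hG : x0 ord0 ord0 + B%:R <= G.
  by rewrite /G natrD natrM; exact: height_gap_le.
have BnG : (B.+1 * (2 * B))%:R + G <= Bn%:R :> R by rewrite /G -natrD ler_nat.
have qN : (q ^ K <= N)%N by exact: leq_addr.
have [x [[xv xR] xh x01 [b [m [m0 mb sl mass]]]]] :=
  slicing W0 c20 wt q0 N0 qN B1 ptB h01 hG BnG C10 ball good_step (conj x0v x0R : Good 0%N x0) erefl.
have mass' i l : b i -> (l <= K)%N -> 2 ^+ l * \sum_(i' | b i' &&
    (`|pt i ord0 ord0 - pt i' ord0 ord0| <= (2 * B)%:R / ((2 ^ p) ^ l)%:R)) W i' <= C * m by exact: mass.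
have ptl t : b t -> `|v (pt t)| <= lam.
  by move=> _; have [_ ] := radP _ (valP t.1); apply; exact: omT.
have Kq : k.+1%:R * (G / (q ^ K)%:R) <= rho / 2.
  rewrite mulrA -/g1 ler_pdivrMr//; rewrite -ler_pdivrMl ?divr_gt0//.
  apply: le_trans qK; apply: le_trans (ltW ZK).
  have -> : (rho / 2)^-1 * g1 = 2 * g1 / rho by rewrite invf_div mulrAC.
  by rewrite /Z addrAC lerDr addr_ge0.
have KD : 2 * C * (D k.+1).+1%:R < 2 ^+ K.
  by apply: le_lt_trans ZK; rewrite /Z -addrA lerDl addr_ge0.
have Klam : 2 * (k.+1%:R * (G / (q ^ K)%:R) / rho) * M <= lam.
  have -> : 2 * (k.+1%:R * (G / (q ^ K)%:R) / rho) * M = 2 * g1 / rho * M / (q ^ K)%:R.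
    by rewrite /g1; move: (_^-1) (_^-1) (k.+1%:R) => z1 z2 z3; ring.
  rewrite ler_pdivrMr//; rewrite -ler_pdivrMl ?kap0//.
  apply: le_trans qK; apply: le_trans (ltW ZK).
  by rewrite mulrC /Z lerDr addr_ge0.
have ls := line_step pv (ltW M0) rho0 (D := D k.+1) (lam := lam) W0 B1 ptB h01 hG C_1 m0 xh x01 mb sl mass' KD ptl Kq Klam Q2r.
by have := le_lt_trans ls (chain _ k.+1 Q20 Q2A); rewrite ltNge xv.
Qed.

End static_bound.

(** * Choice of the scales and the estimate at one time *)

Section path_scale.
Context {R : realType} {n : nat}.
Local Notation rV := 'rV[R]_n.
Implicit Types (s t z rho M : R).

Lemma le_expR_self s : s <= expR s.
Proof. by apply: le_trans (expR_ge1Dx s); rewrite lerDr. Qed.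

Lemma dyadic_scale z : 1 <= z -> exists l : nat, z / (2 ^ l)%:R <= 1 /\ 1 <= 2 * (z / (2 ^ l)%:R).
Proof.
move=> z1; have ex : exists l, z <= (2 ^ l)%:R.
  by exists (Num.bound z); rewrite natrX ltW// upper_nthrootP.
have pw l : 0 < (2 ^ l)%:R :> R by rewrite ltr0n expn_gt0.
have [l zl lmin] := ex_minnP ex; exists l; split; first by rewrite ler_pdivrMr// mul1r.
rewrite mulrA ler_pdivlMr// mul1r; case: l zl lmin => [|l] _ lmin; first by rewrite expn0; lra.
rewrite expnS natrM ler_pM2l// leNgt; apply/negP => /ltW /lmin; by rewrite ltnn.
Qed.

Lemma sqrt_gauZ_le s : 0 < s -> s <= 1 ->
  Num.sqrt (2 / gauZ (n := n) (4 * s)^-1) <= expR (1 + 2 * n%:R / s).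
Proof.
move=> s0 s1; have nr : 0 <= n%:R :> R by [].
have a0 : 0 < (4 * s)^-1 :> R by rewrite invr_gt0 mulr_gt0.
have Z0 := gauZ_gt0 (n := n) a0.
have s2 : 1 <= s^-1 by rewrite invf_ge1.
have ns : n%:R <= n%:R / s :> R by rewrite ler_peMr.
have h1 := gauZ_ge (n := n) a0 s0.
have h2 : expR (- (n%:R / s)) <= (2 * s) ^+ n.
  have -> : - (n%:R / s) = n%:R * - s^-1 by ring.
  rewrite expRM_natl lerXn2r ?nnegrE ?expR_ge0 ?mulr_ge0 ?(ltW s0)//.
  rewrite expRN -[2 * s]invrK lef_pV2 ?posrE ?expR_gt0 ?invr_gt0 ?mulr_gt0//.
  apply: le_trans (le_expR_self _); rewrite lef_pV2 ?posrE ?mulr_gt0//; lra.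
have h3 : expR (- n%:R) <= expR (- ((4 * s)^-1 * (n%:R * s ^+ 2))) :> R.
  rewrite ler_expR lerN2; have -> : (4 * s)^-1 * (n%:R * s ^+ 2) = n%:R * (s / 4).
    by field; rewrite gt_eqF.
  by rewrite ler_piMr// ler_pdivrMr//; lra.
have h4 : expR (- (n%:R + n%:R / s)) <= gauZ (n := n) (4 * s)^-1.
  apply: le_trans h1; rewrite opprD expRD.
  by apply: ler_pM; rewrite ?expR_ge0.
have h5 : 2 / gauZ (n := n) (4 * s)^-1 <= expR (1 + 2 * n%:R / s).
  rewrite ler_pdivrMr//; apply: (@le_trans _ _ (expR (1 + 2 * n%:R / s) * expR (- (n%:R + n%:R / s)))).
    rewrite -expRD; apply: (@le_trans _ _ (expR 1)).
      by apply: le_trans (expR_ge1Dx _); lra.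
    by rewrite ler_expR -mulrA; move: (n%:R / s) ns => u; lra.
  by rewrite ler_wpM2l ?expR_ge0.
have E1 : 1 <= expR (1 + 2 * n%:R / s).
  by rewrite -[leLHS]expR0 ler_expR addr_ge0// divr_ge0 ?mulr_ge0// ltW.
apply: le_trans (ler_wsqrtr h5) _; rewrite -(ler_pXn2r (n := 2)) ?nnegrE ?sqrtr_ge0 ?expR_ge0//.
by rewrite sqr_sqrtr ?expR_ge0// expr2 ler_peMr ?expR_ge0.
Qed.

Lemma path_class_le (v : rV -> R) M M' rho : 0 <= rho -> M <= M' -> path_class v M rho -> path_class v M' rho.
Proof.
move=> rho0 MM pv x e sw D e1 kD sr; apply: (le_trans (pv x e sw D e1 kD sr)).
by rewrite ler_wpM2l// mulr_ge0// tail_weight_ge0.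
Qed.

Lemma flow_path_class m (v : R -> rV -> R) s t l rho : schr_flow m v -> 0 <= s -> 0 < t ->
  0 < nrm (v (s + t)) -> 0 < rho ->
  path_class (v (s + t)) (path_const (n := n) m (t / (2 ^ l)%:R) rho *
    (nrm (v (s + t)) * expR (ln (nrm (v s) / nrm (v (s + t))) / (2 ^ l)%:R))) rho.
Proof.
by move=> fv s0 t0 a0 rho0 x e sw D e1 kD sr; exact: flow_line_bound.
Qed.

Lemma pot_norm_le m (x : rV) (r : R) : (0 < m)%N -> 0 < r -> pot m x < r ^+ (2 * m) -> `|x| <= r.
Proof.
move=> m0 r0; rewrite exprM /pot => h.
have h2 : nsq x < r ^+ 2 by rewrite -(ltr_pXn2r m0) ?nnegrE ?nsq_ge0 ?exprn_ge0 ?ltW.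
apply: rV_norm_le => [|i]; first exact: ltW.
rewrite -(ler_pXn2r (n := 2)) ?nnegrE ?(ltW r0)// real_normK ?num_real//.
apply: le_trans (ltW h2); rewrite /nsq /dotv (bigD1 i)//= expr2 lerDl.
by apply: sumr_ge0 => j _; rewrite -expr2 sqr_ge0.
Qed.

Lemma exponent_sum (z1 z2 z3 z4 z u c q : R) : z1 <= 4 * u * z -> z2 <= 2 * c * z -> z3 <= q * z ->
  z4 <= z -> 1 <= z -> 1 + z1 + (z2 + z3) + z4 <= (2 + 4 * u + 2 * c + q) * z.
Proof. by lra. Qed.

Lemma le_affine_power (nn r z : R) : 0 <= nn -> r <= z -> 1 <= z ->
  1 + nn * (2 * r) <= (1 + 2 * nn) * z.
Proof. by nra. Qed.

Lemma le_affine_mul (c j p : R) : 0 <= c -> 1 <= p -> 13 * (c + j * p) <= 13 * (c + j) * p.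
Proof. by nra. Qed.

Lemma exponent_loss (z1 z2 z3 z4 z : R) : z1 <= z2 -> z2 <= 1 + z4 - 1 + z3 -> 0 <= z ->
  - z4 + - z3 <= z + - z1.
Proof. by lra. Qed.

End path_scale.

Section scale_choice.
Context {R : realType}.
Implicit Types (t Lam : R).

(* The radius is the least admissible one, so that its high power is bounded
   by the logarithmic loss [Lam] up to a term depending on [t] only. *)
Lemma scale_choice (e1 d : nat) (C : R) : (e1 < d)%N -> 1 <= C -> exists2 K : R, 1 <= K &
  forall t Lam, 0 < t -> t <= 1 -> 1 <= Lam -> exists P : nat,
  [/\ (0 < P)%N, 1 <= t * P%:R, 64 * Lam <= t * P%:R ^+ d &
      C * P%:R ^+ e1 <= Lam - 1 + K / t ^+ e1].
Proof.
move=> ed C1; pose C3 : R := C * 64 * 2 ^+ d.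
have C31 : 1 <= C3.
  have : 1 <= 2 ^+ d :> R by rewrite exprn_ege1// ler1n.
  by rewrite /C3; move: (2 ^+ d) => u u1; nra.
have K1 : 1 <= C * (2 * C3) ^+ e1.
  rewrite -[leLHS]mulr1; apply: ler_pM => //; rewrite exprn_ege1//; lra.
exists (1 + C * (2 * C3) ^+ e1) => [|t Lam t0 t1 L1]; first by rewrite lerDl (le_trans ler01).
have C3t : 1 <= C3 / t by rewrite ler_pdivlMr// mul1r (le_trans t1).
have C3t0 : 0 <= C3 / t by apply: le_trans C3t.
pose p0 := (Num.truncn (C3 / t)).+1.
have p0a : C3 / t <= p0%:R by rewrite ltW// truncnS_gt.
have p0b : p0%:R <= 2 * C3 / t.
  have /andP[h _] := truncn_itv C3t0; rewrite /p0 -natr1 -mulrA; move: (_%:R) h => u; lra.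
pose good P := (p0 <= P)%N && (64 * Lam <= t * P%:R ^+ d).
have ex : exists P, good P.
  exists (p0 + Num.bound (64 * Lam / t))%N; rewrite /good leq_addr /=.
  have LT0 : 0 <= 64 * Lam / t by rewrite divr_ge0 ?(ltW t0)// mulr_ge0// (le_trans ler01).
  have h := archi_boundP LT0; set b := Num.bound _ in h *.
  have h1 : 64 * Lam / t <= (p0 + b)%:R by apply: (le_trans (ltW h)); rewrite ler_nat leq_addl.
  rewrite [leRHS]mulrC -ler_pdivrMr//; apply: (le_trans h1).
  have P1 : 1 <= (p0 + b)%:R :> R by rewrite ler1n addn_gt0.
  by rewrite ler_eXnr//; exact: leq_ltn_trans ed.
have [P /andP[pP LP] Pmin] := ex_minnP ex.
have Pr : C3 / t <= P%:R by apply: le_trans p0a _; rewrite ler_nat.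
have tP : C3 <= t * P%:R by rewrite mulrC -ler_pdivrMr.
exists P; split => //; first exact: leq_trans pP.
  exact: le_trans tP.
have e0 : 0 < t ^+ e1 by rewrite exprn_gt0.
have it : 1 <= (t ^+ e1)^-1 by rewrite invf_ge1// exprn_ile1// ltW.
have KE : (1 + C * (2 * C3) ^+ e1) / t ^+ e1 = (t ^+ e1)^-1 + C * (2 * C3 / t) ^+ e1.
  have alg (u z w : R) : (1 + u * z) / w = w^-1 + u * (z / w) by ring.
  by rewrite expr_div_n alg.
rewrite KE; move: pP; rewrite leq_eqVlt => /orP[/eqP pP|pP].
  have : C * P%:R ^+ e1 <= C * (2 * C3 / t) ^+ e1.
    rewrite -pP ler_wpM2l ?(le_trans ler01)// lerXn2r ?nnegrE// -mulrA mulr_ge0//.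
  by move: (C * _) (C * _) => u w; lra.
have P0 : 0 < P%:R :> R by rewrite ltr0n (leq_trans _ pP).
have P2 : (2 <= P)%N by apply: leq_trans pP.
have : 64 * Lam > t * (P.-1)%:R ^+ d.
  rewrite ltNge; apply/negP => h; have Pp : P.-1.+1 = P by rewrite prednK// (leq_trans _ P2).
  have pq : (p0 <= P.-1)%N by rewrite -ltnS Pp.
  by have := Pmin P.-1; rewrite /good h pq => /(_ isT); rewrite -ltnS Pp ltnn.
have half : P%:R / 2 <= P.-1%:R :> R.
  have : P%:R = P.-1%:R + 1 :> R by rewrite natr1 prednK// (leq_trans _ P2).
  have : 1 <= P.-1%:R :> R by rewrite ler1n -ltnS prednK// (leq_trans _ P2).
  by move=> h1 ->; lra.
have h1 : t * (P%:R / 2) ^+ d <= t * P.-1%:R ^+ d.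
  by rewrite ler_wpM2l ?(ltW t0)// lerXn2r ?nnegrE ?divr_ge0.
move=> /(le_lt_trans h1) h2.
have h3 : C3 * P%:R ^+ e1 <= t * P%:R ^+ d.
  have -> : P%:R ^+ d = P%:R * P%:R ^+ d.-1 :> R by rewrite -exprS prednK// (leq_trans _ ed).
  rewrite mulrA; apply: ler_pM => //; rewrite ?exprn_ge0 ?(le_trans ler01)//.
  by rewrite ler_weXn2l ?ler1n ?(leq_trans _ P2)// -ltnS prednK// (leq_trans _ ed).
have p2 : 0 < 2 ^+ d :> R by rewrite exprn_gt0.
have h4 : C * P%:R ^+ e1 <= Lam.
  move: h2; rewrite expr_div_n mulrA ltr_pdivrMr// => h2.
  have := le_lt_trans h3 h2; rewrite /C3.
  rewrite (_ : C * 64 * 2 ^+ d * _ = 64 * (C * P%:R ^+ e1) * 2 ^+ d); last by ring.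
  by rewrite ltr_pM2r// ltr_pM2l// => /ltW.
have h5 : 0 <= C * (2 * C3 / t) ^+ e1.
  apply: mulr_ge0; first exact: le_trans C1.
  by rewrite exprn_ge0// -mulrA mulr_ge0.
by lra.
Qed.

End scale_choice.

Section one_time.
Context {R : realType} {k : nat}.
Local Notation rV := 'rV[R]_k.+1.
Variables (m : nat) (delta r0 r1 : R) (Theta : set rV).
Hypotheses (k1 : (1 <= k)%N) (m2 : (2 <= m)%N) (d0 : 0 < delta) (r00 : 0 < r0) (r01 : r0 < r1).
Hypothesis Tsub : Theta `<=` unit_sphere.
Hypothesis content0 : (0 < hausdorff_content (k.+1%:R - 2 + delta) Theta)%E.

(** F stands for the squared supremum over Theta, possibly infinite, of a quantity dominating |w|.
    This dichotomy lets the same F serve for the real and the imaginary part. *)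
Definition obs_for (w : rV -> R) (F : R -> \bar R) : Prop := (forall r, (0 <= F r)%E) /\
  forall r lam, r0 < r < r1 -> 0 < lam ->
    (forall om, Theta om -> `|w (r *: om)| <= lam) \/ ((lam ^+ 2)%:E <= F r)%E.

(** The bound of [static_bound] is a e^E e^{-loss}, with loss at most ln(b / a) + K / t^kap by the
    choice of P; the factor e^{-ln(b/a)} turns a into a^2 / b. *)
Lemma one_time_observation : exists (K : R) (kap : nat), [/\ 1 <= K, (0 < kap)%N &
  forall (v : R -> rV -> R) (s t : R) (F : R -> \bar R), schr_flow m v -> 0 <= s -> 0 < t -> t <= 1 ->
  obs_for (v (s + t)) F ->
  (((nrm (v (s + t)) ^+ 2 / nrm (v s) * expR (- (K / t ^+ kap))) ^+ 2 * ((r1 - r0) / 2))%:E <=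
    \int[lebesgue_measure]_(r in `]r0, r1[) F r)%E].
Proof.
have m_1 : (m.+1 = m.-1 + 2)%N by lia.
have m_2 : (2 * m = m.-1 + m.+1)%N by lia.
have m_3 : (m.-1 <= m.+1)%N by lia.
have m_4 : (0 < m.-1)%N by lia.
have m_5 : (0 < m)%N by lia.
have [Cs Cs1 static] := static_bound k1 d0 r00 r01 Tsub content0.
(* With radius P^J the loss is of order P^e1 and concentration requires t P^d to exceed 64 Lam.
   Since J = k + 3 exceeds the power k + 2 from the chain of propagations, e1 < J (m + 2) <= 2 J m =
   d, where m >= 2 is used. *)
pose J := k.+3; pose e1 := (k.+2 + J * m.+1)%N; pose d := (J * (2 * m))%N.
have ed : (e1 < d)%N.
  have -> : e1.+1 = (J * m.+2)%N by rewrite [RHS]mulnS.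
  rewrite /d leq_mul2l /= mul2n -addnn -addn2 leq_add2l.
  exact: m2.
have Cs0 : 0 <= Cs by apply: le_trans Cs1.
pose nn : R := k.+1%:R.
pose CE : R := 2 + 4 * nn + 2 * Cs ^+ 2 + CV m * Cs ^+ (2 * m).
have nn0 : 0 <= nn by [].
have CV0 : 0 <= CV m * Cs ^+ (2 * m) by rewrite mulr_ge0 ?CV_ge0// exprn_ge0.
have Cs20 : 0 <= Cs ^+ 2 by exact: sqr_ge0.
have CE1 : 2 <= CE by rewrite /CE; lra.
pose Cl : R := CE + 1 + 2 * nn.
have Cl1 : 1 <= Cl by rewrite /Cl; lra.
pose CA : R := 13 * (Cs + J%:R).
have CA1 : 1 <= CA by rewrite /CA; have : 0 <= J%:R :> R by []; lra.
pose C2 : R := CA ^+ k.+2 * Cl.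
have C21 : 1 <= C2 by rewrite -[leLHS]mulr1; apply: ler_pM => //; rewrite exprn_ege1.
have [K K1 scale] := scale_choice ed C21.
exists K, e1; split => // v s t F fv s0 t0 t1 [F0 FT].
have L0 : 0 < (r1 - r0) / 2 by rewrite divr_gt0// subr_gt0.
set a := nrm (v (s + t)); set b := nrm (v s).
have I0 : (0 <= \int[lebesgue_measure]_(r in `]r0, r1[) F r)%E by apply: integral_ge0 => r _; exact: F0.
have [a00|an0] := eqVneq a 0.
  by rewrite a00 expr0n /= !mul0r expr0n /= mul0r.
have a0 : 0 < a by rewrite lt_def an0 nrm_ge0.
have ab : a <= b := flow_contr fv s0 t0.
have b0 : 0 < b by apply: lt_le_trans ab.
have lnab : 0 <= ln (b / a) by rewrite ln_ge0// ler_pdivlMr// mul1r.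
pose Lam := 1 + ln (b / a).
have Lam1 : 1 <= Lam by rewrite /Lam lerDl.
have [P [P0 tP LP CP]] := scale t Lam t0 t1 Lam1.
have P1 : 1 <= P%:R :> R by rewrite ler1n.
have [Rr RrE] : exists Rr : R, P%:R ^+ J = Rr by exists (P%:R ^+ J).
have R1 : 1 <= Rr by rewrite -RrE exprn_ege1.
have R0 : 0 < Rr by apply: lt_le_trans R1.
have RP : P%:R <= Rr by rewrite -RrE ler_eXnr.
have [y yH ay] : exists2 y : rV, pot m y < Rr ^+ (2 * m) &
    a ^+ 2 <= 4 * (2 * Rr) ^+ k.+1 * v (s + t) y ^+ 2.
  apply: (flow_point fv s0 t0 a0) => //; first by rewrite exprn_gt0.
    by rewrite -RrE -exprM -/d; exact: LP.
  by move=> x; apply: pot_norm_le => //; exact: leq_trans m2.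
have yR : `|y| <= Rr by apply: pot_norm_le yH => //; exact: leq_trans m2.
(* The final time span s' = t / 2^l is comparable to Rr^{-(m-1)}: this balances rho^2 / s' and s'
   rho^{2m}, both of order Rr^{m+1} for rho proportional to Rr. *)
have [l [l1 l2]] : exists l : nat, t * Rr ^+ m.-1 / (2 ^ l)%:R <= 1 /\ 1 <= 2 * (t * Rr ^+ m.-1 / (2 ^ l)%:R).
  apply: dyadic_scale; apply: (le_trans tP); rewrite ler_wpM2l ?(ltW t0)//.
  by apply: (le_trans RP); rewrite ler_eXnr.
pose s' := t / (2 ^ l)%:R.
have pl : 0 < (2 ^ l)%:R :> R by rewrite ltr0n expn_gt0.
have s'0 : 0 < s' by rewrite divr_gt0.
have s'1 : s' <= 1.
  by rewrite ler_pdivrMr// mul1r (le_trans t1)// ler1n expn_gt0.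
have Rm : 0 < Rr ^+ m.-1 by rewrite exprn_gt0.
have sR1 : s' * Rr ^+ m.-1 <= 1 by move: l1; rewrite mulrAC.
have sR2 : s'^-1 <= 2 * Rr ^+ m.-1.
  by rewrite -[leLHS]mul1r ler_pdivrMr// mulrAC -mulrA; move: l2; rewrite mulrAC [s' * _]mulrC.
pose E := CE * Rr ^+ m.+1.
pose rho := Cs * Rr; have rho0 : 0 < rho by rewrite mulr_gt0// (lt_le_trans ltr01).
have Rm1 : Rr ^+ m.+1 = Rr ^+ m.-1 * Rr ^+ 2.
  by rewrite -exprD -m_1.
have R2m : Rr ^+ (2 * m) = Rr ^+ m.-1 * Rr ^+ m.+1.
  by rewrite -exprD -m_2.
have Rm11 : 1 <= Rr ^+ m.+1 by rewrite exprn_ege1.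
have Rmm : Rr ^+ m.-1 <= Rr ^+ m.+1 by rewrite ler_weXn2l.
have sR3 : s' * Rr ^+ (2 * m) <= Rr ^+ m.+1.
  by rewrite R2m mulrA ler_piMl// (le_trans ler01).
have M_le : path_const (n := k.+1) m s' rho * (a * expR (ln (b / a) / (2 ^ l)%:R)) <= a * expR E.
  rewrite mulrCA ler_pM2l//; apply: (@le_trans _ _ (expR (1 + 2 * nn / s') *
     expR (rho ^+ 2 / s' + s' * (CV m * rho ^+ (2 * m))) * expR (ln (b / a) / (2 ^ l)%:R))).
    rewrite ler_wpM2r ?expR_ge0// /path_const ler_wpM2r ?expR_ge0//.
    exact: sqrt_gauZ_le.
  rewrite -!expRD ler_expR.
  have t1' : 2 * nn / s' <= 4 * nn * Rr ^+ m.+1.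
    apply: (@le_trans _ _ (2 * nn * (2 * Rr ^+ m.-1))); first by rewrite ler_wpM2l// mulr_ge0.
    rewrite (_ : 2 * nn * (2 * Rr ^+ m.-1) = 4 * nn * Rr ^+ m.-1); last by ring.
    by rewrite ler_wpM2l// mulr_ge0.
  have t2 : rho ^+ 2 / s' <= 2 * Cs ^+ 2 * Rr ^+ m.+1.
    apply: (@le_trans _ _ (rho ^+ 2 * (2 * Rr ^+ m.-1))); first by rewrite ler_wpM2l// sqr_ge0.
    by rewrite /rho exprMn Rm1 le_eqVlt; apply/orP; left; apply/eqP; ring.
  have t3 : s' * (CV m * rho ^+ (2 * m)) <= CV m * Cs ^+ (2 * m) * Rr ^+ m.+1.
    rewrite /rho exprMn (_ : s' * _ = CV m * Cs ^+ (2 * m) * (s' * Rr ^+ (2 * m))); last by ring.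
    by rewrite ler_wpM2l.
  have t4 : ln (b / a) / (2 ^ l)%:R <= Rr ^+ m.+1.
    apply: le_trans sR3; rewrite /s' mulrAC ler_wpM2r ?invr_ge0 ?(ltW pl)//.
    have : Lam <= 64 * Lam by lra.
    by move: LP; rewrite /d exprM RrE /Lam; move: (t * _) => u; lra.
  exact: exponent_sum.
have pc : path_class (v (s + t)) (a * expR E) rho.
  apply: path_class_le M_le (flow_path_class l fv s0 t0 a0 rho0); exact: ltW.
pose ell := Cl * Rr ^+ m.+1.
have ell1 : 1 <= ell by rewrite -[leLHS]mulr1; apply: ler_pM.
have RR0 : 0 <= 2 * Rr by rewrite mulr_ge0// ltW.
have Mw : a * expR E <= `|v (s + t) y| * expR ell.
  have aw : a <= 2 * (2 * Rr) ^+ k.+1 * `|v (s + t) y|.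
    have R2 : 1 <= (2 * Rr) ^+ k.+1 by rewrite exprn_ege1//; lra.
    rewrite -(ler_pXn2r (n := 2)) ?nnegrE ?(ltW a0) ?mulr_ge0 ?exprn_ge0 ?RR0//.
    apply: (le_trans ay); rewrite [leRHS]exprMn real_normK ?num_real// ler_wpM2r ?sqr_ge0// [leRHS]exprMn.
    rewrite (_ : 2 ^+ 2 = 4 :> R); last by rewrite expr2; ring.
    by rewrite ler_wpM2l// expr2 ler_peMr// (le_trans ler01).
  have eR : 2 * (2 * Rr) ^+ k.+1 <= expR ((1 + 2 * nn) * Rr ^+ m.+1).
    apply: (@le_trans _ _ (expR 1 * expR (2 * Rr) ^+ k.+1)).
      apply: ler_pM; rewrite ?exprn_ge0//.
        by apply: le_trans (expR_ge1Dx _); lra.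
      by rewrite lerXn2r ?nnegrE ?expR_ge0 ?le_expR_self.
    rewrite -expRM_natl -expRD ler_expR -/nn.
    by apply: le_affine_power => //; rewrite ler_eXnr.
  have -> : ell = (1 + 2 * nn) * Rr ^+ m.+1 + E by rewrite /ell /Cl /E; ring.
  rewrite expRD mulrA ler_wpM2r ?expR_ge0//; apply: (le_trans aw).
  by rewrite mulrC ler_wpM2l.
pose A := Cs + J%:R * P%:R.
have A1 : 1 <= A by rewrite /A (le_trans Cs1)// lerDl mulr_ge0.
have CsA : Cs * Rr <= expR A.
  rewrite /A expRD expRM_natl; apply: ler_pM; rewrite ?(ltW R0) ?le_expR_self//.
  by rewrite -RrE lerXn2r ?nnegrE ?expR_ge0 ?le_expR_self.
have loss : (13 * A) ^+ k.+2 * ell <= C2 * P%:R ^+ e1.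
  have AP : 13 * A <= CA * P%:R by exact: le_affine_mul.
  apply: (@le_trans _ _ ((CA * P%:R) ^+ k.+2 * ell)).
    rewrite ler_wpM2r ?(le_trans ler01)// lerXn2r ?nnegrE//.
      by rewrite mulr_ge0// (le_trans ler01).
    by rewrite mulr_ge0// (le_trans ler01).
  rewrite /ell /C2 /e1 exprD exprM RrE exprMn le_eqVlt; apply/orP; left; apply/eqP.
  by move: (CA ^+ _) (P%:R ^+ _) (Rr ^+ _) => z1 z2 z3; ring.
have key : a ^+ 2 / b * expR (- (K / t ^+ e1)) <= a * expR E * expR (- ((13 * A) ^+ k.+2 * ell)).
  rewrite (_ : a ^+ 2 / b * expR (- (K / t ^+ e1)) = a * (a / b * expR (- (K / t ^+ e1)))); last by ring.
  rewrite -[leRHS]mulrA ler_pM2l// -expRD.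
  have -> : a / b = expR (- ln (b / a)).
    by rewrite expRN lnK ?posrE ?divr_gt0// invf_div.
  rewrite -expRD ler_expR.
  have E0 : 0 <= E by rewrite mulr_ge0 ?exprn_ge0 ?(ltW R0)// (le_trans _ CE1).
  exact: exponent_loss loss CP E0.
have q0 : 0 <= a ^+ 2 / b * expR (- (K / t ^+ e1)).
  by rewrite mulr_ge0 ?expR_ge0// divr_ge0 ?sqr_ge0// ltW.
have := static _ _ rho Rr A ell y F pc (mulr_gt0 a0 (expR_gt0 _)) R1 (lexx _) CsA A1 ell1 yR Mw F0 FT.
apply: le_trans; rewrite lee_fin ler_wpM2r ?(ltW L0)//.
by rewrite lerXn2r ?nnegrE// (le_trans q0).
Qed.

End one_time.

(** * Telescoping over a sequence of times *)

Section telescoping.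
Context {R : realType}.
Implicit Types (b E : nat -> R) (I B x : R).

Lemma bernoulli_decay x (j : nat) : 0 <= x -> x <= 1 -> 1 - j%:R * x <= (1 - x) ^+ j.
Proof.
move=> x0 x1; elim: j => [|j IH]; first by rewrite mul0r subr0 expr0.
rewrite exprS -[j.+1%:R]natr1.
have h : (1 - x) * (1 - j%:R * x) <= (1 - x) * (1 - x) ^+ j by rewrite ler_wpM2l// subr_ge0.
apply: le_trans h; have : 0 <= j%:R * (x * x) by rewrite !mulr_ge0.
by move: (j%:R : R) => u; lra.
Qed.

(* The normalised quantities [b i / (expR (2 * E i) * I)] at least square at
   each step and stay bounded, so the first one is at most [1]. *)
Lemma telescope_bound b E I B : 0 < I -> (forall i, 0 <= b i) -> (forall i, b i <= B) ->
  (forall i, 0 <= E i) -> (forall i, E i.+1 <= 3 / 2 * E i) ->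
  (forall i, b i ^+ 2 <= expR (E i) * b i.+1 * I) -> b 0%N <= expR (2 * E 0%N) * I.
Proof.
move=> I0 b0 bB E0 EE bE; pose y i := b i / (expR (2 * E i) * I).
have p i : 0 < expR (2 * E i) * I by rewrite mulr_gt0 ?expR_gt0.
have y0 i : 0 <= y i by rewrite divr_ge0// ltW.
have yy i : y i ^+ 2 <= y i.+1.
  rewrite /y expr_div_n ler_pdivrMr ?exprn_gt0// mulrAC ler_pdivlMr//.
  apply: (@le_trans _ _ (expR (E i) * b i.+1 * I * (expR (3 * E i) * I))).
    apply: ler_pM => //; first exact: sqr_ge0.
      exact: ltW.
    by rewrite ler_pM2r// ler_expR; have := EE i; lra.
  rewrite le_eqVlt; apply/orP; left; apply/eqP.
  rewrite exprMn -expRM_natl (_ : 2%:R * (2 * E i) = E i + 3 * E i); last by ring.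
  by rewrite expRD; ring.
have yB i : y i <= B / I.
  have B0 : 0 <= B by apply: le_trans (bB i).
  rewrite /y invfM mulrA ler_pM2r ?invr_gt0// ler_pdivrMr ?expR_gt0//.
  apply: (le_trans (bB i)); rewrite ler_peMr// -[leLHS]expR0 ler_expR mulr_ge0//.
rewrite -[leRHS]mul1r -ler_pdivrMr// -/(y 0%N) leNgt; apply/negP => y1.
pose h := y 0%N - 1; have h0 : 0 < h by rewrite subr_gt0.
have yh i : 1 + i.+1%:R * h <= y i.
  elim: i => [|i IH]; first by rewrite mul1r /h; lra.
  apply: le_trans (yy i); apply: (@le_trans _ _ ((1 + i.+1%:R * h) ^+ 2)).
    have := ltW (mulr_gt0 h0 h0); rewrite -[i.+2%:R]natr1 expr2.
    have : 1 <= i.+1%:R :> R by rewrite ler1n.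
    by move: (i.+1%:R : R) => u u1 hh; nra.
  by rewrite lerXn2r ?nnegrE// addr_ge0// mulr_ge0// ltW.
have BI0 : 0 <= B / I / h by rewrite divr_ge0 ?(ltW h0)// (le_trans (y0 0%N)).
have := archi_boundP BI0; set N := Num.bound _ => hN.
have := le_trans (yh N) (yB N); rewrite -natr1.
move: hN; rewrite ltr_pdivrMr//; move: (B / I) (N%:R : R) => c u; lra.
Qed.

End telescoping.

Section observability.
Context {R : realType} {k : nat}.
Local Notation rV := 'rV[R]_k.+1.
Variables (m : nat) (delta r0 r1 : R) (Theta : set rV).
Hypotheses (k1 : (1 <= k)%N) (m2 : (2 <= m)%N) (d0 : 0 < delta) (r00 : 0 < r0) (r01 : r0 < r1).
Hypothesis Tsub : Theta `<=` unit_sphere.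
Hypothesis content0 : (0 < hausdorff_content (k.+1%:R - 2 + delta) Theta)%E.

Definition observed (F : R -> R -> \bar R) (T : R) : \bar R :=
  (\int[lebesgue_measure]_(t in `]0%R, T[)
    ((\int[lebesgue_measure]_(r in `]r0, r1[) F t r) `^ (2^-1)))%E.

Lemma inv_le_expR (x : R) : 0 < x -> expR (- x^-1) <= x.
Proof.
move=> x0; rewrite expRN -[leRHS]invrK lef_pV2 ?posrE ?expR_gt0 ?invr_gt0//.
exact: le_expR_self.
Qed.

(** The one-time estimate started at l' is integrated over the upper half of the interval from l' to
    l, where t - l' is at least d and the norm is at least its value at l. *)
Lemma interval_observation : exists (K : R) (kap : nat), [/\ 0 < K, (0 < kap)%N &
  forall (v : R -> rV -> R) (F : R -> R -> \bar R) (T l l' : R), schr_flow m v ->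
  (forall t, 0 < t -> obs_for r0 r1 Theta (v t) (F t)) -> 0 < l' -> l' < l -> l <= T -> l <= 1 ->
  ((nrm (v l) ^+ 2 / nrm (v l') * expR (- (K / ((l - l') / 2) ^+ kap)))%:E <= observed F T)%E].
Proof.
have [K [kap [K1 kap0 one]]] := one_time_observation k1 m2 d0 r00 r01 Tsub content0.
have L0 : 0 < (r1 - r0) / 2 by rewrite divr_gt0// subr_gt0.
pose c := Num.sqrt ((r1 - r0) / 2); have c0 : 0 < c by rewrite sqrtr_gt0.
(* The two extra terms absorb the length d of the time interval and the factor c = sqrt((r1 -
   r0)/2), through x >= e^{-1/x}. *)
exists (K + 1 + c^-1), kap; split => // [|v F T l l' fv FT l0 ll lT l1].
  by rewrite !addr_gt0 ?invr_gt0// (lt_le_trans ltr01).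
pose d := (l - l') / 2; have dd0 : 0 < d by rewrite divr_gt0// subr_gt0.
have d1 : d <= 1 by rewrite /d; lra.
have l0' : 0 < l by apply: lt_trans ll.
pose x := nrm (v l) ^+ 2 / nrm (v l') * expR (- (K / d ^+ kap)).
have x0 : 0 <= x by rewrite mulr_ge0 ?expR_ge0// divr_ge0 ?sqr_ge0 ?nrm_ge0.
pose X := x * c; have X0 : 0 <= X by rewrite mulr_ge0// ltW.
have int0 t : 0 < t -> (0 <= \int[lebesgue_measure]_(r in `]r0, r1[) F t r)%E.
  by move=> t0; apply: integral_ge0 => r _; have [F0 _] := FT t t0; exact: F0.
pose G t := ((\int[lebesgue_measure]_(r in `]r0, r1[) F t r) `^ (2^-1))%E.
have step (t : R) : l - d < t < l -> (X%:E <= G t)%E.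
  move=> /andP[dt tl]; have tl' : l' < t by rewrite (lt_trans _ dt)// /d; lra.
  have t0 : 0 < t by apply: lt_trans tl'.
  have dtl : d <= t - l' by rewrite /d in dt *; lra.
  have h : (((X ^+ 2)%:E <= \int[lebesgue_measure]_(r in `]r0, r1[) F t r)%E).
    have s0 : 0 < t - l' by rewrite subr_gt0.
    have s1 : t - l' <= 1 by lra.
    have := one v l' (t - l') (F t) fv (ltW l0) s0 s1; rewrite [l' + _]addrC subrK => /(_ (FT t t0)).
    apply: le_trans; rewrite lee_fin exprMn sqr_sqrtr ?(ltW L0)// ler_wpM2r ?(ltW L0)//.
    rewrite lerXn2r ?nnegrE//; first by rewrite mulr_ge0 ?expR_ge0// divr_ge0 ?sqr_ge0 ?nrm_ge0.
    have cl : nrm (v l) <= nrm (v t).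
      have lt0 : 0 < l - t by rewrite subr_gt0.
      by have := flow_contr fv (ltW t0) lt0; rewrite [t + _]addrC subrK.
    apply: ler_pM; rewrite ?expR_ge0 ?divr_ge0 ?sqr_ge0 ?nrm_ge0//.
      by rewrite ler_wpM2r ?invr_ge0 ?nrm_ge0// lerXn2r ?nnegrE ?nrm_ge0.
    rewrite ler_expR lerN2 ler_wpM2l ?(le_trans ler01 K1)// lef_pV2 ?posrE ?exprn_gt0//.
    by rewrite lerXn2r ?nnegrE ?(ltW s0) ?(ltW dd0).
  have -> : X%:E = ((X ^+ 2)%:E `^ 2^-1)%E.
    by rewrite poweR_EFin powR12_sqrt ?sqr_ge0// sqrtr_sqr ger0_norm.
  apply: gt0_ler_poweR => //; rewrite ?invr_ge0// in_itv /= leey andbT.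
    by rewrite lee_fin sqr_ge0.
  exact: int0.
have G0 t : (0 <= G t)%E by exact: poweR_ge0.
have := @step_integral R 1 (fun=> l - d) (fun=> l) (fun=> X) 0 T G G0.
have dl : 0 <= l - d by rewrite /d; lra.
have ld : l - d <= l by lra.
move=> /(_ (fun=> And4 X0 ld dl lT) (fun g g' _ _ _ => etrans (ord1 g) (esym (ord1 g')))
  (fun _ r => step r)) h.
apply: le_trans h; rewrite big_ord1 lee_fin.
have -> : l - (l - d) = d by ring.
rewrite (_ : X * d = nrm (v l) ^+ 2 / nrm (v l') * (expR (- (K / d ^+ kap)) * (c * d))); last first.
  by rewrite /X /x; ring.
rewrite -/d ler_wpM2l ?divr_ge0 ?sqr_ge0 ?nrm_ge0//.
have dk : 0 < d ^+ kap by rewrite exprn_gt0.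
have dk1 : d ^+ kap <= d by rewrite ler_iXnr// ltW.
have id : 1 <= (d ^+ kap)^-1 by rewrite invf_ge1// (le_trans dk1).
apply: (@le_trans _ _ (expR (- (K / d ^+ kap)) * (expR (- c^-1) * expR (- d^-1)))).
  rewrite -!expRD ler_expR.
  have h1 : d^-1 <= (d ^+ kap)^-1 by rewrite lef_pV2.
  have h2 : c^-1 <= c^-1 / d ^+ kap by rewrite ler_peMr// invr_ge0 ltW.
  by rewrite [X in - X <= _]mulrDl mulrDl mul1r; move: (_ / _) h2 => z; lra.
rewrite ler_wpM2l ?expR_ge0//; apply: ler_pM; rewrite ?expR_ge0 ?inv_le_expR//.
Qed.

(** Along times decreasing geometrically to 0, the exponents of consecutive intervals grow by a
    factor at most 3/2, less than 2, so the quadratic recursion of [telescope_bound] closes while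
    the norms stay bounded by the initial one. *)
Lemma flow_observability (T : R) : 0 < T -> exists2 C : R, 0 < C &
  forall (v : R -> rV -> R) (F : R -> R -> \bar R), schr_flow m v ->
  (forall t, 0 < t -> obs_for r0 r1 Theta (v t) (F t)) ->
  ((nrm (v T))%:E <= C%:E * observed F T)%E.
Proof.
move=> T0; have [K [kap [K0 kap0 step]]] := interval_observation.
pose T1 := Num.min T 1; have T10 : 0 < T1 by rewrite lt_min T0 ltr01.
have T1T : T1 <= T by rewrite ge_min lexx.
have T11 : T1 <= 1 by rewrite ge_min lexx orbT.
have kr : 1 <= kap%:R :> R by rewrite ler1n.
(* With q = 1 - x, Bernoulli's inequality gives q^kap >= 2/3, hence the growth factor 3/2 of the
   exponents. *)
pose x : R := (3 * kap%:R)^-1.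
have x0 : 0 < x by rewrite invr_gt0 mulr_gt0// (lt_le_trans ltr01).
have x1 : x <= 1 / 3 by rewrite /x invfM mul1r ler_piMr// invf_le1// (lt_le_trans ltr01).
have kx : kap%:R * x = 1 / 3.
  by rewrite /x; field; rewrite gt_eqF// (lt_le_trans ltr01).
pose q := 1 - x; have q0 : 0 < q by rewrite /q; lra.
have q1 : q < 1 by rewrite /q; lra.
have qk : 2 / 3 <= q ^+ kap.
  have : x <= 1 by lra.
  by move=> /(bernoulli_decay kap (ltW x0)); rewrite kx -/q; lra.
pose l i := T1 * q ^+ i; have l0 i : 0 < l i by rewrite mulr_gt0 ?exprn_gt0.
have lS i : l i.+1 < l i by rewrite ltr_pM2l// exprS gtr_pMl ?exprn_gt0.
have lT1 i : l i <= T1.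
  by rewrite ger_pMr// exprn_ile1// ltW.
pose E i := K / ((l i - l i.+1) / 2) ^+ kap.
have dl i : 0 < (l i - l i.+1) / 2 by rewrite divr_gt0// subr_gt0.
have E0 i : 0 <= E i by rewrite divr_ge0 ?exprn_ge0// ltW.
have EE i : E i.+1 <= 3 / 2 * E i.
  have dE : (l i.+1 - l i.+2) / 2 = q * ((l i - l i.+1) / 2) by rewrite /l !exprS; ring.
  rewrite /E dE exprMn invfM mulrCA ler_wpM2r//; first exact: E0.
  rewrite invf_ple ?posrE//; first by apply: le_trans qk; lra.
  by rewrite exprn_gt0.
exists (expR (2 * E 0%N)); first exact: expR_gt0.
move=> v F fv FT; set I := observed F T.
have I0 : (0 <= I)%E by apply: integral_ge0 => t _; exact: poweR_ge0.
have mono s t : 0 <= s -> s <= t -> nrm (v t) <= nrm (v s).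
  move=> s0; rewrite le_eqVlt => /orP[/eqP ->//|st].
  have ts : 0 < t - s by rewrite subr_gt0.
  by have := flow_contr fv s0 ts; rewrite [s + _]addrC subrK.
have l00 : l 0%N = T1 by rewrite /l expr0 mulr1.
have bT : nrm (v T) <= nrm (v (l 0%N)) by rewrite l00; apply: mono => //; exact: ltW.
suff : ((nrm (v (l 0%N)))%:E <= (expR (2 * E 0%N))%:E * I)%E.
  by apply: le_trans; rewrite lee_fin.
have st i := step v F T (l i) (l i.+1) fv FT (l0 _) (lS _) (le_trans (lT1 _) T1T) (le_trans (lT1 _) T11).
have bm i : nrm (v (l i)) <= nrm (v (l i.+1)) by apply: mono; exact: ltW.
have [Ioo|Ifin] := eqVneq I +oo%E.
  by rewrite Ioo gt0_muley ?leey// lte_fin expR_gt0.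
have If : I \is a fin_num by rewrite ge0_fin_numE// ltey.
rewrite -(fineK If) -EFinM lee_fin.
have sq i : nrm (v (l i)) ^+ 2 <= expR (E i) * nrm (v (l i.+1)) * fine I.
  have [b0|b0] := eqVneq (nrm (v (l i.+1))) 0.
    have := bm i; rewrite b0 => h; have -> : nrm (v (l i)) = 0.
      by apply/eqP; rewrite eq_le h nrm_ge0.
    by rewrite expr0n mulr0 mul0r.
  have bp : 0 < nrm (v (l i.+1)) by rewrite lt_def b0 nrm_ge0.
  have := st i; rewrite -/I -[in X in X -> _](fineK If) lee_fin -/(E i) expRN ler_pdivrMr ?expR_gt0//.
  by rewrite ler_pdivrMr// [fine I * _]mulrC mulrAC.
have fI0 : 0 <= fine I by exact: fine_ge0.
(* When the observation vanishes, the first inequality of the recursion already forces the norm to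
   vanish; otherwise one may divide by it. *)
have [I00|In0] := eqVneq (fine I) 0.
  rewrite I00 mulr0; have := sq 0%N; rewrite I00 mulr0 => h.
  by rewrite -(@ler_pXn2r _ 2) ?nnegrE ?nrm_ge0// expr0n.
apply: (@telescope_bound _ (fun i => nrm (v (l i))) E (fine I) (nrm (v 0))) => // [|i|i].
- by rewrite lt_def In0.
- exact: nrm_ge0.
- by apply: mono => //; exact: ltW.
Qed.

End observability.

(** * Real flows from the complex semigroup, and conclusion *)

Section semigroup_flow.
Context {R : realType} {n : nat}.
Local Notation rV := 'rV[R]_n.
Local Notation mu := (lebesgue_rV R n).
Local Notation ip := (@ippair _ rV R mu).
Implicit Types (f g : rV -> R[i]).

Lemma L2_ae f g : L2 f -> ae_equal g f ->
  measurable_fun [set: rV] (fun x => complex.Re (g x)) ->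
  measurable_fun [set: rV] (fun x => complex.Im (g x)) -> L2 g.
Proof.
move=> /L2_pairP[[m1 f1] [m2 f2]] gf mg1 mg2; apply/L2_pairP.
have ae (h : R[i] -> R) : measurable_fun [set: rV] (fun x => h (f x)) ->
    measurable_fun [set: rV] (fun x => h (g x)) ->
    sqnorm mu (fun x => h (g x)) = sqnorm mu (fun x => h (f x)).
  move=> mf mg; apply: ae_eq_integral => //; [exact: measurable_sqr|exact: measurable_sqr|].
  by apply: filterS gf => x /(_ I) -> _.
by split; split => //; [rewrite (ae (fun z => complex.Re z))|rewrite (ae (fun z => complex.Im z))].
Qed.

Lemma nrm_fst_le (v : (rV -> R) * (rV -> R)) : nrm v.1 <= hnorm ip v.
Proof. by rewrite /nrm /hnorm /ippair ler_wsqrtr// lerDl ip2_ge0. Qed.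

Lemma nrm_snd_le (v : (rV -> R) * (rV -> R)) : nrm v.2 <= hnorm ip v.
Proof. by rewrite /nrm /hnorm /ippair ler_wsqrtr// lerDr ip2_ge0. Qed.

Lemma nrm_fstB_le (a b c d : rV -> R) : nrm (fun x => a x - c x) <= hnorm ip ((a, b) - (c, d)).
Proof. exact: (nrm_fst_le ((a, b) - (c, d))). Qed.

Lemma nrm_sndB_le (a b c d : rV -> R) : nrm (fun x => b x - d x) <= hnorm ip ((a, b) - (c, d)).
Proof. exact: (nrm_snd_le ((a, b) - (c, d))). Qed.

Lemma hnorm_le_nrm (v : (rV -> R) * (rV -> R)) : hnorm ip v <= nrm v.1 + nrm v.2.
Proof.
rewrite -(ler_pXn2r (n := 2)) ?nnegrE ?sqrtr_ge0 ?addr_ge0 ?nrm_ge0//.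
rewrite sqr_sqrtr ?addr_ge0 ?ip2_ge0// /ippair -!nrm_sqr.
have : 0 <= nrm v.1 * nrm v.2 by rewrite mulr_ge0 ?nrm_ge0.
by move: (nrm _) (nrm _) => a b ab; rewrite sqrrD lerD2r lerDl mulrn_wge0.
Qed.

Lemma iter_pair_op (A : (rV -> R) -> rV -> R) N v : iter N (pair_op A) v = (iter N A v.1, iter N A v.2).
Proof. by elim: N => [|N IH] /=; [case: v|rewrite IH]. Qed.

Variables (m : nat) (S : R -> (rV -> R[i]) -> rV -> R[i]) (u0 : rV -> R[i]) (u : R -> rV -> R[i]).
Hypotheses (hS : schrodinger_semigroup m S) (Lu0 : L2 u0) (cu : continuous_version S u0 u).

(** A continuous version is prescribed only for positive times, so the value at time 0 is set to
    u0. *)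
Definition extended_version (t : R) : rV -> R[i] := if t == 0 then u0 else u t.

Lemma extended_version_ae t : 0 <= t -> L2 (extended_version t) /\ ae_equal (extended_version t) (S t u0).
Proof.
have c0 := hS.1; rewrite /extended_version => t0; case: eqVneq => [->|tn0].
  by split => //; apply: filterS (C0_id c0 Lu0) => x h /h ->.
have tp : 0 < t by rewrite lt_def tn0.
have [c1 c2 ae] := cu tp; split => //.
apply: (L2_ae (C0_L2 c0 t0 Lu0) ae); exact: measurable_fun_continuous_rV.
Qed.

(** The semigroup law, valid up to null sets, lets the product formula start at any time s from the
    continuous version. *)
Lemma extended_version_chernoff s t e : 0 <= s -> 0 < t -> 0 < e ->
  exists k0 : nat, forall k, (k0 <= k)%N ->
  hnorm ip (iter (2 ^ k) (pair_op (split_op m (t / (2 ^ k)%:R))) (pair_of (extended_version s)) -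
    pair_of (extended_version (s + t))) <= e.
Proof.
have c0 := hS.1; move=> s0 t0 e0; have [Ls aes] := extended_version_ae s0.
have st0 : 0 <= s + t by rewrite addr_ge0// ltW.
have [Lst aest] := extended_version_ae st0; set w := extended_version in Ls aes Lst aest *.
have Lp : L2pair mu (pair_of (w s)) by exact/L2_pairP.
have [k0 h] := schrodinger_chernoff hS Lp t0 e0; exists k0 => k kk.
have LSs : L2 (S s u0) := C0_L2 c0 s0 Lu0.
have LStw : L2 (S t (w s)) := C0_L2 c0 (ltW t0) Ls.
have LX : L2pair mu (iter (2 ^ k) (pair_op (split_op m (t / (2 ^ k)%:R))) (pair_of (w s))).
  have tk : 0 < t / (2 ^ k)%:R by rewrite divr_gt0// ltr0n expn_gt0.
  by rewrite iter_pair_op; case: Lp => p1 p2; split; exact: sq_int_iter.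
have ae : ae_equal (S t (w s)) (w (s + t)).
  have a1 := C0_ae c0 (ltW t0) Ls LSs aes.
  have a2 := C0_add c0 (ltW t0) s0 Lu0; rewrite addrC in a2.
  by apply: filterS3 a1 a2 aest => x b1 b2 b3 xT; rewrite b1// -b2// b3.
have d := ae_equal_hnorm ae LStw Lst.
have sh := L2pair_semi_hilbert mu.
move: h => /(_ k kk); rewrite /pair_semigroup pair_ofK; apply: le_trans.
set X := iter _ _ _; rewrite -[leRHS]addr0 -d.
have -> : X - pair_of (w (s + t)) = (X - pair_of (S t (w s))) + (pair_of (S t (w s)) - pair_of (w (s + t))).
  by rewrite addrA subrK.
have LB x y : L2pair mu x -> L2pair mu y -> L2pair mu (x - y).
  by move=> [x1 x2] [y1 y2]; split; exact: sq_intB.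
by apply: (hnorm_triangle sh); apply: LB => //; exact/L2_pairP.
Qed.

Lemma extended_version_flow_Re : schr_flow m (fun t x => complex.Re (extended_version t x)).
Proof.
split=> [t t0|t t0|s t e s0 t0 e0].
- by have [/L2_pairP[]] := extended_version_ae t0.
- by rewrite /extended_version gt_eqF//; have [] := cu t0.
have [k0 h] := extended_version_chernoff s0 t0 e0; exists k0 => k /h.
rewrite iter_pair_op; apply: le_trans; exact: nrm_fstB_le.
Qed.

Lemma extended_version_flow_Im : schr_flow m (fun t x => complex.Im (extended_version t x)).
Proof.
split=> [t t0|t t0|s t e s0 t0 e0].
- by have [/L2_pairP[]] := extended_version_ae t0.
- by rewrite /extended_version gt_eqF//; have [] := cu t0.
have [k0 h] := extended_version_chernoff s0 t0 e0; exists k0 => k /h.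
rewrite iter_pair_op; apply: le_trans; exact: nrm_sndB_le.
Qed.

Lemma L2norm_flow_le t : 0 <= t -> (L2norm (S t u0) <=
  (nrm (fun x => complex.Re (extended_version t x)) +
   nrm (fun x => complex.Im (extended_version t x)))%:E)%E.
Proof.
move=> t0; have [Lw ae] := extended_version_ae t0.
rewrite -(ae_equal_L2norm ae Lw (C0_L2 hS.1 t0 Lu0)) L2normE// lee_fin.
exact: hnorm_le_nrm.
Qed.

End semigroup_flow.

(** If the supremum does not control a value above lam, that value itself shows the supremum to be
    at least lam; infinite suprema are included. *)
Lemma obs_for_sup (R : realType) (k : nat) (r0 r1 : R) (Theta : set 'rV[R]_k.+1)
    (f : 'rV[R]_k.+1 -> R[i]) (h : R[i] -> R) :
  (forall z, `|h z| <= ComplexField.Normc.normc z) ->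
  obs_for r0 r1 Theta (fun x => h (f x)) (fun r => sup_on_sphere Theta f r ^+ 2)%E.
Proof.
move=> hn; split=> [r|r lam _ l0]; first exact: sqre_ge0.
have [|/existsNP[om /not_implyP[Tom /negP]]] := pselect (forall om, Theta om -> `|h (f (r *: om))| <= lam).
  by left.
rewrite -ltNge => lt; right; rewrite EFin_expe.
have ls : (lam%:E <= sup_on_sphere Theta f r)%E.
  apply: (@le_trans _ _ (ComplexField.Normc.normc (f (r *: om)))%:E).
    by rewrite lee_fin (le_trans (ltW lt)).
  by apply: ereal_sup_ubound; exists om.
rewrite lee_sqr// ?lee_fin ?(ltW l0)//.
by apply: le_trans ls; rewrite lee_fin ltW.
Qed.

Theorem theorem1p3 (R : realType) (n m : nat) (r0 r1 delta : R)
    (Theta1 : set 'rV[R]_n) :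
  (2 <= n)%N -> (2 <= m)%N ->
  0 < r0 -> r0 < r1 ->
  0 < delta -> delta < 1 ->
  closed Theta1 -> Theta1 `<=` unit_sphere ->
  (0 < hausdorff_content (n%:R - 2 + delta) Theta1)%E ->
  forall T : R, 0 < T ->
  exists2 C : R, 0 < C &
  forall S : R -> ('rV[R]_n -> R[i]) -> 'rV[R]_n -> R[i],
    schrodinger_semigroup m S ->
  forall u0 : 'rV[R]_n -> R[i], L2 u0 ->
  forall u : R -> 'rV[R]_n -> R[i], continuous_version S u0 u ->
  (L2norm (S T u0) <=
   C%:E * \int[lebesgue_measure]_(t in `]0%R, T[)
     ((\int[lebesgue_measure]_(r in `]r0, r1[)
         (sup_on_sphere Theta1 (u t) r ^+ 2)) `^ (2^-1)))%E.
Proof.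
case: n Theta1 => // k Theta1 k1 m2 r00 r01 d0 _ _ Tsub content0 T T0.
have [C C0 obs] := flow_observability k1 m2 d0 r00 r01 Tsub content0 T0.
(* The estimate is applied to the real and imaginary parts, both bounded by the modulus, and their
   norms are added. *)
exists (2 * C); first by rewrite mulr_gt0.
move=> S hS u0 Lu0 u cu; set I := integral _ _ _.
apply: (le_trans (L2norm_flow_le hS Lu0 cu (ltW T0))).
have ob (h : R[i] -> R) : (forall z, `|h z| <= ComplexField.Normc.normc z) ->
    forall t, 0 < t -> obs_for r0 r1 Theta1 (fun x => h (extended_version u0 u t x))
      (fun r => sup_on_sphere Theta1 (u t) r ^+ 2)%E.
  by move=> hn t t0; rewrite /extended_version gt_eqF//; exact: obs_for_sup.
have sqrt_le (a b c : R) : c ^+ 2 = a ^+ 2 + b ^+ 2 -> 0 <= c -> `|a| <= c.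
  move=> cE c0; rewrite -(ler_pXn2r (n := 2)) ?nnegrE// real_normK ?num_real// cE lerDl.
  exact: sqr_ge0.
have n0 (z : R[i]) : 0 <= ComplexField.Normc.normc z by case: z => a b /=; exact: sqrtr_ge0.
have hRe (z : R[i]) : `|complex.Re z| <= ComplexField.Normc.normc z.
  exact: sqrt_le (normc_sqr z) (n0 z).
have hIm (z : R[i]) : `|complex.Im z| <= ComplexField.Normc.normc z.
  by apply: sqrt_le (n0 z); rewrite normc_sqr addrC.
have o1 := obs _ _ (extended_version_flow_Re hS Lu0 cu) (ob _ hRe).
have o2 := obs _ _ (extended_version_flow_Im hS Lu0 cu) (ob _ hIm).
rewrite EFinD (_ : 2 * C = C + C); last by ring.
by rewrite EFinD ge0_muleDl ?lee_fin ?(ltW C0)//; exact: leeD o1 o2.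
Qed.
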